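(* Let $\nabla$ be a torsion free affine connection on a $C^\infty$ manifold $M$, let $\gamma : I \to M$ be a $C^\infty$ curve from an open interval $I$, and let $t_0 \in I$. (1) Let $\dim(M) = 3$. If $(\nabla\gamma)(t_0), (\nabla^2\gamma)(t_0), (\nabla^3\gamma)(t_0)$ are linearly independent, then the $\nabla$-tangent surface $\nabla\text{-}\mathrm{Tan}(\gamma)$ is locally diffeomorphic to the cuspidal edge at $(t_0,0)\in I\times\mathbf{R}$. If $(\nabla\gamma)(t_0), (\nabla^2\gamma)(t_0), (\nabla^3\gamma)(t_0)$ are linearly dependent and $(\nabla\gamma)(t_0), (\nabla^2\gamma)(t_0), (\nabla^4\gamma)(t_0)$ are linearly independent, then $\nabla\text{-}\mathrm{Tan}(\gamma)$ is locally diffeomorphic to the folded umbrella at $(t_0,0)\in I\times\mathbf{R}$. (2) Let $\dim(M)\geq 4$. If $(\nabla\gamma)(t_0), (\nabla^2\gamma)(t_0), (\nabla^3\gamma)(t_0)$ are linearly independent, then $\nabla\text{-}\mathrm{Tan}(\gamma)$ is locally diffeomorphic to the embedded cuspidal edge at $(t_0,0)\in I\times\mathbf{R}$.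
   Context: All manifolds and mappings are of class $C^\infty$. Einstein summation is used and $\nabla_{\partial/\partial x^\mu}\frac{\partial}{\partial x^\nu} = \Gamma^\lambda_{\mu\nu}\frac{\partial}{\partial x^\lambda}$ in local coordinates; $\nabla$ is torsion free if $\nabla_XY-\nabla_YX-[X,Y]=0$ for all vector fields $X,Y$, equivalently $\Gamma^\lambda_{\mu\nu}=\Gamma^\lambda_{\nu\mu}$. Iterated covariant derivatives of a curve: $(\nabla\gamma)(t) := \gamma'(t)$ and $(\nabla^k\gamma)(t) := \nabla^\gamma_{\partial/\partial t}(\nabla^{k-1}\gamma)(t)$ for $k\ge 2$, where $\nabla^\gamma_{\partial/\partial t}$ is the covariant derivative along $\gamma$: for a vector field $v(t)=v^\lambda(t)\frac{\partial}{\partial x^\lambda}(\gamma(t))$ along $\gamma$, $(\nabla^\gamma_{\partial/\partial t}v)^\lambda(t) = \frac{dv^\lambda}{dt}(t)+\Gamma^\lambda_{\mu\nu}(\gamma(t))(\gamma^\mu)'(t)v^\nu(t)$. Geodesics: for $x\in M$, $v\in T_xM$, $s\mapsto\varphi(x,v,s)$ is the $\nabla$-geodesic, i.e. the solution of $\frac{\partial^2\varphi^\lambda}{\partial s^2}+\Gamma^\lambda_{\mu\nu}(\varphi)\frac{\partial\varphi^\mu}{\partial s}\frac{\partial\varphi^\nu}{\partial s}=0$ with $\varphi(x,v,0)=x$, $\frac{\partial\varphi}{\partial s}(x,v,0)=v$; it is defined on an open neighborhood of $TM\times\{0\}$ in $TM\times\mathbf{R}$. The $\nabla$-tangent surface of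 $\gamma$ is $\nabla\text{-}\mathrm{Tan}(\gamma)(t,s):=\varphi(\gamma(t),\gamma'(t),s)$, defined on an open neighborhood of $I\times\{0\}$ in $I\times\mathbf{R}$. (Under each hypothesis of the theorem $\gamma$ is an immersion near $t_0$.) Two map-germs $f:(\mathbf{R}^2,p)\to M$ and $g:(\mathbf{R}^2,p')\to M'$ are locally diffeomorphic if there are diffeomorphism-germs $\sigma:(\mathbf{R}^2,p)\to(\mathbf{R}^2,p')$ and $\tau:(M,f(p))\to(M',g(p'))$ with $\tau\circ f=g\circ\sigma$. A map is locally diffeomorphic to a given model germ at $p$ if its germ at $p$ is. The cuspidal edge (called embedded cuspidal edge when $m\ge 4$) is the map-germ $(\mathbf{R}^2,0)\to(\mathbf{R}^m,0)$, $m=\dim M\geq 3$, $(t,s)\mapsto(t+s,\ t^2+2st,\ t^3+3st^2,\ 0,\dots,0)$, which is locally diffeomorphic to $(u,w)\mapsto(u,w^2,w^3,0,\dots,0)$. The folded umbrella (cuspidal cross cap) is the map-germ $(\mathbf{R}^2,0)\to(\mathbf{R}^3,0)$, $(t,s)\mapsto(t+s,\ t^2+2st,\ t^4+4st^3)$. *)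

(* Defs.v *)
From HB Require Import structures.
From mathcomp Require Import all_boot all_order all_algebra.
From mathcomp Require Import all_classical all_reals all_analysis.

Set Implicit Arguments.
Unset Strict Implicit.
Unset Printing Implicit Defensive.

Import Order.TTheory GRing.Theory Num.Theory.
Import numFieldNormedType.Exports.

Local Open Scope classical_set_scope.
Local Open Scope ring_scope.

(* Only used with [U] open: all iterated partial derivatives of order at most
   [k] exist and are continuous at the points of [U].  Values outside [U] are
   irrelevant. *)
Fixpoint Ck_on (R : realType) (n : nat) (W : normedModType R) (k : nat)
    (U : set 'rV[R]_n) (f : 'rV[R]_n -> W) : Prop :=
  (forall x, U x -> {for x, continuous f}) /\
  if k is k'.+1 then
    forall i : 'I_n,
      (forall x, U x -> derivable f x (delta_mx 0 i)) /\
      Ck_on k' U ('D_(delta_mx 0 i) f)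
  else True.

Definition smooth_on (R : realType) (n : nat) (W : normedModType R)
    (U : set 'rV[R]_n) (f : 'rV[R]_n -> W) : Prop :=
  forall k, Ck_on k U f.

(* Charts are indexed by [chart].  The chart [c] is the homeomorphism
   [coord c] from the open set [dom c] onto the open set [coord c @` dom c],
   with inverse [param c]; [coord c] and [param c] are arbitrary elsewhere. *)
Record manifold (R : realType) (m : nat) := Manifold {
  carrier :> topologicalType ;
  chart : Type ;
  dom : chart -> set carrier ;
  coord : chart -> carrier -> 'rV[R]_m ;
  param : chart -> 'rV[R]_m -> carrier ;
  carrier_hausdorff : hausdorff_space carrier ;
  carrier_second_countable : @second_countable carrier ;
  dom_cover : forall p, exists c, dom c p ;
  dom_open : forall c, open (dom c) ;
  codom_open : forall c, open (coord c @` dom c) ;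
  coordK : forall c p, dom c p -> param c (coord c p) = p ;
  coord_continuous : forall c p, dom c p -> {for p, continuous (coord c)} ;
  param_continuous : forall c x,
    (coord c @` dom c) x -> {for x, continuous (param c)} ;
  transition_smooth : forall c d,
    smooth_on (coord c @` (dom c `&` dom d)) (coord d \o param c)
}.

Arguments dom {R m M} c : rename.
Arguments coord {R m M} c p : rename.
Arguments param {R m M} c x : rename.

Definition smooth_map (R : realType) (m n : nat)
    (M : manifold R m) (N : manifold R n) (U : set M) (h : M -> N) : Prop :=
  (forall p, U p -> {for p, continuous h}) /\
  forall (c : chart M) (d : chart N),
    smooth_on (coord c @` (U `&` dom c `&` h @^-1` dom d))
              (coord d \o h \o param c).

Definition smooth_fun (R : realType) (m : nat) (M : manifold R m)
    (U : set M) (f : M -> R) : Prop :=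
  forall c : chart M, smooth_on (coord c @` (U `&` dom c)) (f \o param c).

Definition smooth_curve (R : realType) (m : nat) (M : manifold R m)
    (J : set R) (g : R -> M) : Prop :=
  (forall t, J t -> {for t, continuous g}) /\
  forall (c : chart M) (k : nat) (t : R), J t -> dom c (g t) ->
    derivable (derive1n k (coord c \o g)) t 1.

Definition diffeo_between (R : realType) (m n : nat)
    (M : manifold R m) (N : manifold R n)
    (U : set M) (V : set N) (h : M -> N) : Prop :=
  exists h' : N -> M,
    [/\ open U /\ open V, smooth_map U h, smooth_map V h',
        forall p, U p -> V (h p) /\ h' (h p) = p &
        forall q, V q -> U (h' q) /\ h (h' q) = q].

Lemma Ck_on_cst (R : realType) (n : nat) (W : normedModType R) k
    (U : set 'rV[R]_n) (a : W) : Ck_on k U (fun=> a).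
Proof.
elim: k a => [|k IHk] a /=; split=> //; try by move=> x _; exact: cst_continuous.
move=> i; split; first by move=> x _; exact: derivable_cst.
have -> : 'D_(delta_mx 0 i) (fun=> a) = (fun=> 0) :> ('rV[R]_n -> W).
  by apply/funext => x; exact: derive_cst.
exact: IHk.
Qed.

Lemma smooth_on_id (R : realType) (n : nat) (U : set 'rV[R]_n) :
  smooth_on U (id : 'rV[R]_n -> 'rV[R]_n).
Proof.
case=> [|k] /=; split=> //; try by move=> x _.
move=> i; split; first by move=> x _; exact: derivable_id.
have -> : 'D_(delta_mx 0 i) (id : 'rV[R]_n -> 'rV[R]_n) = (fun=> delta_mx 0 i).
  by apply/funext => x; exact: derive_id.
exact: Ck_on_cst.
Qed.

Lemma rV_second_countable (R : realType) (n : nat) :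
  @second_countable 'rV[R]_n.
Proof.
pose B (z : 'rV[rat]_n * nat) : set 'rV[R]_n :=
  ball (\row_j ratr (z.1 0 j) : 'rV[R]_n) z.2.+1%:R^-1.
exists (range B); first exact: sub_countable (card_image_le _ _) (countableP _).
split; first by move=> _ [z _ <-]; exact: ball_open.
move=> x A /nbhs_ballP[e /= e0 eA].
have [k ke] : exists k : nat, k.+1%:R^-1 < e / 2 :> R.
  have := near_infty_natSinv_lt (PosNum (divr_gt0 e0 (ltr0n R 2))).
  by case=> k _ /(_ k (leqnn k)) /= ?; exists k.
have k0 : 0 < k.+1%:R^-1 :> R by rewrite invr_gt0.
have /choice[q hq] (j : 'I_n) : exists q : rat, `|ratr q - x 0 j| < k.+1%:R^-1.
  have /rat_in_itvoo[q] : x 0 j - k.+1%:R^-1 < x 0 j + k.+1%:R^-1.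
    by rewrite ltrD2l gtrN.
  by rewrite in_itv/= => ?; exists q; rewrite ltr_distl.
exists (B (\row_j q j, k)).
  split; first by exists (\row_j q j, k).
  by split=> // i j; rewrite !ord1 !mxE; exact: hq.
move=> y [_ By]; apply: eA; split=> // i j; have := By i j.
rewrite !ord1 !mxE /ball/= => hy.
rewrite (le_lt_trans (ler_distD (ratr (q j)) _ _))// (splitr e) ltrD//.
  by rewrite distrC (lt_trans (hq j)).
exact: lt_trans hy ke.
Qed.

Definition euclid (R : realType) (n : nat) : manifold R n.
Proof.
refine (@Manifold R n 'rV[R]_n unit (fun=> setT) (fun=> id) (fun=> id)
  _ _ _ _ _ _ _ _ _) => //=.
- exact: rV_second_countable.
- by move=> _; exact: openT.
- by move=> _; rewrite image_id; exact: openT.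
- by move=> _ p _ A; exact.
- by move=> _ x _ A; exact.
- by move=> _ _; exact: smooth_on_id.
Defined.

Definition components (R : realType) (m : nat) (M : manifold R m) : Type :=
  chart M -> 'rV[R]_m.

(* Components in charts not containing the base point are irrelevant. *)
Definition tangent_at (R : realType) (m : nat) (M : manifold R m) (p : M)
    (v : components M) : Prop :=
  forall c d : chart M, dom c p -> dom d p ->
    v d = 'D_(v c) (coord d \o param c) (coord c p).

Definition lin_indep (R : realType) (m : nat) (M : manifold R m) (p : M)
    (vs : seq (components M)) : Prop :=
  forall a : 'I_(size vs) -> R,
    (forall c : chart M, dom c p ->
       \sum_(i < size vs) a i *: nth (fun=> 0) vs i c = 0) ->
    forall i, a i = 0.

Definition vfield (R : realType) (m : nat) (M : manifold R m) : Type :=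
  M -> components M.

Definition smooth_vfield (R : realType) (m : nat) (M : manifold R m)
    (U : set M) (X : vfield M) : Prop :=
  (forall p, U p -> tangent_at p (X p)) /\
  forall c : chart M,
    smooth_on (coord c @` (U `&` dom c)) (fun x => X (param c x) c).

Definition vfield_eq (R : realType) (m : nat) (M : manifold R m)
    (U : set M) (X Y : vfield M) : Prop :=
  forall (p : M) (c : chart M), U p -> dom c p -> X p c = Y p c.

Definition vfield_add (R : realType) (m : nat) (M : manifold R m)
    (X Y : vfield M) : vfield M := fun p c => X p c + Y p c.

Definition vfield_scale (R : realType) (m : nat) (M : manifold R m)
    (f : M -> R) (X : vfield M) : vfield M := fun p c => f p *: X p c.

(* [X f], computed in the chart [c]. *)
Definition vfield_apply (R : realType) (m : nat) (M : manifold R m)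
    (X : vfield M) (f : M -> R) (p : M) (c : chart M) : R :=
  'D_(X p c) (f \o param c) (coord c p).

Definition lie_bracket (R : realType) (m : nat) (M : manifold R m)
    (X Y : vfield M) : vfield M := fun p c =>
  'D_(X p c) (fun x => Y (param c x) c) (coord c p) -
  'D_(Y p c) (fun x => X (param c x) c) (coord c p).

(* The coordinate field [d/dx^i] of the chart [c], a vector field on [dom c]. *)
Definition coord_vfield (R : realType) (m : nat) (M : manifold R m)
    (c : chart M) (i : 'I_m) : vfield M := fun p d =>
  'D_(delta_mx 0 i) (coord d \o param c) (coord c p).

(* A connection acts on smooth vector fields defined on open subsets of [M]
   (a vector field on [U] is a [vfield] up to its values outside [U]),
   compatibly with restriction. *)
Record connection (R : realType) (m : nat) (M : manifold R m) := Connection {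
  cov :> vfield M -> vfield M -> vfield M ;
  cov_smooth : forall U X Y, open U ->
    smooth_vfield U X -> smooth_vfield U Y -> smooth_vfield U (cov X Y) ;
  cov_local : forall U X X' Y Y', open U ->
    smooth_vfield U X -> smooth_vfield U X' ->
    smooth_vfield U Y -> smooth_vfield U Y' ->
    vfield_eq U X X' -> vfield_eq U Y Y' ->
    vfield_eq U (cov X Y) (cov X' Y') ;
  cov_addl : forall U X X' Y, open U ->
    smooth_vfield U X -> smooth_vfield U X' -> smooth_vfield U Y ->
    vfield_eq U (cov (vfield_add X X') Y) (vfield_add (cov X Y) (cov X' Y)) ;
  cov_scalel : forall U f X Y, open U ->
    smooth_fun U f -> smooth_vfield U X -> smooth_vfield U Y ->
    vfield_eq U (cov (vfield_scale f X) Y) (vfield_scale f (cov X Y)) ;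
  cov_addr : forall U X Y Y', open U ->
    smooth_vfield U X -> smooth_vfield U Y -> smooth_vfield U Y' ->
    vfield_eq U (cov X (vfield_add Y Y')) (vfield_add (cov X Y) (cov X Y')) ;
  cov_leibniz : forall U f X Y, open U ->
    smooth_fun U f -> smooth_vfield U X -> smooth_vfield U Y ->
    vfield_eq U (cov X (vfield_scale f Y))
      (fun p c => vfield_apply X f p c *: Y p c + f p *: cov X Y p c)
}.

Definition torsion_free (R : realType) (m : nat) (M : manifold R m)
    (nabla : connection M) : Prop :=
  forall (U : set M) (X Y : vfield M), open U ->
    smooth_vfield U X -> smooth_vfield U Y ->
    vfield_eq U (fun p c => nabla X Y p c - nabla Y X p c) (lie_bracket X Y).

(* [christoffel nabla c l mu nu p] is Gamma^l_{mu nu} at the point [p] of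
   [dom c]. *)
Definition christoffel (R : realType) (m : nat) (M : manifold R m)
    (nabla : connection M) (c : chart M) (l mu nu : 'I_m) (p : M) : R :=
  nabla (coord_vfield c mu) (coord_vfield c nu) p c 0 l.

Definition velocity (R : realType) (m : nat) (M : manifold R m)
    (g : R -> M) : R -> components M :=
  fun t c => derive1 (coord c \o g) t.

Definition cov_along (R : realType) (m : nat) (M : manifold R m)
    (nabla : connection M) (g : R -> M) (v : R -> components M) :
    R -> components M := fun t c =>
  \row_(l < m) (derive1 (v ^~ c) t 0 l +
    \sum_(mu < m) \sum_(nu < m)
      christoffel nabla c l mu nu (g t) * velocity g t c 0 mu * v t c 0 nu).

(* Meant for [k >= 1]; [cov_iter nabla g 1] is the velocity of [g]. *)
Definition cov_iter (R : realType) (m : nat) (M : manifold R m)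
    (nabla : connection M) (g : R -> M) (k : nat) : R -> components M :=
  iter k.-1 (cov_along nabla g) (velocity g).

Definition geodesic (R : realType) (m : nat) (M : manifold R m)
    (nabla : connection M) (J : set R) (g : R -> M) : Prop :=
  smooth_curve J g /\
  forall (t : R) (c : chart M), J t -> dom c (g t) ->
    cov_along nabla g (velocity g) t c = 0.

Definition geodesic_reaches (R : realType) (m : nat) (M : manifold R m)
    (nabla : connection M) (x : M) (v : components M) (s : R) (y : M) : Prop :=
  exists (J : set R) (g : R -> M),
    [/\ open J /\ is_interval J, J 0 /\ J s, geodesic nabla J g,
        g 0 = x /\ (forall c : chart M, dom c x -> velocity g 0 c = v c) &
        g s = y].

(* phi(x, v, s); the value is the junk [x] when the maximal geodesic with
   initial velocity [v] does not reach time [s]. *)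
Definition geodesic_flow (R : realType) (m : nat) (M : manifold R m)
    (nabla : connection M) (x : M) (v : components M) (s : R) : M :=
  xget x [set y | geodesic_reaches nabla x v s y].

Definition pt (R : realType) (t s : R) : euclid R 2 :=
  (\row_(i < 2) (if i == 0 then t else s) : 'rV[R]_2).

Definition fst_coord (R : realType) (q : euclid R 2) : R := (q : 'rV[R]_2) 0 0.
Definition snd_coord (R : realType) (q : euclid R 2) : R := (q : 'rV[R]_2) 0 1.

Definition tangent_surface (R : realType) (m : nat) (M : manifold R m)
    (nabla : connection M) (g : R -> M) (q : euclid R 2) : M :=
  let t := fst_coord q in let s := snd_coord q in
  geodesic_flow nabla (g t) (velocity g t) s.

(* The germs of [f] at [p] and of [g] at [p'] are locally diffeomorphic.  The
   clause [V (f q)] makes the composition of germs meaningful. *)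
Definition locally_diffeomorphic (R : realType) (m n : nat)
    (M : manifold R m) (N : manifold R n)
    (f : euclid R 2 -> M) (p : euclid R 2)
    (g : euclid R 2 -> N) (p' : euclid R 2) : Prop :=
  exists (U U' : set (euclid R 2)) (V : set M) (V' : set N)
         (sigma : euclid R 2 -> euclid R 2) (tau : M -> N),
    [/\ diffeo_between U U' sigma /\ diffeo_between V V' tau,
        U p /\ sigma p = p', V (f p) /\ tau (f p) = g p' &
        forall q, U q -> V (f q) /\ tau (f q) = g (sigma q)].

Definition cuspidal_edge (R : realType) (m : nat) (q : euclid R 2) :
    euclid R m :=
  let t := fst_coord q in let s := snd_coord q in
  (\row_(i < m) nth 0 [:: t + s; t ^+ 2 + 2 * s * t; t ^+ 3 + 3 * s * t ^+ 2] i
   : 'rV[R]_m).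

Definition folded_umbrella (R : realType) (q : euclid R 2) : euclid R 3 :=
  let t := fst_coord q in let s := snd_coord q in
  (\row_(i < 3) nth 0 [:: t + s; t ^+ 2 + 2 * s * t; t ^+ 4 + 4 * s * t ^+ 3] i
   : 'rV[R]_3).

(* Main.v *)
(* Read in a chart and in the parameters [a = t + s], [w = s], the surface has
   vanishing [w]-derivative along [w = 0].  Whitney's theorem on even functions
   therefore puts it in the form [x(a) + w^2 A(a, w^2) + w^3 B(a, w^2)], where
   [x] is the curve; the geodesic equation and the symmetry of the Christoffel
   symbols give [A(a, 0) = - nabla^2 gamma / 2] and [B(a, 0) = nabla^3 gamma / 3].

   If these vectors and [x'] are independent, [x(a) + y A(a, y) + z B(a, y)] is
   (after completing a basis) a chart in which the surface is [(a, w^2, w^3)],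
   and a polynomial diffeomorphism turns this into the cuspidal edge.

   Otherwise [B] is replaced in this chart by [nabla^4 gamma (t0)], and the
   surface becomes [(a + w^3 P0, w^2 + w^3 P1, w^3 P2)] where [P2] vanishes at the
   origin and, by differentiating [P0 x' + P1 A + P2 nabla^4 gamma = B] along the
   curve, has [a]-derivative [1/3] there.  A change of source coordinates
   and another application of Whitney's theorem lead to [(a, w^2, a w^3)]. *)

(* At fixed [a = t + s] the [w]-derivative is [D = d/ds - d/dt], applied to the family [X(t, s)] of
   geodesics. On [s = 0] it satisfies [D X = 0], [D^2 X = - nabla^2 gamma] and
   [D^3 X = 2 nabla^3 gamma]; the Taylor factors [1/2] and [1/6] turn this into [-1/2] and [1/3].
   Torsion freeness enters in [D^3 X], where two Christoffel terms with exchanged arguments must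
   coincide. The geodesic flow is defined by a choice, which carries no regularity. It is therefore
   identified with the solution of a first-order system in a chart, and smoothness in [(t, s)] is
   proved for that solution. The analytic obstacle is smoothness in [y = w^2] at [y = 0]. An even
   function is written as a Borel-type series in [y], with sines in place of cut-off functions, plus
   a flat remainder that survives the substitution [w = sqrt y]. For the models, [t = a - w] and
   [s = w] give [(a, a^2 - w^2, a^3 - 3 a w^2 + 2 w^3)] and the last component
   [a^4 - 6 a^2 w^2 + 8 a w^3 - 3 w^4], which are triangular in [(a, w^2, w^3)] and
   [(a, w^2, a w^3)]. *)
Require Import Defs.
From HB Require Import structures.
From mathcomp Require Import all_boot all_order all_algebra.
From mathcomp Require Import all_classical all_reals all_analysis.
From mathcomp Require Import ring lra.
Import numFieldNormedType.Exports.
Import Order.TTheory GRing.Theory Num.Theory.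
Set Implicit Arguments.
Unset Strict Implicit.
Unset Printing Implicit Defensive.
Local Open Scope classical_set_scope.
Local Open Scope ring_scope.

(* The vector library also has a [coord]. *)
Local Notation coord := Defs.coord.

(** * Directional derivatives and coordinates *)

Section NormedCalculus.
Context {R : realType}.
Implicit Types V W X : normedModType R.

Lemma nbhs_norm_ltP (V : normedModType R) (x : V) (A : set V) :
  (\forall y \near x, A y) <-> exists2 e : R, 0 < e & forall y, `|y - x| < e -> A y.
Proof.
split=> [/nbhs_ballP[e /= e0 eA]|[e e0 eA]].
  by exists e => // y yx; apply: eA; rewrite -ball_normE /= distrC.
by apply/nbhs_ballP; exists e => //= y; rewrite -ball_normE /= distrC; exact: eA.
Qed.

Lemma differentiable_of_estimate V W (f : V -> W) (df : {linear V -> W}) y :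
  continuous df ->
  (forall e, 0 < e ->
    \forall h \near (0 : V), `|f (h + y) - f y - df h| <= e * `|h|) ->
  differentiable f y /\ ('d f y = df :> (V -> W)).
Proof.
move=> dfc H.
have E : f \o shift y = cst (f y) + df +o_ (0 : V) id.
  apply/eqaddoP => e e0; apply: filterS (H e e0) => h /=.
  by rewrite -![(_ - _ : _ -> _) _]/(_ - _) -![(_ + _ : _ -> _) _]/(_ + _) opprD addrA.
have D := diff_unique dfc E; split=> //.
by apply/diff_locallyP; rewrite D.
Qed.

Lemma derive_line V W (f : V -> W) a v :
  'D_v f a = 'D_1 (fun h : R => f (h *: v + a)) 0.
Proof.
rewrite /derive; set g1 := fun h => h^-1 *: _; set g2 := fun h => h^-1 *: _.
suff -> : g1 = g2 by [].
by rewrite funeqE /g1 /g2 => h /=; rewrite addr0 scale0r add0r [_%:A]mulr1.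
Qed.

(** Only a derivative of [f] in one direction is assumed. Restricting [f] to the line through [a]
    gives a function on [R], where derivability is differentiability, so the chain rule for
    differentials applies. *)
Lemma is_derive_chain V W X (f : V -> W) (g : W -> X) a v df :
  differentiable g (f a) -> is_derive a v f df ->
  is_derive a v (g \o f) ('d g (f a) df).
Proof.
move=> dg [dfa dfE].
pose p (h : R) := f (h *: v + a).
have p0 : p 0 = f a by rewrite /p scale0r add0r.
have dp : differentiable p 0.
  by apply: (derivable1_diffP _ _).1; exact: (derivable1P _ _ _).1 dfa.
have dgp : differentiable (g \o p) 0 by apply: differentiable_comp => //; rewrite p0.
have d1 : derivable (g \o f) a v.
  by apply: (derivable1P _ _ _).2; exact: (derivable1_diffP _ _).2 dgp.
apply: DeriveDef => //.
rewrite derive_line (deriveE _ dgp) diff_comp //= ?p0//.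
by rewrite -dfE derive_line (deriveE _ dp) /=.
Qed.

(** The line in direction [c *: v] is the line in direction [v] reparametrised by [h |-> h * c];
    this also covers [c = 0]. *)
Lemma is_derive_dirZ V W (f : V -> W) a v df (c : R) :
  is_derive a v f df -> is_derive a (c *: v) f (c *: df).
Proof.
move=> [dfa dfE].
pose p (h : R) := f (h *: v + a).
have dp : differentiable p 0.
  by apply: (derivable1_diffP _ _).1; exact: (derivable1P _ _ _).1 dfa.
pose q (h : R) := h * c.
have q0 : q 0 = 0 by rewrite /q mul0r.
have dq : is_derive (0 : R) (1 : R) q c.
  have -> : q = c *: (id : R -> R) by apply/funext => h; rewrite /q mulrC.
  by apply: is_derive_eq; rewrite [_ *: _]mulr1.
have dp' : differentiable p (q 0) by rewrite q0.
have H := is_derive_chain dp' dq.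
have E : (fun h : R => f (h *: (c *: v) + a)) = p \o q.
  by apply/funext => h; rewrite /p /q /= scalerA.
apply: DeriveDef; first by apply/derivable1P; rewrite E; case: H.
rewrite derive_line E; case: H => _ ->; rewrite q0.
rewrite -[in LHS](mulr1 c) -[c * 1]/(c *: (1 : R)) linearZ /=; congr (_ *: _).
by rewrite -dfE derive_line -(deriveE _ dp).
Qed.

Lemma is_derive_line V W (f : V -> W) a v (s : R) :
  derivable f (a + s *: v) v ->
  is_derive s (1 : R) (fun s => f (a + s *: v)) ('D_v f (a + s *: v)).
Proof.
move=> d; have E : (fun h : R => h^-1 *: (f (a + (h *: 1 + s) *: v) - f (a + s *: v)))
   = (fun h : R => h^-1 *: (f (h *: v + (a + s *: v)) - f (a + s *: v))).
  apply/funext => h; congr (_ *: (f _ - _)).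
  by rewrite [h%:A]mulr1 scalerDl addrCA addrA.
by apply: DeriveDef; rewrite /derivable /derive /= E.
Qed.

Lemma line_mvt V (f : V -> R) a v :
  (forall th : R, 0 <= th <= 1 -> derivable f (a + th *: v) v) ->
  exists2 th : R, 0 <= th <= 1 & f (a + v) - f a = 'D_v f (a + th *: v).
Proof.
move=> d.
have [|s|c cI] := @MVT_segment R (fun s => f (a + s *: v))
    (fun s => 'D_v f (a + s *: v)) 0 1 ler01.
- move=> s; rewrite in_itv /= => /andP[s0 s1].
  by apply: is_derive_line; apply: d; rewrite !ltW.
- apply: derivable_within_continuous => {}s; rewrite in_itv /= => sI.
  by have [] := is_derive_line (d s sI).
rewrite scale1r scale0r addr0 subr0 mulr1 => E.
by exists c => //; move: cI; rewrite in_itv.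
Qed.

End NormedCalculus.

(** * Row vectors with the sup norm *)

Section RowVectors.
Context {R : realType}.
Local Notation e_ i := (delta_mx 0 i).

Lemma coord_le_norm n (x : 'rV[R]_n) j : `|x 0 j| <= `|x|.
Proof.
rewrite [leRHS]/Num.Def.normr /= mx_normrE.
exact: (le_bigmax _ (fun ij : 'I_1 * 'I_n => `|x ij.1 ij.2|) (0, j)).
Qed.

Lemma norm_rV_le n (x : 'rV[R]_n) e :
  0 <= e -> (forall j, `|x 0 j| <= e) -> `|x| <= e.
Proof.
move=> e0 H; rewrite /Num.Def.normr /= mx_normrE; apply: bigmax_le => //.
by move=> [i j] _ /=; rewrite ord1.
Qed.

Lemma norm_rV_lt n (x : 'rV[R]_n) e :
  0 < e -> (forall j, `|x 0 j| < e) -> `|x| < e.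
Proof.
move=> e0 H; rewrite /Num.Def.normr /= mx_normrE; apply: bigmax_lt => //.
by move=> [i j] _ /=; rewrite ord1.
Qed.

Lemma norm_e n (i : 'I_n) : `|e_ i : 'rV[R]_n| <= 1.
Proof.
by apply: norm_rV_le => // j; rewrite mxE; case: eqP => _; case: eqP; rewrite ?normr0 ?normr1.
Qed.

Lemma rV_sum_e n (x : 'rV[R]_n) : x = \sum_i x 0 i *: e_ i.
Proof. exact: row_sum_delta. Qed.

Lemma norm_dot_le n (x a : 'rV[R]_n) :
  `|\sum_i x 0 i * a 0 i| <= n%:R * (`|x| * `|a|).
Proof.
apply: (le_trans (ler_norm_sum _ _ _)).
apply: (@le_trans _ _ (\sum_(i < n) (`|x| * `|a|))).
  by apply: ler_sum => i _; rewrite normrM ler_pM ?coord_le_norm.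
by rewrite sumr_const card_ord mulr_natl.
Qed.

Definition hyb n (z z' : 'rV[R]_n) k : 'rV[R]_n :=
  \row_i (if (i < k)%N then z 0 i else z' 0 i).

Lemma hybS n (z z' : 'rV[R]_n) (k : 'I_n) :
  hyb z z' k.+1 = hyb z z' k + (z - z') 0 k *: e_ k.
Proof.
apply/rowP => i; rewrite !mxE eqxx /= ltnS leq_eqVlt.
have [->|ik] := eqVneq i k.
  by rewrite eqxx ltnn /= mulr1 addrC subrK.
by rewrite -[(i == k :> nat)]/(i == k) (negbTE ik) /= mulr0 addr0.
Qed.

(** Every coordinate of the point is one of [z], of [z'], or a convex combination of the two, so the
    sup-norm ball is not left. *)
Lemma hyb_near n (z z' y : 'rV[R]_n) d k (th : R) (i : 'I_n) : 0 < d -> 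
  `|z - y| < d -> `|z' - y| < d -> 0 <= th <= 1 -> i = k :> nat ->
  `|hyb z z' k + th *: ((z - z') 0 i *: e_ i) - y| < d.
Proof.
move=> d0 zy z'y /andP[th0 th1] ik; apply: norm_rV_lt => // j; rewrite !mxE eqxx /=.
have zj := le_lt_trans (coord_le_norm (z - y) j) zy.
have z'j := le_lt_trans (coord_le_norm (z' - y) j) z'y.
rewrite !mxE in zj z'j.
have [ji|ji] := eqVneq j i; last first.
  by rewrite /= !mulr0 addr0; case: ifP.
rewrite ji ik ltnn mulr1 -ji.
have -> : z' 0 j + th * (z 0 j - z' 0 j) - y 0 j =
   th * (z 0 j - y 0 j) + (1 - th) * (z' 0 j - y 0 j) by ring.
apply: (le_lt_trans (ler_normD _ _)); rewrite !normrM.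
rewrite (ger0_norm th0) (@ger0_norm _ (1 - th)) ?subr_ge0//.
have [->|thn0] := eqVneq th 0; first by rewrite mul0r add0r subr0 mul1r.
have : th * `|z 0 j - y 0 j| < th * d by rewrite ltr_pM2l // lt_def thn0.
have : (1 - th) * `|z' 0 j - y 0 j| <= (1 - th) * d.
  by rewrite ler_wpM2l ?subr_ge0 // ltW.
move=> h1 h2; have := ltr_leD h2 h1.
by have -> : th * d + (1 - th) * d = d by ring.
Qed.

(* Moving one coordinate at a time stays inside a ball of the sup norm, so only
   partial derivatives are involved. *)
Lemma hyb_increment n (f : 'rV[R]_n -> R) (z z' y a : 'rV[R]_n) d e :
  0 < d ->
  (forall i x, `|x - y| < d -> derivable f x (e_ i) /\
      `|'D_(e_ i) f x - a 0 i| <= e) ->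
  `|z - y| < d -> `|z' - y| < d ->
  `|f z - f z' - \sum_i (z - z') 0 i * a 0 i| <= n%:R * (e * `|z - z'|).
Proof.
move=> d0 H zy z'y.
have -> : f z - f z' = \sum_(k < n) (f (hyb z z' k.+1) - f (hyb z z' k)).
  rewrite -(big_mkord xpredT (fun k => f (hyb z z' k.+1) - f (hyb z z' k))).
  rewrite telescope_sumr //; congr (f _ - f _).
  - by apply/rowP => i; rewrite mxE ltn_ord.
  - by apply/rowP => i; rewrite mxE.
rewrite -sumrB; apply: (le_trans (ler_norm_sum _ _ _)).
apply: (@le_trans _ _ (\sum_(i < n) (e * `|z - z'|))); last first.
  by rewrite sumr_const card_ord mulr_natl.
apply: ler_sum => k _; rewrite hybS.
set c := (z - z') 0 k.
have dk (th : R) : 0 <= th <= 1 -> is_derive (hyb z z' k + th *: (c *: e_ k)) (c *: e_ k) f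
    (c *: 'D_(e_ k) f (hyb z z' k + th *: (c *: e_ k))).
  move=> thI; apply: is_derive_dirZ; apply: derivableP.
  by apply: (H k _ _).1; apply: hyb_near.
have [|th thI ->] := @line_mvt R _ f (hyb z z' k) (c *: e_ k).
  by move=> th /dk [].
have [_ ->] := dk th thI.
rewrite -[_ *: _]/(_ * _) -mulrBr normrM mulrC ler_pM // ?coord_le_norm //.
by apply: (H k _ _).2; apply: hyb_near.
Qed.

End RowVectors.

(** * Stability of differentiability classes *)

Section CkTheory.
Context {R : realType}.
Implicit Types (W : normedModType R).
Local Notation e_ i := (delta_mx 0 i).

Lemma Ck_on_cont n W k (U : set 'rV[R]_n) (f : 'rV[R]_n -> W) x :
  Ck_on k U f -> U x -> {for x, continuous f}.
Proof. by case: k => [|k] [H _] Ux; exact: H. Qed.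

Lemma Ck_on_sub n W k (U V : set 'rV[R]_n) (f : 'rV[R]_n -> W) :
  V `<=` U -> Ck_on k U f -> Ck_on k V f.
Proof.
move=> VU; elim: k f => [|k IH] f /= [cf df]; split=> //.
- by move=> x /VU; exact: cf.
- by move=> x /VU; exact: cf.
- move=> i; have [d1 d2] := df i; split; last exact: IH.
  by move=> x /VU; exact: d1.
Qed.

Lemma Ck_onW n W k (U : set 'rV[R]_n) (f : 'rV[R]_n -> W) :
  Ck_on k.+1 U f -> Ck_on k U f.
Proof.
elim: k f => [|k IH] f [cf df]; split=> // i.
have [d1 d2] := df i; split=> //; exact: IH.
Qed.

Lemma Ck_on_le n W k l (U : set 'rV[R]_n) (f : 'rV[R]_n -> W) :
  (k <= l)%N -> Ck_on l U f -> Ck_on k U f.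
Proof.
elim: l => [|l IH]; first by rewrite leqn0 => /eqP ->.
by rewrite leq_eqVlt => /orP[/eqP-> //|]; rewrite ltnS => kl /Ck_onW; exact: IH.
Qed.

Lemma near_open n (U : set 'rV[R]_n) x : open U -> U x -> \forall y \near x, U y.
Proof. by move=> oU Ux; exact: open_nbhs_nbhs. Qed.

Lemma near_and (T : topologicalType) (x : T) (P Q : T -> Prop) :
  (\forall y \near x, P y) -> (\forall y \near x, Q y) -> \forall y \near x, P y /\ Q y.
Proof. exact: filterI. Qed.

Lemma near_forall (T : topologicalType) (I : finType) (x : T) (P : I -> T -> Prop) :
  (forall i, \forall y \near x, P i y) -> \forall y \near x, forall i, P i y.
Proof. exact: filter_forall. Qed.

Lemma continuous_near_eq (S T : topologicalType) (f g : S -> T) (x : S) :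
  (\forall y \near x, f y = g y) -> {for x, continuous f} -> {for x, continuous g}.
Proof.
move=> fg cf; rewrite /prop_for /continuous_at -(nbhs_singleton fg).
by apply: cvg_trans cf; apply: near_eq_cvg.
Qed.

Lemma Ck_on_ext n W k (U : set 'rV[R]_n) (f g : 'rV[R]_n -> W) :
  open U -> (forall x, U x -> f x = g x) -> Ck_on k U f -> Ck_on k U g.
Proof.
move=> oU; elim: k f g => [|k IH] f g fg [cf df];
  have nfg x : U x -> \forall y \near x, f y = g y
    by move=> Ux; apply: filterS (near_open oU Ux) => y /fg.
  by split=> // x Ux; exact: continuous_near_eq (nfg x Ux) (cf x Ux).
split; first by move=> x Ux; exact: continuous_near_eq (nfg x Ux) (cf x Ux).
move=> i; have [d1 d2] := df i; split.
  by move=> x Ux; apply: near_eq_derivable (nfg x Ux) (d1 x Ux).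
by apply: IH d2 => x Ux; exact: near_eq_derive (nfg x Ux).
Qed.

(** Successor step with the partial derivatives given by a formula. Each closure property below then
    becomes an induction on [k] in which the formula is handled by the induction hypothesis. *)
Lemma Ck_onS n W k (U : set 'rV[R]_n) (f : 'rV[R]_n -> W) g :
  open U -> (forall x, U x -> {for x, continuous f}) ->
  (forall i x, U x -> is_derive x (e_ i) f (g i x)) ->
  (forall i, Ck_on k U (g i)) -> Ck_on k.+1 U f.
Proof.
move=> oU cf df Cg; split=> // i; split; first by move=> x /(df i) [].
by apply: Ck_on_ext (Cg i) => // x /(df i) [_ ->].
Qed.

Lemma cvg_rV (T : Type) (F : set_system T) {FF : Filter F} m (f : T -> 'rV[R]_m) (l : 'rV[R]_m) :
  (forall j, (fun t => f t 0 j) @ F --> l 0 j) -> f @ F --> l.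
Proof.
move=> H; apply/cvgrPdist_lt => e e0.
have Hf : \forall t \near F, forall j, `|l 0 j - f t 0 j| < e.
  apply: filter_forall => j; have /cvgrPdist_lt /(_ e e0) := H j.
  by rewrite near_simpl.
rewrite near_simpl; near=> t.
apply: norm_rV_lt => // j; rewrite !mxE.
by move: j; near: t; exact: Hf.
Unshelve. all: by end_near. Qed.

Lemma continuous_rV (T : topologicalType) m (f : T -> 'rV[R]_m) (x : T) :
  (forall j, {for x, continuous (fun y => f y 0 j)}) -> {for x, continuous f}.
Proof. by move=> H; apply: (@cvg_rV _ (nbhs x)) => j; exact: H. Qed.

Lemma Ck_on_coord n m k (U : set 'rV[R]_n) (f : 'rV[R]_n -> 'rV[R]_m) j :
  open U -> Ck_on k U f -> Ck_on k U (fun x => f x 0 j).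
Proof.
move=> oU; elim: k f => [|k IH] f [cf df].
  by split=> // x Ux; exact: (cvg_comp _ _ (cf x Ux) (@coord_continuous R 1 m 0 j _)).
apply: (@Ck_onS _ _ _ _ _ (fun i x => 'D_(e_ i) f x 0 j)) => //.
- move=> x Ux; exact: (cvg_comp _ _ (cf x Ux) (@coord_continuous R 1 m 0 j _)).
- move=> i x Ux; have d := (df i).1 x Ux; apply: DeriveDef.
    exact: (derivable_mxP _ _ _).1 d 0 j.
  by rewrite (derive_mx d) mxE.
- by move=> i; apply: IH; exact: (df i).2.
Qed.

Lemma Ck_on_rV n m k (U : set 'rV[R]_n) (f : 'rV[R]_n -> 'rV[R]_m) :
  open U -> (forall j, Ck_on k U (fun x => f x 0 j)) -> Ck_on k U f.
Proof.
move=> oU; elim: k f => [|k IH] f H.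
  by split=> // x Ux; apply: continuous_rV => j; exact: (H j).1.
apply: (@Ck_onS _ _ _ _ _ (fun i x => \row_j 'D_(e_ i) (fun x => f x 0 j) x)) => //.
- by move=> x Ux; apply: continuous_rV => j; exact: (H j).1.
- move=> i x Ux.
  have d : derivable f x (e_ i).
    by apply/derivable_mxP => a b; rewrite ord1; exact: ((H b).2 i).1.
  apply: DeriveDef => //; rewrite (derive_mx d).
  by apply/matrixP => a b; rewrite ord1 !mxE.
- move=> i; apply: IH => j; have [_ /(_ i)[_ Hj]] := H j.
  by apply: Ck_on_ext Hj => // x _; rewrite mxE.
Qed.

Lemma Ck_on_D n W k (U : set 'rV[R]_n) (f g : 'rV[R]_n -> W) :
  open U -> Ck_on k U f -> Ck_on k U g -> Ck_on k U (fun x => f x + g x).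
Proof.
move=> oU; elim: k f g => [|k IH] f g [cf df] [cg dg].
  by split=> // x Ux; apply: continuousD; [exact: cf|exact: cg].
apply: (@Ck_onS _ _ _ _ _ (fun i x => 'D_(e_ i) f x + 'D_(e_ i) g x)) => //.
- by move=> x Ux; apply: continuousD; [exact: cf|exact: cg].
- move=> i x Ux; apply: is_deriveD; apply: derivableP;
    [exact: (df i).1|exact: (dg i).1].
- by move=> i; apply: IH; [exact: (df i).2|exact: (dg i).2].
Qed.

Lemma Ck_on_Z n W k (U : set 'rV[R]_n) (c : R) (f : 'rV[R]_n -> W) :
  open U -> Ck_on k U f -> Ck_on k U (fun x => c *: f x).
Proof.
move=> oU; elim: k f => [|k IH] f [cf df].
  by split=> // x Ux; apply: continuousZl_tmp; exact: cf.
apply: (@Ck_onS _ _ _ _ _ (fun i x => c *: 'D_(e_ i) f x)) => //.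
- by move=> x Ux; apply: continuousZl_tmp; exact: cf.
- by move=> i x Ux; apply: is_deriveZ; apply: derivableP; exact: (df i).1.
- by move=> i; apply: IH; exact: (df i).2.
Qed.

Lemma Ck_on_N n W k (U : set 'rV[R]_n) (f : 'rV[R]_n -> W) :
  open U -> Ck_on k U f -> Ck_on k U (fun x => - f x).
Proof.
move=> oU Cf; have -> : (fun x => - f x) = (fun x => (-1) *: f x).
  by apply/funext => x; rewrite scaleN1r.
exact: Ck_on_Z.
Qed.

Lemma Ck_on_B n W k (U : set 'rV[R]_n) (f g : 'rV[R]_n -> W) :
  open U -> Ck_on k U f -> Ck_on k U g -> Ck_on k U (fun x => f x - g x).
Proof. by move=> oU Cf Cg; apply: Ck_on_D => //; exact: Ck_on_N. Qed.

Lemma Ck_on_M n k (U : set 'rV[R]_n) (f g : 'rV[R]_n -> R) :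
  open U -> Ck_on k U f -> Ck_on k U g -> Ck_on k U (fun x => f x * g x).
Proof.
move=> oU; elim: k f g => [|k IH] f g Cf Cg.
  by split=> // x Ux; apply: continuousM; [exact: Cf.1|exact: Cg.1].
apply: (@Ck_onS _ _ _ _ _ (fun i x => f x * 'D_(e_ i) g x + g x * 'D_(e_ i) f x)) => //.
- by move=> x Ux; apply: continuousM; [exact: Cf.1|exact: Cg.1].
- move=> i x Ux; apply: (@is_deriveM _ _ f g); apply: derivableP;
    [exact: (Cf.2 i).1|exact: (Cg.2 i).1].
- move=> i; apply: Ck_on_D => //; apply: IH.
  + exact: Ck_onW Cf.
  + exact: (Cg.2 i).2.
  + exact: Ck_onW Cg.
  + exact: (Cf.2 i).2.
Qed.

Lemma Ck_on_X n k (U : set 'rV[R]_n) (f : 'rV[R]_n -> R) p :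
  open U -> Ck_on k U f -> Ck_on k U (fun x => f x ^+ p).
Proof.
move=> oU Cf; elim: p => [|p IH]; first exact: (@Ck_on_cst R n R k U 1).
apply: (@Ck_on_ext _ _ _ _ (fun x => f x * f x ^+ p)) => //.
  by move=> x _; rewrite exprS.
exact: Ck_on_M.
Qed.

Lemma Ck_on_sum n W k (U : set 'rV[R]_n) (I : Type) (r : seq I) (P : pred I)
    (f : I -> 'rV[R]_n -> W) :
  open U -> (forall i, P i -> Ck_on k U (f i)) ->
  Ck_on k U (fun x => \sum_(i <- r | P i) f i x).
Proof.
move=> oU H; elim: r => [|i r IH].
  by apply: (@Ck_on_ext _ _ _ _ (fun=> 0)); [|move=> x _; rewrite big_nil|exact: Ck_on_cst].
apply: (@Ck_on_ext _ _ _ _ (fun x => (if P i then f i x else 0) + \sum_(j <- r | P j) f j x)) => //.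
  by move=> x _; rewrite big_cons; case: ifP; rewrite ?add0r.
by apply: Ck_on_D => //; case: (boolP (P i)) => [/H//|_]; exact: Ck_on_cst.
Qed.

Lemma Ck_on_prod n k (U : set 'rV[R]_n) (I : Type) (r : seq I) (P : pred I)
    (f : I -> 'rV[R]_n -> R) :
  open U -> (forall i, P i -> Ck_on k U (f i)) ->
  Ck_on k U (fun x => \prod_(i <- r | P i) f i x).
Proof.
move=> oU H; elim: r => [|i r IH].
  by apply: (@Ck_on_ext n R _ _ (fun=> 1)); [|move=> x _; rewrite big_nil|exact: (@Ck_on_cst R n R)].
apply: (@Ck_on_ext n R _ _ (fun x => (if P i then f i x else 1) * \prod_(j <- r | P j) f j x)) => //.
  by move=> x _; rewrite big_cons; case: ifP; rewrite ?mul1r.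
by apply: Ck_on_M => //; case: (boolP (P i)) => [/H//|_]; exact: (@Ck_on_cst R n R).
Qed.

Lemma Ck_on_id n k (U : set 'rV[R]_n) : Ck_on k U (id : 'rV[R]_n -> 'rV[R]_n).
Proof. exact: smooth_on_id. Qed.

Lemma Ck_on_proj n k (U : set 'rV[R]_n) j : open U -> Ck_on k U (fun x : 'rV[R]_n => x 0 j).
Proof. by move=> oU; exact: (@Ck_on_coord n n k U id j oU (@Ck_on_id n k U)). Qed.

Lemma Ck_on_mulmx n p q k (U : set 'rV[R]_n) (f : 'rV[R]_n -> 'rV[R]_p) (A : 'M[R]_(p, q)) :
  open U -> Ck_on k U f -> Ck_on k U (fun x => f x *m A).
Proof.
move=> oU Cf; apply: Ck_on_rV => // j.
apply: (@Ck_on_ext _ _ _ _ (fun x => \sum_i A i j *: (f x 0 i : R))) => //.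
  by move=> x _; rewrite mxE; apply: eq_bigr => i _; rewrite [LHS]mulrC.
apply: Ck_on_sum => // i _; apply: Ck_on_Z => //; exact: Ck_on_coord.
Qed.

(** Strict differentiability, with two moving points: it yields the Lipschitz and contraction
    estimates of the inverse function theorem and of the ODE theory. *)
Lemma C1_strict n (U : set 'rV[R]_n) (f : 'rV[R]_n -> R) y (e : R) :
  open U -> Ck_on 1 U f -> U y -> 0 < e ->
  exists2 d, 0 < d & forall z z', `|z - y| < d -> `|z' - y| < d ->
   `|f z - f z' - \sum_i (z - z') 0 i * 'D_(e_ i) f y| <= e * `|z - z'|.
Proof.
(* [hyb_increment] adds up [n] errors; dividing by [n + 1] absorbs this factor and keeps [e']
   defined when [n = 0]. *)
move=> oU [cf df] Uy e0; pose e' := e / n.+1%:R.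
have e'0 : 0 < e' by rewrite divr_gt0.
have H2 : \forall x \near y, forall i, `|'D_(e_ i) f x - 'D_(e_ i) f y| <= e'.
  apply: near_forall => i; have := (df i).2.1 y Uy => /cvgrPdist_le /(_ _ e'0).
  by rewrite near_simpl => H; near do rewrite distrC.
have H1 : \forall x \near y, U x /\ forall i, `|'D_(e_ i) f x - 'D_(e_ i) f y| <= e'.
  exact: near_and (near_open oU Uy) H2.
have [d d0 H] := (nbhs_norm_ltP _ _).1 H1.
exists d => // z z' zy z'y.
have Hd i x : `|x - y| < d -> derivable f x (e_ i) /\
    `|'D_(e_ i) f x - (\row_i 'D_(e_ i) f y) 0 i| <= e'.
  by move=> /H[Ux Hx]; rewrite mxE; split; [exact: (df i).1|exact: Hx].
have := hyb_increment d0 Hd zy z'y.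
under eq_bigr do rewrite [(\row_i _) _ _]mxE.
move=> Hh; apply: (le_trans Hh).
rewrite mulrA ler_wpM2r // /e' mulrA ler_pdivrMr ?ltr0n // mulrC.
by rewrite ler_wpM2l ?ler_nat // ltW.
Unshelve. all: by end_near. Qed.

Lemma C1_differentiable n (U : set 'rV[R]_n) (f : 'rV[R]_n -> R) y :
  open U -> Ck_on 1 U f -> U y ->
  differentiable f y /\ forall v, 'd f y v = \sum_i v 0 i * 'D_(e_ i) f y.
Proof.
move=> oU Cf Uy.
pose g (v : 'rV[R]_n) := \sum_i v 0 i * 'D_(e_ i) f y.
have lin_g : linear g.
  move=> a u v; rewrite /g scaler_sumr -big_split /=; apply: eq_bigr => i _.
  by rewrite !mxE mulrDl -mulrA.
pose gL : {linear 'rV[R]_n -> R} := HB.pack g (GRing.isLinear.Build _ _ _ _ g lin_g).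
have cg : continuous gL.
  move=> v; apply: (@Ck_on_cont n R 0 setT g v) => //.
  apply: Ck_on_sum => [|i _]; first exact: openT.
  apply: Ck_on_M; [exact: openT|apply: Ck_on_proj; exact: openT|exact: (@Ck_on_cst R n R)].
have [e e0|dfy dfE] := @differentiable_of_estimate R _ _ f gL y cg.
  have [d d0 H] := C1_strict oU Cf Uy e0.
  apply/nbhs_norm_ltP; exists d => // h; rewrite subr0 => hd.
  have := H (h + y) y; rewrite addrK subrr normr0; exact.
by split=> // v; rewrite dfE.
Qed.

Lemma differentiable_rV n m (f : 'rV[R]_n -> 'rV[R]_m) y :
  (forall j, differentiable (fun x => f x 0 j) y) -> differentiable f y.
Proof.
move=> H; have -> : f = \sum_(j < m) (fun x => f x 0 j *: (e_ j : 'rV[R]_m)).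
  apply/funext => x; rewrite [LHS]rV_sum_e fct_sumE.
  by [].
by apply: differentiable_sum => j; apply: differentiableZl.
Qed.

Lemma C1_differentiable_rV n m (U : set 'rV[R]_n) (f : 'rV[R]_n -> 'rV[R]_m) y :
  open U -> Ck_on 1 U f -> U y -> differentiable f y.
Proof.
move=> oU Cf Uy; apply: differentiable_rV => j.
by have [] := C1_differentiable oU (Ck_on_coord j oU Cf) Uy.
Qed.

Lemma derive_sum_e_rV n m (f : 'rV[R]_n -> 'rV[R]_m) y v :
  differentiable f y -> 'D_v f y = \sum_i v 0 i *: 'D_(e_ i) f y.
Proof.
move=> df; rewrite deriveE // {1}(rV_sum_e v) raddf_sum; apply: eq_bigr => i _.
by rewrite /= linearZ /= deriveE.
Qed.

(** The partials of the composite are sums of products of a partial of [f] with a partial of [g]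
    taken along [f], to which the induction hypothesis applies one order lower. Full
    differentiability of [g] comes from its being of class C1. *)
Lemma Ck_on_comp n p k (U : set 'rV[R]_n) (V : set 'rV[R]_p)
    (f : 'rV[R]_n -> 'rV[R]_p) (g : 'rV[R]_p -> R) :
  open U -> open V -> (forall x, U x -> V (f x)) ->
  Ck_on k U f -> Ck_on k V g -> Ck_on k U (fun x => g (f x)).
Proof.
move=> oU oV UV; elim: k f g UV => [|k IH] f g UV Cf Cg.
  split=> // x Ux; apply: (cvg_comp _ _ (Cf.1 x Ux)); exact: Cg.1 (UV x Ux).
apply: (@Ck_onS _ _ _ _ _ (fun i x => \sum_j 'D_(e_ i) f x 0 j * 'D_(e_ j) g (f x))) => //.
- move=> x Ux; apply: (cvg_comp _ _ (Cf.1 x Ux)); exact: Cg.1 (UV x Ux).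
- move=> i x Ux.
  have [dg dgE] := C1_differentiable oV (Ck_on_le (ltn0Sn k) Cg) (UV x Ux).
  have df := derivableP ((Cf.2 i).1 x Ux).
  by have := is_derive_chain dg df; rewrite dgE.
- move=> i; apply: Ck_on_sum => // j _; apply: Ck_on_M => //.
    by apply: Ck_on_coord => //; exact: (Cf.2 i).2.
  by apply: (IH f ('D_(e_ j) g)) => //; [exact: Ck_onW Cf|exact: (Cg.2 j).2].
Qed.

Lemma Ck_on_comp_rV n p m k (U : set 'rV[R]_n) (V : set 'rV[R]_p)
    (f : 'rV[R]_n -> 'rV[R]_p) (g : 'rV[R]_p -> 'rV[R]_m) :
  open U -> open V -> (forall x, U x -> V (f x)) ->
  Ck_on k U f -> Ck_on k V g -> Ck_on k U (fun x => g (f x)).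
Proof.
move=> oU oV UV Cf Cg; apply: Ck_on_rV => // j.
by apply: (@Ck_on_comp _ _ _ _ V f (fun y => g y 0 j)) => //; exact: Ck_on_coord.
Qed.

Lemma is_derive_outer n (H : R -> R) (h' : R) (f : 'rV[R]_n -> R) x v df :
  is_derive (f x) 1 H h' -> is_derive x v f df ->
  is_derive x v (fun x => H (f x)) (df * h').
Proof.
move=> [dH HE] Df.
have dH' : differentiable H (f x) by apply: (derivable1_diffP _ _).1.
apply: is_derive_eq; first exact: is_derive_chain dH' Df.
rewrite -[df]mulr1 -[df * 1]/(df *: (1 : R)) linearZ /= -HE deriveE //.
by rewrite [_ *: 1]mulr1.
Qed.

(** [H] lists the successive derivatives of the outer function. The induction moves from [H j] to
    [H j.+1], hence the statement for all [j]. *)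
Lemma Ck_on_outer n k (U : set 'rV[R]_n) (D : set R) (H : nat -> R -> R)
    (f : 'rV[R]_n -> R) j :
  open U -> (forall j y, D y -> is_derive y 1 (H j) (H j.+1 y)) ->
  (forall x, U x -> D (f x)) ->
  Ck_on k U f -> Ck_on k U (fun x => H j (f x)).
Proof.
move=> oU dH UD.
have cH i y : D y -> {for y, continuous (H i)}.
  move=> Dy; apply: differentiable_continuous; apply: (derivable1_diffP _ _).1.
  by have [] := dH i y Dy.
have cHf i x : Ck_on 0 U f -> U x -> {for x, continuous (fun x => H i (f x))}.
  by move=> Cf Ux; exact: (cvg_comp _ _ (Cf.1 x Ux) (cH i _ (UD x Ux))).
elim: k j => [|k IH] j Cf.
  by split=> // x; exact: cHf.
apply: (@Ck_onS _ _ _ _ _ (fun i x => 'D_(e_ i) f x * H j.+1 (f x))) => //.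
- by move=> x; apply: cHf; exact: Ck_on_le Cf.
- move=> i x Ux; apply: is_derive_outer; first exact: dH (UD x Ux).
  by apply: derivableP; exact: (Cf.2 i).1.
- move=> i; apply: Ck_on_M => //; first exact: (Cf.2 i).2.
  by apply: IH; exact: Ck_onW Cf.
Qed.

Lemma Ck_on_inv n k (U : set 'rV[R]_n) (f : 'rV[R]_n -> R) :
  open U -> (forall x, U x -> f x != 0) ->
  Ck_on k U f -> Ck_on k U (fun x => (f x)^-1).
Proof.
move=> oU f0; elim: k => [|k IH] Cf.
  by split=> // x Ux; apply: continuousV; [exact: f0|exact: Cf.1].
apply: (@Ck_onS _ _ _ _ _ (fun i x => - ((f x)^-1 * (f x)^-1 * 'D_(e_ i) f x))) => //.
- by move=> x Ux; apply: continuousV; [exact: f0|exact: Cf.1].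
- move=> i x Ux; have d := (Cf.2 i).1 x Ux; apply: DeriveDef.
    exact: derivableV (f0 x Ux) d.
  rewrite (deriveV (f0 x Ux) d) -expr2 -exprVn -[_ *: _]/(_ * _); ring.
- move=> i; apply: Ck_on_N => //; apply: Ck_on_M => //; last exact: (Cf.2 i).2.
  by apply: Ck_on_M => //; apply: IH; exact: Ck_onW Cf.
Qed.

Lemma Ck_on_det n p k (U : set 'rV[R]_n) (A : 'rV[R]_n -> 'M[R]_p) :
  open U -> (forall i j, Ck_on k U (fun x => A x i j)) -> Ck_on k U (fun x => \det (A x)).
Proof.
move=> oU H; rewrite /determinant; apply: Ck_on_sum => // s _.
apply: Ck_on_M => //; first exact: (@Ck_on_cst R n R).
by apply: Ck_on_prod => // i _; exact: H.
Qed.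

(** By Cramer's rule the entries are cofactors divided by the determinant. *)
Lemma Ck_on_invmx n p k (U : set 'rV[R]_n) (A : 'rV[R]_n -> 'M[R]_p) i j :
  open U -> (forall x, U x -> A x \in unitmx) ->
  (forall i j, Ck_on k U (fun x => A x i j)) -> Ck_on k U (fun x => invmx (A x) i j).
Proof.
move=> oU uA H.
apply: (@Ck_on_ext _ _ _ _ (fun x => (\det (A x))^-1 * ((-1) ^+ (j + i) * \det (row' j (col' i (A x)))))) => //.
  by move=> x /uA ux; rewrite /invmx ux !mxE /cofactor.
apply: Ck_on_M => //.
  by apply: Ck_on_inv => //; [move=> x /uA; rewrite unitmxE unitfE|exact: Ck_on_det].
apply: Ck_on_M => //; first exact: (@Ck_on_cst R n R).
apply: Ck_on_det => // a b.
by apply: (@Ck_on_ext _ _ _ _ (fun x => A x (lift j a) (lift i b))) => // x _; rewrite !mxE.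
Qed.

End CkTheory.

(** * Hadamard division *)

Section DerivativeCriteria.
Context {R : realType}.

Lemma is_derive_epsP (V W : normedModType R) (f : V -> W) x v l :
  is_derive x v f l <->
  (forall e : R, 0 < e -> exists2 d : R, 0 < d & forall h : R, h != 0 -> `|h| < d ->
    `|h^-1 *: (f (h *: v + x) - f x) - l| <= e).
Proof.
split=> [[/cvg_ex[/= l' fl'] <-] e e0|H].
  have -> : 'D_v f x = l' by exact: cvg_lim fl'.
  have /cvgrPdist_le /(_ e e0) := fl'.
  rewrite ?near_simpl near_withinE => /nbhs_norm_ltP[d d0 dH].
  exists d => // h h0 hd; rewrite distrC; apply: dH => //; by rewrite subr0.
have fl : (fun h : R => h^-1 *: (f (h *: v + x) - f x)) @ 0^' --> l.
  apply/cvgrPdist_le => e e0; have [d d0 dH] := H e e0.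
  rewrite ?near_simpl near_withinE; apply: (nbhs_norm_ltP (0 : R) _).2; exists d => // h.
  by rewrite subr0 => hd h0; rewrite distrC; exact: dH.
by apply: DeriveDef; [apply/cvg_ex; exists l|exact: cvg_lim fl].
Qed.

Lemma mvt_increment (f df : R -> R) (s h : R) :
  (forall th, 0 <= th <= 1 -> is_derive (s + th * h) (1 : R) f (df (s + th * h))) ->
  exists2 th, 0 <= th <= 1 & f (s + h) - f s = h * df (s + th * h).
Proof.
move=> H.
have D (th : R) : 0 <= th <= 1 -> is_derive (s + th *: h) h f (h * df (s + th * h)).
  move=> thI; have := is_derive_dirZ h (H th thI).
  by rewrite [h *: 1]mulr1 => D; exact: D.
have [|th thI E] := @line_mvt R R f s h.
  by move=> th /D[].
exists th => //; rewrite E.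
by have [_ ->] := D th thI.
Qed.

(** Differentiation of a limit when the derivatives converge uniformly. No continuity of the
    derivatives is assumed, so mean values are used instead of integrals. *)
Lemma uniform_derive (f g : nat -> R -> R) (F G : R -> R) (a b : R) :
  (forall n s, a < s < b -> is_derive s (1 : R) (f n) (g n s)) ->
  (forall s, a < s < b -> (f ^~ s) @ \oo --> F s) ->
  (forall e, 0 < e -> exists N, forall n, (N <= n)%N -> forall s, a < s < b ->
     `|g n s - G s| <= e) ->
  forall s, a < s < b -> is_derive s (1 : R) F (G s).
Proof.
move=> df fF gG s /andP[sa sb]; apply/is_derive_epsP => e e0.
(* The budget [e] is split into [e / 2] for replacing [f N] by the limit [F], and [e / 4] each for
   the difference quotient of [f N] and for [g N - G]. *)
have e4 : 0 < e / 4 by rewrite divr_gt0.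
have [N HN] := gG _ e4.
have sab : a < s < b by rewrite sa.
have [d0 d00 Hd0] := (is_derive_epsP _ _ _ _).1 (df N s sab) _ e4.
pose d := Num.min d0 (Num.min (s - a) (b - s)).
have d_gt0 : 0 < d by rewrite !lt_min d00 !subr_gt0 sa.
exists d => // h h0; rewrite !lt_min => /and3P[hd0 hsa hsb].
have inab (th : R) : 0 <= th <= 1 -> a < s + th * h < b.
  move=> /andP[th0 th1].
  have : `|th * h| <= `|h| by rewrite normrM ger0_norm // ler_piMl.
  move: hsa hsb; rewrite !ltr_norml => /andP[h1 h2] /andP[h3 h4].
  move=> /le_lt_trans h5; have /h5 : `|h| < s - a by rewrite ltr_norml h1.
  have /h5 : `|h| < b - s by rewrite ltr_norml h3.
  rewrite !ltr_norml => /andP[k1 k2] /andP[k3 k4]; apply/andP; split; lra.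
have shI : a < h + s < b by have := inab 1; rewrite mul1r addrC; apply; rewrite ler01 lexx.
(* The mean value theorem is applied to [f N - f m], whose derivative is at most [e / 2]; letting
   [m] tend to infinity gives [incrF]. *)
have incr m : (N <= m)%N ->
  `|(f N (h + s) - f N s) - (f m (h + s) - f m s)| <= `|h| * (e / 2).
  move=> Nm.
  have D th : 0 <= th <= 1 ->
      is_derive (s + th * h) (1 : R) (f N - f m) ((g N - g m) (s + th * h)).
    by move=> /inab I; apply: is_deriveB; apply: df.
  have [th thI] := mvt_increment D.
  rewrite [s + h]addrC -![(_ - _ : _ -> _) _]/(_ - _) => E.
  have -> : f N (h + s) - f N s - (f m (h + s) - f m s) =
     f N (h + s) - f m (h + s) - (f N s - f m s) by ring.
  rewrite E normrM ler_wpM2l //.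
  have := HN N (leqnn N) _ (inab th thI); have := HN m Nm _ (inab th thI).
  rewrite !ler_norml => /andP[k1 k2] /andP[k3 k4]; apply/andP; split; lra.
have incrF : `|(f N (h + s) - f N s) - (F (h + s) - F s)| <= `|h| * (e / 2).
  have C : (fun m => `|(f N (h + s) - f N s) - (f m (h + s) - f m s)|) @ \oo -->
      `|(f N (h + s) - f N s) - (F (h + s) - F s)|.
    apply: cvg_norm; apply: cvgB; first exact: cvg_cst.
    by apply: cvgB; exact: fF.
  rewrite -(cvg_lim _ C) //; apply: limr_le; first by apply/cvg_ex; eexists; exact: C.
  by exists N => // m /= Nm; exact: incr.
have := Hd0 h h0 hd0; rewrite [h *: 1]mulr1 -![_^-1 *: _]/(_ * _) => Hq.
have Hg := HN N (leqnn N) s sab.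
have Hh : `|h^-1 * (f N (h + s) - f N s) - h^-1 * (F (h + s) - F s)| <= e / 2.
  by rewrite -mulrBr normrM normfV ler_pdivrMl ?normr_gt0.
move: Hh Hq Hg; rewrite !ler_norml => /andP[k1 k2] /andP[k3 k4] /andP[k5 k6].
apply/andP; split; lra.
Qed.

End DerivativeCriteria.

(** * Integrals over the unit interval depending on a parameter *)

Section Integral01.
Context {R : realType}.
Local Notation mu := (@lebesgue_measure R).
Local Notation e_ i := (delta_mx 0 i).

Definition int01 (f : R -> R) : R := (\int[mu]_(t in `[0%R, 1%R]) f t)%R.

Definition cont01 (f : R -> R) := forall t : R, 0 <= t <= 1 -> {for t, continuous f}.

Lemma cont01_integrable f : cont01 f -> mu.-integrable `[0%R, 1%R] (EFin \o f).
Proof.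
move=> cf; apply: continuous_compact_integrable; first exact: segment_compact.
apply: continuous_in_subspaceT => t; rewrite inE /= in_itv /=; exact: cf.
Qed.

Lemma int01B f g : cont01 f -> cont01 g ->
  int01 (fun t => f t - g t) = int01 f - int01 g.
Proof. by move=> cf cg; apply: RintegralB => //; exact: cont01_integrable. Qed.

Lemma int01Z f c : cont01 f -> int01 (fun t => c * f t) = c * int01 f.
Proof. by move=> cf; apply: RintegralZl => //; exact: cont01_integrable. Qed.

Lemma eq_int01 f g : (forall t, 0 <= t <= 1 -> f t = g t) -> int01 f = int01 g.
Proof. by move=> fg; apply: eq_Rintegral => t; rewrite inE /= in_itv /=; exact: fg. Qed.

Lemma int01_bound f M : cont01 f -> (forall t, 0 <= t <= 1 -> `|f t| <= M) ->
  `|int01 f| <= M.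
Proof.
move=> cf fM; have If := cont01_integrable cf.
apply: (le_trans (le_normr_Rintegral _ If)) => //.
apply: (@le_trans _ _ (int01 (fun=> M))).
  have I1 : mu.-integrable `[0%R, 1%R] (EFin \o (fun t => `|f t|)).
    by apply: cont01_integrable => t tI; exact: cvg_norm (cf t tI).
  have I2 : mu.-integrable `[0%R, 1%R] (EFin \o (fun=> M)).
    by apply: cont01_integrable => t tI; exact: cvg_cst.
  apply: (@le_Rintegral _ _ _ mu _ (fun t => `|f t|) (fun=> M)) => //.
rewrite /int01 Rintegral_cst //= lebesgue_measure_itv /= lte_fin ltr01.
by rewrite oppr0 adde0 /= mulr1.
Qed.

Lemma int01_ftc (F f : R -> R) : cont01 f ->
  (forall t : R, 0 <= t <= 1 -> is_derive t (1 : R) F (f t)) -> int01 f = F 1 - F 0.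
Proof.
move=> cf dF.
have cF (t : R) : 0 <= t <= 1 -> {for t, continuous F}.
  move=> tI; apply: differentiable_continuous; apply: (derivable1_diffP _ _).1.
  by have [] := dF t tI.
have -> : int01 f = fine (\int[mu]_(x in `[0%R, 1%R]) (f x)%:E)%E by [].
rewrite (@continuous_FTC2 R f F) //.
- apply: continuous_in_subspaceT => t; rewrite inE /= in_itv /=; exact: cf.
- split.
  + by move=> t; rewrite in_itv /= => /andP[t0 t1]; have [] // := dF t; rewrite !ltW.
  + by apply: cvg_at_right_filter; apply: cF; rewrite lexx ler01.
  + by apply: cvg_at_left_filter; apply: cF; rewrite lexx ler01.
- move=> t; rewrite in_itv /= => /andP[t0 t1]; rewrite derive1E.
  by have [|_ ->] // := dF t; rewrite !ltW.
Qed.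

(** Tube lemma: joint continuity at every point of the compact segment over [x] gives closeness
    uniform in [t]. *)
Lemma uniform_near (T : topologicalType) (g : R -> T -> R) x :
  (forall t : R, 0 <= t <= 1 -> {for (t, x), continuous (fun z : R * T => g z.1 z.2)}) ->
  forall e, 0 < e ->
  \forall y \near x, forall t, 0 <= t <= 1 -> `|g t y - g t x| <= e.
Proof.
move=> cg e e0.
have e2 : 0 < e / 2 by rewrite divr_gt0.
have K : compact `[0%R, 1%R : R] by exact: segment_compact.
have /compact_near_coveringP NC := K.
have := NC T (nbhs x) (fun y t => `|g t y - g t x| <= e) _ _.
move=> /(_ _ _) H.
have {}H : \forall y \near x, `[0%R, 1%R] `<=` (fun t => `|g t y - g t x| <= e).
  apply: H => t; rewrite /= in_itv /= => tI.
  have /cvgrPdist_le /(_ _ e2) C := cg t tI.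
  have [[A B] /= [At Bx] AB] : nbhs (t, x) [set z | `|g t x - g z.1 z.2| <= e / 2] by exact: C.
  exists (A, B) => //= -[t' y] /= [At' By].
  have h1 := AB (t', y) (conj At' By).
  have h2 := AB (t', x) (conj At' (nbhs_singleton Bx)).
  move: h1 h2; rewrite /= !ler_norml => /andP[k1 k2] /andP[k3 k4].
  apply/andP; split; lra.
apply: filterS H => y Hy t tI; apply: Hy; by rewrite /= in_itv.
Qed.

Definition joint_cont (T : topologicalType) (g : R -> T -> R) x :=
  forall t : R, 0 <= t <= 1 -> {for (t, x), continuous (fun z : R * T => g z.1 z.2)}.

Lemma joint_cont01 (T : topologicalType) (g : R -> T -> R) x :
  joint_cont g x -> cont01 (g ^~ x).
Proof.
move=> cg t tI.
apply: (@continuous2_cvg R R T R (nbhs t) _ id (fun=> x) g t x (cg t tI)).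
  exact: cvg_id.
exact: cvg_cst.
Qed.

Lemma int01_continuous (T : topologicalType) (g : R -> T -> R) x :
  (\forall y \near x, cont01 (g ^~ y)) -> joint_cont g x ->
  {for x, continuous (fun y => int01 (g ^~ y))}.
Proof.
move=> cy cg; apply/cvgrPdist_le => e e0; rewrite ?near_simpl.
have := uniform_near cg e0; move: cy; apply: filterS2 => y cy H.
rewrite distrC -int01B //; last exact: joint_cont01.
apply: int01_bound => //.
by move=> t tI; apply: cvgB; [exact: cy|exact: (joint_cont01 cg)].
Qed.

(** For each [t] the mean value theorem turns the difference quotient into a value of [psi] near
    [x], and [uniform_near] makes the error independent of [t]. *)
Lemma int01_derive (V : normedModType R) (g psi : R -> V -> R) x v :
  (\forall y \near x, cont01 (g ^~ y) /\
     forall t : R, 0 <= t <= 1 -> is_derive y v (g t) (psi t y)) ->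
  joint_cont psi x ->
  is_derive x v (fun y => int01 (g ^~ y)) (int01 (psi ^~ x)).
Proof.
move=> Hg cpsi; apply/is_derive_epsP => e e0.
have /nbhs_norm_ltP[d d0 Hd] := near_and Hg (uniform_near cpsi e0).
have v0 : 0 < `|v| + 1 by rewrite ltr_wpDl.
exists (d / (`|v| + 1)); first by rewrite divr_gt0.
move=> h h0; rewrite ltr_pdivlMr // => hd.
have near_x (th : R) : 0 <= th <= 1 -> `|x + th *: (h *: v) - x| < d.
  move=> /andP[th0 th1]; rewrite addrAC subrr add0r !normrZ ger0_norm //.
  apply: le_lt_trans hd; apply: (@le_trans _ _ (1 * (`|h| * `|v|))).
    by rewrite ler_wpM2r // mulr_ge0.
  by rewrite mul1r ler_wpM2l // lerDl.
have hx : `|h *: v + x - x| < d.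
  by have := near_x 1; rewrite scale1r [x + _]addrC; apply; rewrite ler01 lexx.
have xx : `|x - x| < d by rewrite subrr normr0.
have [[cgx _] _] := Hd x xx; have [[cgh _] _] := Hd _ hx.
have cB : cont01 (fun t => g t (h *: v + x) - g t x).
  by move=> t tI; apply: cvgB; [exact: cgh|exact: cgx].
have cpx := joint_cont01 cpsi.
have cZ : cont01 (fun t => h^-1 * (g t (h *: v + x) - g t x)).
  by move=> t tI; apply: cvgM; [exact: cvg_cst|exact: cB].
rewrite -int01B // -[_ *: _]/(_ * _) -int01Z // -int01B //.
apply: int01_bound; first by move=> t tI; apply: cvgB; [exact: cZ|exact: cpx].
move=> t tI.
have D (th : R) : 0 <= th <= 1 -> is_derive (x + th *: (h *: v)) (h *: v) (g t)
    (h *: psi t (x + th *: (h *: v))).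
  by move=> thI; apply: is_derive_dirZ; exact: (Hd _ (near_x th thI)).1.2.
have [|th thI] := @line_mvt R V (g t) x (h *: v).
  by move=> th /D[].
rewrite [x + h *: v]addrC => E.
have -> : g t (h *: v + x) - g t x = h * psi t (x + th *: (h *: v)).
  by rewrite E; have [_ ->] := D th thI.
rewrite mulrA mulVf // mul1r.
exact: (Hd _ (near_x th thI)).2.
Qed.

End Integral01.

(** * Division of a smooth function by a coordinate *)

Section Hadamard.
Context {R : realType} {n : nat} (i : 'I_n).
Local Notation e_ i := (delta_mx 0 i).

(** Multiplies coordinate [i] by [t]. Written as a displacement along [e_i], it shows
    [t |-> scal t x] as a line in that direction. *)
Definition scal (t : R) (x : 'rV[R]_n) : 'rV[R]_n := x + ((t - 1) * x 0 i) *: e_ i.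

Lemma scalE t x j : scal t x 0 j = (if j == i then t else 1) * x 0 j.
Proof.
by rewrite !mxE eqxx; case: eqP => [->|_] /=; rewrite ?mulr0 ?addr0 ?mul1r//; ring.
Qed.

Lemma scal_lin t (h : R) x y : scal t (h *: x + y) = h *: scal t x + scal t y.
Proof. by apply/rowP => j; rewrite /scal !mxE; ring. Qed.

Lemma scal_e t j : scal t (e_ j) = (if j == i then t else 1) *: (e_ j : 'rV[R]_n).
Proof.
apply/rowP => l; rewrite scalE !mxE eqxx /=.
by have [->|lj] := eqVneq l j; rewrite ?mulr0.
Qed.

Lemma scal1 x : scal 1 x = x.
Proof. by rewrite /scal subrr mul0r scale0r addr0. Qed.

Lemma scal_fix t (x : 'rV[R]_n) : x 0 i = 0 -> scal t x = x.
Proof. by move=> x0; rewrite /scal x0 mulr0 scale0r addr0. Qed.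

Definition scal_stable (U : set 'rV[R]_n) :=
  forall t x, 0 <= t <= 1 -> U x -> U (scal t x).

Variable U : set 'rV[R]_n.
Hypotheses (oU : open U) (sU : scal_stable U).

Lemma scal_continuous (z : R * 'rV[R]_n) :
  {for z, continuous (fun z : R * 'rV[R]_n => scal z.1 z.2)}.
Proof.
have C2 : {for z, continuous (fun z : R * 'rV[R]_n => z.2)} by case: z => a b; exact: cvg_snd.
have C1 : {for z, continuous (fun z : R * 'rV[R]_n => z.1)} by clear; case: z => a b; exact: cvg_fst.
have C3 : {for z, continuous (fun z : R * 'rV[R]_n => (z.1 - 1) * z.2 0 i)}.
  have C4 : {for z, continuous (fun z : R * 'rV[R]_n => z.1 - 1)}.
    by apply: (continuousB C1); exact: cst_continuous.
  exact: (continuousM C4 (cvg_comp _ _ C2 (@coord_continuous R 1 n 0 i _))).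
have C5 : {for z, continuous (fun z : R * 'rV[R]_n => ((z.1 - 1) * z.2 0 i) *: (e_ i : 'rV[R]_n))}.
  exact: continuousZr_tmp.
exact: (continuousD C2 C5).
Qed.

Lemma joint_cont_scal p (f : 'rV[R]_n -> R) x :
  (forall x, U x -> {for x, continuous f}) -> U x ->
  joint_cont (fun t y => t ^+ p * f (scal t y)) x.
Proof.
move=> cf Ux t tI.
have C1 : {for (t, x), continuous (fun z : R * 'rV[R]_n => z.1)} by exact: cvg_fst.
apply: continuousM.
  exact: (cvg_comp _ _ C1 (@exprn_continuous R p t)).
exact: (cvg_comp _ _ (@scal_continuous (t, x)) (cf _ (sU tI Ux))).
Qed.

(** Average of [f] over the segment joining [x] to the hyperplane where coordinate [i] is zero. The
    weight [t ^+ p] makes the family closed under differentiation, since each derivative in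
    direction [i] brings out a factor [t]. *)
Definition had p (f : 'rV[R]_n -> R) x := int01 (fun t => t ^+ p * f (scal t x)).

Lemma had_continuous p (f : 'rV[R]_n -> R) x :
  (forall x, U x -> {for x, continuous f}) -> U x -> {for x, continuous (had p f)}.
Proof.
move=> cf Ux.
have J y : U y -> cont01 (fun t => t ^+ p * f (scal t y)).
  by move=> Uy; have J := @joint_cont01 _ _ _ _ (@joint_cont_scal p f y cf Uy); exact: J.
have N : \forall y \near x, cont01 (fun t => t ^+ p * f (scal t y)).
  apply: filterS (near_open oU Ux) => y. exact: J.
apply: (@int01_continuous R _ (fun t y => t ^+ p * f (scal t y))).
  exact: N.
exact: joint_cont_scal.
Qed.

Lemma had_derive p (f : 'rV[R]_n -> R) x j : Ck_on 1 U f -> U x ->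
  is_derive x (e_ j) (had p f) (had (p + (j == i)) ('D_(e_ j) f) x).
Proof.
move=> Cf Ux.
apply: (@int01_derive R _ (fun t y => t ^+ p * f (scal t y))
  (fun t y => t ^+ (p + (j == i)) * 'D_(e_ j) f (scal t y))); last first.
  exact: (@joint_cont_scal (p + (j == i)) ('D_(e_ j) f) x (Cf.2 j).2.1 Ux).
apply: filterS (near_open oU Ux) => y Uy; split.
  exact: (joint_cont01 (@joint_cont_scal p f y Cf.1 Uy)).
move=> t tI; have Uty := sU tI Uy.
have D0 := derivableP ((Cf.2 j).1 _ Uty).
have D1 : is_derive (scal t y) (scal t (e_ j)) f
    ((if j == i then t else 1) * 'D_(e_ j) f (scal t y)).
  by rewrite scal_e; exact: is_derive_dirZ.
have D2 : is_derive y (e_ j) (fun y => f (scal t y))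
    ((if j == i then t else 1) * 'D_(e_ j) f (scal t y)).
  apply/is_derive_epsP => e e0; have [d d0 H] := (is_derive_epsP _ _ _ _).1 D1 e e0.
  by exists d => // h h0 hd; rewrite scal_lin; exact: H.
have -> : t ^+ (p + (j == i)) * 'D_(e_ j) f (scal t y) =
    t ^+ p *: ((if j == i then t else 1) * 'D_(e_ j) f (scal t y)).
  rewrite exprD -mulrA; congr (_ * (_ * _)); by case: eqP.
exact: is_deriveZ.
Qed.

Lemma Ck_on_had k p (f : 'rV[R]_n -> R) : Ck_on k U f -> Ck_on k U (had p f).
Proof.
elim: k p f => [|k IH] p f Cf.
  by split=> // x Ux; apply: had_continuous => //; exact: Cf.1.
apply: (@Ck_onS _ _ _ _ _ _ (fun j => had (p + (j == i)) ('D_(e_ j) f))) => //.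
- by move=> x Ux; apply: had_continuous => //; exact: Cf.1.
- by move=> j x Ux; apply: had_derive => //; exact: Ck_on_le Cf.
- by move=> j; apply: IH; exact: (Cf.2 j).2.
Qed.

(** Fundamental theorem of calculus along the segment from [scal 0 x] to [x]. *)
Lemma hadamard (f : 'rV[R]_n -> R) x : Ck_on 1 U f -> U x ->
  f x - f (scal 0 x) = x 0 i * had 0 ('D_(e_ i) f) x.
Proof.
move=> Cf Ux.
have Jc := joint_cont01 (@joint_cont_scal 0 _ x (Cf.2 i).2.1 Ux).
have Jx : cont01 (fun t => x 0 i * (t ^+ 0 * 'D_(e_ i) f (scal t x))).
  by move=> t tI; apply: continuousM; [exact: cst_continuous|exact: Jc].
have dF (t : R) : 0 <= t <= 1 -> is_derive t (1 : R) (fun t => f (scal t x))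
    (x 0 i * (t ^+ 0 * 'D_(e_ i) f (scal t x))).
  move=> tI.
  have E s : scal s x = scal 0 x + s *: (x 0 i *: e_ i).
    by rewrite /scal -addrA; congr (_ + _); rewrite scalerA -scalerDl; congr (_ *: _); ring.
  have -> : (fun t => f (scal t x)) = (fun t => f (scal 0 x + t *: (x 0 i *: e_ i))).
    by apply/funext => s; rewrite E.
  have D0 := derivableP ((Cf.2 i).1 _ (sU tI Ux)).
  have D := is_derive_dirZ (x 0 i) D0.
  rewrite expr0 mul1r; case: D => dD ED; rewrite -[_ * _]/(_ *: _) -ED (E t).
  by apply: (@is_derive_line _ _ _ f (scal 0 x) (x 0 i *: e_ i) t); rewrite -E.
by rewrite -int01Z // (int01_ftc Jx dF) scal1.
Qed.

Lemma had_boundary (f : 'rV[R]_n -> R) (x : 'rV[R]_n) : x 0 i = 0 -> had 0 f x = f x.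
Proof.
move=> x0; rewrite /had (@eq_int01 _ _ (fun=> f x)) => [|t _]; last first.
  by rewrite expr0 mul1r scal_fix.
have C : cont01 (fun=> f x) by move=> t _; exact: cst_continuous.
have D (t : R) : 0 <= t <= 1 -> is_derive t (1 : R) (f x *: (id : R -> R)) (f x).
  by move=> _; apply: is_derive_eq; rewrite [_ *: _]mulr1.
rewrite (int01_ftc C D) -![(_ *: _ : _ -> _) _]/(_ *: _).
by rewrite [_ *: 1]mulr1 [_ *: 0]mulr0 subr0.
Qed.

(** The quotient is the average of the [i]-th partial of [f]. At a point of the hyperplane the
    segment is a single point, which gives the last clause. *)
Lemma hadamard_div (f : 'rV[R]_n -> R) : smooth_on U f ->
  (forall x, U x -> x 0 i = 0 -> f x = 0) ->
  exists h : 'rV[R]_n -> R, [/\ smooth_on U h, forall x, U x -> f x = x 0 i * h x &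
    forall x, U x -> x 0 i = 0 -> h x = 'D_(e_ i) f x].
Proof.
move=> Cf f0; exists (had 0 ('D_(e_ i) f)); split.
- by move=> k; apply: Ck_on_had; exact: ((Cf k.+1).2 i).2.
- move=> x Ux; rewrite -(hadamard (Cf 1) Ux).
  rewrite [X in _ - X]f0 ?subr0 //; first by apply: sU; rewrite // lexx ler01.
  by rewrite scalE eqxx mul0r.
- by move=> x Ux x0; rewrite had_boundary.
Qed.

End Hadamard.

(** * The inverse function theorem *)

Section InverseFunction.
Context {R : realType}.
Local Notation e_ i := (delta_mx 0 i).

Lemma continuous_epsP (V W : normedModType R) (f : V -> W) (x : V) :
  {for x, continuous f} <->
  (forall e : R, 0 < e -> exists2 d : R, 0 < d & forall y, `|y - x| < d -> `|f y - f x| <= e).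
Proof.
split=> [cf e e0|H].
  have /cvgrPdist_le /(_ e e0) := cf; rewrite ?near_simpl => /nbhs_norm_ltP[d d0 Hd].
  by exists d => // y /Hd; rewrite distrC.
apply/cvgrPdist_le => e e0; have [d d0 Hd] := H e e0.
rewrite ?near_simpl; apply: (nbhs_norm_ltP x _).2; exists d => // y /Hd.
by rewrite distrC.
Qed.

Lemma common_radius (I : finType) (P : I -> R -> Prop) :
  (forall i d d', d' <= d -> P i d -> P i d') ->
  (forall i, exists2 d, 0 < d & P i d) -> exists2 d, 0 < d & forall i, P i d.
Proof.
move=> Pm H; have /choice[d Hd] : forall i, exists d, 0 < d /\ P i d.
  by move=> i; have [d d0 Pd] := H i; exists d.
(* The default value [1] provides a positive radius when [I] is empty. *)
exists (\big[Num.min/1]_i d i).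
  by apply: lt_bigmin => // i _; have [] := Hd i.
move=> i; apply: Pm (Hd i).2; exact: bigmin_le_cond.
Qed.

Lemma derive_coord (V : normedModType R) m (f : V -> 'rV[R]_m) x v j :
  derivable f x v -> 'D_v (fun x => f x 0 j) x = 'D_v f x 0 j.
Proof. by move=> df; rewrite (derive_mx df) mxE. Qed.

(** Transpose of the usual Jacobian matrix: vectors are rows, and the derivative in direction [v] is
    [v *m jac f x]. *)
Definition jac n m (f : 'rV[R]_n -> 'rV[R]_m) x : 'M[R]_(n, m) :=
  \matrix_(i, j) 'D_(e_ i) f x 0 j.

Lemma jacE n m (f : 'rV[R]_n -> 'rV[R]_m) x v :
  differentiable f x -> 'D_v f x = v *m jac f x.
Proof.
move=> df; rewrite derive_sum_e_rV //; apply/rowP => j.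
rewrite summxE mxE; apply: eq_bigr => i _; by rewrite !mxE.
Qed.

Lemma norm_mulmx_bound n m (A : 'M[R]_(n, m)) :
  exists2 C, 0 < C & forall v : 'rV[R]_n, `|v *m A| <= C * `|v|.
Proof.
exists (n%:R * `|A| + 1); first by rewrite ltr_wpDl // mulr_ge0.
move=> v; apply: norm_rV_le; first by rewrite mulr_ge0 // addr_ge0 // mulr_ge0.
move=> j; rewrite mxE.
have -> : \sum_k v 0 k * A k j = \sum_k v 0 k * (\row_k A k j) 0 k.
  by apply: eq_bigr => k _; rewrite [in RHS]mxE.
apply: (le_trans (norm_dot_le _ _)).
rewrite mulrDl mul1r (@le_trans _ _ (n%:R * `|A| * `|v|)) ?lerDl //.
rewrite -mulrA ler_wpM2l // mulrC ler_wpM2r //.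
apply: norm_rV_le => // k; rewrite mxE.
rewrite [leRHS]/Num.Def.normr /= mx_normrE.
exact: (le_bigmax _ (fun ij : 'I_n * 'I_m => `|A ij.1 ij.2|) (k, j)).
Qed.

Lemma C1_strict_rV n m (U : set 'rV[R]_n) (f : 'rV[R]_n -> 'rV[R]_m) y (e : R) :
  open U -> Ck_on 1 U f -> U y -> 0 < e ->
  exists2 d, 0 < d & forall z z', `|z - y| < d -> `|z' - y| < d ->
   `|f z - f z' - (z - z') *m jac f y| <= e * `|z - z'|.
Proof.
move=> oU Cf Uy e0.
have [|j|d d0 H] := @common_radius 'I_m (fun j d => forall z z', `|z - y| < d -> `|z' - y| < d ->
   `|(f z - f z' - (z - z') *m jac f y) 0 j| <= e * `|z - z'|).
- by move=> j d d' dd' H z z' zy z'y; apply: H; apply: lt_le_trans dd'.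
- have [d d0 H] := C1_strict oU (Ck_on_coord j oU Cf) Uy e0.
  exists d => // z z' zy z'y; have := H z z' zy z'y.
  congr (`|_| <= _); rewrite !mxE; congr (_ - _); apply: eq_bigr => i _.
  by rewrite !mxE derive_coord //; exact: (Cf.2 i).1.
- exists d => // z z' zy z'y; apply: norm_rV_le; first by rewrite mulr_ge0 // ltW.
  by move=> j; exact: H.
Qed.

Lemma open_preimage (S T : topologicalType) (U : set S) (V : set T) (f : S -> T) :
  open U -> open V -> (forall x, U x -> {for x, continuous f}) ->
  open (U `&` f @^-1` V).
Proof.
move=> oU oV cf; rewrite openE => x [Ux Vfx]; apply: filterI.
  exact: open_nbhs_nbhs.
apply: cf => //; exact: open_nbhs_nbhs.
Qed.

Lemma contraction_fixed_point n (phi : 'rV[R]_n -> 'rV[R]_n) x0 (r : R) : 0 <= r ->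
  (forall x, `|x - x0| <= r -> `|phi x - x0| <= r) ->
  (forall x x', `|x - x0| <= r -> `|x' - x0| <= r -> `|phi x - phi x'| <= 2^-1 * `|x - x'|) ->
  exists2 x, `|x - x0| <= r & phi x = x.
Proof.
move=> r0 phiK phiL; pose K := [set x : 'rV[R]_n | `|x - x0| <= r].
have fK : set_fun K K phi by move=> x; exact: phiK.
have clK : closed K.
  apply: (@closed_comp _ _ (fun x : 'rV[R]_n => `|x - x0|) [set t | t <= r]).
    move=> x _; have c : {for x, continuous (fun x : 'rV[R]_n => x - x0)}.
      by apply: continuousB; [exact: cvg_id|exact: cst_continuous].
    apply: (@continuous_comp _ _ _ (fun x : 'rV[R]_n => x - x0) (@Num.norm _ _) _ c).
    exact: norm_continuous.
  exact: closed_le.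
have ctr : is_contraction (mkfun fK).
  have h0 : 0 <= (2^-1 : R) by rewrite invr_ge0.
  exists (NngNum h0); split; first by rewrite /= invf_lt1 // ltr1n.
  by move=> [x x'] /= [Kx Kx']; exact: phiL.
(* Banach's theorem is stated for complete normed modules; this structure is assembled from the
   convergence of Cauchy filters of row vectors. *)
pose X : completeNormedModType R :=
  HB.pack_for (completeNormedModType R) 'rV[R]_n (Uniform_isComplete.Build 'rV[R]_n (@cauchy_cvg 'rV[R]_n)).
have [|x Kx xE] := @banach_fixed_point R X K _ ctr clK.
  by exists x0; rewrite /K /= subrr normr0.
by exists x.
Qed.

Section Core.
Variables (n : nat) (U : set 'rV[R]_n) (f : 'rV[R]_n -> 'rV[R]_n) (x0 : 'rV[R]_n) (r : R).
Hypotheses (oU : open U) (Cf : smooth_on U f) (r0 : 0 < r).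
Hypothesis rU : forall x, `|x - x0| < r -> U x.
Hypothesis near_id : forall z z', `|z - x0| < r -> `|z' - x0| < r ->
  `|f z - f z' - (z - z')| <= 2^-1 * `|z - z'|.

Let B := [set y : 'rV[R]_n | `|y - f x0| < r / 2].
Let A := [set x | `|x - x0| < r] `&` f @^-1` B.

Lemma open_norm_ball (c : 'rV[R]_n) (d : R) : open [set y : 'rV[R]_n | `|y - c| < d].
Proof.
have -> : [set y : 'rV[R]_n | `|y - c| < d] = ball c d.
  by rewrite -ball_normE; apply/seteqP; split => y /=; rewrite distrC.
exact: ball_open.
Qed.

(** [f] is the identity up to a perturbation of Lipschitz constant [1/2], so it shrinks distances by
    at most a factor 2. Hence it is injective and its inverse is 2-Lipschitz. *)
Lemma core_expand z z' : `|z - x0| < r -> `|z' - x0| < r -> `|z - z'| <= 2 * `|f z - f z'|.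
Proof.
move=> zr z'r; have := near_id zr z'r; rewrite distrC => h.
have := ler_distD (f z - f z') (z - z') 0; rewrite !subr0 => h2.
have : `|z - z'| <= 2^-1 * `|z - z'| + `|f z - f z'| by exact: le_trans h2 (lerD h (lexx _)).
lra.
Qed.

(** A preimage of [y] is a fixed point of [x - f x + y], a contraction by [near_id]. *)
Lemma core_surj y : B y -> exists2 x, `|x - x0| < r & f x = y.
Proof.
(* The centre [x0] is moved by [y - f x0], half of the radius [s], and the contraction contributes
   at most the other half, so the closed ball of radius [s] is stable. *)
rewrite /B /= => yB; pose s := 2 * `|y - f x0|.
have sr : s < r by rewrite /s; lra.
have s0 : 0 <= s by rewrite mulr_ge0.
have ins x : `|x - x0| <= s -> `|x - x0| < r by move=> /le_lt_trans; exact.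
have L x x' : `|x - x0| <= s -> `|x' - x0| <= s ->
    `|(x - f x + y) - (x' - f x' + y)| <= 2^-1 * `|x - x'|.
  move=> /ins xr /ins x'r; rewrite distrC.
  have -> : x' - f x' + y - (x - f x + y) = f x - f x' - (x - x').
    by apply/rowP => j; rewrite !mxE; ring.
  exact: near_id.
have [||x xs xE] := @contraction_fixed_point n (fun x => x - f x + y) x0 s s0; last 1 first.
- exists x; first exact: ins.
  apply/eqP; rewrite eq_sym -subr_eq0; apply/eqP; apply: (addrI x).
  by rewrite addr0 -[RHS]xE -addrA; congr (_ + _); rewrite addrC.
- move=> x xs; have x00 : `|x0 - x0| <= s by rewrite subrr normr0.
  have := L x x0 xs x00 => h.
  have E : x - f x + y - x0 = (x - f x + y - (x0 - f x0 + y)) + (y - f x0).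
    by apply/rowP => j; rewrite !mxE; ring.
  rewrite E; apply: (le_trans (ler_normD _ _)).
  apply: (le_trans (lerD h (lexx _))); move: xs; rewrite /s; lra.
- by [].
Qed.

Let g y := xget x0 [set x | `|x - x0| < r /\ f x = y].

Lemma core_gP y : B y -> `|g y - x0| < r /\ f (g y) = y.
Proof.
move=> /core_surj[x xr fx]; rewrite /g; case: xgetP => [x' -> //|/(_ x)]; by case.
Qed.

Lemma core_gK x : A x -> g (f x) = x.
Proof.
move=> [/= xr Bfx]; have [gr fg] := core_gP Bfx.
have := core_expand gr xr; rewrite fg subrr normr0 mulr0 normr_le0 subr_eq0.
by move/eqP.
Qed.

(** If [v] is killed by the Jacobian, then [f] moves by [o(h)] along [h *: v], whereas [near_id]
    forces a motion of at least [h * |v| / 2]. *)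
Lemma core_jac x : `|x - x0| < r -> jac f x \in unitmx.
Proof.
move=> xr; have df := C1_differentiable_rV oU (Cf 1) (rU xr).
rewrite -row_free_unit -kermx_eq0; apply/eqP/row_matrixP => i; rewrite row0.
set v := row i _.
have vJ : v *m jac f x = 0 by apply/sub_kermxP; exact: row_sub.
have D0 : 'D_v f x = 0 by rewrite jacE.
have Dv := derivableP (@diff_derivable _ _ _ _ _ v df); rewrite D0 in Dv.
apply/eqP; rewrite -normr_le0; apply/ler_addgt0Pr => e e0; rewrite add0r.
have e2 : 0 < e / 2 by rewrite divr_gt0.
have [d d0 H] := (is_derive_epsP _ _ _ _).1 Dv _ e2.
have v1 : 0 < `|v| + 1 by rewrite ltr_wpDl.
have rx : 0 < r - `|x - x0| by rewrite subr_gt0.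
(* One step that is both small enough for the difference quotient and small enough to stay in the
   ball around [x0]. *)
pose h := Num.min d ((r - `|x - x0|) / (`|v| + 1)) / 2.
have h0 : 0 < h by rewrite divr_gt0 // lt_min d0 divr_gt0.
have hd : `|h| < d.
  rewrite gtr0_norm //; apply: (@lt_le_trans _ _ (Num.min d ((r - `|x - x0|) / (`|v| + 1)))).
    by rewrite gtr_pMr ?lt_min ?d0 ?divr_gt0 // invf_lt1 // ltr1n.
  by rewrite ge_min lexx.
have hr : h * (`|v| + 1) < r - `|x - x0|.
  rewrite -ltr_pdivlMr //; apply: (@lt_le_trans _ _ (Num.min d ((r - `|x - x0|) / (`|v| + 1)))).
    by rewrite gtr_pMr ?lt_min ?d0 ?divr_gt0 // invf_lt1 // ltr1n.
  by rewrite ge_min lexx orbT.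
have zr : `|h *: v + x - x0| < r.
  rewrite -addrA; apply: (le_lt_trans (ler_normD _ _)).
  rewrite normrZ gtr0_norm //; move: hr; rewrite mulrDr mulr1; lra.
have hn0 : h != 0 by rewrite gt_eqF.
have := H h hn0 hd; rewrite subr0 normrZ normfV gtr0_norm // ler_pdivrMl // => H1.
have := near_id zr xr; rewrite addrK normrZ gtr0_norm // distrC => H2.
have := ler_distD (f (h *: v + x) - f x) (h *: v) 0; rewrite !subr0 normrZ gtr0_norm // => H3.
have H4 : h * `|v| <= 2^-1 * (h * `|v|) + h * (e / 2).
  exact: le_trans H3 (lerD H2 H1).
have : h * `|v| <= h * e by lra.
by rewrite ler_pM2l.
Qed.

(** With [x = g y] and [z = g (h *: w + y)], strict differentiability of [f] at [x] compares
    [h *: w] with [(z - x) *m J]. The 2-Lipschitz bound turns the error in [z - x] into one in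
    [h *: w]. *)
Lemma core_derive y w : B y -> is_derive y w g (w *m invmx (jac f (g y))).
Proof.
move=> By; have [xr fx] := core_gP By.
set x := g y in xr fx *; set J := jac f x.
have uJ : J \in unitmx by exact: core_jac.
have [C C0 HC] := norm_mulmx_bound (invmx J).
apply/is_derive_epsP => e e0.
(* Chosen so that [C * eta * 2 * |h| * |w|] is at most [|h| * e]; the [+ 1] covers [w = 0]. *)
pose eta := e / (C * (2 * (`|w| + 1))).
have w1 : 0 < `|w| + 1 by rewrite ltr_wpDl.
have D0 : 0 < C * (2 * (`|w| + 1)) by rewrite !mulr_gt0.
have eta0 : 0 < eta by rewrite divr_gt0.
have [d d0 Hd] := C1_strict_rV oU (Cf 1) (rU xr) eta0.
have oB : open B by exact: open_norm_ball.
have /nbhs_norm_ltP[d1 d10 Hd1] := open_nbhs_nbhs (conj oB By).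
pose d2 := Num.min d1 (d / 2).
have d20 : 0 < d2 by rewrite lt_min d10 divr_gt0.
exists (d2 / (`|w| + 1)); first by rewrite divr_gt0.
move=> h h0; rewrite ltr_pdivlMr // => hd2.
have hw : `|h *: w| < d2.
  by rewrite normrZ; apply: le_lt_trans hd2; rewrite ler_wpM2l // lerDl.
have Bz : B (h *: w + y).
  by apply: Hd1; rewrite addrK; apply: (lt_le_trans hw); rewrite ge_min lexx.
have [zr fz] := core_gP Bz; set z := g _ in zr fz *.
have zx : `|z - x| <= 2 * (`|h| * `|w|).
  by have := core_expand zr xr; rewrite fz fx addrK normrZ.
have zd : `|z - x| < d.
  apply: (le_lt_trans zx); rewrite -normrZ; have : d2 <= d / 2 by rewrite ge_min lexx orbT.
  move: hw; lra.
have xd : `|x - x| < d by rewrite subrr normr0.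
have := Hd z x zd xd; rewrite fz fx addrK => Hz.
have -> : h^-1 *: (z - x) - w *m invmx J = - h^-1 *: ((h *: w - (z - x) *m J) *m invmx J).
  rewrite mulmxBl mulmxK // -scalemxAl scaleNr [X in _ = - X]scalerBr scalerA.
  by rewrite mulVf // scale1r opprB.
rewrite normrZ normrN normfV ler_pdivrMl ?normr_gt0 //.
apply: (le_trans (HC _)); apply: (@le_trans _ _ (C * (eta * (2 * (`|h| * `|w|))))).
  by rewrite ler_pM2l //; apply: (le_trans Hz); rewrite ler_pM2l.
rewrite /eta.
have -> : C * (e / (C * (2 * (`|w| + 1))) * (2 * (`|h| * `|w|))) =
   `|h| * e * (`|w| / (`|w| + 1)).
  by field; rewrite !gt_eqF.
rewrite ler_piMr //; first by rewrite mulr_ge0 // ltW.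
by rewrite ler_pdivrMr // mul1r lerDl ler01.
Qed.

Lemma core_continuous y : B y -> {for y, continuous g}.
Proof.
move=> By; apply/continuous_epsP => e e0.
have oB : open B by exact: open_norm_ball.
have /nbhs_norm_ltP[d1 d10 Hd1] := open_nbhs_nbhs (conj oB By).
exists (Num.min d1 (e / 2)); first by rewrite lt_min d10 divr_gt0.
move=> z; rewrite lt_min => /andP[/Hd1 Bz ze].
have [xr fx] := core_gP By; have [zr fz] := core_gP Bz.
have := core_expand zr xr; rewrite fx fz => h; lra.
Qed.

(** Bootstrap: the derivative of [g] is the inverse of the Jacobian of [f] along [g], so [g] of
    class [C^k] makes its derivative of class [C^k]. *)
Lemma core_smooth : smooth_on B g.
Proof.
have oB : open B by exact: open_norm_ball.
elim=> [|k IH]; first by split=> // y; exact: core_continuous.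
apply: (@Ck_onS _ _ _ _ _ _ (fun i y => e_ i *m invmx (jac f (g y)))) => //.
- by move=> y; exact: core_continuous.
- by move=> i y By; exact: core_derive.
move=> i; apply: Ck_on_rV => // j.
apply: (@Ck_on_ext _ _ R _ _ (fun y => invmx (jac f (g y)) i j)) => //.
  by move=> y _; rewrite -rowE [in RHS]mxE.
apply: Ck_on_invmx => //.
  by move=> y By; apply: core_jac; have [] := core_gP By.
move=> a b.
apply: (@Ck_on_ext _ _ R _ _ (fun y => 'D_(e_ a) f (g y) 0 b)) => //.
  by move=> y _; rewrite [in RHS]mxE.
apply: (@Ck_on_comp _ _ _ _ _ U g (fun x => 'D_(e_ a) f x 0 b)) => //.
  by move=> y By; apply: rU; have [] := core_gP By.
apply: Ck_on_coord => //; exact: ((Cf k.+1).2 a).2.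
Qed.

Lemma core_inverse : exists (A B : set 'rV[R]_n) (g : 'rV[R]_n -> 'rV[R]_n),
  [/\ open A /\ open B, A x0 /\ A `<=` U, smooth_on B g,
      forall x, A x -> B (f x) /\ g (f x) = x &
      forall y, B y -> A (g y) /\ f (g y) = y].
Proof.
exists A, B, g; split.
- split; last exact: open_norm_ball.
  apply: open_preimage; [exact: open_norm_ball|exact: open_norm_ball|].
  by move=> x /rU Ux; exact: Ck_on_cont (Cf 0) Ux.
- split; last by move=> x [/rU].
  by split; rewrite /B /= subrr normr0 // divr_gt0.
- exact: core_smooth.
- by move=> x Ax; split; [exact: Ax.2|exact: core_gK].
- move=> y By; have [gr fg] := core_gP By; split=> //; split=> //=.
  by rewrite fg.
Qed.

End Core.

Theorem inverse_function n (U : set 'rV[R]_n) (f : 'rV[R]_n -> 'rV[R]_n) x0 :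
  open U -> smooth_on U f -> U x0 -> jac f x0 \in unitmx ->
  exists (A B : set 'rV[R]_n) (g : 'rV[R]_n -> 'rV[R]_n),
  [/\ open A /\ open B, A x0 /\ A `<=` U, smooth_on B g,
      forall x, A x -> B (f x) /\ g (f x) = x &
      forall y, B y -> A (g y) /\ f (g y) = y].
Proof.
move=> oU Cf Ux0 uJ; set J := jac f x0 in uJ.
pose f1 x := f x *m invmx J.
have Cf1 : smooth_on U f1 by move=> k; apply: Ck_on_mulmx.
have [C C0 HC] := norm_mulmx_bound (invmx J).
(* Multiplication by the inverse Jacobian enlarges norms by at most [C], so this precision leaves
   the constant [1/2] required of [f1 = f *m invmx J]. *)
have e0 : 0 < (2 * C)^-1 by rewrite invr_gt0 mulr_gt0.
have [d d0 Hd] := C1_strict_rV oU (Cf 1) Ux0 e0.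
have /nbhs_norm_ltP[d1 d10 Hd1] := open_nbhs_nbhs (conj oU Ux0).
pose r := Num.min d d1.
have r0 : 0 < r by rewrite lt_min d0.
have [A [B [g [[oA oB] [Ax0 AU] Cg fK gK]]]] : exists (A B : set 'rV[R]_n) (g : 'rV[R]_n -> 'rV[R]_n),
  [/\ open A /\ open B, A x0 /\ A `<=` U, smooth_on B g,
      forall x, A x -> B (f1 x) /\ g (f1 x) = x &
      forall y, B y -> A (g y) /\ f1 (g y) = y].
  apply: (@core_inverse n U f1 x0 r) => //.
    by move=> x; rewrite lt_min => /andP[_ /Hd1].
  move=> z z'; rewrite !lt_min => /andP[zd _] /andP[z'd _].
  have -> : f1 z - f1 z' - (z - z') = (f z - f z' - (z - z') *m J) *m invmx J.
    by rewrite [RHS]mulmxBl mulmxK // mulmxBl.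
  apply: (le_trans (HC _)); rewrite mulrC -ler_pdivlMr //.
  apply: (le_trans (Hd z z' zd z'd)).
  by rewrite invfM mulrAC.
have f1E x : f x = f1 x *m J by rewrite /f1 mulmxKV.
pose q (y : 'rV[R]_n) := y *m invmx J.
have Cq : smooth_on setT q by move=> k; apply: Ck_on_mulmx; [exact: openT|exact: Ck_on_id].
have oB' : open (q @^-1` B).
  have -> : q @^-1` B = setT `&` q @^-1` B by rewrite setTI.
  apply: (open_preimage openT oB) => x _.
  exact: (Ck_on_cont (Cq 0%N) I).
exists A, (q @^-1` B), (g \o q); split => //.
- move=> k; have Cqk : Ck_on k (q @^-1` B) q by apply: Ck_on_sub (Cq k) => x.
  exact: (Ck_on_comp_rV oB' oB (fun x Bx => Bx) Cqk (Cg k)).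
- by move=> y By; have [Ag fg] := gK _ By; split=> //=; rewrite f1E fg /q mulmxKV.
Qed.

End InverseFunction.

(** * Ordinary differential equations *)

Section Gronwall.
Context {R : realType}.

(** The step hypothesis treats the point [s] and a piece beyond it at once, so it contains both the
    closedness and the openness argument; applied at the supremum it forces that supremum past every
    [s]. *)
Lemma real_induction (P : R -> Prop) (S : R) :
  (forall s, 0 <= s <= S -> (forall r, 0 <= r < s -> P r) ->
     exists2 d, 0 < d & forall r, 0 <= r <= S -> r < s + d -> P r) ->
  forall s, 0 <= s <= S -> P s.
Proof.
move=> step s /andP[s0 sS]; have S0 : 0 <= S by exact: le_trans sS.
pose A := [set s | 0 <= s <= S /\ forall r, 0 <= r < s -> P r].
have A0 : A 0.
  split; first by rewrite lexx S0.
  by move=> r /andP[r0 /(le_lt_trans r0)]; rewrite ltxx.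
have hA : has_sup A.
  by split; [exists 0|exists S => r [/andP[_ ?]]].
have supS : 0 <= sup A <= S.
  apply/andP; split; first by apply: ub_le_sup => //; case: hA.
  by apply: ge_sup; [exists 0|move=> r [/andP[_ ?]]].
have H r : 0 <= r < sup A -> P r.
  move=> /andP[r0 rs]; have [a [_ Aa] ra] := sup_gt hA.1 rs.
  by apply: Aa; rewrite r0.
have [d d0 Hd] := step _ supS H.
apply: (Hd); first by rewrite s0.
rewrite ltNge; apply/negP => le_s.
have : A (sup A + d).
  split.
    apply/andP; split; last exact: le_trans sS.
    by case/andP: supS => sup0 _; apply: addr_ge0 => //; exact: ltW.
  move=> r /andP[r0 rd]; apply: Hd => //; rewrite r0 /=.
  by apply: le_trans (le_trans le_s sS); exact: ltW.
move=> /(ub_le_sup hA.2); rewrite gerDl leNgt d0 //.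
Qed.


Lemma derive_continuous (V : normedModType R) (f : R -> V) s df :
  is_derive s (1 : R) f df -> {for s, continuous f}.
Proof.
by move=> [d _]; apply: differentiable_continuous; apply: (derivable1_diffP _ _).1.
Qed.

Lemma is_derive_component (V : normedModType R) m (f : V -> 'rV[R]_m) x v df j :
  is_derive x v f df -> is_derive x v (fun y => f y 0 j) (df 0 j).
Proof.
move=> [d <-]; apply: DeriveDef; last by rewrite derive_coord.
exact: (derivable_mxP _ _ _).1 d 0 j.
Qed.

Lemma is_derive_rV (V : normedModType R) m (f : V -> 'rV[R]_m) x v (df : 'rV[R]_m) :
  (forall j, is_derive x v (fun y => f y 0 j) (df 0 j)) -> is_derive x v f df.
Proof.
move=> H; have d : derivable f x v.
  by apply/derivable_mxP => a b; rewrite ord1; case: (H b).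
apply: DeriveDef => //; apply/rowP => j; rewrite -derive_coord //.
by case: (H j).
Qed.

(** The norm is not differentiable, so each component and its opposite are compared with [b] by the
    mean value theorem. The strict initial gap is thereby preserved. *)
Lemma barrier m (e e' : R -> 'rV[R]_m) (b b' : R -> R) (S : R) :
  (forall s, 0 <= s <= S -> is_derive s (1 : R) e (e' s)) ->
  (forall s, 0 <= s <= S -> is_derive s (1 : R) b (b' s)) ->
  `|e 0| < b 0 ->
  (forall s, 0 <= s <= S -> `|e s| <= b s -> `|e' s| < b' s) ->
  forall s, 0 <= s <= S -> `|e s| < b s.
Proof.
move=> de db e0 He; apply: real_induction => s sI IH.
have /andP[s0 sS] := sI.
have in0S r : 0 <= r <= s -> 0 <= r <= S.
  by move=> /andP[-> /= rs]; exact: le_trans sS.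
have ce := derive_continuous (de s sI).
have cb := derive_continuous (db s sI).
have cn : {for s, continuous (fun r => b r - `|e r|)}.
  apply: continuousB => //.
  by apply: (@continuous_comp _ _ _ e (@Num.norm _ _) _ ce); exact: norm_continuous.
(* Strict inequality before [s] passes by continuity to a weak one at [s], which suffices to use the
   differential inequality on all of [[0, s]]. *)
have les : `|e s| <= b s.
  rewrite leNgt; apply/negP => lt_s.
  have g0 : 0 < `|e s| - b s by rewrite subr_gt0.
  have g2 : 0 < (`|e s| - b s) / 2 by rewrite divr_gt0.
  have [s_eq0|sn0] := eqVneq s 0; first by move: lt_s; rewrite s_eq0 ltNge ltW.
  have sp : 0 < s by rewrite lt_def sn0.
  have [d d0 Hd] := (continuous_epsP _ _).1 cn _ g2.
  pose r := s - Num.min s d / 2.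
  have mp : 0 < Num.min s d by rewrite lt_min sp.
  have ms : Num.min s d <= s by rewrite ge_min lexx.
  have md : Num.min s d <= d by rewrite ge_min lexx orbT.
  have rI : 0 <= r < s by rewrite /r; apply/andP; split; lra.
  have rd : `|r - s| < d by rewrite /r addrAC subrr add0r normrN gtr0_norm; lra.
  by have := IH r rI; have := Hd r rd; rewrite ler_norml => /andP[k1 k2]; lra.
have all_le r : 0 <= r <= s -> `|e r| <= b r.
  move=> /andP[r0]; rewrite le_eqVlt => /orP[/eqP-> //|rs].
  by apply: ltW; apply: IH; rewrite r0.
have incr (f f' : R -> R) : (forall r, 0 <= r <= s -> is_derive r (1 : R) f (f' r)) ->
    (forall r, 0 <= r <= s -> f' r <= b' r) -> f s - f 0 <= b s - b 0.
  move=> df lf; pose h := f - b.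
  have [|th /andP[t0 t1] E] := @mvt_increment R h (f' - b') 0 s.
    move=> th /andP[t0 t1]; have I : 0 <= 0 + th * s <= s.
      by rewrite add0r mulr_ge0 // ler_piMl.
    by apply: is_deriveB; [exact: df|apply: db; exact: in0S].
  have I : 0 <= 0 + th * s <= s by rewrite add0r mulr_ge0 // ler_piMl.
  have : h (0 + s) - h 0 <= 0.
    rewrite E; apply: mulr_ge0_le0 => //.
    by rewrite -[(_ - _) _]/(f' _ - b' _) subr_le0; exact: lf.
  by rewrite add0r /h -![(_ - _ : _ -> _) _]/(_ - _); lra.
have b0s : b 0 <= b s.
  have := @incr (fun=> 0) (fun=> 0); rewrite subrr subr_ge0; apply.
  by move=> r rI; apply: ltW; apply: le_lt_trans (He r (in0S _ rI) (all_le r rI)).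
have lts : `|e s| < b s.
  apply: norm_rV_lt => [|j]; first by apply: lt_le_trans b0s; apply: le_lt_trans e0.
  have ej r : 0 <= r <= s -> `|e' r 0 j| <= b' r.
    move=> rI; apply: ltW; apply: (le_lt_trans (coord_le_norm _ _)).
    exact: He (in0S _ rI) (all_le r rI).
  have e0j := le_lt_trans (coord_le_norm (e 0) j) e0.
  have H1 : e s 0 j - e 0 0 j <= b s - b 0.
    apply: (@incr (fun r => e r 0 j) (fun r => e' r 0 j)).
      by move=> r rI; apply: is_derive_component; exact: de (in0S _ rI).
    by move=> r rI; have := ej r rI; rewrite ler_norml => /andP[].
  have H2 : - e s 0 j - - e 0 0 j <= b s - b 0.
    apply: (@incr (fun r => - e r 0 j) (fun r => - e' r 0 j)).
      move=> r rI; apply: (@is_deriveN _ _ _ (fun r => e r 0 j)).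
      by apply: is_derive_component; exact: de (in0S _ rI).
    by move=> r rI; have := ej r rI; rewrite ler_norml lerNl => /andP[].
  by move: e0j; rewrite !ltr_norml => /andP[k1 k2]; apply/andP; split; lra.
have g2 : 0 < (b s - `|e s|) / 2 by rewrite divr_gt0 // subr_gt0.
have [d d0 Hd] := (continuous_epsP _ _).1 cn _ g2.
exists d => // r /andP[r0 rS] rsd.
have [rs|sr] := ltP r s; first by apply: IH; rewrite r0.
have rd : `|r - s| < d by rewrite ger0_norm ?subr_ge0 //; lra.
by have := Hd r rd; rewrite ler_norml => /andP[k1 k2]; lra.
Qed.

Lemma is_derive_expRZ (K c s : R) :
  is_derive s (1 : R) (fun s => c * expR (K * s)) (c * (K * expR (K * s))).
Proof.
have D1 : is_derive s (1 : R) (fun s => K * s) K.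
  have -> : (fun s => K * s) = K *: (id : R -> R) by [].
  by apply: is_derive_eq; rewrite [_ *: _]mulr1.
have D3 := is_derive1_comp (is_derive_expR (K * s)) D1.
rewrite mulrC in D3.
exact: (@is_deriveZ _ _ _ (fun s => expR (K * s)) c).
Qed.

(** The inequality for [e'] is known only while [|e| <= d]. The barrier [k * expR ((L + 1) * s)]
    stays below [d], and its derivative [L k E + k E] strictly dominates [L * |e| + eta] because
    [eta <= k0 < k]. *)
Lemma gronwall_pos m (e e' : R -> 'rV[R]_m) (S L k0 eta d : R) :
  0 <= L -> 0 <= S ->
  (forall s, 0 <= s <= S -> is_derive s (1 : R) e (e' s)) ->
  `|e 0| <= k0 -> eta <= k0 -> k0 * expR ((L + 1) * S) < d ->
  (forall s, 0 <= s <= S -> `|e s| <= d -> `|e' s| <= L * `|e s| + eta) ->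
  forall s, 0 <= s <= S -> `|e s| <= k0 * expR ((L + 1) * s).
Proof.
move=> L0 S0 de e0 ek kd He s sI; have /andP[s0 sS] := sI.
have ES : 0 < expR ((L + 1) * S) by exact: expR_gt0.
have Es : 0 < expR ((L + 1) * s) by exact: expR_gt0.
have mono r r' : 0 <= r <= r' -> expR ((L + 1) * r) <= expR ((L + 1) * r').
  by move=> /andP[r0 rr']; rewrite ler_expR ler_wpM2l // addr_ge0.
have ex1 r : 0 <= r -> 1 <= expR ((L + 1) * r).
  move=> r0; rewrite -expR0 ler_expR mulr_ge0 // addr_ge0 //.
(* The barrier argument needs strict inequalities, so it is run for [k > k0], and then [k] tends to
   [k0]. *)
suff H k : k0 < k -> k * expR ((L + 1) * S) <= d -> `|e s| < k * expR ((L + 1) * s).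
  rewrite -ler_pdivrMr //; apply/ler_addgt0Pr => ep ep0.
  pose k := Num.min (k0 + ep) ((k0 + d / expR ((L + 1) * S)) / 2).
  have kd' : k0 < d / expR ((L + 1) * S) by rewrite ltr_pdivlMr.
  have k0k : k0 < k by rewrite lt_min ltrDl ep0 /=; lra.
  have k1 : k <= k0 + ep by rewrite ge_min lexx.
  have k2 : k <= (k0 + d / expR ((L + 1) * S)) / 2 by rewrite ge_min lexx orbT.
  apply: (le_trans _ k1); apply: ltW; rewrite ltr_pdivrMr //.
  apply: H => //; rewrite -ler_pdivlMr //; lra.
move=> k0k kSd.
have kp : 0 < k by apply: le_lt_trans k0k; apply: le_trans e0.
apply: (@barrier m e e' (fun s => k * expR ((L + 1) * s))
   (fun s => k * ((L + 1) * expR ((L + 1) * s))) S) => //.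
- by move=> r _; exact: is_derive_expRZ.
- by rewrite mulr0 expR0 mulr1; exact: le_lt_trans k0k.
move=> r rI er; have /andP[r0 rS] := rI.
have erd : `|e r| <= d.
  apply: (le_trans er); apply: le_trans kSd; rewrite ler_pM2l //; exact: mono.
apply: (le_lt_trans (He r rI erd)).
have := ex1 r r0; set E := expR _ in er * => E1.
have h1 : L * `|e r| <= L * (k * E) by rewrite ler_wpM2l.
have h2 : k <= k * E by rewrite ler_peMr // ltW.
have -> : k * ((L + 1) * E) = L * (k * E) + k * E by ring.
lra.
Qed.

Lemma is_derive_reflect (V : normedModType R) (f : R -> V) (s : R) df :
  is_derive (- s) (1 : R) f df -> is_derive s (1 : R) (fun s => f (- s)) (- df).
Proof.
move=> D; have D1 : is_derive s (1 : R) (fun s : R => - s) (- 1).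
  exact: (@is_deriveN _ _ _ id).
have df' : differentiable f (- s).
  by case: D => d _; apply: (derivable1_diffP _ _).1.
have := is_derive_chain df' D1.
have -> : 'd f (- s) (- 1) = - df; last by [].
by rewrite linearN /= -deriveE //; case: D => _ ->.
Qed.

Lemma gronwall m (e e' : R -> 'rV[R]_m) (S L k0 eta d : R) :
  0 <= L -> 0 <= S ->
  (forall s, `|s| <= S -> is_derive s (1 : R) e (e' s)) ->
  `|e 0| <= k0 -> eta <= k0 -> k0 * expR ((L + 1) * S) < d ->
  (forall s, `|s| <= S -> `|e s| <= d -> `|e' s| <= L * `|e s| + eta) ->
  forall s, `|s| <= S -> `|e s| <= k0 * expR ((L + 1) * S).
Proof.
move=> L0 S0 de e0 ek kd He s sS.
have k00 : 0 <= k0 by apply: le_trans e0.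
apply: (@le_trans _ _ (k0 * expR ((L + 1) * `|s|))); last first.
  by rewrite ler_wpM2l // ler_expR ler_wpM2l // addr_ge0.
have inI r : 0 <= r <= S -> `|r| <= S by move=> /andP[r0]; rewrite ger0_norm.
have [s0|s0] := leP 0 s.
  rewrite ger0_norm //; apply: (@gronwall_pos m e e' S L k0 eta d) => //.
  - by move=> r /inI; exact: de.
  - by move=> r /inI; exact: He.
  - by move: sS; rewrite ger0_norm // s0.
rewrite ltr0_norm // -[e s]/(e s) -[in e s](opprK s).
apply: (@gronwall_pos m (fun r => e (- r)) (fun r => - e' (- r)) S L k0 eta d) => //.
- by move=> r /inI rS; apply: is_derive_reflect; apply: de; rewrite normrN.
- by rewrite oppr0.
- by move=> r /inI rS; rewrite normrN; apply: He; rewrite normrN.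
- by move: sS; rewrite ltr0_norm // => ->; rewrite andbT oppr_ge0 ltW.
Qed.

End Gronwall.

(** * Existence of solutions by Picard iteration *)

Section Picard.
Context {R : realType}.

(** Retraction onto [[-S, S]] when [0 <= S]; it extends data given on an interval or a box to
    globally defined continuous data. *)
Definition clamp (S s : R) : R := Num.max (- S) (Num.min s S).

Lemma clamp_id S s : `|s| <= S -> clamp S s = s.
Proof.
by rewrite ler_norml /clamp => /andP[h1 h2]; rewrite min_l // max_r.
Qed.

Lemma clamp_norm S s : 0 <= S -> `|clamp S s| <= S.
Proof.
move=> S0; rewrite ler_norml /clamp le_max lexx /= ge_max ge_min lexx orbT andbT.
by rewrite ge0_cp.
Qed.

Lemma clamp_lip S s t : `|clamp S s - clamp S t| <= `|s - t|.
Proof.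
wlog st : s t / t <= s.
  move=> H; have [/H//|/ltW/H] := leP t s.
  by rewrite distrC [`|t - s|]distrC.
have c1 : clamp S t <= clamp S s by rewrite /clamp; case: (leP t S); case: (leP s S) => h1 h2;
  rewrite /Num.max; repeat case: ifP => //=; lra.
rewrite !ger0_norm ?subr_ge0 // /clamp /Num.max /Num.min.
by repeat case: ifPn; rewrite -?leNgt => *; lra.
Qed.

Lemma lipschitz_continuous (V W : normedModType R) (f : V -> W) x (C : R) : 0 < C ->
  (forall y, `|f y - f x| <= C * `|y - x|) -> {for x, continuous f}.
Proof.
move=> C0 H; apply/continuous_epsP => e e0; exists (e / C); first by rewrite divr_gt0.
move=> y; rewrite ltr_pdivlMr // mulrC => /ltW; exact: le_trans.
Qed.

Lemma clamp_continuous S : continuous (clamp S).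
Proof.
move=> s; apply: (@lipschitz_continuous _ _ _ s 1) => // t.
by rewrite mul1r clamp_lip.
Qed.

Lemma open_interval_near (S s : R) : `|s| < S -> \forall r \near s, `|r| < S.
Proof.
move=> sS; apply: (nbhs_norm_ltP (s : R) _).2; exists (S - `|s|); first by rewrite subr_gt0.
move=> r rs; have := ler_normD (r - s) s; rewrite subrK; lra.
Qed.

Lemma antiderivative (phi : R -> R) (S : R) : 0 < S -> continuous phi ->
  exists Phi : R -> R, [/\ continuous Phi, Phi 0 = 0 &
    forall s, `|s| < S -> is_derive s (1 : R) Phi (phi s)].
Proof.
move=> S0 cphi.
(* Integrating from [- S - 1] makes every point of [[-S, S]] interior to the interval, so [I] has
   two-sided derivatives at the ends as well. *)
pose I (s : R) : R := (\int[@lebesgue_measure R]_(t in `[(- S - 1)%R, s]) phi t)%R.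
have dI s : `|s| <= S -> is_derive s (1 : R) I (phi s).
  rewrite ler_norml => /andP[s1 s2].
  have Hi : (@lebesgue_measure R).-integrable `[(- S - 1)%R, (S + 1)%R] (EFin \o phi).
    apply: continuous_compact_integrable; first exact: segment_compact.
    by apply: continuous_subspaceT.
  have := @continuous_FTC1_closed R phi (- S - 1) s (S + 1) _ Hi _ (cphi s).
  move=> /(_ _ _)[||d E]; [lra|lra|].
  by apply: DeriveDef; [exact: d|rewrite -derive1E].
(* Clamping the argument makes the primitive continuous on the whole line without changing it on
   [[-S, S]]. *)
exists (fun s => I (clamp S s) - I 0); split.
- move=> s; have c : {for s, continuous (fun s => I (clamp S s))}.
    apply: (@continuous_comp _ _ _ (clamp S) I); first exact: clamp_continuous.
    by apply: (derive_continuous (dI _ _)); rewrite clamp_norm // ltW.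
  by apply: (continuousB c); exact: cst_continuous.
- by rewrite clamp_id ?subrr // normr0 ltW.
- move=> s sS; rewrite -[phi s]subr0.
  apply: (@is_deriveB _ _ _ (fun s => I (clamp S s)) (fun=> I 0)).
  apply: near_eq_is_derive (dI s (ltW sS)).
  by apply: filterS (open_interval_near sS) => r rS; rewrite clamp_id // ltW.
Qed.

Lemma antiderivative_rV m (phi : R -> 'rV[R]_m) (S : R) : 0 < S -> continuous phi ->
  exists Phi : R -> 'rV[R]_m, [/\ continuous Phi, Phi 0 = 0 &
    forall s, `|s| < S -> is_derive s (1 : R) Phi (phi s)].
Proof.
move=> S0 cphi.
have /choice[P HP] : forall j, exists Phi : R -> R, [/\ continuous Phi, Phi 0 = 0 &
    forall s, `|s| < S -> is_derive s (1 : R) Phi (phi s 0 j)].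
  move=> j; apply: antiderivative => // s.
  by apply: (@continuous_comp _ _ _ phi (fun M : 'rV[R]_m => M 0 j)); [exact: cphi|exact: coord_continuous].
exists (fun s => \row_j P j s); split.
- move=> s; apply: continuous_rV => j; have [c _ _] := HP j.
  have -> : (fun y => (\row_j P j y) 0 j) = P j by apply/funext => y; rewrite mxE.
  exact: c.
- by apply/rowP => j; rewrite !mxE; have [_ -> _] := HP j.
- move=> s sS; apply: is_derive_rV => j.
  have -> : (fun y => (\row_j P j y) 0 j) = P j by apply/funext => y; rewrite mxE.
  by have [_ _ d] := HP j; exact: d.
Qed.

(** Integrating a bound with weight [expR (K * s)] gains a factor [1 / K]. With a large [K], Picard
    iteration contracts on an interval of any length. *)
Lemma exp_comparison_pos m (f f' : R -> 'rV[R]_m) (S C K : R) :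
  0 <= C -> 0 < K ->
  (forall s, 0 <= s < S -> is_derive s (1 : R) f (f' s)) -> f 0 = 0 ->
  (forall s, 0 <= s < S -> `|f' s| <= C * expR (K * s)) ->
  forall s, 0 <= s < S -> `|f s| <= C / K * expR (K * s).
Proof.
move=> C0 K0 df f0 Hf s /andP[s0 sS].
have in0 th : 0 <= th <= 1 -> 0 <= 0 + th * s < S.
  move=> /andP[t0 t1]; rewrite add0r mulr_ge0 //=; apply: le_lt_trans sS.
  by rewrite ler_piMl.
have incr (h h' : R -> R) : h 0 = 0 ->
    (forall r, 0 <= r < S -> is_derive r (1 : R) h (h' r)) ->
    (forall r, 0 <= r < S -> h' r <= C * expR (K * r)) -> h s <= C / K * expR (K * s).
  move=> h0 dh lh; pose b s := C / K * expR (K * s).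
  have [|th thI E] := @mvt_increment R (h - b) (fun r => h' r - C / K * (K * expR (K * r))) 0 s.
    move=> th /in0 I; apply: is_deriveB; first exact: dh.
    exact: is_derive_expRZ.
  move: E; rewrite !add0r -![(_ - _ : _ -> _) _]/(_ - _) => E.
  have H := lh _ (in0 _ thI); rewrite add0r in H.
  have H2 : h' (th * s) - C / K * (K * expR (K * (th * s))) <= 0.
    by rewrite mulrA divfK ?gt_eqF // subr_le0.
  have : h s - b s - (h 0 - b 0) <= 0.
    by rewrite E; apply: mulr_ge0_le0.
  have b0 : 0 <= b 0 by rewrite /b mulr_ge0 ?divr_ge0 ?expR_ge0 // ltW.
  by rewrite h0 -/(b s); lra.
apply: norm_rV_le; first by rewrite mulr_ge0 ?divr_ge0 ?expR_ge0 // ltW.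
move=> j; rewrite ler_norml; apply/andP; split; last first.
  apply: (incr (fun r => f r 0 j) (fun r => f' r 0 j)).
  - by rewrite f0 mxE.
  - by move=> r /df; exact: is_derive_component.
  - move=> r rI; apply: le_trans (Hf r rI); apply: le_trans (coord_le_norm _ j).
    exact: ler_norm.
rewrite lerNl; apply: (incr (fun r => - f r 0 j) (fun r => - f' r 0 j)).
- by rewrite f0 mxE oppr0.
- move=> r rI; apply: (@is_deriveN _ _ _ (fun r => f r 0 j)).
  exact: is_derive_component (df r rI).
- move=> r rI; apply: le_trans (Hf r rI); apply: le_trans (coord_le_norm _ j).
  by rewrite -normrN ler_norm.
Qed.

Lemma exp_comparison m (f f' : R -> 'rV[R]_m) (S C K : R) :
  0 <= C -> 0 < K ->
  (forall s, `|s| < S -> is_derive s (1 : R) f (f' s)) -> f 0 = 0 ->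
  (forall s, `|s| < S -> `|f' s| <= C * expR (K * `|s|)) ->
  forall s, `|s| < S -> `|f s| <= C / K * expR (K * `|s|).
Proof.
move=> C0 K0 df f0 Hf s sS.
have inI r : 0 <= r < S -> `|r| < S by move=> /andP[r0]; rewrite ger0_norm.
have [s0|s0] := leP 0 s.
  rewrite ger0_norm //; apply: (@exp_comparison_pos m f f' S) => //.
  - by move=> r /inI; exact: df.
  - by move=> r rI; have := Hf r (inI r rI); rewrite [`|r|]ger0_norm //; case/andP: rI.
  - by move: sS; rewrite ger0_norm // s0.
rewrite ltr0_norm // -[in f s](opprK s).
apply: (@exp_comparison_pos m (fun r => f (- r)) (fun r => - f' (- r)) S) => //.
- by move=> r /inI rS; apply: is_derive_reflect; apply: df; rewrite normrN.
- by rewrite oppr0.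
- move=> r rI; rewrite normrN; have := Hf (- r); rewrite normrN => /(_ (inI r rI)).
  by rewrite [`|r|]ger0_norm //; case/andP: rI.
- by move: sS; rewrite ltr0_norm // => ->; rewrite andbT oppr_ge0 ltW.
Qed.

(** The sequences [u n - 2 D 2^-n] and [u n + 2 D 2^-n] are monotone and enclose each other; the
    supremum of the lower one is the limit, with the stated rate. *)
Lemma geometric_limit (u : nat -> R) (D : R) :
  (forall n, `|u n.+1 - u n| <= D * 2^-1 ^+ n) ->
  exists l, forall n, `|u n - l| <= 2 * D * 2^-1 ^+ n.
Proof.
move=> Hu; pose a n := u n - 2 * D * 2^-1 ^+ n; pose b n := u n + 2 * D * 2^-1 ^+ n.
have D0 n : 0 <= D * 2^-1 ^+ n by exact: le_trans (Hu n).
have aS n : a n <= a n.+1.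
  by have := Hu n; rewrite ler_norml /a exprS => /andP[h1 h2]; lra.
have bS n : b n.+1 <= b n.
  by have := Hu n; rewrite ler_norml /b exprS => /andP[h1 h2]; lra.
have ab n : a n <= b n by have := D0 n; rewrite /a /b; lra.
have a_mono k n : a n <= a (n + k)%N.
  by elim: k => [|k IH]; rewrite ?addn0 // addnS; exact: le_trans (aS _).
have b_mono k n : b (n + k)%N <= b n.
  by elim: k => [|k IH]; rewrite ?addn0 // addnS; exact: le_trans IH.
have aub n : ubound (range a) (b n).
  move=> _ [k _ <-]; apply: (le_trans (a_mono n k)).
  by apply: (le_trans (ab _)); rewrite addnC.
exists (sup (range a)) => n.
have h1 : a n <= sup (range a) by apply: ub_le_sup; [exists (b n); exact: aub|exists n].
have h2 : sup (range a) <= b n by apply: ge_sup; [exists (a n); exists n|exact: aub].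
by rewrite ler_norml; move: h1 h2; rewrite /a /b => h1 h2; apply/andP; split; lra.
Qed.

Lemma geometric_eventually (D e : R) : 0 < e ->
  exists N, forall n, (N <= n)%N -> D * 2^-1 ^+ n <= e.
Proof.
move=> e0.
have C : (fun n => D * 2^-1 ^+ n) @ \oo --> (D * 0 : R).
  apply: cvgM; first exact: cvg_cst.
  by apply: cvg_expr; rewrite gtr0_norm ?invr_gt0 // invf_lt1 // ltr1n.
rewrite mulr0 in C; have /cvgrPdist_le /(_ e e0) [N _ HN] := C.
exists N => n /HN; rewrite sub0r normrN; exact: le_trans (ler_norm _).
Qed.

Theorem picard m (G : R -> 'rV[R]_m -> 'rV[R]_m) (L S : R) (x : 'rV[R]_m) :
  0 < S -> 0 <= L ->
  (forall s y z, `|G s y - G s z| <= L * `|y - z|) ->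
  (forall w : R -> 'rV[R]_m, continuous w -> continuous (fun s => G s (w s))) ->
  exists w : R -> 'rV[R]_m, w 0 = x /\
    forall s, `|s| < S -> is_derive s (1 : R) w (G s (w s)).
Proof.
move=> S0 L0 GL Gc.
(* [step] is a total function on curves; its properties are asserted for continuous arguments, which
   the iterates are. *)
have /choice[step Hstep] : forall w : R -> 'rV[R]_m, exists w' : R -> 'rV[R]_m,
    continuous w -> [/\ continuous w', w' 0 = x &
       forall s, `|s| < S -> is_derive s (1 : R) w' (G s (w s))].
  move=> w; have [cw|ncw] := pselect (continuous w); last by exists w.
  have [P [cP P0 dP]] := antiderivative_rV S0 (Gc w cw).
  exists (fun s => x + P s) => _; split.
  - move=> s; have c : {for s, continuous (fun _ : R => x)} by exact: cst_continuous.
    exact: (continuousD c (cP s)).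
  - by rewrite P0 addr0.
  - move=> s /dP d; rewrite -[G s (w s)]add0r.
    exact: (@is_deriveD _ _ _ (fun=> x) P).
pose W n := iter n step (fun=> x).
have cW n : continuous (W n).
  elim: n => [|n IH]; first by move=> s; exact: cst_continuous.
  by have [] := Hstep _ IH.
have W0 n : W n 0 = x by case: n => [//|n]; have [] := Hstep _ (cW n).
have dW n s : `|s| < S -> is_derive s (1 : R) (W n.+1) (G s (W n s)).
  by have [_ _] := Hstep _ (cW n); exact.
(* With this weight one iteration multiplies the error by [L / K], which is less than [1/2]. *)
pose K := 2 * L + 1.
have K0 : 0 < K by rewrite /K; lra.
have [C C0 HC] : exists2 C, 0 <= C & forall s, `|s| < S -> `|W 1%N s - W 0%N s| <= C.
  have cn : {within `[- S, S], continuous (fun s => `|W 1%N s - W 0%N s|)}.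
    apply: continuous_subspaceT => s.
    have c : {for s, continuous (fun s => W 1%N s - W 0%N s)}.
      by apply: continuousB; exact: cW.
    apply: (@continuous_comp _ _ _ (fun s => W 1%N s - W 0%N s) (@Num.norm _ _) _ c).
    exact: norm_continuous.
  have SS : - S <= S by lra.
  have [c _ Hc] := EVT_max SS cn.
  exists `|W 1%N c - W 0%N c| => // s; rewrite ltr_norml => /andP[s1 s2].
  by apply: Hc; rewrite in_itv /= !ltW.
have HW n s : `|s| < S -> `|W n.+1 s - W n s| <= C * 2^-1 ^+ n * expR (K * `|s|).
  elim: n s => [|n IH] s sS.
    rewrite expr0 mulr1; apply: (le_trans (HC s sS)).
    by rewrite ler_peMr // -expR0 ler_expR mulr_ge0 // ltW.
  have Cn : 0 <= L * (C * 2^-1 ^+ n) by rewrite !mulr_ge0 // exprn_ge0 // invr_ge0.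
  apply: (@le_trans _ _ (L * (C * 2^-1 ^+ n) / K * expR (K * `|s|))).
    apply: (@exp_comparison m (fun s => W n.+2 s - W n.+1 s)
       (fun s => G s (W n.+1 s) - G s (W n s)) S) => //.
    - move=> r rS; apply: (@is_deriveB _ _ _ (W n.+2) (W n.+1)); exact: dW.
    - by rewrite !W0 subrr.
    - move=> r rS; apply: (le_trans (GL _ _ _)); rewrite -[leRHS]mulrA ler_wpM2l //.
      exact: IH.
  rewrite ler_wpM2r ?expR_ge0 // ler_pdivrMr // exprS /K.
  have : 0 <= C * 2^-1 ^+ n by rewrite mulr_ge0 // exprn_ge0 // invr_ge0.
  set c := C * 2^-1 ^+ n => c0.
  have -> : C * (2^-1 * 2^-1 ^+ n) * (2 * L + 1) = L * c + c / 2 by rewrite /c; field.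
  lra.
pose D := C * expR (K * S).
have HD n s : `|s| < S -> `|W n.+1 s - W n s| <= D * 2^-1 ^+ n.
  move=> sS; apply: (le_trans (HW n s sS)); rewrite /D mulrAC ler_wpM2r //.
  by rewrite ler_wpM2l // ler_expR ler_wpM2l ?ltW.
have /choice[w Hw] : forall s, exists l : 'rV[R]_m, `|s| < S ->
    forall n, `|W n s - l| <= 2 * D * 2^-1 ^+ n.
  move=> s; have [sS|sS] := boolP (`|s| < S); last by exists 0.
  have /choice[l Hl] : forall j, exists l, forall n, `|W n s 0 j - l| <= 2 * D * 2^-1 ^+ n.
    move=> j; apply: geometric_limit => n; apply: le_trans (HD n s sS).
    by apply: le_trans (coord_le_norm _ j); rewrite !mxE.
  exists (\row_j l j) => _ n; apply: norm_rV_le => [|j].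
    by rewrite -mulrA mulr_ge0 //; exact: le_trans (HD n s sS).
  by rewrite !mxE.
have cvg_w s : `|s| < S -> forall e, 0 < e -> exists N, forall n, (N <= n)%N -> `|W n s - w s| <= e.
  move=> sS e e0; have [N HN] := geometric_eventually (2 * D) e0.
  by exists N => n /HN; apply: le_trans; exact: Hw.
exists w; split.
  have S00 : `|0 : R| < S by rewrite normr0.
  apply/eqP; rewrite -subr_eq0 -normr_le0; apply/ler_addgt0Pr => e e0; rewrite add0r.
  by have [N HN] := cvg_w 0 S00 e e0; have := HN N (leqnn N); rewrite W0 distrC.
move=> s; rewrite ltr_norml => sI; apply: is_derive_rV => j.
apply: (@uniform_derive R (fun n s => W n.+1 s 0 j) (fun n s => G s (W n s) 0 j)
   (fun s => w s 0 j) (fun s => G s (w s) 0 j) (- S) S) => //.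
- by move=> n r; rewrite -ltr_norml => rS; apply: is_derive_component; exact: dW.
- move=> r; rewrite -ltr_norml => rS; apply/cvgrPdist_le => e e0.
  have [N HN] := cvg_w r rS e e0; exists N => // n /= Nn.
  rewrite distrC; apply: le_trans (HN n.+1 (leqW Nn)).
  by apply: le_trans (coord_le_norm _ j); rewrite !mxE.
- move=> e e0; have [N HN] := geometric_eventually (L * (2 * D)) e0.
  exists N => n /HN Hn r; rewrite -ltr_norml => rS; apply: le_trans Hn.
  rewrite -mulrA; apply: le_trans (ler_wpM2l L0 (Hw r rS n)).
  by apply: le_trans (GL r _ _); apply: le_trans (coord_le_norm _ j); rewrite !mxE.
Qed.

End Picard.

(** * Differentiable dependence on the initial value *)

Section SmoothDependence.
Context {R : realType}.
Local Notation e_ i := (delta_mx 0 i).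

(** A property that gets weaker as the radius [d] shrinks and holds locally with some radius holds
    on the compact interval with a common one; the near-covering form of compactness is used with
    the filter of [d] tending to [0] from the right. *)
Lemma compact_uniform_itv (S : R) (Q : R -> R -> Prop) :
  (forall s d d', 0 < d' -> d' <= d -> Q s d -> Q s d') ->
  (forall s, `|s| <= S -> exists2 d, 0 < d & \forall s' \near s, Q s' d) ->
  exists2 d, 0 < d & forall s, `|s| <= S -> Q s d.
Proof.
move=> Qm H.
have /compact_near_coveringP NC : compact `[(- S)%R, S] by exact: segment_compact.
have F : Filter (0^'+ : set_system R) by exact: at_right_proper_filter.
have {}NC : \forall d \near 0^'+, `[(- S)%R, S]%classic `<=` (Q ^~ d).
  apply: (NC R (0^'+ : set_system R) (fun d s => Q s d) F) => s.
  rewrite /= in_itv /= -ler_norml => sS; have [d d0 Hd] := H s sS.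
  exists ([set s' | Q s' d], [set d' | 0 < d' <= d]); last first.
    by move=> [s' d'] /= [Qs' /andP[d'0 d'd]]; exact: Qm Qs'.
  split=> //=; near=> d'; apply/andP; split; near: d'; [exact: nbhs_right_gt|exact: nbhs_right_le].
have pos : \forall d \near (0 : R)^'+, 0 < d by exact: nbhs_right_gt.
have [d [d0 Hd]] := filter_ex (filterI pos NC).
by exists d => // s; rewrite ler_norml => sI; apply: Hd; rewrite /= in_itv.
Unshelve. all: by end_near. Qed.

Lemma norm_le_subD (V : normedModType R) (a b : V) : `|a| <= `|a - b| + `|b|.
Proof. by have := ler_normD (a - b) b; rewrite subrK. Qed.

Lemma norm_sub_split (V : normedModType R) (x a b : V) (p q : R) :
  `|x - a| <= p -> `|b - a| <= q -> `|x - b| <= p + q.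
Proof.
move=> xa ba; have -> : x - b = (x - a) - (b - a) by rewrite opprB addrA subrK.
by apply: (le_trans (ler_normB _ _)); exact: lerD.
Qed.

Lemma jac_vec n m (f : 'rV[R]_n -> 'rV[R]_m) y (v : 'rV[R]_n) :
  v *m jac f y = \sum_i v 0 i *: 'D_(e_ i) f y.
Proof.
apply/rowP => j; rewrite summxE mxE; apply: eq_bigr => i _; by rewrite !mxE.
Qed.

Lemma jac_near n m (U : set 'rV[R]_n) (f : 'rV[R]_n -> 'rV[R]_m) y (e : R) :
  open U -> Ck_on 1 U f -> U y -> 0 < e ->
  exists2 d, 0 < d & forall y', `|y' - y| < d ->
    forall v : 'rV[R]_n, `|v *m jac f y' - v *m jac f y| <= e * `|v|.
Proof.
move=> oU Cf Uy e0; pose e' := e / n.+1%:R.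
have e'0 : 0 < e' by rewrite divr_gt0.
pose P (i : 'I_n) (d : R) := forall y' : 'rV[R]_n, `|y' - y| < d ->
  `|'D_(e_ i) f y' - 'D_(e_ i) f y : 'rV[R]_m| <= e'.
have Pm i d d' : d' <= d -> P i d -> P i d'.
  by move=> dd' H y' y'd; apply: H; exact: lt_le_trans dd'.
have Pe i : exists2 d, 0 < d & P i d.
  exact: (continuous_epsP _ _).1 ((Cf.2 i).2.1 y Uy) e' e'0.
have [d d0 H] := common_radius Pm Pe.
exists d => // y' y'd v; rewrite !jac_vec -sumrB.
apply: (le_trans (ler_norm_sum _ _ _)).
apply: (@le_trans _ _ (\sum_(i < n) (`|v| * e'))).
  apply: ler_sum => i _; rewrite -scalerBr normrZ ler_pM // ?coord_le_norm //.
  exact: H.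
rewrite sumr_const card_ord -mulr_natl /e'.
have -> : n%:R * (`|v| * (e / n.+1%:R)) = n%:R / n.+1%:R * (e * `|v|) by ring.
rewrite ler_piMl //; first by rewrite mulr_ge0 // ltW.
by rewrite ler_pdivrMr ?ltr0n // mul1r ler_nat.
Qed.

Section AlongCurve.
Variables (n : nat) (Om : set 'rV[R]_n) (F : 'rV[R]_n -> 'rV[R]_n).
Hypotheses (oOm : open Om) (CF : Ck_on 1 Om F).

Lemma tube_strict (c : R -> 'rV[R]_n) (S e : R) : 0 < e ->
  (forall s, `|s| <= S -> {for s, continuous c} /\ Om (c s)) ->
  exists2 d, 0 < d & forall s, `|s| <= S -> forall z z', `|z - c s| < d -> `|z' - c s| < d ->
    `|F z - F z' - (z - z') *m jac F (c s)| <= e * `|z - z'|.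
Proof.
move=> e0 Hc; apply: compact_uniform_itv.
  by move=> s d d' _ dd' H z z' zd z'd; apply: H; [exact: lt_le_trans dd'|exact: lt_le_trans dd'].
move=> s0 s0S; have [cc Oc] := Hc s0 s0S.
have e2 : 0 < e / 2 by rewrite divr_gt0.
have [d1 d10 H1] := C1_strict_rV oOm CF Oc e2.
have [d2 d20 H2] := jac_near oOm CF Oc e2.
(* A point within [d] of [c s], itself within [d] of [c s0], must stay within [d1] of [c s0]. *)
pose d := Num.min (d1 / 2) d2.
have d0 : 0 < d by rewrite lt_min d20 divr_gt0.
have dd1 : d <= d1 / 2 by rewrite ge_min lexx.
have dd2 : d <= d2 by rewrite ge_min lexx orbT.
exists d => //; have /cvgrPdist_lt /(_ d d0) := cc; rewrite ?near_simpl.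
apply: filterS => s; rewrite distrC => sd z z' zd z'd.
have near_c (w : 'rV[R]_n) : `|w - c s| < d -> `|w - c s0| < d1.
  move=> wd; apply: (le_lt_trans (ler_distD (c s) w (c s0))); move: wd sd dd1 d0.
  by move: `|w - c s| `|c s - c s0| => p q; clear; lra.
have := H1 z z' (near_c _ zd) (near_c _ z'd).
have := H2 (c s) (lt_le_trans sd dd2) (z - z').
move=> h2 h1; apply: (le_trans (norm_sub_split h1 h2)).
by rewrite -mulrDl -splitr.
Qed.

(** One number [d] serves as radius and, through [d^-1], as Lipschitz constant, so that the
    statement has the single monotone parameter required by [compact_uniform_itv]. *)
Lemma tube_lip (c : R -> 'rV[R]_n) (S : R) :
  (forall s, `|s| <= S -> {for s, continuous c} /\ Om (c s)) ->
  exists2 d, 0 < d & forall s, `|s| <= S ->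
    (forall z z', `|z - c s| < d -> `|z' - c s| < d -> `|F z - F z'| <= d^-1 * `|z - z'|) /\
    (forall v : 'rV[R]_n, `|v *m jac F (c s)| <= d^-1 * `|v|).
Proof.
move=> Hc; apply: compact_uniform_itv.
  move=> s d d' d'0 dd' [H H']; have dd'V : d^-1 <= d'^-1.
    by rewrite lef_pV2 // posrE; apply: lt_le_trans dd'.
  split=> [z z' zd z'd|v].
    apply: (le_trans (H _ _ (lt_le_trans zd dd') (lt_le_trans z'd dd'))).
    by rewrite ler_wpM2r.
  by apply: (le_trans (H' v)); rewrite ler_wpM2r.
move=> s0 s0S; have [cc Oc] := Hc s0 s0S.
have [d1 d10 H1] := C1_strict_rV oOm CF Oc ltr01.
have [d2 d20 H2] := jac_near oOm CF Oc ltr01.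
have [C C0 HC] := norm_mulmx_bound (jac F (c s0)).
have C10 : 0 < C + 1 by lra.
pose d := Num.min (Num.min (d1 / 2) d2) (C + 1)^-1.
have d0 : 0 < d by rewrite !lt_min d20 divr_gt0 ?invr_gt0.
have dd1 : d <= d1 / 2 by rewrite !ge_min lexx.
have dd2 : d <= d2 by rewrite !ge_min lexx orbT.
have dC : C + 1 <= d^-1.
  by rewrite -[C + 1]invrK lef_pV2 ?posrE ?invr_gt0 // !ge_min lexx !orbT.
exists d => //; have /cvgrPdist_lt /(_ d d0) := cc; rewrite ?near_simpl.
apply: filterS => s; rewrite distrC => sd; split=> [z z' zd z'd|v].
  have near_c (w : 'rV[R]_n) : `|w - c s| < d -> `|w - c s0| < d1.
    move=> wd; apply: (le_lt_trans (ler_distD (c s) w (c s0))); move: wd sd dd1 d0.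
    by move: `|w - c s| `|c s - c s0| => p q; clear; lra.
  have h1 := H1 z z' (near_c _ zd) (near_c _ z'd).
  have h2 := HC (z - z').
  apply: (le_trans (norm_le_subD _ ((z - z') *m jac F (c s0)))).
  apply: (le_trans (lerD h1 h2)); by rewrite -mulrDl addrC ler_wpM2r.
have h1 := H2 (c s) (lt_le_trans sd dd2) v.
apply: (le_trans (norm_le_subD _ (v *m jac F (c s0)))).
apply: (le_trans (lerD h1 (HC v))); by rewrite -mulrDl addrC ler_wpM2r.
Qed.

Definition solves (sg : R) (c : R -> 'rV[R]_n) :=
  forall s, `|s| < sg -> Om (c s) /\ is_derive s (1 : R) c (F (c s)).

Lemma solves_cont sg c S : solves sg c -> S < sg ->
  forall s, `|s| <= S -> {for s, continuous c} /\ Om (c s).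
Proof.
move=> Hc Ssg s sS; have [Oc dc] := Hc s (le_lt_trans sS Ssg).
by split=> //; exact: derive_continuous dc.
Qed.

(** Gronwall for [v - c] inside the tube of [tube_lip]; the radius [r] is chosen so that the
    Gronwall bound stays within [d / 2]. *)
Lemma dep_lip (sg S : R) (c : R -> 'rV[R]_n) : 0 <= S -> S < sg -> solves sg c ->
  exists C r : R, [/\ 0 < C, 0 < r & forall v, solves sg v -> `|v 0 - c 0| < r ->
    forall s, `|s| <= S -> `|v s - c s| <= C * `|v 0 - c 0|].
Proof.
move=> S0 Ssg Hc; have [d d0 H] := tube_lip (solves_cont Hc Ssg).
pose E := expR ((d^-1 + 1) * S); have E0 : 0 < E by exact: expR_gt0.
have d2 : 0 < d / 2 by rewrite divr_gt0.
exists E, (d / 2 / E); split=> //; first by rewrite divr_gt0.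
move=> v Hv; rewrite ltr_pdivlMr // => vd s sS; rewrite mulrC.
apply: (@gronwall R n (fun s => v s - c s) (fun s => F (v s) - F (c s)) S d^-1 _ 0 (d / 2)) => //.
- by rewrite invr_ge0 ltW.
- move=> r rS; have rsg := le_lt_trans rS Ssg.
  by apply: (@is_deriveB _ _ _ v c); [have [] := Hv r rsg|have [] := Hc r rsg].
- move=> r rS rd; rewrite addr0; apply: (H r rS).1; last by rewrite subrr normr0.
  by apply: (le_lt_trans rd); lra.
Qed.

Lemma continuous_sum (T : topologicalType) m (I : Type) (r : seq I) (f : I -> T -> 'rV[R]_m) (x : T) :
  (forall i, {for x, continuous (f i)}) -> {for x, continuous (fun y => \sum_(i <- r) f i y)}.
Proof.
move=> H; elim: r => [|i r IH].
  have -> : (fun y => \sum_(i <- [::]) f i y) = (fun=> 0).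
    by apply/funext => y; rewrite big_nil.
  exact: cst_continuous.
have -> : (fun y => \sum_(j <- i :: r) f j y) = (fun y => f i y + \sum_(j <- r) f j y).
  by apply/funext => y; rewrite big_cons.
exact: (continuousD (H i) IH).
Qed.

(** The linearised equation is globally Lipschitz in the unknown, so it is solvable on the whole
    interval. Its coefficient is clamped outside [[-S, S]], where [c] may leave [Om]. *)
Lemma variational (sg S : R) (c : R -> 'rV[R]_n) (x' : 'rV[R]_n) : 0 < S -> S < sg -> solves sg c ->
  exists z : R -> 'rV[R]_n, z 0 = x' /\
    forall s, `|s| < S -> is_derive s (1 : R) z (z s *m jac F (c s)).
Proof.
move=> S0 Ssg Hc.
have Hcc := solves_cont Hc Ssg.
have [d d0 H] := tube_lip Hcc.
have cl s : `|clamp S s| <= S by apply: clamp_norm; exact: ltW.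
have [||s y z|w cw s0|z [z0 dz]] := @picard R n (fun s y => y *m jac F (c (clamp S s))) d^-1 S x'.
- by [].
- by rewrite invr_ge0 ltW.
- by rewrite -mulmxBl; apply: (H _ (cl s)).2.
- have -> : (fun s => w s *m jac F (c (clamp S s))) =
     (fun s => \sum_i w s 0 i *: 'D_(e_ i) F (c (clamp S s))).
    by apply/funext => s; rewrite jac_vec.
  apply: continuous_sum => i.
  have [cc Oc] := Hcc _ (cl s0).
  have c1 : {for s0, continuous (fun s => c (clamp S s))}.
    by apply: (@continuous_comp _ _ _ (clamp S) c); [exact: clamp_continuous|exact: cc].
  have c2 : {for s0, continuous (fun s => 'D_(e_ i) F (c (clamp S s)))}.
    by apply: (@continuous_comp _ _ _ _ ('D_(e_ i) F) _ c1); exact: (CF.2 i).2.1.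
  have c3 : {for s0, continuous (fun s => w s 0 i)}.
    apply: (@continuous_comp _ _ _ w (fun M : 'rV[R]_n => M 0 i)); first exact: cw.
    exact: coord_continuous.
  exact: (continuousZ c3 c2).
exists z; split; first exact: z0.
move=> s sS; have := dz s sS; by rewrite (clamp_id (ltW sS)).
Qed.

(** The error [u (h + t0) s - u t0 s - h *: z s] satisfies the linearised equation up to a term
    [o(h)], uniform in [s] by [tube_strict]. Gronwall makes the error itself [o(h)]. *)
Lemma dep_deriv (sg S t0 : R) (u : R -> R -> 'rV[R]_n) (x' : 'rV[R]_n) (z : R -> 'rV[R]_n) :
  0 <= S -> S < sg -> (\forall t \near t0, solves sg (u t)) ->
  is_derive t0 (1 : R) (u ^~ 0) x' -> z 0 = x' ->
  (forall s, `|s| <= S -> is_derive s (1 : R) z (z s *m jac F (u t0 s))) ->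
  forall s, `|s| <= S -> is_derive t0 (1 : R) (u ^~ s) (z s).
Proof.
move=> S0 Ssg Hu dx z0 dz s sS.
have Hc := nbhs_singleton Hu.
have Hcc := solves_cont Hc Ssg.
have [d d0 Hlip] := tube_lip Hcc.
have [C [r [C0 r0 Hdep]]] := dep_lip S0 Ssg Hc.
have L0 : 0 <= d^-1 by rewrite invr_ge0 ltW.
pose E := expR ((d^-1 + 1) * S); have E0 : 0 < E by exact: expR_gt0.
apply/is_derive_epsP => e e0.
(* [B * |h|] bounds the distance of the two solutions. The [+ 1] gives [1 <= B], so that [ep * B]
   also covers the initial error; in [ep] below, [E] compensates the Gronwall factor. *)
pose B := C * (`|x'| + 1) + 1.
have x1 : 0 < `|x'| + 1 by rewrite ltr_wpDl.
have B0 : 0 < B by rewrite /B ltr_wpDl // mulr_ge0 ?ltW.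
pose ep := e / (B * E).
have ep0 : 0 < ep by rewrite divr_gt0 // mulr_gt0.
have [d1 d10 Hst] := tube_strict ep0 Hcc.
have [h1 h10 Hh1] := (is_derive_epsP _ _ _ _).1 dx ep ep0.
have [h2 h20 Hh2] := (is_derive_epsP _ _ _ _).1 dx 1 ltr01.
have [h3 h30 Hh3] := (nbhs_norm_ltP _ _).1 Hu.
pose h4 := Num.min r (d1 / C) / (`|x'| + 1).
have m0 : 0 < Num.min r (d1 / C) by rewrite lt_min r0 divr_gt0.
have h40 : 0 < h4 by rewrite divr_gt0.
exists (Num.min (Num.min h1 h2) (Num.min h3 h4)); first by rewrite !lt_min h10 h20 h30.
move=> h hn0; rewrite !lt_min => /andP[/andP[hh1 hh2] /andP[hh3 hh4]].
have hp : 0 < `|h| by rewrite normr_gt0.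
have E1 : h *: (1 : R) + t0 = h + t0 by rewrite [_ *: 1]mulr1.
have Hv : solves sg (u (h + t0)) by apply: Hh3; rewrite addrK.
have diffq (y : 'rV[R]_n) (l : 'rV[R]_n) (b : R) : `|h^-1 *: y - l| <= b -> `|y - h *: l| <= b * `|h|.
  move=> H; have -> : y - h *: l = h *: (h^-1 *: y - l) by rewrite scalerBr scalerA mulfV // scale1r.
  by rewrite normrZ mulrC ler_wpM2r.
have dx1 : `|u (h + t0) 0 - u t0 0 - h *: x'| <= ep * `|h|.
  by apply: diffq; have := Hh1 h hn0 hh1; rewrite E1.
have dx2 : `|u (h + t0) 0 - u t0 0| <= (`|x'| + 1) * `|h|.
  have := Hh2 h hn0 hh2; rewrite E1 => /diffq k1.
  apply: (le_trans (norm_le_subD _ (h *: x'))); apply: (le_trans (lerD k1 (lexx _))).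
  by rewrite normrZ -[`|h| * _]mulrC -mulrDl addrC.
have small : `|u (h + t0) 0 - u t0 0| < Num.min r (d1 / C).
  by apply: (le_lt_trans dx2); move: hh4; rewrite /h4 ltr_pdivlMr // mulrC.
have smr : `|u (h + t0) 0 - u t0 0| < r by move: small; rewrite lt_min => /andP[].
have smd : C * `|u (h + t0) 0 - u t0 0| < d1.
  by move: small; rewrite lt_min => /andP[_]; rewrite ltr_pdivlMr // mulrC.
have Hdp := Hdep _ Hv smr.
have uh q : `|q| <= S -> `|u (h + t0) q - u t0 q| <= C * (`|x'| + 1) * `|h|.
  by move=> qS; apply: (le_trans (Hdp q qS)); rewrite -mulrA ler_wpM2l // ltW.
have -> : h^-1 *: (u (h *: 1 + t0) s - u t0 s) - z s =
    h^-1 *: (u (h + t0) s - u t0 s - h *: z s).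
  by rewrite E1 [in RHS]scalerBr scalerA mulVf // scale1r.
rewrite normrZ normfV ler_pdivrMl //.
have -> : `|h| * e = ep * B * `|h| * E.
  by rewrite /ep; field; rewrite !gt_eqF.
(* The differential inequality holds for errors of any size, so every radius above the Gronwall
   bound will do; [+ 1] makes the comparison strict. *)
apply: (@gronwall R n (fun s => u (h + t0) s - u t0 s - h *: z s)
   (fun s => F (u (h + t0) s) - F (u t0 s) - h *: (z s *m jac F (u t0 s))) S d^-1 (ep * B * `|h|)
   (ep * B * `|h|) (ep * B * `|h| * E + 1)) => //.
- move=> q qS; have qsg := le_lt_trans qS Ssg.
  apply: (@is_deriveB _ _ _ (fun s => u (h + t0) s - u t0 s) (fun s => h *: z s)).
    by apply: (@is_deriveB _ _ _ (u (h + t0)) (u t0)); [have [] := Hv q qsg|have [] := Hc q qsg].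
  by apply: (@is_deriveZ _ _ _ z h); exact: dz.
- rewrite z0; apply: (le_trans dx1); rewrite ler_wpM2r // ler_peMr //; first exact: ltW.
  by rewrite /B lerDr mulr_ge0 // ?ltW.
- by rewrite ltrDl.
- move=> q qS _.
  have zd : `|u (h + t0) q - u t0 q| < d1 by exact: le_lt_trans (Hdp q qS) smd.
  have cd : `|u t0 q - u t0 q| < d1 by rewrite subrr normr0.
  have k1 := Hst q qS _ _ zd cd.
  have k2 := (Hlip q qS).2 (u (h + t0) q - u t0 q - h *: z q).
  have -> : F (u (h + t0) q) - F (u t0 q) - h *: (z q *m jac F (u t0 q)) =
     (F (u (h + t0) q) - F (u t0 q) - (u (h + t0) q - u t0 q) *m jac F (u t0 q)) +
     (u (h + t0) q - u t0 q - h *: z q) *m jac F (u t0 q).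
    by rewrite !mulmxBl -scalemxAl addrA subrK.
  apply: (le_trans (ler_normD _ _)); rewrite addrC lerD //.
  apply: (le_trans k1); rewrite -mulrA ler_pM2l //.
  apply: (le_trans (uh q qS)); rewrite ler_wpM2r // /B lerDl.
  exact: ler01.
Qed.

End AlongCurve.
End SmoothDependence.

(** * Smooth dependence on parameters and local existence *)

Section OdeSmooth.
Context {R : realType}.
Local Notation e_ i := (delta_mx 0 i).

Definition uncurry2 (W : Type) (f : R -> R -> W) (q : 'rV[R]_2) : W := f (q 0 0) (q 0 1).

Definition strip (T : set R) (sg : R) : set 'rV[R]_2 :=
  [set q | T (q 0 0) /\ `|q 0 1| < sg].

Lemma strip_open (T : set R) sg : open T -> open (strip T sg).
Proof.
move=> oT.
have c0 (q : 'rV[R]_2) : {for q, continuous (fun q : 'rV[R]_2 => q 0 0)}.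
  exact: coord_continuous.
have c1 (q : 'rV[R]_2) : {for q, continuous (fun q : 'rV[R]_2 => q 0 1)}.
  exact: coord_continuous.
rewrite openE => q [Tq qs].
have h0 := c0 q _ (open_nbhs_nbhs (conj oT Tq)).
have h1 := c1 q _ (open_interval_near qs).
exact: (@near_and _ q (fun q => T (q 0 0)) (fun q => `|q 0 1| < sg) h0 h1).
Qed.

Lemma partial0 (W : normedModType R) (f : R -> R -> W) (q : 'rV[R]_2) l :
  is_derive (q 0 0) (1 : R) (f ^~ (q 0 1)) l -> is_derive q (e_ 0) (uncurry2 f) l.
Proof.
move=> /is_derive_epsP H; apply/is_derive_epsP => e /H[d d0 Hd].
exists d => // h h0 hd; have := Hd h h0 hd.
by rewrite /uncurry2 !mxE /= mulr1 mulr0 add0r [_ *: 1]mulr1.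
Qed.

Lemma partial1 (W : normedModType R) (f : R -> R -> W) (q : 'rV[R]_2) l :
  is_derive (q 0 1) (1 : R) (f (q 0 0)) l -> is_derive q (e_ 1) (uncurry2 f) l.
Proof.
move=> /is_derive_epsP H; apply/is_derive_epsP => e /H[d d0 Hd].
exists d => // h h0 hd; have := Hd h h0 hd.
by rewrite /uncurry2 !mxE /= mulr1 mulr0 add0r [_ *: 1]mulr1.
Qed.

Lemma ord2P (i : 'I_2) : i = 0 \/ i = 1.
Proof.
by case: i => -[|[|//]] i2; [left|right]; apply/val_inj.
Qed.

Lemma Ck_on_2 (W : normedModType R) k (U : set 'rV[R]_2) (f f0 f1 : 'rV[R]_2 -> W) :
  open U -> (forall q, U q -> {for q, continuous f}) ->
  (forall q, U q -> is_derive q (e_ 0) f (f0 q)) ->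
  (forall q, U q -> is_derive q (e_ 1) f (f1 q)) ->
  Ck_on k U f0 -> Ck_on k U f1 -> Ck_on k.+1 U f.
Proof.
move=> oU cf d0 d1 C0 C1.
apply: (@Ck_onS _ _ _ _ _ _ (fun i => if i == 0 then f0 else f1)) => //.
  by move=> i q Uq; case: (ord2P i) => ->; [exact: d0|exact: d1].
by move=> i; case: (ord2P i) => ->.
Qed.

Lemma Ck_on_row_mx n p q k (U : set 'rV[R]_n) (f : 'rV[R]_n -> 'rV[R]_p) (g : 'rV[R]_n -> 'rV[R]_q) :
  open U -> Ck_on k U f -> Ck_on k U g -> Ck_on k U (fun x => row_mx (f x) (g x)).
Proof.
move=> oU Cf Cg; apply: Ck_on_rV => // j.
rewrite -(splitK j); case: (fintype.split j) => i /=.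
  apply: (@Ck_on_ext _ _ R _ _ (fun x => f x 0 i)) => //; last exact: Ck_on_coord.
  by move=> x _; rewrite row_mxEl.
apply: (@Ck_on_ext _ _ R _ _ (fun x => g x 0 i)) => //; last exact: Ck_on_coord.
by move=> x _; rewrite row_mxEr.
Qed.

Lemma Ck_on_lsubmx n p q k (U : set 'rV[R]_n) (f : 'rV[R]_n -> 'rV[R]_(p + q)) :
  open U -> Ck_on k U f -> Ck_on k U (fun x => lsubmx (f x)).
Proof.
move=> oU Cf; apply: Ck_on_rV => // j.
apply: (@Ck_on_ext _ _ R _ _ (fun x => f x 0 (lshift q j))) => //; last exact: Ck_on_coord.
by move=> x _; rewrite mxE.
Qed.

Lemma Ck_on_rsubmx n p q k (U : set 'rV[R]_n) (f : 'rV[R]_n -> 'rV[R]_(p + q)) :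
  open U -> Ck_on k U f -> Ck_on k U (fun x => rsubmx (f x)).
Proof.
move=> oU Cf; apply: Ck_on_rV => // j.
apply: (@Ck_on_ext _ _ R _ _ (fun x => f x 0 (rshift p j))) => //; last exact: Ck_on_coord.
by move=> x _; rewrite mxE.
Qed.

Definition smooth_on_line (W : normedModType R) (T : set R) (x : R -> W) :=
  forall k t, T t -> derivable (derive1n k x) t 1.

Lemma smooth_on_line_is_derive (W : normedModType R) (T : set R) (x : R -> W) k (t : R) :
  smooth_on_line T x -> T t -> is_derive t (1 : R) (derive1n k x) (derive1n k.+1 x t).
Proof. by move=> sx Tt; apply: DeriveDef; [exact: sx|rewrite derive1nS derive1E]. Qed.

Lemma smooth_on_line_derive1 (W : normedModType R) (T : set R) (x : R -> W) :
  smooth_on_line T x -> smooth_on_line T (derive1 x).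
Proof. by move=> sx k t Tt; rewrite -derive1Sn; exact: sx. Qed.

Lemma near_eq_derive1n (W : normedModType R) (f g : R -> W) k (t : R) :
  (\forall s \near t, f s = g s) -> \forall s \near t, derive1n k f s = derive1n k g s.
Proof.
elim: k => [//|k IH] /IH fg; rewrite !derive1nS.
have := near_join fg; apply: filterS => s H; rewrite !derive1E; exact: near_eq_derive.
Qed.

Lemma smooth_on_line_ext (W : normedModType R) (T : set R) (f g : R -> W) :
  open T -> (forall t, T t -> f t = g t) -> smooth_on_line T f -> smooth_on_line T g.
Proof.
move=> oT fg sf k t Tt; apply: near_eq_derivable (sf k t Tt).
apply: near_eq_derive1n; apply: filterS (open_nbhs_nbhs (conj oT Tt)); exact: fg.
Qed.

Lemma smooth_on_line_rV m (T : set R) (f : R -> 'rV[R]_m) : open T ->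
  (forall j, smooth_on_line T (fun t => f t 0 j)) -> smooth_on_line T f.
Proof.
move=> oT H.
have E k t : T t -> derive1n k f t = \row_j derive1n k (fun t => f t 0 j) t /\
    derivable (derive1n k f) t 1.
  elim: k t => [|k IH] t Tt.
    split; first by apply/rowP => j; rewrite mxE.
    by apply/derivable_mxP => i j; rewrite ord1; exact: (H j 0%N).
  have [_ d] := IH t Tt.
  have N s : T s -> \forall r \near s, derive1n k f r = \row_j derive1n k (fun t => f t 0 j) r.
    by move=> Ts; apply: filterS (open_nbhs_nbhs (conj oT Ts)) => r /IH[].
  have E s : T s -> derive1n k.+1 f s = \row_j derive1n k.+1 (fun t => f t 0 j) s.
    move=> Ts; have [_ ds] := IH s Ts; rewrite derive1nS derive1E (derive_mx ds).
    apply/rowP => j; rewrite !mxE derive1nS derive1E; apply: near_eq_derive.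
    by apply: filterS (N s Ts) => r ->; rewrite mxE.
  split; first exact: E.
  have NE : \forall s \near t, (\row_j derive1n k.+1 (fun t => f t 0 j) s) = derive1n k.+1 f s.
    by apply: filterS (open_nbhs_nbhs (conj oT Tt)) => s /E.
  apply: near_eq_derivable NE _; apply/derivable_mxP => i j; rewrite ord1.
  have -> : (fun s => (\row_j derive1n k.+1 (fun t => f t 0 j) s) 0 j) = derive1n k.+1 (fun t => f t 0 j).
    by apply/funext => s; rewrite mxE.
  exact: H.
by move=> k t /(E k)[].
Qed.

Lemma smooth_on_line_coord m (T : set R) (f : R -> 'rV[R]_m) j : open T ->
  smooth_on_line T f -> smooth_on_line T (fun t => f t 0 j).
Proof.
move=> oT sf.
have E k : forall t, T t -> derive1n k (fun t => f t 0 j) t = derive1n k f t 0 j.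
  elim: k => [//|k IH] t Tt; rewrite !derive1nS !derive1E -derive_coord; last exact: sf.
  by apply: near_eq_derive; apply: filterS (open_nbhs_nbhs (conj oT Tt)); exact: IH.
move=> k t Tt; apply: (@near_eq_derivable _ _ _ (fun s => derive1n k f s 0 j)).
  by apply: filterS (open_nbhs_nbhs (conj oT Tt)) => s /E.
exact: (derivable_mxP _ _ _).1 (sf k t Tt) 0 j.
Qed.

Lemma smooth_on_line_row_mx p q (T : set R) (f : R -> 'rV[R]_p) (g : R -> 'rV[R]_q) : open T ->
  smooth_on_line T f -> smooth_on_line T g -> smooth_on_line T (fun t => row_mx (f t) (g t)).
Proof.
move=> oT sf sg; apply: smooth_on_line_rV => // j.
rewrite -(splitK j); case: (fintype.split j) => i /=.
  have -> : (fun t => row_mx (f t) (g t) 0 (lshift q i)) = (fun t => f t 0 i).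
    by apply/funext => t; rewrite row_mxEl.
  exact: smooth_on_line_coord.
have -> : (fun t => row_mx (f t) (g t) 0 (rshift p i)) = (fun t => g t 0 i).
  by apply/funext => t; rewrite row_mxEr.
exact: smooth_on_line_coord.
Qed.

Lemma is_derive_row_mx p q (f : R -> 'rV[R]_p) (g : R -> 'rV[R]_q) s df dg :
  is_derive s (1 : R) f df -> is_derive s (1 : R) g dg ->
  is_derive s (1 : R) (fun t => row_mx (f t) (g t)) (row_mx df dg).
Proof.
move=> Df Dg; apply: is_derive_rV => j.
rewrite -(splitK j); case: (fintype.split j) => i /=.
  have -> : (fun t => row_mx (f t) (g t) 0 (lshift q i)) = (fun t => f t 0 i).
    by apply/funext => t; rewrite row_mxEl.
  by rewrite row_mxEl; exact: is_derive_component.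
have -> : (fun t => row_mx (f t) (g t) 0 (rshift p i)) = (fun t => g t 0 i).
  by apply/funext => t; rewrite row_mxEr.
by rewrite row_mxEr; exact: is_derive_component.
Qed.

Lemma ode_continuous n (Om : set 'rV[R]_n) F (T : set R) sg (u : R -> R -> 'rV[R]_n) q :
  open Om -> Ck_on 1 Om F -> open T ->
  (forall t, T t -> solves Om F sg (u t)) ->
  (forall t, T t -> {for t, continuous (u ^~ 0)}) ->
  strip T sg q -> {for q, continuous (uncurry2 u)}.
Proof.
move=> oOm CF oT Hu cx [Tq qs]; set t := q 0 0 in Tq *; set s := q 0 1 in qs *.
pose S := (`|s| + sg) / 2.
have S0 : 0 <= S by rewrite /S; have := normr_ge0 s; lra.
have sS : `|s| < S by rewrite /S; lra.
have Ssg : S < sg by rewrite /S; lra.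
have [C [r [C0 r0 Hdep]]] := dep_lip oOm CF S0 Ssg (Hu t Tq).
apply/continuous_epsP => e e0.
have e2 : 0 < e / 2 by rewrite divr_gt0.
have [d1 d10 Hd1] := (nbhs_norm_ltP _ _).1 (open_nbhs_nbhs (conj oT Tq)).
have [mn [mn0 min1 min2]] : exists mn, [/\ 0 < mn, mn < r & mn <= e / 2 / C].
  exists (Num.min (r / 2) (e / 2 / C)); rewrite lt_min !divr_gt0 // gt_min ge_min lexx orbT; split=> //.
  by apply/orP; left; lra.
have [d2 d20 Hd2] := (continuous_epsP _ _).1 (cx t Tq) _ mn0.
have cu : {for s, continuous (u t)}.
  by have [_ d] := Hu t Tq s qs; exact: derive_continuous d.
have [d3 d30 Hd3] := (continuous_epsP _ _).1 cu _ e2.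
have [d4 d40 Hd4] := (nbhs_norm_ltP _ _).1 (open_interval_near sS).
exists (Num.min (Num.min d1 d2) (Num.min d3 d4)); first by rewrite !lt_min d10 d20 d30.
move=> q'; rewrite !lt_min => /andP[/andP[q1 q2] /andP[q3 q4]].
have c0 : `|q' 0 0 - t| <= `|q' - q| by have := coord_le_norm (q' - q) 0; rewrite !mxE.
have c1 : `|q' 0 1 - s| <= `|q' - q| by have := coord_le_norm (q' - q) 1; rewrite !mxE.
have Tq' := Hd1 _ (le_lt_trans c0 q1).
have sq' := Hd4 _ (le_lt_trans c1 q4).
have k2 := Hd2 _ (le_lt_trans c0 q2).
have k3 := Hd3 _ (le_lt_trans c1 q3).
have kr : `|u (q' 0 0) 0 - u t 0| < r by exact: (le_lt_trans k2).
have k4 := Hdep _ (Hu _ Tq') kr _ (ltW sq').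
have k5 : C * `|u (q' 0 0) 0 - u t 0| <= e / 2.
  by rewrite mulrC -ler_pdivlMr //; apply: (le_trans k2).
rewrite /uncurry2; apply: (le_trans (ler_distD (u t (q' 0 1)) _ _)).
rewrite [e]splitr lerD //; exact: le_trans k5.
Qed.

(** The pair of [u] and its [t]-derivative [z] solves an autonomous smooth system in twice the
    dimension, so the induction hypothesis gives [C^k] for [z] as well. The [s]-derivative of [u] is
    [F] along [u]. The dimension and [F] change in the induction, hence the generalisation over
    both. *)
Theorem ode_smooth k n (Om : set 'rV[R]_n) F (T : set R) sg (u : R -> R -> 'rV[R]_n) :
  open Om -> smooth_on Om F -> open T ->
  (forall t, T t -> solves Om F sg (u t)) ->
  smooth_on_line T (u ^~ 0) -> Ck_on k (strip T sg) (uncurry2 u).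
Proof.
elim: k n Om F u => [|k IH] n Om F u oOm CF oT Hu sx.
  have cx t : T t -> {for t, continuous (u ^~ 0)}.
    by move=> Tt; exact: derive_continuous (smooth_on_line_is_derive 0 sx Tt).
  split; last by [].
  by move=> q Wq; exact: (ode_continuous oOm (CF 1%N) oT Hu cx Wq).
have oW := @strip_open T sg oT.
pose z t s := 'D_1 (u ^~ s) t.
have dx t : T t -> is_derive t (1 : R) (u ^~ 0) (derive1 (u ^~ 0) t).
  by move=> Tt; exact: (smooth_on_line_is_derive 0 sx Tt).
have key t S : T t -> 0 < S -> S < sg -> exists z' : R -> 'rV[R]_n,
    [/\ z' 0 = derive1 (u ^~ 0) t,
     forall s, `|s| <= S -> is_derive s (1 : R) z' (z' s *m jac F (u t s)) &
     forall s, `|s| <= S -> is_derive t (1 : R) (u ^~ s) (z' s)].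
  move=> Tt S0 Ssg; pose S1 := (S + sg) / 2.
  have S10 : 0 < S1 by rewrite /S1; lra.
  have S1sg : S1 < sg by rewrite /S1; lra.
  have SS1 : S < S1 by rewrite /S1; lra.
  have [z' [z'0 dz']] := variational oOm (CF 1%N) (derive1 (u ^~ 0) t) S10 S1sg (Hu t Tt).
  have dz'' s : `|s| <= S -> is_derive s (1 : R) z' (z' s *m jac F (u t s)).
    by move=> sS; apply: dz'; exact: le_lt_trans SS1.
  exists z'; split=> // s sS.
  apply: (dep_deriv oOm (CF 1%N) (ltW S0) Ssg _ (dx t Tt) z'0 dz'' sS).
  apply: filterS (open_nbhs_nbhs (conj oT Tt)); exact: Hu.
have mid s : `|s| < sg -> exists S, [/\ 0 < S, S < sg & `|s| < S].
  move=> ssg; exists ((`|s| + sg) / 2); have := normr_ge0 s => h; split; lra.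
have du t s : T t -> `|s| < sg -> is_derive t (1 : R) (u ^~ s) (z t s).
  move=> Tt /mid[S [S0 Ssg sS]]; have [z' [_ _ H]] := key t S Tt S0 Ssg.
  by apply: derivableP; case: (H s (ltW sS)).
have dz t s : T t -> `|s| < sg -> is_derive s (1 : R) (z t) (z t s *m jac F (u t s)).
  move=> Tt /mid[S [S0 Ssg sS]]; have [z' [_ dz' H]] := key t S Tt S0 Ssg.
  have E r : `|r| < S -> z' r = z t r.
    by move=> rS; rewrite /z; case: (H r (ltW rS)).
  rewrite -(E s sS); apply: near_eq_is_derive (dz' s (ltW sS)).
  by apply: filterS (open_interval_near sS) => r; exact: E.
have z0 t : T t -> z t 0 = derive1 (u ^~ 0) t.
  by move=> Tt; rewrite /z derive1E.
(* The doubled system: [F] on the first half, the variational equation on the second. *)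
pose Om2 : set 'rV[R]_(n + n) := [set Y | Om (lsubmx Y)].
pose F2 (Y : 'rV[R]_(n + n)) := row_mx (F (lsubmx Y)) (rsubmx Y *m jac F (lsubmx Y)).
have Cl l : Ck_on l setT (fun Y : 'rV[R]_(n + n) => lsubmx Y : 'rV[R]_n).
  by apply: Ck_on_lsubmx; [exact: openT|exact: Ck_on_id].
have oOm2 : open Om2.
  have -> : Om2 = setT `&` (fun Y : 'rV[R]_(n + n) => lsubmx Y : 'rV[R]_n) @^-1` Om by rewrite setTI.
  by apply: (open_preimage openT oOm) => Y _; exact: (Ck_on_cont (Cl 0%N) I).
have ClO l : Ck_on l Om2 (fun Y : 'rV[R]_(n + n) => lsubmx Y : 'rV[R]_n).
  exact: Ck_on_sub (Cl l).
have CF2 : smooth_on Om2 F2.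
  move=> l; apply: Ck_on_row_mx => //.
    exact: (Ck_on_comp_rV oOm2 oOm (fun Y OY => OY) (ClO l) (CF l)).
  apply: (@Ck_on_ext _ _ _ _ _ (fun Y : 'rV[R]_(n + n) =>
     \sum_i (row_mx (0 : 'rV[R]_n) (rsubmx Y) 0 (rshift n i)) *: 'D_(e_ i) F (lsubmx Y))) => //.
    by move=> Y _; rewrite jac_vec; apply: eq_bigr => i _; rewrite row_mxEr.
  apply: Ck_on_rV => // j.
  apply: (@Ck_on_ext _ _ R _ _ (fun Y : 'rV[R]_(n + n) =>
     \sum_i Y 0 (rshift n i) * 'D_(e_ i) F (lsubmx Y) 0 j)) => //.
    by move=> Y _; rewrite summxE; apply: eq_bigr => i _; rewrite row_mxEr !mxE.
  apply: Ck_on_sum => // i _; apply: Ck_on_M => //; first exact: Ck_on_proj.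
  have CD : Ck_on l Om (fun x => 'D_(e_ i) F x 0 j).
    by apply: Ck_on_coord => //; exact: ((CF l.+1).2 i).2.
  exact: (Ck_on_comp oOm2 oOm (fun Y OY => OY) (ClO l) CD).
pose u2 t s := row_mx (u t s) (z t s).
have Hu2 t : T t -> solves Om2 F2 sg (u2 t).
  move=> Tt s ssg; have [Ou du'] := Hu t Tt s ssg.
  rewrite /Om2 /F2 /= /u2 row_mxKl row_mxKr; split; first exact: Ou.
  exact: (is_derive_row_mx du' (dz t s Tt ssg)).
have sx2 : smooth_on_line T (u2 ^~ 0).
  have E t : T t -> row_mx (u t 0) (derive1 (u ^~ 0) t) = u2 t 0.
    by move=> Tt; rewrite /u2 (z0 t Tt).
  apply: (smooth_on_line_ext oT E).
  exact: (smooth_on_line_row_mx oT sx (smooth_on_line_derive1 sx)).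
have C2 := IH _ _ _ _ oOm2 CF2 oT Hu2 sx2.
have Cu : Ck_on k (strip T sg) (uncurry2 u).
  apply: (@Ck_on_ext _ _ _ _ _ (fun q => lsubmx (uncurry2 u2 q)) _ oW).
    by move=> q _; rewrite /uncurry2 /u2 row_mxKl.
  exact: (Ck_on_lsubmx oW C2).
have Cz : Ck_on k (strip T sg) (uncurry2 z).
  apply: (@Ck_on_ext _ _ _ _ _ (fun q => rsubmx (uncurry2 u2 q)) _ oW).
    by move=> q _; rewrite /uncurry2 /u2 row_mxKr.
  exact: (Ck_on_rsubmx oW C2).
apply: (@Ck_on_2 _ _ _ _ (uncurry2 z) (fun q => F (uncurry2 u q)) oW _ _ _ Cz).
- by move=> q Wq; exact: (Ck_on_cont Cu Wq).
- by move=> q [Tq qs]; apply: partial0; exact: du.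
- by move=> q [Tq qs]; apply: partial1; exact: (Hu _ Tq _ qs).2.
apply: (Ck_on_comp_rV oW oOm _ Cu (CF k)).
by move=> q [Tq qs]; exact: (Hu _ Tq _ qs).1.
Qed.

(** The field is composed with a retraction onto a box around [y0], which makes it globally
    Lipschitz; for short times the solution does not reach the boundary of the box, so it solves the
    original equation. *)
Theorem ode_exists n (Om : set 'rV[R]_n) F y0 : open Om -> Ck_on 1 Om F -> Om y0 ->
  exists r S : R, [/\ 0 < r, 0 < S & forall x, `|x - y0| < r ->
    exists u : R -> 'rV[R]_n, u 0 = x /\ solves Om F S u].
Proof.
move=> oOm CF Oy.
have [d d0 Hd] := C1_strict_rV oOm CF Oy ltr01.
have [d1 d10 Hd1] := (nbhs_norm_ltP _ _).1 (open_nbhs_nbhs (conj oOm Oy)).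
have [C C0 HC] := norm_mulmx_bound (jac F y0).
pose rho := Num.min d d1 / 2.
have m0 : 0 < Num.min d d1 by rewrite lt_min d0.
have rho0 : 0 < rho by rewrite divr_gt0.
have rhod : rho < d by apply: (@lt_le_trans _ _ (Num.min d d1)); [rewrite /rho; lra|rewrite ge_min lexx].
have rhod1 : rho < d1 by apply: (@lt_le_trans _ _ (Num.min d d1)); [rewrite /rho; lra|rewrite ge_min lexx orbT].
have lipF z z' : `|z - y0| <= rho -> `|z' - y0| <= rho -> `|F z - F z'| <= (C + 1) * `|z - z'|.
  move=> zr z'r; apply: (le_trans (norm_le_subD _ ((z - z') *m jac F y0))).
  have h1 := Hd z z' (le_lt_trans zr rhod) (le_lt_trans z'r rhod).
  by apply: (le_trans (lerD h1 (HC _))); rewrite -mulrDl addrC.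
pose pi (y : 'rV[R]_n) : 'rV[R]_n := y0 + \row_j clamp rho (y 0 j - y0 0 j).
have pi_norm y : `|pi y - y0| <= rho.
  rewrite /pi addrAC subrr add0r; apply: norm_rV_le => [|j]; first exact: ltW.
  by rewrite mxE clamp_norm // ltW.
have pi_id y : `|y - y0| <= rho -> pi y = y.
  move=> yr; apply/rowP => j; rewrite !mxE clamp_id; first by rewrite addrC subrK.
  by apply: le_trans yr; apply: le_trans (coord_le_norm _ j); rewrite !mxE.
have pi_lip y z : `|pi y - pi z| <= `|y - z|.
  apply: norm_rV_le => // j; rewrite !mxE.
  have -> : y0 0 j + clamp rho (y 0 j - y0 0 j) - (y0 0 j + clamp rho (z 0 j - y0 0 j)) =
     clamp rho (y 0 j - y0 0 j) - clamp rho (z 0 j - y0 0 j) by ring.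
  apply: (le_trans (clamp_lip _ _ _)); apply: le_trans (coord_le_norm _ j); rewrite !mxE.
  by have -> : y 0 j - y0 0 j - (z 0 j - y0 0 j) = y 0 j - z 0 j by ring.
pose M := `|F y0| + (C + 1) * rho.
have M0 : 0 <= M by rewrite addr_ge0 // mulr_ge0 // ?addr_ge0 ?ltW.
have FM y : `|F (pi y)| <= M.
  have y0r : `|y0 - y0| <= rho by rewrite subrr normr0 ltW.
  apply: (le_trans (norm_le_subD _ (F y0))); rewrite addrC lerD //.
  apply: (le_trans (lipF _ _ (pi_norm y) y0r)).
  by rewrite ler_wpM2l // addr_ge0 // ltW.
have C1 : 0 < C + 1 by rewrite addr_gt0.
(* The start is within [rho / 2] of [y0], and at speed at most [M] the solution moves by less than
   [rho / 2] in this time; [M + 1] avoids a zero denominator. *)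
exists (rho / 2), (Num.min 1 (rho / (2 * (M + 1)))).
have MM : 0 < 2 * (M + 1) by rewrite mulr_gt0 // ltr_wpDl.
split; first by rewrite divr_gt0.
  by rewrite lt_min ltr01 divr_gt0.
move=> x xr.
have [||s y z|w cw s|u [u0 du]] := @picard R n (fun _ y => F (pi y)) (C + 1) 1 x.
- by [].
- exact: ltW.
- apply: (le_trans (lipF _ _ (pi_norm y) (pi_norm z))); rewrite ler_pM2l //.
- have L : {for w s, continuous (fun y => F (pi y))}.
    apply: (@lipschitz_continuous _ _ _ _ _ (C + 1)) => // y.
    by apply: (le_trans (lipF _ _ (pi_norm y) (pi_norm _))); rewrite ler_pM2l.
  by apply: (@continuous_comp _ _ _ w (fun y => F (pi y))); [exact: cw|exact: L].
exists u; split=> // s; rewrite lt_min => /andP[s1]; rewrite ltr_pdivlMr // => s2.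
have us : `|u s - x| <= M * `|s|.
  apply: norm_rV_le => [|j]; first by rewrite mulr_ge0.
  have in1 th : 0 <= th <= 1 -> `|0 + th * s| < 1.
    move=> /andP[t0 t1]; rewrite add0r normrM ger0_norm //.
    by apply: le_lt_trans s1; rewrite ler_piMl.
  have [|th thI] := @mvt_increment R (fun r => u r 0 j) (fun r => F (pi (u r)) 0 j) 0 s.
    by move=> th /in1 I; apply: is_derive_component; exact: du.
  rewrite add0r u0 => E; rewrite !mxE E normrM mulrC ler_wpM2r //.
  exact: le_trans (coord_le_norm _ _) (FM _).
have ur : `|u s - y0| < rho.
  apply: (le_lt_trans (ler_distD x _ _)).
  have : `|u s - x| < rho / 2.
    apply: (le_lt_trans us); apply: (@le_lt_trans _ _ ((M + 1) * `|s|)).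
      by rewrite ler_wpM2r // lerDl.
    by rewrite ltr_pdivlMr //; have -> : (M + 1) * `|s| * 2 = `|s| * (2 * (M + 1)) by ring.
  by move: xr; move: `|u s - x| `|x - y0|; clear => a b; lra.
split; first by apply: Hd1; exact: lt_trans rhod1.
by have := du s s1; rewrite (pi_id _ (ltW ur)).
Qed.

Lemma ode_local_unique n (Om : set 'rV[R]_n) F sg (u v : R -> 'rV[R]_n) : 0 < sg ->
  open Om -> Ck_on 1 Om F -> solves Om F sg u -> solves Om F sg v -> u 0 = v 0 ->
  forall s, `|s| < sg -> u s = v s.
Proof.
move=> sg0 oOm CF Hu Hv uv s ssg.
have [C [r [C0 r0 H]]] := dep_lip oOm CF (normr_ge0 s) ssg Hv.
have := H u Hu; rewrite uv subrr normr0 mulr0 => /(_ r0 s (lexx _)).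
by rewrite normr_le0 subr_eq0 => /eqP.
Qed.

End OdeSmooth.

(** * Even functions *)

Section Series.
Context {R : realType}.
Local Notation e_ i := (delta_mx 0 i).

Fixpoint deriv_bounded n k (U : set 'rV[R]_n) (M : R) (f : 'rV[R]_n -> R) : Prop :=
  (forall x, U x -> `|f x| <= M) /\
  if k is k'.+1 then forall i, deriv_bounded k' U M ('D_(e_ i) f) else True.

Lemma deriv_bounded_ext n k (U : set 'rV[R]_n) M f g : open U ->
  (forall x, U x -> f x = g x) -> deriv_bounded k U M f -> deriv_bounded k U M g.
Proof.
move=> oU; elim: k f g => [|k IH] f g fg [bf df].
  by split=> // x Ux; rewrite -fg //; exact: bf.
split; first by move=> x Ux; rewrite -fg //; exact: bf.
move=> i; apply: IH (df i) => x Ux; apply: near_eq_derive.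
by apply: filterS (near_open oU Ux) => y; exact: fg.
Qed.

Lemma deriv_boundedW n k l (U : set 'rV[R]_n) M f : (l <= k)%N ->
  deriv_bounded k U M f -> deriv_bounded l U M f.
Proof.
elim: l k f => [|l IH] [|k] f //= lk [bf df]; split=> // i.
by apply: IH (df i).
Qed.

Definition series_sum n (T : nat -> 'rV[R]_n -> R) (x : 'rV[R]_n) : R :=
  lim ((fun m => \sum_(j < m) T j x) @ \oo).

Lemma series_sum_tail n (T : nat -> 'rV[R]_n -> R) x (N : nat) (c : R) :
  (forall j, (N <= j)%N -> `|T j x| <= c * 2^-1 ^+ j) ->
  forall m, (N <= m)%N -> `|series_sum T x - \sum_(j < m) T j x| <= 2 * c * 2^-1 ^+ m.
Proof.
move=> HT.
have [k|l Hl] := @geometric_limit R (fun m => \sum_(j < N + m) T j x) (c * 2^-1 ^+ N).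
  rewrite addnS big_ord_recr /= [X in `|X - _|]addrC addrK.
  by rewrite -mulrA -exprD; apply: HT; rewrite leq_addr.
have {}Hl m : (N <= m)%N -> `|\sum_(j < m) T j x - l| <= 2 * c * 2^-1 ^+ m.
  move=> Nm; have := Hl (m - N)%N; rewrite subnKC // => h.
  have -> : 2 * c * 2^-1 ^+ m = 2 * (c * 2^-1 ^+ N) * 2^-1 ^+ (m - N).
    by rewrite -[in LHS](subnKC Nm) exprD; ring.
  exact: h.
have C : (fun m => \sum_(j < m) T j x) @ \oo --> l.
  apply/cvgrPdist_le => e e0; have [N' HN'] := geometric_eventually (2 * c) e0.
  exists (maxn N N') => // m /=; rewrite geq_max => /andP[Nm N'm].
  by rewrite distrC; apply: le_trans (Hl m Nm) (HN' m N'm).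
move=> m Nm; rewrite /series_sum (cvg_lim _ C) // distrC; exact: Hl.
Qed.

(** Weierstrass test for all partials up to order [k]. The bounds are asked from index [N] on, so
    [N] may depend on [k] when smoothness is derived. *)
Lemma series_Ck n k (U : set 'rV[R]_n) (T : nat -> 'rV[R]_n -> R) (N : nat) : open U ->
  (forall j, Ck_on k U (T j)) ->
  (forall j, (N <= j)%N -> deriv_bounded k U (2^-1 ^+ j) (T j)) ->
  Ck_on k U (series_sum T).
Proof.
move=> oU; elim: k T => [|k IH] T CT bT.
  have bT0 x j : U x -> (N <= j)%N -> `|T j x| <= 1 * 2^-1 ^+ j.
    by move=> Ux Nj; rewrite mul1r; exact: (bT j Nj).1.
  split=> // x Ux; apply/continuous_epsP => e e0.
  have e3 : 0 < e / 3 by rewrite divr_gt0.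
  have [N' HN'] := geometric_eventually (2 * 1) e3.
  pose m := maxn N N'.
  have tail y : U y -> `|series_sum T y - \sum_(j < m) T j y| <= e / 3.
    move=> Uy; apply: le_trans (HN' m (leq_maxr _ _)).
    by apply: (series_sum_tail (fun j => @bT0 y j Uy)); rewrite leq_maxl.
  have Cm : Ck_on 0 U (fun y => \sum_(j < m) T j y).
    by apply: Ck_on_sum => // j _; exact: CT.
  have [d d0 Hd] := (continuous_epsP _ _).1 (Cm.1 x Ux) _ e3.
  have [d1 d10 Hd1] := (nbhs_norm_ltP _ _).1 (open_nbhs_nbhs (conj oU Ux)).
  exists (Num.min d d1); first by rewrite lt_min d0.
  move=> y; rewrite lt_min => /andP[yd yd1].
  have h1 := Hd y yd; have h2 := tail x Ux; have h3 := tail y (Hd1 y yd1).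
  move: h1 h2 h3.
  move: (series_sum T y) (series_sum T x) (\sum_(j < m) T j y) (\sum_(j < m) T j x) => a b c d'.
  by rewrite !ler_norml => /andP[? ?] /andP[? ?] /andP[? ?]; apply/andP; split; lra.
have C0 : Ck_on 0 U (series_sum T).
  have [CT0 bT0] : (forall j, Ck_on 0 U (T j)) /\
      (forall j, (N <= j)%N -> deriv_bounded 0 U (2^-1 ^+ j) (T j)).
    split=> j; first exact: Ck_on_le (CT j).
    by move=> Nj; exact: deriv_boundedW (bT j Nj).
  have Ck0 : Ck_on k U (series_sum T).
    apply: IH => j; first exact: Ck_onW.
    by move=> Nj; exact: deriv_boundedW (bT j Nj).
  exact: Ck_on_le Ck0.
apply: (@Ck_onS _ _ _ _ _ _ (fun i => series_sum (fun j => 'D_(e_ i) (T j)))) => //.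
- exact: C0.1.
- move=> i x Ux.
  have [d d0 Hd] := (nbhs_norm_ltP _ _).1 (open_nbhs_nbhs (conj oU Ux)).
  have in_U h : - d < h < d -> U (h *: e_ i + x).
    rewrite -ltr_norml => hd; apply: Hd; rewrite addrK normrZ.
    by apply: le_lt_trans hd; rewrite ler_piMr // norm_e.
  have bU y j : U y -> (N <= j)%N -> `|T j y| <= 1 * 2^-1 ^+ j.
    by move=> Uy Nj; rewrite mul1r; exact: (bT j Nj).1.
  have bdU y j : U y -> (N <= j)%N -> `|'D_(e_ i) (T j) y| <= 1 * 2^-1 ^+ j.
    by move=> Uy Nj; rewrite mul1r; have [_ /(_ i)] := bT j Nj; case: (k) => [|k'] [+ _]; exact.
  have D0 : is_derive (0 : R) (1 : R) (fun h : R => series_sum T (h *: e_ i + x))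
      (series_sum (fun j => 'D_(e_ i) (T j)) (0 *: e_ i + x)).
    apply: (@uniform_derive R (fun m h => \sum_(j < m) T j (h *: e_ i + x))
      (fun m h => \sum_(j < m) 'D_(e_ i) (T j) (h *: e_ i + x))
      (fun h => series_sum T (h *: e_ i + x))
      (fun h => series_sum (fun j => 'D_(e_ i) (T j)) (h *: e_ i + x)) (- d) d); last first.
    + by rewrite oppr_lt0 d0.
    + move=> e e0; have [N' HN'] := geometric_eventually (2 * 1) e0.
      exists (maxn N N') => m; rewrite geq_max => /andP[Nm N'm] h hd.
      rewrite distrC; apply: le_trans (HN' m N'm).
      exact: (@series_sum_tail _ _ _ N 1 (fun j => @bdU _ j (in_U h hd)) m Nm).
    + move=> h hd; apply/cvgrPdist_le => e e0; have [N' HN'] := geometric_eventually (2 * 1) e0.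
      exists (maxn N N') => // m /=; rewrite geq_max => /andP[Nm N'm].
      apply: le_trans (HN' m N'm).
      exact: (@series_sum_tail _ _ _ N 1 (fun j => @bU _ j (in_U h hd)) m Nm).
    + move=> m h hd; have Uh := in_U h hd.
      have Cm : Ck_on 1 U (fun y => \sum_(j < m) T j y).
        by apply: Ck_on_sum => // j _; exact: Ck_on_le (CT j).
      have dj j : derivable (T j) (h *: e_ i + x) (e_ i) by exact: ((CT j).2 i).1.
      have -> : \sum_(j < m) 'D_(e_ i) (T j) (h *: e_ i + x) =
          'D_(e_ i) (fun y => \sum_(j < m) T j y) (x + h *: e_ i).
        rewrite addrC -derive_sum //; last by move=> j; rewrite addrC.
        by congr ('D_ _ _ _); apply/funext => y; rewrite fct_sumE.
      have -> : (fun h : R => \sum_(j < m) T j (h *: e_ i + x)) =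
          (fun h => (fun y => \sum_(j < m) T j y) (x + h *: e_ i)).
        by apply/funext => h'; rewrite [x + _]addrC.
      apply: (@is_derive_line _ _ _ (fun y => \sum_(j < m) T j y)).
      by rewrite addrC; exact: (Cm.2 i).1.
  rewrite scale0r add0r in D0; case: D0 => D0 E0.
  apply: DeriveDef; first exact: (derivable1P _ _ _).2 D0.
  by rewrite derive_line.
- move=> i; apply: IH => j; first exact: ((CT j).2 i).2.
  by move=> /(bT j)[_]; exact.
Qed.

End Series.

(** * Functions of one variable with bounded derivatives *)

Section BoundedDerivatives.
Context {R : realType}.

(** The derivative is existentially quantified, so that sums and products are plain inductions;
    [bounded_derivs_seq] converts back to iterated derivatives. *)
Fixpoint bounded_derivs k (f : R -> R) : Prop :=
  (exists C, forall x, `|f x| <= C) /\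
  if k is k'.+1 then exists2 f' : R -> R,
    (forall x, is_derive x (1 : R) f (f' x)) & bounded_derivs k' f'
  else True.

Lemma bounded_derivs_bound k f : bounded_derivs k f -> exists C, forall x, `|f x| <= C.
Proof. by case: k => [|k] []. Qed.

Lemma bounded_derivsW k f : bounded_derivs k.+1 f -> bounded_derivs k f.
Proof.
elim: k f => [|k IH] f [bf [f' df bf']]; split=> //.
by exists f' => //; exact: IH.
Qed.

Lemma bounded_derivsD k f g : bounded_derivs k f -> bounded_derivs k g ->
  bounded_derivs k (fun x => f x + g x).
Proof.
elim: k f g => [|k IH] f g [[C HC] Hf] [[D HD] Hg].
  by split=> //; exists (C + D) => x; apply: (le_trans (ler_normD _ _)); exact: lerD.
split; first by exists (C + D) => x; apply: (le_trans (ler_normD _ _)); exact: lerD.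
case: Hf => f' df bf; case: Hg => g' dg bg.
by exists (fun x => f' x + g' x); [move=> x; exact: is_deriveD|exact: IH].
Qed.

Lemma bounded_derivsM k f g : bounded_derivs k f -> bounded_derivs k g ->
  bounded_derivs k (fun x => f x * g x).
Proof.
have B h1 h2 C D : (forall x, `|h1 x| <= C) -> (forall x, `|h2 x| <= D) ->
    exists C, forall x : R, `|h1 x * h2 x| <= C.
  by move=> HC HD; exists (C * D) => x; rewrite normrM ler_pM.
elim: k f g => [|k IH] f g Hf Hg.
  by case: Hf Hg => -[C HC] _ [[D HD] _]; split=> //; exact: B HC HD.
have Hf0 := bounded_derivsW Hf; have Hg0 := bounded_derivsW Hg.
case: Hf Hg => -[C HC] [f' df bf] [[D HD] [g' dg bg]]; split; first exact: B HC HD.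
exists (fun x => f x * g' x + g x * f' x).
  by move=> x; apply: (@is_deriveM _ _ f g).
by apply: bounded_derivsD; apply: IH.
Qed.

(** The four functions form a cycle under differentiation and are treated together. *)
Lemma bounded_derivs_sin k : bounded_derivs k (@sin R) /\ bounded_derivs k (@cos R) /\
  bounded_derivs k (fun x : R => - sin x) /\ bounded_derivs k (fun x : R => - cos x).
Proof.
have bs : exists C : R, forall x : R, `|sin x| <= C.
  by exists 1 => x; rewrite ler_norml sin_geN1 sin_le1.
have bc : exists C : R, forall x : R, `|cos x| <= C.
  by exists 1 => x; rewrite ler_norml cos_geN1 cos_le1.
have bs' : exists C : R, forall x : R, `|- sin x| <= C.
  by case: bs => C H; exists C => x; rewrite normrN.
have bc' : exists C : R, forall x : R, `|- cos x| <= C.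
  by case: bc => C H; exists C => x; rewrite normrN.
elim: k => [|k [s [c [s' c']]]]; first by [].
split; first by split=> //; exists (@cos R) => // x; exact: is_derive_sin.
split; first by split=> //; exists (fun x => - sin x) => // x; exact: is_derive_cos.
split.
  by split=> //; exists (fun x => - cos x) => // x; apply: is_deriveN; exact: is_derive_sin.
split=> //; exists (@sin R) => // x.
by rewrite -[sin x]opprK; apply: is_deriveN; exact: is_derive_cos.
Qed.

Lemma bounded_derivs_sinX k n : bounded_derivs k (fun x : R => sin x ^+ n).
Proof.
elim: n => [|n IH].
  have E : (fun x : R => sin x ^+ 0) = cst 1 by apply/funext => x; rewrite expr0.
  rewrite E; have B0 : forall j, bounded_derivs j (cst (0 : R)).
    elim=> [|j IHj]; split=> //; first by exists 0 => x; rewrite normr0.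
      by exists 0 => x; rewrite normr0.
    by exists (cst 0) => // x; exact: is_derive_cst.
  case: k => [|k]; split=> //; try by exists 1 => x; rewrite normr1.
  by exists (cst 0) => // x; exact: is_derive_cst.
have -> : (fun x : R => sin x ^+ n.+1) = (fun x => sin x * sin x ^+ n).
  by apply/funext => x; rewrite exprS.
by apply: bounded_derivsM => //; have [] := bounded_derivs_sin k.
Qed.

Lemma bounded_derivs_seq (f : R -> R) : (forall k, bounded_derivs k f) ->
  forall j, (forall x : R, is_derive x (1 : R) (derive1n j f) (derive1n j.+1 f x)) /\
    exists C, forall x, `|derive1n j f x| <= C.
Proof.
move=> bf; have H j : forall k, bounded_derivs k (derive1n j f).
  elim: j => [//|j IH] k; have [_ [f' df bf']] := IH k.+1.
  rewrite derive1nS; have -> : derive1 (derive1n j f) = f'; last by [].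
  by apply/funext => x; rewrite derive1E; have [_ ->] := df x.
move=> j; split; last exact: bounded_derivs_bound (H j 0%N).
move=> x; have [_ [f' df _]] := H j 1%N; have [d _] := df x.
by apply: DeriveDef; [exact: d|rewrite derive1nS derive1E].
Qed.

End BoundedDerivatives.

(** * Functions on planar boxes, parity and division by powers *)

Section Boxes.
Context {R : realType}.
Local Notation e_ i := (delta_mx 0 i).

Definition mk2 (a w : R) : 'rV[R]_2 := \row_(i < 2) (if i == 0 then a else w).

Lemma mk20 a w : mk2 a w 0 0 = a. Proof. by rewrite mxE. Qed.
Lemma mk21 a w : mk2 a w 0 1 = w. Proof. by rewrite mxE. Qed.

Lemma mk2_eta (q : 'rV[R]_2) : mk2 (q 0 0) (q 0 1) = q.
Proof. by apply/rowP => i; case: (ord2P i) => ->; rewrite mxE. Qed.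

Lemma rV2_ext (p q : 'rV[R]_2) : p 0 0 = q 0 0 -> p 0 1 = q 0 1 -> p = q.
Proof. by move=> h0 h1; apply/rowP => i; case: (ord2P i) => ->. Qed.

Lemma norm_mk2_sub_lt a w b v d : 0 < d -> `|a - b| < d -> `|w - v| < d ->
  `|mk2 a w - mk2 b v| < d.
Proof.
by move=> d0 h0 h1; apply: norm_rV_lt => // i; case: (ord2P i) => ->; rewrite !mxE.
Qed.

Lemma Ck_on_mk2 n k (U : set 'rV[R]_n) (f g : 'rV[R]_n -> R) : open U ->
  Ck_on k U f -> Ck_on k U g -> Ck_on k U (fun x => mk2 (f x) (g x)).
Proof.
move=> oU Cf Cg; apply: Ck_on_rV => // i; case: (ord2P i) => ->.
  by apply: Ck_on_ext Cf => // x _; rewrite mk20.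
by apply: Ck_on_ext Cg => // x _; rewrite mk21.
Qed.

Definition box (al be : R) : set 'rV[R]_2 := strip [set a : R | `|a| < al] be.

Lemma abs_open (al : R) : open [set a : R | `|a| < al].
Proof. by rewrite openE => a /= /open_interval_near. Qed.

Lemma box_open al be : open (box al be).
Proof. apply: strip_open; exact: abs_open. Qed.

Lemma box_stable al be : scal_stable (1 : 'I_2) (box al be).
Proof.
move=> t x /andP[t0 t1] [x0 x1]; split; rewrite /= scalE /= ?mul1r //.
by rewrite normrM ger0_norm //; apply: le_lt_trans x1; rewrite ler_piMl.
Qed.

Lemma box_mono al be al' be' : al' <= al -> be' <= be -> box al' be' `<=` box al be.
Proof.
by move=> h h' q [q0 q1]; split; [exact: lt_le_trans h|exact: lt_le_trans h'].
Qed.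

Definition refl2 (q : 'rV[R]_2) := mk2 (q 0 0) (- q 0 1).

Lemma box_refl al be q : box al be q -> box al be (refl2 q).
Proof. by move=> [q0 q1]; split; rewrite /refl2 /= ?mk20 ?mk21 ?normrN. Qed.

Lemma Ck_on_refl k al be (f : 'rV[R]_2 -> R) : Ck_on k (box al be) f ->
  Ck_on k (box al be) (fun q => f (refl2 q)).
Proof.
move=> Cf; have ob := @box_open al be.
apply: (Ck_on_comp ob ob (@box_refl al be) _ Cf).
by apply: Ck_on_mk2 => //; [|apply: Ck_on_N => //]; exact: Ck_on_proj.
Qed.

Lemma boundary_vanish (U : set 'rV[R]_2) f N C : open U ->
  (forall q, U q -> {for q, continuous f}) ->
  (forall q, U q -> q 0 1 != 0 -> `|f q| <= C * `|q 0 1| ^+ N.+1) ->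
  forall q, U q -> q 0 1 = 0 -> f q = 0 :> R.
Proof.
move=> oU cf Hf q Uq q1; apply/eqP; rewrite -normr_le0; apply/ler_addgt0Pr => e e0; rewrite add0r.
have e2 : 0 < e / 2 by rewrite divr_gt0.
have [d d0 Hd] := (continuous_epsP _ _).1 (cf q Uq) _ e2.
have [d1 d10 Hd1] := (nbhs_norm_ltP _ _).1 (open_nbhs_nbhs (conj oU Uq)).
have C1 : 0 < `|C| + 1 by rewrite ltr_wpDl.
have [h [h0 hd hd1 h1 hC]] : exists h : R, [/\ 0 < h, h < d, h < d1, h <= 1 & (`|C| + 1) * h <= e / 2].
  pose m := Num.min (Num.min d d1) (Num.min 1 (e / 2 / (`|C| + 1))).
  have m0 : 0 < m by rewrite !lt_min d0 d10 ltr01 divr_gt0.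
  have mh : m / 2 < m by lra.
  exists (m / 2); split; first by rewrite divr_gt0.
  - by apply: (lt_le_trans mh); rewrite !ge_min lexx.
  - by apply: (lt_le_trans mh); rewrite !ge_min lexx orbT.
  - by apply: ltW; apply: (lt_le_trans mh); rewrite !ge_min lexx !orbT.
  - rewrite mulrC -ler_pdivlMr //; apply: ltW; apply: (lt_le_trans mh).
    by rewrite !ge_min lexx !orbT.
pose q' := mk2 (q 0 0) h.
have Eq : mk2 (q 0 0) 0 = q by rewrite -q1 mk2_eta.
have qq (d' : R) : 0 < d' -> h < d' -> `|q' - q| < d'.
  move=> d'0 hd'; rewrite -Eq; apply: norm_mk2_sub_lt => //; first by rewrite subrr normr0.
  by rewrite subr0 gtr0_norm.
have Uq' := Hd1 _ (qq d1 d10 hd1).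
have q'1 : q' 0 1 = h by rewrite mk21.
have hn0 : q' 0 1 != 0 by rewrite q'1 gt_eqF.
have k1 := Hf q' Uq' hn0; have k2 := Hd _ (qq d d0 hd).
apply: (le_trans (norm_le_subD (f q) (f q'))); rewrite distrC (splitr e) lerD //.
apply: (le_trans k1); apply: le_trans hC; rewrite q'1 gtr0_norm //.
have hN0 : h ^+ N <= 1 by apply: exprn_ile1 => //; exact: ltW.
have hN : h ^+ N.+1 <= h by rewrite exprS; apply: ler_piMr => //; exact: ltW.
apply: (@le_trans _ _ ((`|C| + 1) * h ^+ N.+1)).
  by rewrite ler_wpM2r ?exprn_ge0 ?ltW //; apply: (le_lt_trans (ler_norm C)); rewrite ltrDl.
by rewrite ler_pM2l.
Qed.

(** Each Hadamard division uses one power of the bound to see that the function vanishes on the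
    axis, so a bound of order [N + 1] allows [N] divisions. The bound is assumed off the axis
    because it is divided by [|q 0 1|] in the induction. *)
Lemma power_div al be N C (f : 'rV[R]_2 -> R) : smooth_on (box al be) f ->
  (forall q, box al be q -> q 0 1 != 0 -> `|f q| <= C * `|q 0 1| ^+ N.+1) ->
  exists h : 'rV[R]_2 -> R, smooth_on (box al be) h /\
    forall q, box al be q -> f q = q 0 1 ^+ N * h q.
Proof.
elim: N f => [|N IH] f Cf Hf.
  by exists f; split=> // q _; rewrite expr0 mul1r.
have van := boundary_vanish (@box_open al be) (fun q => Ck_on_cont (Cf 0%N)) Hf.
have [f1 [Cf1 Ef1 _]] := hadamard_div (@box_open al be) (@box_stable al be) Cf van.
have [h [Ch Eh]] : exists h : 'rV[R]_2 -> R, smooth_on (box al be) h /\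
    forall q, box al be q -> f1 q = q 0 1 ^+ N * h q.
  apply: IH => // q bq q1; have := Hf q bq q1.
  rewrite (Ef1 q bq) normrM [_ ^+ N.+2]exprS mulrCA ler_pM2l //.
  by rewrite normr_gt0.
by exists h; split=> // q bq; rewrite (Ef1 q bq) (Eh q bq) exprS mulrA.
Qed.

Definition even2 (U : set 'rV[R]_2) (f : 'rV[R]_2 -> R) := forall q, U q -> f (refl2 q) = f q.

(** The first quotient is odd, hence zero on the axis, and can be divided again; the second quotient
    is even. *)
Lemma even_div al be (f : 'rV[R]_2 -> R) : smooth_on (box al be) f -> even2 (box al be) f ->
  (forall q, box al be q -> q 0 1 = 0 -> f q = 0) ->
  exists h : 'rV[R]_2 -> R, [/\ smooth_on (box al be) h, even2 (box al be) h &
    forall q, box al be q -> f q = q 0 1 ^+ 2 * h q].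
Proof.
move=> Cf ef f0; have ob := @box_open al be.
have [h1 [Ch1 E1 _]] := hadamard_div ob (@box_stable al be) Cf f0.
have odd1 q : box al be q -> q 0 1 != 0 -> h1 q + h1 (refl2 q) = 0.
  move=> bq q1; have := E1 _ (box_refl bq); rewrite ef // (E1 q bq) /refl2 mk21.
  by rewrite mulNr => /eqP; rewrite -subr_eq0 opprK -mulrDr mulf_eq0 (negbTE q1) => /eqP.
have h10 q : box al be q -> q 0 1 = 0 -> h1 q = 0.
  move=> bq q1.
  have Cs : Ck_on 0 (box al be) (fun q => h1 q + h1 (refl2 q)).
    by apply: Ck_on_D => //; apply: Ck_on_refl.
  have := @boundary_vanish (box al be) (fun q => h1 q + h1 (refl2 q)) 0 0 ob (fun q => Ck_on_cont Cs) _ q bq q1.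
  have -> : refl2 q = q by rewrite /refl2 q1 oppr0 -[in LHS]q1 mk2_eta.
  move=> H; have {}H : h1 q + h1 q = 0.
    by apply: H => p bp p1; rewrite odd1 // normr0 mul0r.
  lra.
have [h2 [Ch2 E2 _]] := hadamard_div ob (@box_stable al be) Ch1 h10.
exists h2; split=> //.
- move=> q bq; have [q1|q1] := eqVneq (q 0 1) 0.
    by rewrite /refl2 q1 oppr0 -[in LHS]q1 mk2_eta.
  have := ef q bq; rewrite (E1 q bq) (E1 _ (box_refl bq)) (E2 q bq) (E2 _ (box_refl bq)).
  rewrite /refl2 mk21 -/(refl2 q) !mulrA mulrNN => /(mulfI _); apply.
  by rewrite mulf_neq0.
- by move=> q bq; rewrite (E1 q bq) (E2 q bq) mulrA expr2.
Qed.

Lemma smooth_on_line_slice n (W : normedModType R) (U : set 'rV[R]_n) (F : 'rV[R]_n -> W) p i :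
  open U -> smooth_on U F ->
  smooth_on_line [set t : R | U (p + t *: e_ i)] (fun t => F (p + t *: e_ i)).
Proof.
move=> oU CF k; elim: k F CF => [|k IH] F CF t Ut.
  by have [] := is_derive_line (((CF 1%N).2 i).1 _ Ut).
have oT : open [set t : R | U (p + t *: e_ i)].
  have -> : [set t : R | U (p + t *: e_ i)] = setT `&` (fun t : R => p + t *: e_ i) @^-1` U by rewrite setTI.
  apply: (open_preimage openT oU) => s _.
  apply: (@lipschitz_continuous _ _ _ _ _ 1) => // r.
  by rewrite opprD addrACA subrr add0r -scalerBl normrZ mul1r ler_piMr // norm_e.
have CD : smooth_on U ('D_(e_ i) F) by move=> l; exact: ((CF l.+1).2 i).2.
rewrite derive1Sn; apply: near_eq_derivable (IH _ CD t Ut).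
apply: near_eq_derive1n; apply: filterS (open_nbhs_nbhs (conj oT Ut)) => s Us.
by rewrite derive1E; have [_ ->] := is_derive_line (((CF 1%N).2 i).1 _ Us).
Qed.

Lemma bounded_on_segment (f : R -> R) (S : R) :
  (forall s, `|s| <= S -> {for s, continuous f}) ->
  exists2 B, 0 <= B & forall s, `|s| <= S -> `|f s| <= B.
Proof.
move=> cf; have [S0|S0] := leP 0 S; last first.
  by exists 0 => // s /(le_lt_trans)/(_ S0); rewrite ltNge normr_ge0.
have cn : {within `[- S, S], continuous (fun s => `|f s|)}.
  apply: continuous_in_subspaceT => s; rewrite inE /= in_itv /= -ler_norml => sS.
  by apply: (@continuous_comp _ _ _ f (@Num.norm _ _) _ (cf s sS)); exact: norm_continuous.
have SS : - S <= S by lra.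
have [c _ Hc] := EVT_max SS cn.
exists `|f c| => // s sS; apply: Hc; by rewrite in_itv /= -ler_norml.
Qed.

(** The partials of a product with separated variables are again such products, with shifted
    indices. *)
Lemma product_deriv_bounded k (A : set R) be M (bs cs : nat -> R -> R) : open A ->
  (forall i a, A a -> is_derive a (1 : R) (bs i) (bs i.+1 a)) ->
  (forall l y, is_derive y (1 : R) (cs l) (cs l.+1 y)) ->
  (forall i l a y, (i <= k)%N -> (l <= k)%N -> A a -> `|bs i a * cs l y| <= M) ->
  deriv_bounded k (strip A be) M (fun q => bs 0%N (q 0 0) * cs 0%N (q 0 1)).
Proof.
move=> oA db dc bM.
(* The indices already consumed and the order still to come share the budget [k], so every product
   met is covered by [bM]. *)
suff H k' i l : (i + l + k' <= k)%N ->
    deriv_bounded k' (strip A be) M (fun q => bs i (q 0 0) * cs l (q 0 1)) by exact: H.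
have oS := @strip_open _ A be oA.
elim: k' i l => [|k' IH] i l ilk.
  split=> // q [Aq _]; apply: bM => //; apply: leq_trans ilk; rewrite addn0;
   [exact: leq_addr|exact: leq_addl].
split.
  move=> q [Aq _]; apply: bM => //; apply: leq_trans ilk; apply: leq_trans (leq_addr _ _);
   [exact: leq_addr|exact: leq_addl].
move=> j; case: (ord2P j) => ->.
  apply: (@deriv_bounded_ext _ _ _ _ _ (fun q => bs i.+1 (q 0 0) * cs l (q 0 1)) _ oS).
    move=> q [Aq _].
    have D : is_derive (q 0 0) (1 : R) (fun a => bs i a * cs l (q 0 1)) (bs i.+1 (q 0 0) * cs l (q 0 1)).
      have -> : (fun a => bs i a * cs l (q 0 1)) = cs l (q 0 1) *: bs i.
        by apply/funext => a; rewrite mulrC.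
      by rewrite mulrC; apply: is_deriveZ; exact: db.
    by have [_ ->] := partial0 (f := fun a y => bs i a * cs l y) D.
  by apply: IH; rewrite !addSn -addnS.
apply: (@deriv_bounded_ext _ _ _ _ _ (fun q => bs i (q 0 0) * cs l.+1 (q 0 1)) _ oS).
  move=> q [Aq _].
  have D : is_derive (q 0 1) (1 : R) (fun y => bs i (q 0 0) * cs l y) (bs i (q 0 0) * cs l.+1 (q 0 1)).
    exact: (@is_deriveZ _ _ _ (cs l) (bs i (q 0 0))).
  by have [_ ->] := partial1 (f := fun a y => bs i a * cs l y) D.
by apply: IH; rewrite addnS addSn -addnS.
Qed.

End Boxes.

(** * Borel-type terms and the substitution of a square root *)

Section Whitney.
Context {R : realType}.
Local Notation e_ i := (delta_mx 0 i).

Lemma Ck_on_sin n k (U : set 'rV[R]_n) (f : 'rV[R]_n -> R) : open U ->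
  Ck_on k U f -> Ck_on k U (fun x => sin (f x)).
Proof.
move=> oU Cf.
have bs l : bounded_derivs l (@sin R) by have [] := @bounded_derivs_sin R l.
have ds j (y : R) : setT y -> is_derive y (1 : R) (derive1n j (@sin R)) (derive1n j.+1 (@sin R) y).
  by move=> _; exact: (bounded_derivs_seq bs j).1.
exact: (@Ck_on_outer R n k U setT (fun j => derive1n j (@sin R)) f 0 oU ds (fun _ _ => I) Cf).
Qed.

(** [hadamard_div] acts on row vectors, so the sine is regarded as a function on the plane that
    ignores the first coordinate. *)
Lemma sinc_exists : exists S : R -> R, [/\ forall y, sin y = y * S y, S 0 = 1 &
  forall n k (U : set 'rV[R]_n) (f : 'rV[R]_n -> R), open U ->
    Ck_on k U f -> Ck_on k U (fun x => S (f x))].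
Proof.
pose F (q : 'rV[R]_2) : R := sin (q 0 1).
have CF : smooth_on setT F.
  by move=> k; apply: Ck_on_sin; [exact: openT|apply: Ck_on_proj; exact: openT].
have sT : scal_stable (1 : 'I_2) (@setT 'rV[R]_2) by [].
have F0 (q : 'rV[R]_2) : setT q -> q 0 1 = 0 -> F q = 0 by move=> _ q1; rewrite /F q1 sin0.
have [h [Ch E D]] := hadamard_div openT sT CF F0.
exists (fun y => h (mk2 0 y)); split.
- by move=> y; have := E (mk2 0 y) I; rewrite /F mk21.
- rewrite D ?mk21 //.
  have ds : is_derive (mk2 0 0 0 1) (1 : R) (@sin R) 1.
    by rewrite mk21; have := is_derive_sin (0 : R); rewrite cos0.
  by have [_ ->] := @partial1 R R (fun _ y => sin y) (mk2 0 0) 1 ds.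
- move=> n k U f oU Cf; apply: (@Ck_on_comp _ _ _ _ _ setT (fun x => mk2 0 (f x)) h) => //.
  + exact: openT.
  + by apply: Ck_on_mk2 => //; exact: (@Ck_on_cst R n R k U 0).
Qed.

(** The subtracted term is [rho(a, 0) w^(2n) S(lam w^2)^n] with [S(0) = 1], so the difference is
    [w^(2n)] times an even function vanishing on the axis, from which [w^2] splits off. *)
Lemma whitney_step al be n (rho : 'rV[R]_2 -> R) (lam : R) : 0 < lam ->
  smooth_on (box al be) rho -> even2 (box al be) rho ->
  exists rho' : 'rV[R]_2 -> R, [/\ smooth_on (box al be) rho', even2 (box al be) rho' &
    forall q, box al be q ->
      q 0 1 ^+ (2 * n) * rho q - rho (mk2 (q 0 0) 0) * (lam^-1 ^+ n * sin (lam * q 0 1 ^+ 2) ^+ n) =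
      q 0 1 ^+ (2 * n.+1) * rho' q].
Proof.
move=> lam0 Cr er; have [S [sinE S0 CS]] := sinc_exists.
have ob := @box_open R al be.
pose f q := rho q - rho (mk2 (q 0 0) 0) * S (lam * q 0 1 ^+ 2) ^+ n.
have C0 k : Ck_on k (box al be) (fun q : 'rV[R]_2 => q 0 0) by exact: Ck_on_proj.
have C1 k : Ck_on k (box al be) (fun q : 'rV[R]_2 => q 0 1) by exact: Ck_on_proj.
have Cr0 k : Ck_on k (box al be) (fun q => rho (mk2 (q 0 0) 0)).
  apply: (Ck_on_comp ob ob _ _ (Cr k)).
    move=> q [q0 q1]; split; rewrite /= ?mk20 // mk21 normr0.
    by apply: le_lt_trans q1.
  by apply: Ck_on_mk2 => //; exact: (@Ck_on_cst R 2 R).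
have Cf : smooth_on (box al be) f.
  move=> k; apply: Ck_on_B => //; apply: Ck_on_M => //; apply: Ck_on_X => //; apply: CS => //.
  by apply: Ck_on_M => //; [exact: (@Ck_on_cst R 2 R)|exact: Ck_on_X].
have ef : even2 (box al be) f.
  by move=> q bq; rewrite /f er // /refl2 mk20 mk21 sqrrN.
have f0 q : box al be q -> q 0 1 = 0 -> f q = 0.
  move=> bq q1; rewrite /f q1 expr0n /= mulr0 S0 expr1n mulr1 -[in rho q](mk2_eta q) q1 subrr //.
have [h [Ch eh Eh]] := even_div Cf ef f0.
exists h; split=> // q bq; rewrite mulnS exprD -mulrA [q 0 1 ^+ 2 * _]mulrCA -(Eh q bq) /f.
rewrite sinE exprMn exprMn -exprM mulrBr; congr (_ - _).
have lamn : lam^-1 ^+ n * lam ^+ n = 1 by rewrite -exprMn mulVf ?expr1n // gt_eqF.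
move: (S _) (rho (mk2 _ _)) (q 0 1 ^+ (2 * n)) => s r p.
by rewrite !mulrA -[r * _ * _]mulrA lamn mulr1; ring.
Qed.

(** Replaces the monomial [rho(a, 0) y^n]: it has the same leading term at [y = 0], but its
    [y]-derivatives are bounded, those of order [k < n] by a multiple of [lam^(k - n)]. *)
Definition whitney_term n (rho : 'rV[R]_2 -> R) (lam : R) (q : 'rV[R]_2) : R :=
  rho (mk2 (q 0 0) 0) * (lam^-1 ^+ n * sin (lam * q 0 1) ^+ n).

(** A [y]-derivative costs one factor [lam] against the prefactor [lam^(-n)], so below order [n] a
    factor [1 / lam] remains. The passage to [al' < al] gives bounds on a compact interval of
    [a]. *)
Lemma whitney_scale al be al' be' n (rho : 'rV[R]_2 -> R) : al' < al -> 0 < be ->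
  smooth_on (box al be) rho ->
  exists2 lam, 1 <= lam &
    (forall k, (k < n)%N -> deriv_bounded k (box al' be') (2^-1 ^+ n) (whitney_term n rho lam)) /\
    (forall a, `|a| < al' -> `|rho (mk2 a 0)| / lam <= 2^-1 ^+ n).
Proof.
move=> al'al be0 Cr; have ob := @box_open R al be.
pose b (a : R) := rho (mk2 a 0).
pose A : set R := [set a | `|a| < al].
have sb : smooth_on_line A b.
  have E (a : R) : 0 + a *: e_ 0 = mk2 a 0.
    by apply: rV2_ext; rewrite !mxE /= add0r ?mulr1 ?mulr0.
  have := @smooth_on_line_slice R 2 R _ _ 0 0 ob Cr.
  have -> : [set t : R | box al be (0 + t *: e_ 0)] = A.
    apply/seteqP; split => a /=; rewrite E; first by case; rewrite /= mk20.
    by move=> aA; split; rewrite /= ?mk20 // mk21 normr0.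
  by apply: smooth_on_line_ext; [exact: abs_open|move=> t _; rewrite E].
have /choice[B HB] : forall i, exists B, 0 <= B /\ forall a, `|a| < al' -> `|derive1n i b a| <= B.
  move=> i; have [a aal'|B B0 HB] := @bounded_on_segment R (derive1n i b) al'.
    exact: derive_continuous (smooth_on_line_is_derive i sb (le_lt_trans aal' al'al)).
  by exists B; split=> // a /ltW; exact: HB.
have bsin k : bounded_derivs k (fun x : R => sin x ^+ n) by exact: bounded_derivs_sinX.
pose H l := derive1n l (fun x : R => sin x ^+ n).
have /choice[C HC] : forall l, exists C, forall x, `|H l x| <= C.
  by move=> l; exact: (bounded_derivs_seq bsin l).2.
have C0 l : 0 <= C l by exact: le_trans (HC l 0).
pose BB := \sum_(i < n.+1) B i; pose CC := \sum_(l < n.+1) C l.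
have BB0 : 0 <= BB by apply: sumr_ge0 => i _; exact: (HB i).1.
have CC0 : 0 <= CC by apply: sumr_ge0 => i _.
have BBi i a : (i <= n)%N -> `|a| < al' -> `|derive1n i b a| <= BB.
  move=> iN aal'; apply: le_trans ((HB i).2 a aal') _.
  rewrite /BB (bigD1 (Ordinal (iN : (i < n.+1)%N))) //= lerDl.
  by apply: sumr_ge0 => j _; exact: (HB j).1.
have CCl l x : (l <= n)%N -> `|H l x| <= CC.
  move=> lN; apply: le_trans (HC l x) _.
  by rewrite /CC (bigD1 (Ordinal (lN : (l < n.+1)%N))) //= lerDl; apply: sumr_ge0.
have p2 : 0 < (2 : R) ^+ n by rewrite exprn_gt0.
(* The summands serve [1 <= lam], the bound on the derivatives of the term, and the bound on [rho]
   on the axis. *)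
pose lam := 1 + 2 ^+ n * (BB * CC) + 2 ^+ n * BB.
have t1 : 0 <= 2 ^+ n * (BB * CC) by rewrite mulr_ge0 ?mulr_ge0 // ltW.
have t2 : 0 <= 2 ^+ n * BB by rewrite mulr_ge0 // ltW.
have lam1 : 1 <= lam by rewrite /lam; lra.
have lam0 : 0 < lam by apply: lt_le_trans lam1.
exists lam => //; split; last first.
  move=> a aal'; rewrite ler_pdivrMr // exprVn -ler_pdivrMl ?invr_gt0 // invrK.
  apply: (@le_trans _ _ (2 ^+ n * BB)).
    by rewrite ler_pM2l //; exact: (BBi 0%N).
  by rewrite /lam; lra.
move=> k kn.
pose cs l y := lam^-1 ^+ n * (lam ^+ l * H l (lam * y)).
have E : whitney_term n rho lam = (fun q => derive1n 0 b (q 0 0) * cs 0%N (q 0 1)).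
  by apply/funext => q; rewrite /whitney_term /cs /H /b /= expr0 mul1r.
rewrite E; apply: (@product_deriv_bounded R k [set a | `|a| < al'] be' (2^-1 ^+ n) (fun i => derive1n i b) cs).
- exact: abs_open.
- by move=> i a aA; apply: smooth_on_line_is_derive sb _; exact: lt_trans al'al.
- move=> l y.
  have D1 : is_derive y (1 : R) (fun y => lam * y) lam.
    have -> : (fun y => lam * y) = lam *: (id : R -> R) by [].
    by apply: is_derive_eq; rewrite [_ *: _]mulr1.
  have D2 := is_derive1_comp ((bounded_derivs_seq bsin l).1 (lam * y)) D1.
  have -> : cs l.+1 y = lam^-1 ^+ n *: (lam ^+ l *: (H l.+1 (lam * y) * lam)).
    by rewrite /cs exprS -![_ *: _]/(_ * _); ring.
  have -> : cs l = lam^-1 ^+ n *: (lam ^+ l *: (H l \o (fun y => lam * y))) by [].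
  by apply: is_deriveZ; apply: is_deriveZ.
move=> i l a y ik lk aA; rewrite /cs normrM normrM normrM.
have in_n j : (j <= k)%N -> (j <= n)%N by move=> jk; apply: leq_trans jk (ltnW kn).
have h1 := BBi i a (in_n i ik) aA; have h2 := CCl l (lam * y) (in_n l lk).
have ln : (l < n)%N by exact: leq_ltn_trans lk kn.
have h3 : `|lam^-1 ^+ n| * `|lam ^+ l| <= lam^-1.
  rewrite -normrM ger0_norm; last by rewrite mulr_ge0 ?exprn_ge0 ?invr_ge0 ?ltW.
  have -> : lam^-1 ^+ n * lam ^+ l = lam^-1 * lam^-1 ^+ (n - l.+1).
    have -> : lam^-1 ^+ n = lam^-1 * lam^-1 ^+ l * lam^-1 ^+ (n - l.+1).
      by rewrite -exprS -exprD subnKC.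
    have : lam^-1 ^+ l * lam ^+ l = 1 by rewrite -exprMn mulVf ?expr1n // gt_eqF.
    move: lam^-1 (lam^-1 ^+ l) (lam ^+ l) (lam^-1 ^+ (n - l.+1)) => s p q r pq.
    by transitivity (s * r * (p * q)); [ring|rewrite pq mulr1].
  have li0 : 0 <= lam^-1 by rewrite invr_ge0 ltW.
  apply: ler_piMr => //; apply: exprn_ile1 => //; by rewrite invf_le1.
rewrite (mulrA `|lam^-1 ^+ n|).
apply: (@le_trans _ _ (BB * (lam^-1 * CC))).
  by apply: ler_pM => //; apply: ler_pM => //; rewrite mulr_ge0.
rewrite exprVn mulrCA mulrC ler_pdivrMr // -ler_pdivrMl ?invr_gt0 // invrK.
by rewrite /lam; lra.
Qed.

(** Flatness along the axis, expressed by divisibility by all powers so that the smooth quotients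
    are at hand. *)
Definition flat al be (r : 'rV[R]_2 -> R) := forall N, exists h : 'rV[R]_2 -> R,
  smooth_on (box al be) h /\ forall q, box al be q -> r q = q 0 1 ^+ N * h q.

Lemma flat_smooth al be r : flat al be r -> smooth_on (box al be) r.
Proof.
move=> /(_ 0%N)[h [Ch E]] k; apply: (@Ck_on_ext _ _ _ _ _ h); [exact: box_open| |exact: Ch].
by move=> q /E ->; rewrite expr0 mul1r.
Qed.

Lemma pd_near al be f g i q : box al be q ->
  (forall q, box al be q -> f q = g q :> R) -> 'D_(e_ i) f q = 'D_(e_ i) g q.
Proof.
move=> bq fg; apply: near_eq_derive.
by apply: filterS (near_open (@box_open R al be) bq) => p; exact: fg.
Qed.

Lemma coordX_derive (i : 'I_2) N (q : 'rV[R]_2) :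
  is_derive q (e_ i) (fun q : 'rV[R]_2 => q 0 1 ^+ N)
    (if i == 1 then N%:R * q 0 1 ^+ N.-1 else 0).
Proof.
case: (ord2P i) => ->.
  apply: (@partial0 R R (fun _ y => y ^+ N)); exact: is_derive_cst.
apply: (@partial1 R R (fun _ y => y ^+ N)) => /=.
have -> : (fun y : R => y ^+ N) = (id : R -> R) ^+ N by apply/funext => y; rewrite fctE.
by apply: is_derive_eq; rewrite [_ *: 1]mulr1 mulr_natl.
Qed.

Lemma flat_pd0 al be r : flat al be r -> flat al be ('D_(e_ 0) r).
Proof.
move=> fr N; have [h [Ch E]] := fr N; exists ('D_(e_ 0) h); split.
  by move=> k; exact: ((Ch k.+1).2 0).2.
move=> q bq; rewrite (pd_near 0 bq E).
have dh := derivableP (((Ch 1%N).2 0).1 q bq).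
have [_ ->] := @is_deriveM _ _ _ h q (e_ 0) _ _ (coordX_derive 0 N q) dh.
by rewrite /= scaler0 addr0.
Qed.

(** The [y]-derivative of [r(a, sqrt y)] is this function at [w = sqrt y]. *)
Definition flat_quot (r : 'rV[R]_2 -> R) q := 'D_(e_ 1) r q / (2 * q 0 1).

Lemma flat_quotP al be r : flat al be r -> flat al be (flat_quot r).
Proof.
(* Differentiation and the division by [w] cost two powers. The third leaves a factor [w] in the
   witness, which makes it vanish on the axis, where division by zero gives [0]. *)
move=> fr N; have [h [Ch E]] := fr N.+3.
have ob := @box_open R al be.
exists (fun q : 'rV[R]_2 => 2^-1 * (q 0 1 * (N.+3%:R * h q + q 0 1 * 'D_(e_ 1) h q))); split.
  move=> k; have C1 : Ck_on k (box al be) (fun q : 'rV[R]_2 => q 0 1) by exact: Ck_on_proj.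
  apply: Ck_on_M => //; first exact: (@Ck_on_cst R 2 R).
  apply: Ck_on_M => //; apply: Ck_on_D => //; apply: Ck_on_M => //.
    exact: (@Ck_on_cst R 2 R).
  exact: ((Ch k.+1).2 1).2.
move=> q bq; rewrite /flat_quot (pd_near 1 bq E).
have dh := derivableP (((Ch 1%N).2 1).1 q bq).
have [_ ->] := @is_deriveM _ _ _ h q (e_ 1) _ _ (coordX_derive 1 N.+3 q) dh.
rewrite /= -![_ *: _]/(_ * _) !exprS.
have [q1|q1] := eqVneq (q 0 1) 0; first by rewrite q1 !(mul0r, mulr0, addr0).
by field.
Qed.

(** Flatness is what makes the extension by [0] to [y <= 0] smooth. *)
Definition sqrt_pull (r : 'rV[R]_2 -> R) (q : 'rV[R]_2) : R :=
  if 0 < q 0 1 then r (mk2 (q 0 0) (Num.sqrt (q 0 1))) else 0.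

Lemma sqrt_box (al be : R) q : 0 < be -> box al (be ^+ 2) q -> 0 < q 0 1 ->
  box al be (mk2 (q 0 0) (Num.sqrt (q 0 1))).
Proof.
move=> be0 [q0 q1] q1p; split; rewrite /= ?mk20 // mk21 ger0_norm ?sqrtr_ge0 //.
rewrite -[be]gtr0_norm // -sqrtr_sqr ltr_sqrt ?exprn_gt0 //.
by move: q1; rewrite gtr0_norm.
Qed.

(** Writing [r = w^4 h] gives [r(a, sqrt y) = y^2 h], with [h] bounded near the point. The quadratic
    bound yields continuity and a zero derivative across [y = 0]. *)
Lemma sqrt_pull_bound (al be : R) r q : 0 < be -> flat al be r -> box al (be ^+ 2) q -> q 0 1 = 0 ->
  exists C d, [/\ 0 < d, 0 <= C & forall q', `|q' - q| < d -> `|sqrt_pull r q'| <= C * q' 0 1 ^+ 2].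
Proof.
move=> be0 fr bq q1; have [h [Ch E]] := fr 4%N.
have bq0 : box al be q by case: bq => q0 _; split=> //; rewrite q1 normr0.
have [d d0 Hd] := (continuous_epsP _ _).1 (Ck_on_cont (Ch 0%N) bq0) 1 ltr01.
have [d1 d10 Hd1] := (nbhs_norm_ltP _ _).1 (open_nbhs_nbhs (conj (@box_open R al (be ^+ 2)) bq)).
exists (`|h q| + 1), (Num.min (Num.min d (d ^+ 2)) d1); split.
- by rewrite !lt_min d0 d10 exprn_gt0.
- by rewrite addr_ge0.
move=> q'; rewrite !lt_min => /andP[/andP[qd qd2] qd1]; rewrite /sqrt_pull.
have H0 : 0 <= (`|h q| + 1) * q' 0 1 ^+ 2 by rewrite mulr_ge0 ?addr_ge0 ?sqr_ge0.
case: ifP => [q'1|_]; last by rewrite normr0.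
have bq' := Hd1 _ qd1; have bs := sqrt_box be0 bq' q'1.
rewrite (E _ bs) mk21.
have -> : Num.sqrt (q' 0 1) ^+ 4 = q' 0 1 ^+ 2.
  by rewrite -[4%N]/(2 * 2)%N exprM sqr_sqrtr // ltW.
rewrite normrM mulrC [`|q' 0 1 ^+ 2|]ger0_norm ?sqr_ge0 // ler_wpM2r ?sqr_ge0 //.
apply: (le_trans (norm_le_subD _ (h q))); rewrite addrC lerD2l; apply: Hd.
have Eq : mk2 (q 0 0) 0 = q by rewrite -q1 mk2_eta.
rewrite -Eq; apply: norm_mk2_sub_lt => //.
  by apply: le_lt_trans qd; have := coord_le_norm (q' - q) 0; rewrite !mxE.
rewrite subr0 ger0_norm ?sqrtr_ge0 // -[d]gtr0_norm // -sqrtr_sqr ltr_sqrt ?exprn_gt0 //.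
apply: le_lt_trans qd2; have := coord_le_norm (q' - q) 1; rewrite !mxE q1 subr0.
exact: le_trans (ler_norm _).
Qed.

Lemma sum_ord2 (F : 'I_2 -> R) : \sum_i F i = F 0 + F 1.
Proof. by rewrite big_ord_recl big_ord1; congr (_ + F _); exact: val_inj. Qed.

Lemma near_coord1_gt0 (q : 'rV[R]_2) : 0 < q 0 1 -> nbhs q [set p : 'rV[R]_2 | 0 < p 0 1].
Proof.
move=> q1; apply: (nbhs_norm_ltP q _).2; exists (q 0 1) => // p pq.
have := coord_le_norm (p - q) 1; rewrite !mxE => h.
have /andP[h1 h2] : - q 0 1 < p 0 1 - q 0 1 < q 0 1.
  by rewrite -ltr_norml; exact: le_lt_trans h pq.
by rewrite /=; move: (p 0 1) (q 0 1) h1 h2 => x y h1 h2; lra.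
Qed.

Lemma near_coord1_lt0 (q : 'rV[R]_2) : q 0 1 < 0 -> nbhs q [set p : 'rV[R]_2 | p 0 1 < 0].
Proof.
move=> q1; apply: (nbhs_norm_ltP q _).2; exists (- q 0 1); first by rewrite oppr_gt0.
move=> p pq; have := coord_le_norm (p - q) 1; rewrite !mxE => h.
have /andP[h1 h2] : - - q 0 1 < p 0 1 - q 0 1 < - q 0 1.
  by rewrite -ltr_norml; exact: le_lt_trans h pq.
by rewrite /=; move: (p 0 1) (q 0 1) h1 h2 => x y h1 h2; lra.
Qed.

Lemma sqrt_pull_derive (al be : R) r q : 0 < be -> flat al be r -> box al (be ^+ 2) q ->
  is_derive q (e_ 0) (sqrt_pull r) (sqrt_pull ('D_(e_ 0) r) q) /\
  is_derive q (e_ 1) (sqrt_pull r) (sqrt_pull (flat_quot r) q).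
Proof.
move=> be0 fr bq.
have zero_near i : (\forall p \near q, sqrt_pull r p = 0) -> is_derive q (e_ i) (sqrt_pull r) 0.
  move=> Z; apply: (near_eq_is_derive _ (is_derive_cst (0 : R) q (e_ i))).
  by apply: filterS Z => p ->.
case: (ltgtP (q 0 1) 0) => q1.
- have Z : \forall p \near q, sqrt_pull r p = 0.
    by apply: filterS (near_coord1_lt0 q1) => p p1; rewrite /sqrt_pull ltNge ltW.
  by rewrite /sqrt_pull ltNge ltW //=; split; exact: zero_near.
- pose phi (p : 'rV[R]_2) := mk2 (p 0 0) (Num.sqrt (p 0 1)).
  have bs := sqrt_box be0 bq q1.
  have [dr drE] := C1_differentiable (@box_open R al be) (flat_smooth fr 1%N) bs.
  have s0 : Num.sqrt (q 0 1) != 0 by rewrite gt_eqF // sqrtr_gt0.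
  have N : \forall p \near q, (r \o phi) p = sqrt_pull r p.
    by apply: filterS (near_coord1_gt0 q1) => p p1; rewrite /sqrt_pull p1.
  rewrite /sqrt_pull q1; split; apply: near_eq_is_derive N _.
    have dphi : is_derive q (e_ 0) phi (e_ 0).
      apply: is_derive_rV => j; case: (ord2P j) => ->.
        have -> : (fun p => phi p 0 0) = (fun p : 'rV[R]_2 => p 0 0) by apply/funext => p; rewrite mk20.
        by apply: (@partial0 R R (fun a _ => a)); rewrite mxE /=; exact: is_derive_id.
      have -> : (fun p => phi p 0 1) = (fun p : 'rV[R]_2 => Num.sqrt (p 0 1)) by apply/funext => p; rewrite mk21.
      by apply: (@partial0 R R (fun _ y => Num.sqrt y)); rewrite mxE /=; exact: is_derive_cst.
    have := @is_derive_chain _ _ _ _ phi r q _ _ dr dphi; by rewrite drE sum_ord2 !mxE /= mul1r mul0r addr0.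
  have dphi : is_derive q (e_ 1) phi ((2 * Num.sqrt (q 0 1))^-1 *: e_ 1).
    apply: is_derive_rV => j; case: (ord2P j) => ->.
      have -> : (fun p => phi p 0 0) = (fun p : 'rV[R]_2 => p 0 0) by apply/funext => p; rewrite mk20.
      by apply: (@partial1 R R (fun a _ => a)); rewrite !mxE /= mulr0; exact: is_derive_cst.
    have -> : (fun p => phi p 0 1) = (fun p : 'rV[R]_2 => Num.sqrt (p 0 1)) by apply/funext => p; rewrite mk21.
    by apply: (@partial1 R R (fun _ y => Num.sqrt y)); rewrite !mxE /= mulr1; exact: is_derive1_sqrt.
  have := @is_derive_chain _ _ _ _ phi r q _ _ dr dphi; rewrite drE sum_ord2 !mxE /= mulr0 mul0r add0r.
  by rewrite /flat_quot mk21 mulr1 mulrC.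
- have E0 g : sqrt_pull g q = 0 by rewrite /sqrt_pull q1 ltxx.
  rewrite !E0; split.
    apply/is_derive_epsP => e e0; exists 1 => // h _ _.
    have q1' : (h *: e_ 0 + q) 0 1 = 0 by rewrite !mxE /= mulr0 add0r.
    by rewrite {1}/sqrt_pull q1' ltxx E0 subrr scaler0 subrr normr0 ltW.
  have [C [d [d0 C0 H]]] := sqrt_pull_bound be0 fr bq q1.
  apply/is_derive_epsP => e e0; exists (Num.min d (e / (C + 1))).
    by rewrite lt_min d0 divr_gt0 // ltr_wpDl.
  move=> h h0; rewrite lt_min => /andP[hd he].
  have q1' : (h *: e_ 1 + q) 0 1 = h by rewrite !mxE /= mulr1 q1 addr0.
  have hq : `|h *: e_ 1 + q - q| < d.
    by rewrite addrK normrZ; apply: le_lt_trans hd; rewrite ler_piMr // norm_e.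
  have := H _ hq; rewrite q1' E0 !subr0 => Hh.
  rewrite normrZ normfV ler_pdivrMl ?normr_gt0 //; apply: (le_trans Hh).
  rewrite -real_normK ?num_real // expr2 mulrA mulrC ler_wpM2l //.
  move: he; rewrite ltr_pdivlMr ?ltr_wpDl // mulrDr mulr1 mulrC => he.
  by apply: ltW; apply: le_lt_trans he; rewrite lerDl.
Qed.

(** Both partials of a pulled-back flat function are pullbacks of flat functions, so the class is
    stable under differentiation. *)
Lemma sqrt_pull_smooth (al be : R) r : 0 < be -> flat al be r ->
  smooth_on (box al (be ^+ 2)) (sqrt_pull r).
Proof.
move=> be0 fr k; elim: k r fr => [|k IH] r fr; last first.
  apply: (@Ck_on_2 _ _ _ _ _ (sqrt_pull ('D_(e_ 0) r)) (sqrt_pull (flat_quot r))).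
  - exact: box_open.
  - by move=> q; exact: Ck_on_cont (IH r fr).
  - by move=> q bq; exact: (sqrt_pull_derive be0 fr bq).1.
  - by move=> q bq; exact: (sqrt_pull_derive be0 fr bq).2.
  - by apply: IH; exact: flat_pd0.
  - by apply: IH; exact: flat_quotP.
split=> // q bq; case: (ltgtP (q 0 1) 0) => q1.
- apply: (@continuous_near_eq _ _ (cst 0)); last exact: cst_continuous.
  by apply: filterS (near_coord1_lt0 q1) => p p1; rewrite /sqrt_pull ltNge ltW.
- pose phi (p : 'rV[R]_2) := mk2 (p 0 0) (Num.sqrt (p 0 1)).
  apply: (@continuous_near_eq _ _ (r \o phi)).
    by apply: filterS (near_coord1_gt0 q1) => p p1; rewrite /sqrt_pull p1.
  have bs := sqrt_box be0 bq q1.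
  have cphi : {for q, continuous phi}.
    apply: continuous_rV => j; case: (ord2P j) => ->.
      have -> : (fun p => phi p 0 0) = (fun p : 'rV[R]_2 => p 0 0) by apply/funext => p; rewrite mk20.
      exact: coord_continuous.
    have -> : (fun p => phi p 0 1) = (fun p : 'rV[R]_2 => Num.sqrt (p 0 1)) by apply/funext => p; rewrite mk21.
    have c1 : {for q, continuous (fun p : 'rV[R]_2 => p 0 1)} by exact: coord_continuous.
    apply: (@continuous_comp _ _ _ (fun p : 'rV[R]_2 => p 0 1) Num.sqrt _ c1).
    exact: sqrt_continuous.
  by apply: (@continuous_comp _ _ _ phi r _ cphi); exact: Ck_on_cont (flat_smooth fr 0%N) bs.
- have E0 : sqrt_pull r q = 0 by rewrite /sqrt_pull q1 ltxx.
  have [C [d [d0 C0 H]]] := sqrt_pull_bound be0 fr bq q1.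
  apply/continuous_epsP => e e0; exists (Num.min (Num.min d 1) (e / (C + 1))).
    by rewrite !lt_min d0 ltr01 divr_gt0 // ltr_wpDl.
  move=> p; rewrite !lt_min => /andP[/andP[pd p1] pe]; rewrite E0 subr0.
  apply: (le_trans (H p pd)).
  have hp : `|p 0 1| <= `|p - q| by have := coord_le_norm (p - q) 1; rewrite !mxE q1 subr0.
  have h2 : p 0 1 ^+ 2 <= `|p - q|.
    rewrite -real_normK ?num_real // expr2; apply: (@le_trans _ _ (`|p 0 1| * 1)).
      by rewrite ler_wpM2l // (le_trans hp) // ltW.
    by rewrite mulr1.
  apply: (@le_trans _ _ ((C + 1) * `|p - q|)).
    apply: ler_pM => //; first exact: sqr_ge0.
    by rewrite lerDl.
  by rewrite mulrC -ler_pdivlMr ?ltr_wpDl // ltW.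
Qed.

End Whitney.

(** * Whitney's theorem on even functions and the even-odd splitting *)

Section WhitneyEven.
Context {R : realType}.
Local Notation e_ i := (delta_mx 0 i).

Lemma abs_sin_le (x : R) : `|sin x| <= `|x|.
Proof.
have [th _] := @mvt_increment R (@sin R) (@cos R) 0 x (fun th _ => is_derive_sin _).
rewrite add0r sin0 subr0 => ->; rewrite normrM ler_piMr //.
by rewrite ler_norml cos_geN1 cos_le1.
Qed.

(** Of the [j] sine factors, [N + 1] are bounded by [lam w^2] and the others by [1]; the prefactor
    [lam^(-j)] absorbs the powers of [lam] and leaves one [1 / lam] for [rho]. *)
Lemma whitney_term_bound N j (rho : 'rV[R]_2 -> R) (lam a w : R) : (N.+2 <= j)%N ->
  1 <= lam -> `|rho (mk2 a 0)| / lam <= 2^-1 ^+ j ->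
  `|whitney_term j rho lam (mk2 a (w ^+ 2))| <= (w ^+ 2) ^+ N.+1 * 2^-1 ^+ j.
Proof.
move=> Nj lam1 rb; have lam0 : 0 < lam by exact: lt_le_trans lam1.
rewrite /whitney_term mk20 mk21 !normrM [(_ ^+ N.+1) * _]mulrC.
have li0 : 0 < lam^-1 by rewrite invr_gt0.
rewrite !normrX (gtr0_norm li0).
have s1 : `|sin (lam * w ^+ 2)| <= 1 by exact: sin_max.
have s2 : `|sin (lam * w ^+ 2)| <= lam * w ^+ 2.
  by apply: le_trans (abs_sin_le _) _; rewrite ger0_norm // mulr_ge0 ?sqr_ge0 // ltW.
have s0 := normr_ge0 (sin (lam * w ^+ 2)).
move: s0 s1 s2; move: `|sin _| => s s0 s1 s2.
have [i Ej] : exists i, j = (N.+1 + i).+1.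
  by exists (j - N.+2)%N; rewrite -addSn subnKC.
apply: (@le_trans _ _ ((`|rho (mk2 a 0)| / lam) * (w ^+ 2) ^+ N.+1)); last first.
  by apply: ler_wpM2r => //; rewrite exprn_ge0 ?sqr_ge0.
rewrite -mulrA ler_wpM2l // Ej exprS -mulrA ler_wpM2l ?(ltW li0) //.
have sN : s ^+ (N.+1 + i).+1 <= (lam * w ^+ 2) ^+ N.+1.
  rewrite -addnS exprD -[X in _ <= X]mulr1; apply: ler_pM; rewrite ?exprn_ge0 //.
    by rewrite lerXn2r // nnegrE // mulr_ge0 ?sqr_ge0 // ltW.
  exact: exprn_ile1.
apply: (@le_trans _ _ (lam^-1 ^+ (N.+1 + i) * (lam * w ^+ 2) ^+ N.+1)).
  by rewrite ler_wpM2l // exprn_ge0 // ltW.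
rewrite exprMn exprD mulrACA -exprMn mulVf ?gt_eqF // expr1n mul1r ler_piMl //.
  by rewrite exprn_ge0 ?sqr_ge0.
by apply: exprn_ile1; rewrite ?invf_le1 // ltW.
Qed.

(** Successive terms of Borel type exhaust the even Taylor expansion along the axis. Their series is
    smooth in [y], and the remainder is flat, so it becomes a smooth function of [y] through the
    square root. *)
Lemma whitney_even (al' al be : R) (k : 'rV[R]_2 -> R) : al' < al -> 0 < be ->
  smooth_on (box al be) k -> even2 (box al be) k ->
  exists K : 'rV[R]_2 -> R, smooth_on (box al' (be ^+ 2)) K /\
    forall q, box al' be q -> k q = K (mk2 (q 0 0) (q 0 1 ^+ 2)).
Proof.
move=> al'al be0 Ck ek; have ob := @box_open R al be.
have bb := @box_mono R al be al' be (ltW al'al) (lexx _).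
(* For each order and each current remainder, [pick] chooses the scale [lam] and the next remainder;
   iterating it gives the sequence [rho]. *)
have /choice[pick Hpick] : forall x : nat * ('rV[R]_2 -> R), exists p : R * ('rV[R]_2 -> R),
    smooth_on (box al be) x.2 -> even2 (box al be) x.2 ->
    [/\ 1 <= p.1, forall k, (k < x.1)%N -> deriv_bounded k (box al' (be ^+ 2)) (2^-1 ^+ x.1) (whitney_term x.1 x.2 p.1),
      forall a, `|a| < al' -> `|x.2 (mk2 a 0)| / p.1 <= 2^-1 ^+ x.1,
      smooth_on (box al be) p.2 /\ even2 (box al be) p.2 &
      forall q, box al be q -> q 0 1 ^+ (2 * x.1) * x.2 q - whitney_term x.1 x.2 p.1 (mk2 (q 0 0) (q 0 1 ^+ 2)) =
        q 0 1 ^+ (2 * x.1.+1) * p.2 q].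
  move=> [n rho]; have [[Cr er]|no] := pselect (smooth_on (box al be) rho /\ even2 (box al be) rho); last first.
    by exists (0, rho) => Cr er; case: no.
  have [lam lam1 [H1 H2]] := @whitney_scale R al be al' (be ^+ 2) n rho al'al be0 Cr.
  have lam0 : 0 < lam by exact: lt_le_trans lam1.
  have [rho' [Cr' er' H3]] := whitney_step n lam0 Cr er.
  exists (lam, rho') => _ _; split=> //= q bq.
  by rewrite /whitney_term mk20 mk21; exact: H3.
pose rho := fix rho n := if n is n'.+1 then (pick (n', rho n')).2 else k.
pose lam n := (pick (n, rho n)).1.
have Hr n : smooth_on (box al be) (rho n) /\ even2 (box al be) (rho n).
  by elim: n => [|n [Cr er]] //=; have [_ _ _ []] := Hpick (n, rho n) Cr er.
have HP n := Hpick (n, rho n) (Hr n).1 (Hr n).2.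
pose T n := whitney_term n (rho n) (lam n).
have obe := @box_open R al' (be ^+ 2).
have CT n : smooth_on (box al' (be ^+ 2)) (T n).
  move=> l; rewrite /T /whitney_term; apply: Ck_on_M => //.
    apply: (@Ck_on_comp _ _ _ _ _ (box al be) (fun q : 'rV[R]_2 => mk2 (q 0 0) 0) (rho n)) => //.
    - move=> q [q0 q1]; split; rewrite /= ?mk20 ?mk21 ?normr0 //.
      by apply: lt_trans al'al.
    - by apply: Ck_on_mk2 => //; [exact: Ck_on_proj|exact: (@Ck_on_cst R 2 R)].
    - exact: (Hr n).1.
  apply: Ck_on_M => //; first exact: (@Ck_on_cst R 2 R).
  apply: Ck_on_X => //; apply: Ck_on_sin => //; apply: Ck_on_M => //.
    exact: (@Ck_on_cst R 2 R).
  exact: Ck_on_proj.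
(* At order [l] the terms with index above [l] satisfy the derivative bounds, so the series test
   starts at [l + 1]. *)
have CK : smooth_on (box al' (be ^+ 2)) (series_sum T).
  move=> l; apply: (@series_Ck R 2 l _ T l.+1 obe (fun j => CT j l)) => j lj.
  by have [_ h _ _ _] := HP j; exact: h.
have sq q : box al' be q -> box al' (be ^+ 2) (mk2 (q 0 0) (q 0 1 ^+ 2)).
  case=> q0 q1; split; rewrite /= ?mk20 // mk21 normrX.
  by rewrite ltrXn2r // nnegrE // ltW.
have CS l : Ck_on l (box al' be) (fun q : 'rV[R]_2 => mk2 (q 0 0) (q 0 1 ^+ 2)).
  apply: Ck_on_mk2; [exact: box_open|apply: Ck_on_proj; exact: box_open|].
  by apply: Ck_on_X; [exact: box_open|apply: Ck_on_proj; exact: box_open].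
have part n q : box al be q -> k q - \sum_(j < n) T j (mk2 (q 0 0) (q 0 1 ^+ 2)) = q 0 1 ^+ (2 * n) * rho n q.
  move=> bq; elim: n => [|n IH]; first by rewrite big_ord0 subr0 muln0 expr0 mul1r.
  rewrite big_ord_recr opprD addrA IH.
  by have [_ _ _ _ h] := HP n; exact: h.
pose r q := k q - series_sum T (mk2 (q 0 0) (q 0 1 ^+ 2)).
have ob' := @box_open R al' be.
have CKs l : Ck_on l (box al' be) (fun q => series_sum T (mk2 (q 0 0) (q 0 1 ^+ 2))).
  by apply: (@Ck_on_comp _ _ _ _ _ (box al' (be ^+ 2)) (fun q : 'rV[R]_2 => mk2 (q 0 0) (q 0 1 ^+ 2))).
have Cr : smooth_on (box al' be) r.
  move=> l; apply: Ck_on_B => //; exact: Ck_on_sub bb (Ck l).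
(* After [N + 2] terms the remainder is [w^(2N + 4)] times a smooth function, minus a tail bounded
   by a multiple of [|w|^(2N + 2)]; [power_div] extracts [w^N] from the tail. *)
have fr : flat al' be r.
  move=> N.
  pose f q := r q - q 0 1 ^+ (2 * N.+2) * rho N.+2 q.
  have Crho l : Ck_on l (box al' be) (fun q => q 0 1 ^+ (2 * N.+2) * rho N.+2 q).
    apply: Ck_on_M => //; first by apply: Ck_on_X => //; exact: Ck_on_proj.
    by apply: Ck_on_sub bb _; exact: (Hr _).1.
  have Cf : smooth_on (box al' be) f by move=> l; apply: Ck_on_B.
  have [h [Ch Eh]] : exists h : 'rV[R]_2 -> R, smooth_on (box al' be) h /\
      forall q, box al' be q -> f q = q 0 1 ^+ N * h q.
    apply: (@power_div R al' be N (be ^+ N.+1) f Cf) => q bq _.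
    have tb j : (N.+2 <= j)%N -> `|T j (mk2 (q 0 0) (q 0 1 ^+ 2))| <= (q 0 1 ^+ 2) ^+ N.+1 * 2^-1 ^+ j.
      move=> Nj; have [h1 _ h2 _ _] := HP j.
      by apply: whitney_term_bound => //; apply: h2; case: bq.
    have := series_sum_tail tb (leqnn _).
    rewrite /f -(part N.+2 q (bb q bq)) /r => tl.
    have -> : k q - series_sum T (mk2 (q 0 0) (q 0 1 ^+ 2)) - (k q - \sum_(j < N.+2) T j (mk2 (q 0 0) (q 0 1 ^+ 2))) =
       - (series_sum T (mk2 (q 0 0) (q 0 1 ^+ 2)) - \sum_(j < N.+2) T j (mk2 (q 0 0) (q 0 1 ^+ 2))).
      by move: (k q) (series_sum _ _) (\sum_(j < _) _) => x y z; ring.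
    rewrite normrN; apply: (le_trans tl).
    have -> : (q 0 1 ^+ 2) ^+ N.+1 = `|q 0 1| ^+ N.+1 * `|q 0 1| ^+ N.+1.
      by rewrite -[q 0 1 ^+ 2]real_normK ?num_real // -exprM mul2n -addnn exprD.
    have q1b : `|q 0 1| ^+ N.+1 <= be ^+ N.+1.
      by case: bq => _ /ltW hh; rewrite lerXn2r // nnegrE // ltW.
    have h2 : 2 * 2^-1 ^+ N.+2 <= 1 :> R.
      rewrite exprS mulrA divff // mul1r; apply: exprn_ile1 => //; lra.
    rewrite mulrAC; apply: (@le_trans _ _ (1 * (`|q 0 1| ^+ N.+1 * `|q 0 1| ^+ N.+1))).
      by apply: ler_wpM2r => //; rewrite mulr_ge0 ?exprn_ge0.
    by rewrite mul1r; apply: ler_wpM2r => //; rewrite exprn_ge0.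
  (* The exponents match since [N + (N + 4) = 2 (N + 2)]. *)
  exists (fun q => h q + q 0 1 ^+ N.+4 * rho N.+2 q); split.
    move=> l; apply: Ck_on_D => //; apply: Ck_on_M => //; first by apply: Ck_on_X => //; exact: Ck_on_proj.
    by apply: Ck_on_sub bb _; exact: (Hr _).1.
  move=> q bq; have := Eh q bq; rewrite /f mulrDr => <-; rewrite mulrA -exprD.
  have -> : (N + N.+4 = 2 * N.+2)%N by rewrite mul2n -addnn !addnS addSn addSn.
  by rewrite subrK.
(* At [y = w^2] the square root returns [|w|]; the evenness of [r] settles negative [w], and its
   flatness the value at [w = 0]. *)
exists (fun q => series_sum T q + sqrt_pull r q); split.
  by move=> l; apply: Ck_on_D => //; exact: sqrt_pull_smooth.
move=> q bq; rewrite /sqrt_pull mk21 mk20.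
have E : k q = series_sum T (mk2 (q 0 0) (q 0 1 ^+ 2)) + r q by rewrite /r addrC subrK.
case: ifP => [_|/negbT]; last first.
  rewrite -leNgt => q1; rewrite addr0 E.
  have q10 : q 0 1 = 0 by apply/eqP; rewrite -sqrf_eq0 eq_le q1 sqr_ge0.
  have [h [_ Eh]] := fr 1%N.
  by rewrite (Eh q bq) q10 mul0r addr0.
rewrite sqrtr_sqr E; congr (_ + _).
have rr : r (refl2 q) = r q by rewrite /r /refl2 mk20 mk21 sqrrN ek //; exact: bb.
have [q1|q1] := leP 0 (q 0 1); first by rewrite ger0_norm // mk2_eta.
by rewrite ltr0_norm // -/(refl2 q) rr.
Qed.

Lemma whitney_split (al' al be : R) (f : 'rV[R]_2 -> R) : al' < al -> 0 < be ->
  smooth_on (box al be) f ->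
  exists K0 K1 : 'rV[R]_2 -> R, [/\ smooth_on (box al' (be ^+ 2)) K0, smooth_on (box al' (be ^+ 2)) K1 &
    forall q, box al' be q ->
      f q = K0 (mk2 (q 0 0) (q 0 1 ^+ 2)) + q 0 1 * K1 (mk2 (q 0 0) (q 0 1 ^+ 2))].
Proof.
move=> al'al be0 Cf; have ob := @box_open R al be.
have bb := @box_mono R al be al' be (ltW al'al) (lexx _).
have refl2K (q : 'rV[R]_2) : refl2 (refl2 q) = q by rewrite /refl2 mk20 mk21 opprK mk2_eta.
have Cr k : Ck_on k (box al be) (fun q => f (refl2 q)) by exact: Ck_on_refl.
pose fe q := 2^-1 * (f q + f (refl2 q)); pose fo q := 2^-1 * (f q - f (refl2 q)).
have Ce : smooth_on (box al be) fe by move=> k; apply: Ck_on_Z => //; exact: Ck_on_D.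
have Co : smooth_on (box al be) fo by move=> k; apply: Ck_on_Z => //; exact: Ck_on_B.
have ee : even2 (box al be) fe by move=> q bq; rewrite /fe refl2K [f _ + _]addrC.
have [h [Ch Eh _]] : exists h : 'rV[R]_2 -> R, [/\ smooth_on (box al be) h, forall x, box al be x -> fo x = x 0 1 * h x &
    forall x, box al be x -> x 0 1 = 0 -> h x = 'D_(e_ 1) fo x].
  apply: (hadamard_div ob (@box_stable R al be) Co) => q bq q1.
  by rewrite /fo /refl2 q1 oppr0 -[X in mk2 _ X]q1 mk2_eta subrr mulr0.
(* Symmetrising [h] makes it even on the nose; the product with [w] is still the odd part of [f]. *)
pose he q := 2^-1 * (h q + h (refl2 q)).
have Che : smooth_on (box al be) he.
  by move=> k; apply: Ck_on_Z => //; apply: Ck_on_D => //; exact: Ck_on_refl.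
have ehe : even2 (box al be) he by move=> q bq; rewrite /he refl2K [h _ + _]addrC.
have [K0 [CK0 EK0]] := whitney_even al'al be0 Ce ee.
have [K1 [CK1 EK1]] := whitney_even al'al be0 Che ehe.
exists K0, K1; split=> // q bq; rewrite -EK0 // -EK1 //.
have Eo1 := Eh q (bb q bq); have Eo2 := Eh _ (box_refl (bb q bq)).
have m1 : refl2 q 0 1 = - q 0 1 by rewrite mk21.
rewrite m1 in Eo2; move: Eo1 Eo2; rewrite /fe /he /fo refl2K.
move: (f q) (f (refl2 q)) (h q) (h (refl2 q)) (q 0 1) => a b c d e h1 h2.
have -> : e * (2^-1 * (c + d)) = 2^-1 * (e * c - (- e) * d) by ring.
by rewrite -h1 -h2; field.
Qed.

End WhitneyEven.

(** * Charts and Christoffel symbols *)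

Section Transition.
Context {R : realType} {m : nat} {M : manifold R m}.
Local Notation e_ i := (delta_mx 0 i).
Implicit Types (c d e : chart M) (p : M).

Definition chart_range c : set 'rV[R]_m := coord c @` dom c.
Definition trans c d : 'rV[R]_m -> 'rV[R]_m := coord d \o param c.

Lemma param_dom c x : chart_range c x -> dom c (param c x).
Proof. by case=> p dp <-; rewrite coordK. Qed.

Lemma paramK c x : chart_range c x -> coord c (param c x) = x.
Proof. by case=> p dp <-; rewrite coordK. Qed.

Lemma coord_range c p : dom c p -> chart_range c (coord c p).
Proof. by exists p. Qed.

Lemma chart_imageE (U : set M) c x :
  (coord c @` (U `&` dom c)) x <-> chart_range c x /\ U (param c x).
Proof.
split; first by case=> p [Up dp] <-; rewrite coordK //; split=> //; exact: coord_range.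
by case=> cx Ux; exists (param c x); [split=> //; exact: param_dom|exact: paramK].
Qed.

Lemma chart_image_open (U : set M) c : open U -> open (coord c @` (U `&` dom c)).
Proof.
move=> oU.
have -> : coord c @` (U `&` dom c) = chart_range c `&` param c @^-1` U.
  by apply/seteqP; split => x /=; [move/chart_imageE|move=> ?; apply/chart_imageE].
apply: (open_preimage _ oU); first exact: codom_open.
exact: param_continuous.
Qed.

Lemma trans_smooth c d : smooth_on (coord c @` (dom d `&` dom c)) (trans c d).
Proof. by rewrite setIC; exact: transition_smooth. Qed.

Lemma trans_open c d : open (coord c @` (dom d `&` dom c)).
Proof. by apply: chart_image_open; exact: dom_open. Qed.

Lemma trans_dom c d p : dom c p -> dom d p -> (coord c @` (dom d `&` dom c)) (coord c p).
Proof. by move=> cp dp; exists p. Qed.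

Lemma trans_diff c d p : dom c p -> dom d p -> differentiable (trans c d) (coord c p).
Proof.
move=> cp dp; apply: (@C1_differentiable_rV _ _ _ (coord c @` (dom d `&` dom c))).
- exact: trans_open.
- exact: trans_smooth.
- exact: trans_dom.
Qed.

Lemma transE c d p : dom c p -> trans c d (coord c p) = coord d p.
Proof. by move=> cp; rewrite /trans /= coordK. Qed.

Lemma trans_near c d p : dom c p -> dom d p ->
  \forall x \near coord c p, chart_range c x /\ dom d (param c x).
Proof.
move=> cp dp; have := near_open (@trans_open c d) (trans_dom cp dp).
by apply: filterS => x /chart_imageE.
Qed.

Lemma derive_trans_comp (W : normedModType R) c d p (f : 'rV[R]_m -> W) v :
  dom c p -> dom d p -> differentiable f (coord d p) ->
  is_derive (coord c p) v (f \o trans c d) ('D_('D_v (trans c d) (coord c p)) f (coord d p)).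
Proof.
move=> cp dp df; rewrite -(transE d cp) in df *.
have dT := derivableP (diff_derivable (trans_diff cp dp) (v := v)).
have := is_derive_chain df dT.
by rewrite -deriveE.
Qed.

Lemma derive_trans_trans c d e p v : dom c p -> dom d p -> dom e p ->
  'D_('D_v (trans c d) (coord c p)) (trans d e) (coord d p) = 'D_v (trans c e) (coord c p).
Proof.
move=> cp dp ep; have H := derive_trans_comp v cp dp (trans_diff dp ep).
have [_ <-] := H; apply: near_eq_derive.
apply: filterS (trans_near cp dp) => x [cx dx].
by rewrite /trans /= coordK.
Qed.

Lemma derive_trans_id c p v : dom c p -> 'D_v (trans c c) (coord c p) = v.
Proof.
move=> cp; rewrite -[RHS](@derive_id _ _ (coord c p) v); apply: near_eq_derive.
by apply: filterS (trans_near cp cp) => x [cx _]; rewrite /trans /= paramK.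
Qed.

Lemma derive_trans_sum c d p v : dom c p -> dom d p ->
  'D_v (trans c d) (coord c p) = \sum_i v 0 i *: 'D_(e_ i) (trans c d) (coord c p).
Proof. by move=> cp dp; exact: derive_sum_e_rV (trans_diff cp dp). Qed.

Lemma derive_transD c d p u v : dom c p -> dom d p ->
  'D_(u + v) (trans c d) (coord c p) = 'D_u (trans c d) (coord c p) + 'D_v (trans c d) (coord c p).
Proof. by move=> cp dp; have df := trans_diff cp dp; rewrite !deriveE // linearD. Qed.

Lemma derive_transZ c d p k v : dom c p -> dom d p ->
  'D_(k *: v) (trans c d) (coord c p) = k *: 'D_v (trans c d) (coord c p).
Proof. by move=> cp dp; have df := trans_diff cp dp; rewrite !deriveE // linearZ. Qed.

Lemma derive_trans0 c d p : dom c p -> dom d p ->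
  'D_0 (trans c d) (coord c p) = 0.
Proof. by move=> cp dp; have df := trans_diff cp dp; rewrite !deriveE // linear0. Qed.

Lemma smooth_changeR (U : set M) (f : M -> R) d : open U -> U `<=` dom d ->
  smooth_on (coord d @` (U `&` dom d)) (f \o param d) -> smooth_fun U f.
Proof.
move=> oU Ud sf c k; have oc := @chart_image_open U c oU.
apply: (@Ck_on_ext _ _ _ _ _ (fun x => (f \o param d) (trans c d x))); first exact: oc.
  move=> x /chart_imageE[cx Ux]; rewrite /trans /= coordK //; exact: Ud.
apply: (@Ck_on_comp _ _ _ k _ (coord d @` (U `&` dom d)) (trans c d) (f \o param d)).
- exact: oc.
- exact: chart_image_open.
- move=> x /chart_imageE[cx Ux]; exists (param c x) => //; split=> //; exact: Ud.
- apply: Ck_on_sub (@trans_smooth c d k); apply: image_subset => p [Up cp]; split=> //; exact: Ud.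
- exact: sf.
Qed.

Lemma coord_vfield_smooth (U : set M) d i : open U -> U `<=` dom d -> smooth_vfield U (coord_vfield d i).
Proof.
move=> oU Ud; split=> [p /Ud dp c e cp ep|c k].
  by rewrite /coord_vfield -!/(trans _ _) derive_trans_trans.
have oc := @chart_image_open U c oU.
apply: (@Ck_on_ext _ _ _ _ _ (fun x => 'D_(e_ i) (trans d c) (trans c d x))); first exact: oc.
  by move=> x _; [].
apply: (@Ck_on_comp_rV _ _ _ _ k _ (coord d @` (dom c `&` dom d)) (trans c d) ('D_(e_ i) (trans d c))).
- exact: oc.
- exact: trans_open.
- move=> x /chart_imageE[cx Ux]; exists (param c x) => //; split; [exact: param_dom|exact: Ud].
- apply: Ck_on_sub (@trans_smooth c d k); apply: image_subset => p [Up cp]; split=> //; exact: Ud.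
- exact: ((@trans_smooth d c k.+1).2 i).2.
Qed.

Lemma vfield_add_smooth (U : set M) (X Y : vfield M) : open U -> smooth_vfield U X -> smooth_vfield U Y ->
  smooth_vfield U (vfield_add X Y).
Proof.
move=> oU [tX sX] [tY sY]; split=> [p Up c d cp dp|c k].
  by rewrite /vfield_add -!/(trans _ _) derive_transD // (tX p Up c d cp dp) (tY p Up c d cp dp).
by apply: Ck_on_D; [exact: chart_image_open|exact: sX|exact: sY].
Qed.

Lemma Ck_on_scale n q k (U : set 'rV[R]_n) (f : 'rV[R]_n -> R) (g : 'rV[R]_n -> 'rV[R]_q) : open U ->
  Ck_on k U f -> Ck_on k U g -> Ck_on k U (fun x => f x *: g x).
Proof.
move=> oU Cf Cg; apply: Ck_on_rV => // j.
apply: (@Ck_on_ext _ _ _ _ _ (fun x => f x * g x 0 j)) => //; first by move=> x _; rewrite mxE.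
by apply: Ck_on_M => //; exact: Ck_on_coord.
Qed.

Lemma vfield_scale_smooth (U : set M) (f : M -> R) (X : vfield M) : open U -> smooth_fun U f -> smooth_vfield U X ->
  smooth_vfield U (vfield_scale f X).
Proof.
move=> oU sf [tX sX]; split=> [p Up c d cp dp|c k].
  by rewrite /vfield_scale -!/(trans _ _) derive_transZ // (tX p Up c d cp dp).
by apply: Ck_on_scale; [exact: chart_image_open|exact: sf|exact: sX].
Qed.

Lemma vfield0_smooth (U : set M) : smooth_vfield U (fun _ _ => 0).
Proof.
split=> [p Up c d cp dp|c k]; first by rewrite -/(trans _ _) derive_trans0.
exact: Ck_on_cst.
Qed.

(** Built from [vfield_add] and [vfield_scale], because the axioms of a connection are stated for
    these operations. *)
Definition frame_sum d (r : seq 'I_m) (f : 'I_m -> M -> R) : vfield M :=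
  foldr (fun i Z => vfield_add (vfield_scale (f i) (coord_vfield d i)) Z) (fun _ _ => 0) r.

Lemma frame_sumE d r f p c : frame_sum d r f p c = \sum_(i <- r) f i p *: coord_vfield d i p c.
Proof. by elim: r => [|i r IH] /=; rewrite ?big_nil ?big_cons // -IH. Qed.

Lemma frame_sum_smooth (U : set M) d r f : open U -> U `<=` dom d -> (forall i, smooth_fun U (f i)) ->
  smooth_vfield U (frame_sum d r f).
Proof.
move=> oU Ud sf; elim: r => [|i r IH] /=; first exact: vfield0_smooth.
apply: vfield_add_smooth => //; apply: vfield_scale_smooth => //; exact: coord_vfield_smooth.
Qed.

Lemma vfield_coord_smooth (U : set M) d (X : vfield M) i : open U -> U `<=` dom d -> smooth_vfield U X ->
  smooth_fun U (fun p => X p d 0 i).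
Proof.
move=> oU Ud [_ sX]; apply: (smooth_changeR oU Ud) => k.
by apply: (@Ck_on_coord _ _ _ _ _ (fun x => X (param d x) d)); [exact: chart_image_open|exact: sX].
Qed.

Lemma vfield_frame (U : set M) d (X : vfield M) : U `<=` dom d -> smooth_vfield U X ->
  vfield_eq U X (frame_sum d (index_enum 'I_m) (fun i p => X p d 0 i)).
Proof.
move=> Ud [tX _] p c Up cp; rewrite frame_sumE (tX p Up d c (Ud p Up) cp).
by rewrite -/(trans _ _) derive_trans_sum //; exact: Ud.
Qed.

Variable nabla : connection M.

Lemma cov0l (U : set M) (Y : vfield M) p c : open U -> smooth_vfield U Y -> U p -> dom c p ->
  nabla (fun _ _ => 0) Y p c = 0.
Proof.
move=> oU sY Up cp; have s0 := vfield0_smooth U.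
have := cov_addl nabla oU s0 s0 sY Up cp.
have -> : vfield_add (fun _ _ => 0) (fun _ _ => 0) = (fun _ _ => 0) :> vfield M.
  by apply/funext => q; apply/funext => e; rewrite /vfield_add addr0.
by rewrite /vfield_add => /eqP; rewrite -subr_eq0 opprD addrA subrr add0r oppr_eq0 => /eqP.
Qed.

Lemma cov0r (U : set M) (Y : vfield M) p c : open U -> smooth_vfield U Y -> U p -> dom c p ->
  nabla Y (fun _ _ => 0) p c = 0.
Proof.
move=> oU sY Up cp; have s0 := vfield0_smooth U.
have := cov_addr nabla oU sY s0 s0 Up cp.
have -> : vfield_add (fun _ _ => 0) (fun _ _ => 0) = (fun _ _ => 0) :> vfield M.
  by apply/funext => q; apply/funext => e; rewrite /vfield_add addr0.
by rewrite /vfield_add => /eqP; rewrite -subr_eq0 opprD addrA subrr add0r oppr_eq0 => /eqP.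
Qed.

Lemma cov_frame_suml (U : set M) d (f : 'I_m -> M -> R) (Y : vfield M) r p c : open U -> U `<=` dom d ->
  (forall i, smooth_fun U (f i)) -> smooth_vfield U Y -> U p -> dom c p ->
  nabla (frame_sum d r f) Y p c = \sum_(i <- r) f i p *: nabla (coord_vfield d i) Y p c.
Proof.
move=> oU Ud sf sY Up cp; elim: r => [|i r IH] /=; first by rewrite big_nil (cov0l oU).
have si := coord_vfield_smooth i oU Ud.
have ss := vfield_scale_smooth oU (sf i) si.
rewrite big_cons -IH (cov_addl nabla oU ss (frame_sum_smooth r oU Ud sf) sY Up cp) /vfield_add.
by rewrite (cov_scalel nabla oU (sf i) si sY Up cp).
Qed.

Lemma cov_frame_sumr (U : set M) d (f : 'I_m -> M -> R) (X : vfield M) r p c : open U -> U `<=` dom d ->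
  (forall i, smooth_fun U (f i)) -> smooth_vfield U X -> U p -> dom c p ->
  nabla X (frame_sum d r f) p c =
  \sum_(i <- r) (vfield_apply X (f i) p c *: coord_vfield d i p c + f i p *: nabla X (coord_vfield d i) p c).
Proof.
move=> oU Ud sf sX Up cp; elim: r => [|i r IH] /=; first by rewrite big_nil (cov0r oU).
have si := coord_vfield_smooth i oU Ud.
have ss := vfield_scale_smooth oU (sf i) si.
rewrite big_cons -IH (cov_addr nabla oU sX ss (frame_sum_smooth r oU Ud sf) Up cp) /vfield_add.
by rewrite (cov_leibniz nabla oU (sf i) sX si Up cp).
Qed.

Definition Gam c p (a b : 'rV[R]_m) : 'rV[R]_m :=
  \row_l \sum_mu \sum_nu christoffel nabla c l mu nu p * a 0 mu * b 0 nu.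

Lemma Gam_sum c p a b : Gam c p a b =
  \sum_mu \sum_nu (a 0 mu * b 0 nu) *: nabla (coord_vfield c mu) (coord_vfield c nu) p c.
Proof.
apply/rowP => l; rewrite mxE summxE; apply: eq_bigr => mu _; rewrite summxE; apply: eq_bigr => nu _.
by rewrite !mxE /christoffel; ring.
Qed.

(** Both fields are expanded in the coordinate frame of [d]. The Leibniz rule produces the
    derivative of the components of [Y], and the two linearities produce the Christoffel term. *)
Lemma cov_frame (U : set M) d (X Y : vfield M) p : open U -> U `<=` dom d ->
  smooth_vfield U X -> smooth_vfield U Y -> U p ->
  nabla X Y p d = 'D_(X p d) (fun x => Y (param d x) d) (coord d p) + Gam d p (X p d) (Y p d).
Proof.
move=> oU Ud sX sY Up; have dp := Ud p Up.
pose fX i q := X q d 0 i; pose fY i q := Y q d 0 i.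
have sfX i : smooth_fun U (fX i) := vfield_coord_smooth i oU Ud sX.
have sfY i : smooth_fun U (fY i) := vfield_coord_smooth i oU Ud sY.
have sX' := frame_sum_smooth (index_enum 'I_m) oU Ud sfX.
have sY' := frame_sum_smooth (index_enum 'I_m) oU Ud sfY.
rewrite (cov_local nabla oU sX sX sY sY' (fun _ _ _ _ => erefl) (vfield_frame Ud sY) Up dp).
rewrite (cov_frame_sumr _ oU Ud sfY sX Up dp) big_split /=; congr (_ + _).
  have dY : differentiable (fun x => Y (param d x) d) (coord d p).
    apply: (@C1_differentiable_rV _ _ _ (coord d @` (U `&` dom d))).
    - exact: chart_image_open.
    - exact: sY.2.
    - by exists p.
  apply/rowP => l; rewrite summxE.
  rewrite (bigD1 l) //= big1 ?addr0 => [|i il].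
    rewrite /coord_vfield -/(trans _ _) derive_trans_id // !mxE !eqxx mulr1.
    rewrite /vfield_apply -derive_coord //.
    by exact: diff_derivable.
  by rewrite /coord_vfield -/(trans _ _) derive_trans_id // !mxE eqxx eq_sym (negbTE il) mulr0.
rewrite Gam_sum exchange_big /=; apply: eq_bigr => nu _.
have snu := coord_vfield_smooth nu oU Ud.
rewrite (cov_local nabla oU sX sX' snu snu (vfield_frame Ud sX) (fun _ _ _ _ => erefl) Up dp).
rewrite (cov_frame_suml _ oU Ud sfX snu Up dp) scaler_sumr; apply: eq_bigr => mu _.
by rewrite scalerA mulrC.
Qed.

End Transition.

(** * Christoffel symbols and covariant derivatives along curves *)

Section Christoffel.
Context {R : realType} {m : nat} {M : manifold R m}.
Variable nabla : connection M.
Local Notation e_ i := (delta_mx 0 i).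
Local Notation Gam := (Gam nabla).
Implicit Types (c d e : chart M) (p : M).

Lemma GamDl c p a a' b : Gam c p (a + a') b = Gam c p a b + Gam c p a' b.
Proof.
apply/rowP => l; rewrite !mxE -big_split; apply: eq_bigr => mu _ /=.
by rewrite -big_split; apply: eq_bigr => nu _ /=; rewrite !mxE; ring.
Qed.

Lemma GamDr c p a b b' : Gam c p a (b + b') = Gam c p a b + Gam c p a b'.
Proof.
apply/rowP => l; rewrite !mxE -big_split; apply: eq_bigr => mu _ /=.
by rewrite -big_split; apply: eq_bigr => nu _ /=; rewrite !mxE; ring.
Qed.

Lemma GamZl c p k a b : Gam c p (k *: a) b = k *: Gam c p a b.
Proof.
apply/rowP => l; rewrite !mxE mulr_sumr; apply: eq_bigr => mu _ /=.
by rewrite mulr_sumr; apply: eq_bigr => nu _ /=; rewrite !mxE; ring.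
Qed.

Lemma GamZr c p k a b : Gam c p a (k *: b) = k *: Gam c p a b.
Proof.
apply/rowP => l; rewrite !mxE mulr_sumr; apply: eq_bigr => mu _ /=.
by rewrite mulr_sumr; apply: eq_bigr => nu _ /=; rewrite !mxE; ring.
Qed.

Lemma Gam_suml c p (I : Type) (r : seq I) (k : I -> R) (A : I -> 'rV[R]_m) b :
  Gam c p (\sum_(i <- r) k i *: A i) b = \sum_(i <- r) k i *: Gam c p (A i) b.
Proof.
elim: r => [|i r IH]; last by rewrite !big_cons GamDl GamZl IH.
by rewrite !big_nil -(scale0r (0 : 'rV[R]_m)) GamZl !scale0r.
Qed.

Lemma Gam_sumr c p (I : Type) (r : seq I) (k : I -> R) (A : I -> 'rV[R]_m) b :
  Gam c p b (\sum_(i <- r) k i *: A i) = \sum_(i <- r) k i *: Gam c p b (A i).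
Proof.
elim: r => [|i r IH]; last by rewrite !big_cons GamDr GamZr IH.
by rewrite !big_nil -(scale0r (0 : 'rV[R]_m)) GamZr !scale0r.
Qed.

Lemma christoffel_smooth c l mu nu :
  smooth_on (chart_range c) (fun x => christoffel nabla c l mu nu (param c x)).
Proof.
have oc := @dom_open _ _ M c; have sub : dom c `<=` dom c by [].
have [_ sN] := cov_smooth nabla oc (coord_vfield_smooth mu oc sub) (coord_vfield_smooth nu oc sub).
have E : coord c @` (dom c `&` dom c) = chart_range c by rewrite setIid.
move=> k; have := sN c k; rewrite E => h.
by apply: (@Ck_on_coord _ _ _ _ _ (fun x => nabla (coord_vfield c mu) (coord_vfield c nu) (param c x) c)) => //; exact: codom_open.
Qed.

Lemma Gam_smooth n k (U : set 'rV[R]_n) c (X A B : 'rV[R]_n -> 'rV[R]_m) : open U ->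
  (forall q, U q -> chart_range c (X q)) -> Ck_on k U X -> Ck_on k U A -> Ck_on k U B ->
  Ck_on k U (fun q => Gam c (param c (X q)) (A q) (B q)).
Proof.
move=> oU UX CX CA CB; apply: Ck_on_rV => // l.
apply: (@Ck_on_ext _ _ _ _ _ (fun q => \sum_mu \sum_nu
    christoffel nabla c l mu nu (param c (X q)) * A q 0 mu * B q 0 nu)) => //.
  by move=> q _; rewrite mxE.
apply: Ck_on_sum => // mu _; apply: Ck_on_sum => // nu _.
apply: Ck_on_M => //; last exact: Ck_on_coord.
apply: Ck_on_M => //; last exact: Ck_on_coord.
apply: (@Ck_on_comp _ _ _ k U (chart_range c) X (fun x => christoffel nabla c l mu nu (param c x))) => //.
  exact: codom_open.
exact: christoffel_smooth.
Qed.

(** In their own chart the coordinate fields have constant components, so their bracket vanishes. *)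
Lemma christoffel_sym c l mu nu p : torsion_free nabla -> dom c p ->
  christoffel nabla c l mu nu p = christoffel nabla c l nu mu p.
Proof.
move=> tf cp; have oc := @dom_open _ _ M c; have sub : dom c `<=` dom c by [].
have := tf _ _ _ oc (coord_vfield_smooth mu oc sub) (coord_vfield_smooth nu oc sub) p c cp cp.
have D0 i v : 'D_v (fun x => coord_vfield c i (param c x) c) (coord c p) = 0.
  rewrite -[RHS](@derive_cst _ _ _ (e_ i : 'rV[R]_m) (coord c p) v); apply: near_eq_derive.
  apply: filterS (trans_near cp cp) => x [cx dx].
  by rewrite /coord_vfield -/(trans _ _) derive_trans_id.
move=> h; have h0 : lie_bracket (coord_vfield c mu) (coord_vfield c nu) p c = 0.
  exact: etrans (congr2 (fun a b : 'rV[R]_m => a - b) (D0 _ _) (D0 _ _)) (subrr 0).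
exact: (congr1 (fun w : 'rV[R]_m => w 0 l) (subr0_eq (etrans h h0))).
Qed.

Lemma Gam_sym c p a b : torsion_free nabla -> dom c p -> Gam c p a b = Gam c p b a.
Proof.
move=> tf cp; apply/rowP => l; rewrite !mxE exchange_big /=.
apply: eq_bigr => nu _; apply: eq_bigr => mu _.
by rewrite (christoffel_sym _ _ _ tf cp); ring.
Qed.

(** Transformation law in a form free of inverse Jacobians: [cov_frame] in the chart [d] is applied
    to the coordinate fields of [c], whose covariant derivative transforms as a vector. *)
Lemma christoffel_trans c d p mu nu : dom c p -> dom d p ->
  'D_(nabla (coord_vfield c mu) (coord_vfield c nu) p c) (trans c d) (coord c p) =
  'D_(e_ mu) ('D_(e_ nu) (trans c d)) (coord c p) +
  Gam d p ('D_(e_ mu) (trans c d) (coord c p)) ('D_(e_ nu) (trans c d) (coord c p)).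
Proof.
move=> cp dp; pose U := dom c `&` dom d.
have oU : open U by apply: openI; exact: dom_open.
have Uc : U `<=` dom c by move=> q [].
have Ud : U `<=` dom d by move=> q [].
have Up : U p by [].
have sm := coord_vfield_smooth mu oU Uc; have sn := coord_vfield_smooth nu oU Uc.
have [tN _] := cov_smooth nabla oU sm sn.
have dn : differentiable ('D_(e_ nu) (trans c d)) (coord c p).
  apply: (@C1_differentiable_rV _ _ _ (coord c @` (dom d `&` dom c))).
  - exact: trans_open.
  - exact: ((@trans_smooth _ _ _ c d 2).2 nu).2.
  - exact: trans_dom.
have E : 'D_(coord_vfield c mu p d) (fun x => coord_vfield c nu (param d x) d) (coord d p) =
    'D_(e_ mu) ('D_(e_ nu) (trans c d)) (coord c p).
  have [_ h] := derive_trans_comp (coord_vfield c mu p d) dp cp dn; apply: etrans h _.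
  apply: (congr1 (fun v => 'D_v ('D_(e_ nu) (trans c d)) (coord c p))).
  exact: etrans (derive_trans_trans (e_ mu) cp dp cp) (derive_trans_id (e_ mu) cp).
exact: etrans (esym (tN p Up c d cp dp)) (etrans (cov_frame nabla oU Ud sm sn Up)
  (congr1 (fun w : 'rV[R]_m => w + _) E)).
Qed.

Lemma cov_alongE (g : R -> M) v t c : cov_along nabla g v t c =
  derive1 (v ^~ c) t + Gam c (g t) (velocity g t c) (v t c).
Proof. by apply/rowP => l; rewrite !mxE. Qed.

Lemma curve_dom_near (J : set R) (g : R -> M) c t : smooth_curve J g -> J t -> dom c (g t) ->
  \forall s \near t, dom c (g s).
Proof.
move=> [cg _] Jt ct; apply: (cg t Jt).
by apply: open_nbhs_nbhs; split=> //; exact: dom_open.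
Qed.

Lemma curve_is_derive (J : set R) (g : R -> M) c t : smooth_curve J g -> J t -> dom c (g t) ->
  is_derive t (1 : R) (coord c \o g) (velocity g t c).
Proof.
move=> [_ sg] Jt ct; rewrite /velocity derive1E; apply: derivableP.
exact: (sg c 0%N).
Qed.

Lemma velocity_tangent (J : set R) (g : R -> M) t : smooth_curve J g -> J t ->
  tangent_at (g t) (velocity g t).
Proof.
move=> sg Jt c d ct dt; rewrite -/(trans c d).
have dx := curve_is_derive sg Jt ct.
have dT : differentiable (trans c d) ((coord c \o g) t) by exact: trans_diff.
have [_ h] := is_derive_chain dT dx; apply: etrans (esym (deriveE _ dT)); rewrite -h.
rewrite /velocity derive1E; apply: near_eq_derive.
by apply: filterS (curve_dom_near sg Jt ct) => s cs /=; rewrite transE.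
Qed.

(** Differentiating the components of [v] in the chart [d] gives second derivatives of the
    transition map; [christoffel_trans] says that the Christoffel terms compensate them. *)
Lemma cov_along_tangent (J : set R) (g : R -> M) v t : open J -> smooth_curve J g ->
  (forall t, J t -> tangent_at (g t) (v t)) ->
  (forall c t, J t -> dom c (g t) -> derivable (v ^~ c) t (1 : R)) -> J t ->
  tangent_at (g t) (cov_along nabla g v t).
Proof.
move=> oJ sg tv dv Jt c d ct dt; rewrite -/(trans c d) !cov_alongE.
set x := coord c (g t).
pose D nu := 'D_(e_ nu) (trans c d).
have dT : differentiable (trans c d) x by exact: trans_diff.
have dD nu : differentiable (D nu) ((coord c \o g) t).
  apply: (@C1_differentiable_rV _ _ _ (coord c @` (dom d `&` dom c))).
  - exact: trans_open.
  - exact: ((@trans_smooth _ _ _ c d 2).2 nu).2.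
  - exact: trans_dom.
have dx := curve_is_derive sg Jt ct.
have dvc := derivableP (dv c t Jt ct).
have dvi nu : is_derive t (1 : R) (fun s => v s c 0 nu) (derive1 (v ^~ c) t 0 nu).
  by rewrite derive1E; exact: is_derive_component.
have DD nu : is_derive t (1 : R) (fun s => D nu (coord c (g s)))
    (\sum_mu velocity g t c 0 mu *: 'D_(e_ mu) (D nu) x).
  have := is_derive_chain (dD nu) dx; rewrite -deriveE //.
  by rewrite (derive_sum_e_rV _ (dD nu)).
have Dterm nu : is_derive t (1 : R) (fun s => v s c 0 nu *: D nu (coord c (g s)))
    (derive1 (v ^~ c) t 0 nu *: D nu x + v t c 0 nu *: (\sum_mu velocity g t c 0 mu *: 'D_(e_ mu) (D nu) x)).
  apply: is_derive_rV => j.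
  have dDj : is_derive t (1 : R) (fun s => D nu (coord c (g s)) 0 j)
     ((\sum_mu velocity g t c 0 mu *: 'D_(e_ mu) (D nu) x) 0 j) by exact: is_derive_component (DD nu).
  have := is_deriveM (dvi nu) dDj; rewrite addrC -![_ *: _]/(_ * _) => H.
  have E : (fun s => (v s c 0 nu *: D nu (coord c (g s))) 0 j) =
     (fun s => v s c 0 nu) * (fun s => D nu (coord c (g s)) 0 j).
    by apply/funext => s; rewrite fctE mxE.
  rewrite E; apply: is_derive_eq H _; rewrite [in RHS]mxE [in X in _ = X + _]mxE [in X in _ = _ + X]mxE.
  by rewrite [X in X + _]mulrC.
have Dsum : is_derive t (1 : R) (fun s => \sum_nu v s c 0 nu *: D nu (coord c (g s)))
   (\sum_nu (derive1 (v ^~ c) t 0 nu *: D nu x + v t c 0 nu *: (\sum_mu velocity g t c 0 mu *: 'D_(e_ mu) (D nu) x))).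
  have E : (fun s => \sum_nu v s c 0 nu *: D nu (coord c (g s))) =
     \sum_nu (fun s => v s c 0 nu *: D nu (coord c (g s))).
    by apply/funext => s; rewrite fct_sumE.
  by rewrite E; apply: is_derive_sum.
have Ew : derive1 (v ^~ d) t = \sum_nu (derive1 (v ^~ c) t 0 nu *: D nu x +
    v t c 0 nu *: (\sum_mu velocity g t c 0 mu *: 'D_(e_ mu) (D nu) x)).
  have [_ <-] := Dsum; rewrite derive1E; apply: near_eq_derive.
  have nJ : \forall s \near t, J s by apply: open_nbhs_nbhs.
  apply: filterS (near_and nJ (near_and (curve_dom_near sg Jt ct) (curve_dom_near sg Jt dt))) => s [Js [cs ds]].
  by rewrite (tv s Js c d cs ds) -/(trans c d) derive_trans_sum.
rewrite derive_transD // Ew.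
rewrite (derive_trans_sum _ ct dt) big_split /= -addrA; congr (_ + _).
rewrite (velocity_tangent sg Jt ct dt) (tv t Jt c d ct dt) -!/(trans c d).
rewrite [in X in Gam d _ X _](derive_trans_sum _ ct dt) [in X in Gam d _ _ X](derive_trans_sum _ ct dt).
rewrite Gam_sumr Gam_sum [RHS](_ : _ = \sum_nu \sum_mu (velocity g t c 0 mu * v t c 0 nu) *:
   'D_(nabla (coord_vfield c mu) (coord_vfield c nu) (g t) c) (trans c d) x); last first.
  rewrite deriveE // linear_sum exchange_big; apply: eq_bigr => mu _.
  rewrite linear_sum; apply: eq_bigr => nu _; by rewrite linearZ deriveE.
rewrite -big_split; apply: eq_bigr => nu _ /=.
rewrite Gam_suml !scaler_sumr -big_split; apply: eq_bigr => mu _ /=.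
by rewrite christoffel_trans // !scalerA scalerDr [v t c 0 nu * _]mulrC.
Qed.

End Christoffel.

(** * Geodesics *)

Section LineStrip.
Context {R : realType}.
Local Notation e_ i := (delta_mx 0 i).

Lemma line_strip (W : normedModType R) (T : set R) sg (f : R -> W) : open T -> smooth_on_line T f ->
  smooth_on (strip T sg) (fun q => f (q 0 0)).
Proof.
move=> oT sf k; elim: k f sf => [|k IH] f sf; have oS := @strip_open R T sg oT;
  have cf (q : 'rV[R]_2) : strip T sg q -> {for q, continuous (fun q : 'rV[R]_2 => f (q 0 0))}.
- move=> [Tq _]; apply: (@continuous_comp _ _ _ (fun q : 'rV[R]_2 => q 0 0) f); first exact: coord_continuous.
  exact: derive_continuous (smooth_on_line_is_derive 0 sf Tq).
- by split.
- move=> [Tq _]; apply: (@continuous_comp _ _ _ (fun q : 'rV[R]_2 => q 0 0) f); first exact: coord_continuous.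
  exact: derive_continuous (smooth_on_line_is_derive 0 sf Tq).
apply: (@Ck_on_2 _ _ _ _ _ (fun q => derive1 f (q 0 0)) (fun _ => 0)) => //.
- by move=> q [Tq _]; apply: (@partial0 R W (fun a _ => f a)); exact: (smooth_on_line_is_derive 0 sf Tq).
- by move=> q _; apply: (@partial1 R W (fun a _ => f a)); exact: is_derive_cst.
- by apply: IH; exact: smooth_on_line_derive1.
- exact: Ck_on_cst.
Qed.

(** Converse of [line_strip]. Smoothness along a curve can thus be proved with the closure
    properties of [Ck_on], by viewing the curve as a map on a planar strip that ignores the second
    variable. *)
Lemma strip_line (W : normedModType R) (T : set R) sg (f : R -> W) : 0 < sg -> open T ->
  smooth_on (strip T sg) (fun q => f (q 0 0)) -> smooth_on_line T f.
Proof.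
move=> sg0 oT Cf; have oS := @strip_open R T sg oT.
have E (t : R) : ((0 : 'rV[R]_2) + t *: e_ 0) 0 0 = t by rewrite !mxE /= add0r mulr1.
have E1 (t : R) : ((0 : 'rV[R]_2) + t *: e_ 0) 0 1 = 0 by rewrite !mxE /= add0r mulr0.
have := @smooth_on_line_slice R 2 W (strip T sg) (fun q => f (q 0 0)) 0 0 oS Cf.
have -> : [set t : R | strip T sg (0 + t *: e_ 0)] = T.
  apply/seteqP; split => t /=; rewrite /strip /= E E1; first by case.
  by rewrite normr0.
by apply: smooth_on_line_ext => // t _; rewrite E.
Qed.

Lemma smooth_on_line_sub (W : normedModType R) (T T' : set R) (f : R -> W) :
  T' `<=` T -> smooth_on_line T f -> smooth_on_line T' f.
Proof. by move=> TT sf k t /TT; exact: sf. Qed.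

Lemma smooth_on_line_comp n p (T : set R) (V : set 'rV[R]_n) (x : R -> 'rV[R]_n) (f : 'rV[R]_n -> 'rV[R]_p) :
  open T -> open V -> (forall t, T t -> V (x t)) -> smooth_on_line T x -> smooth_on V f ->
  smooth_on_line T (fun t => f (x t)).
Proof.
move=> oT oV TV sx Cf; apply: (strip_line ltr01 oT) => k.
apply: (@Ck_on_comp_rV _ _ _ _ k _ V (fun q : 'rV[R]_2 => x (q 0 0)) f) => //.
- exact: strip_open.
- by move=> q [Tq _]; exact: TV.
- exact: line_strip.
Qed.

Lemma is_derive_translate (W : normedModType R) (f : R -> W) (s r : R) df :
  is_derive (s + r) (1 : R) f df -> is_derive r (1 : R) (fun r => f (s + r)) df.
Proof.
move=> /is_derive_epsP H; apply/is_derive_epsP => e /H[d d0 Hd]; exists d => // h h0 hd.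
by have := Hd h h0 hd; rewrite addrCA.
Qed.

Lemma left_limit_eq (X : topologicalType) (h1 h2 : R -> X) (s : R) : hausdorff_space X -> 0 < s ->
  {for s, continuous h1} -> {for s, continuous h2} ->
  (forall r, 0 <= r < s -> h1 r = h2 r) -> h1 s = h2 s.
Proof.
move=> hX s0 c1 c2 H; apply: hX => A B nA nB.
have [d d0 Hd] := (nbhs_norm_ltP s _).1 (near_and (c1 _ nA) (c2 _ nB)).
have [m0 [ms md]] : exists m : R, 0 <= m < s /\ `|m - s| < d.
  exists (s - Num.min s d / 2).
  have a0 : 0 < Num.min s d by rewrite lt_min s0.
  have as_ : Num.min s d <= s by rewrite ge_min lexx.
  have ad : Num.min s d <= d by rewrite ge_min lexx orbT.
  move: (Num.min s d) a0 as_ ad => a a0 as_ ad; split; first by apply/andP; split; lra.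
  by rewrite addrAC subrr add0r normrN gtr0_norm; lra.
by have [h1A h2B] := Hd _ md; exists (h1 m0); split=> //; rewrite /= H.
Qed.

End LineStrip.

(** * Geodesics as solutions of a first-order system *)

Section Geodesics.
Context {R : realType} {m : nat} {M : manifold R m}.
Variable nabla : connection M.
Local Notation e_ i := (delta_mx 0 i).
Local Notation Gam := (Gam nabla).
Implicit Types (c d : chart M) (J : set R) (g : R -> M).

Definition chart_times J g c : set R := [set t | J t /\ dom c (g t)].

Lemma chart_times_open J g c : open J -> smooth_curve J g -> open (chart_times J g c).
Proof.
move=> oJ sg; rewrite openE => t [Jt ct].
exact: (near_and (open_nbhs_nbhs (conj oJ Jt)) (curve_dom_near sg Jt ct)).
Qed.

Lemma smooth_curve_coord J g c : smooth_curve J g -> smooth_on_line (chart_times J g c) (coord c \o g).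
Proof. by move=> [_ sg] k t [Jt ct]; exact: sg. Qed.

Lemma cov_along_smooth J g v c : open J -> smooth_curve J g ->
  smooth_on_line (chart_times J g c) (v ^~ c) ->
  smooth_on_line (chart_times J g c) (cov_along nabla g v ^~ c).
Proof.
move=> oJ sg sv; have oT := chart_times_open (c := c) oJ sg.
have sx := smooth_curve_coord (c := c) sg.
apply: (strip_line ltr01 oT) => k; have oS := @strip_open R _ 1 oT.
apply: (@Ck_on_ext _ _ _ _ _ (fun q => derive1 (v ^~ c) (q 0 0) +
   Gam c (param c (coord c (g (q 0 0)))) (velocity g (q 0 0) c) (v (q 0 0) c))) => //.
  by move=> q [[_ cq] _]; rewrite cov_alongE coordK.
apply: Ck_on_D => //; first exact: line_strip (smooth_on_line_derive1 sv) k.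
apply: (@Gam_smooth _ _ _ _ _ _ _ c (fun q : 'rV[R]_2 => coord c (g (q 0 0)))
  (fun q : 'rV[R]_2 => velocity g (q 0 0) c) (fun q : 'rV[R]_2 => v (q 0 0) c)) => //.
- by move=> q [[_ cq] _]; exact: coord_range.
- exact: line_strip sx k.
- exact: line_strip (smooth_on_line_derive1 sx) k.
- exact: line_strip sv k.
Qed.

Lemma cov_iterP J g k : open J -> smooth_curve J g ->
  (forall t, J t -> tangent_at (g t) (cov_iter nabla g k.+1 t)) /\
  forall c, smooth_on_line (chart_times J g c) (cov_iter nabla g k.+1 ^~ c).
Proof.
move=> oJ sg; rewrite /cov_iter /=; elim: k => [|k [IHt IHs]].
  split; first by move=> t; exact: velocity_tangent.
  by move=> c; exact: smooth_on_line_derive1 (smooth_curve_coord (c := c) sg).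
split=> [t Jt|c]; rewrite iterS; last exact: cov_along_smooth.
have dv c s : J s -> dom c (g s) -> derivable (iter k (cov_along nabla g) (velocity g) ^~ c) s (1 : R).
  by move=> Js cs; have [] := smooth_on_line_is_derive 0 (IHs c) (conj Js cs).
exact: (cov_along_tangent nabla oJ sg IHt dv Jt).
Qed.

Lemma derive_trans_lin c d (p : M) (I : Type) (r : seq I) (k : I -> R) (v : I -> 'rV[R]_m) :
  dom c p -> dom d p -> 'D_(\sum_(i <- r) k i *: v i) (trans c d) (coord c p) =
  \sum_(i <- r) k i *: 'D_(v i) (trans c d) (coord c p).
Proof.
move=> cp dp; elim: r => [|i r IH]; first by rewrite !big_nil; exact: derive_trans0.
by rewrite !big_cons derive_transD // derive_transZ // IH.
Qed.

(** A linear relation between tangent vectors in one chart holds in all charts, by linearity of the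
    change of components. *)
Lemma lin_indep_chart (p : M) (vs : seq (components M)) c : dom c p ->
  (forall i, (i < size vs)%N -> tangent_at p (nth (fun=> 0) vs i)) -> lin_indep p vs ->
  forall a : 'I_(size vs) -> R, \sum_(i < size vs) a i *: nth (fun=> 0) vs i c = 0 -> forall i, a i = 0.
Proof.
move=> cp tv li a a0; apply: li => d dp.
have dT := trans_diff cp dp.
have -> : \sum_(i < size vs) a i *: nth (fun=> 0) vs i d = 'D_(0) (trans c d) (coord c p).
  rewrite -[X in 'D_X _ _]a0 derive_trans_lin //; apply: eq_bigr => i _.
  by rewrite (tv i (ltn_ord i) c d cp dp).
exact: derive_trans0.
Qed.

Definition phase_dom c : set 'rV[R]_(m + m) := [set z | chart_range c (lsubmx z)].

(** The geodesic equation in the chart [c], as a first-order system for position and velocity. *)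
Definition spray c (z : 'rV[R]_(m + m)) : 'rV[R]_(m + m) :=
  row_mx (rsubmx z) (- Gam c (param c (lsubmx z)) (rsubmx z) (rsubmx z)).

Definition phase g c (t : R) : 'rV[R]_(m + m) := row_mx (coord c (g t)) (velocity g t c).

Lemma phase_dom_open c : open (phase_dom c).
Proof.
have cl (z : 'rV[R]_(m + m)) : setT z -> {for z, continuous (@lsubmx R 1 m m)}.
  have Cl : Ck_on 0 setT (@lsubmx R 1 m m).
    by apply: (@Ck_on_lsubmx _ _ _ _ _ _ id); [exact: openT|exact: Ck_on_id].
  exact: Ck_on_cont Cl.
rewrite openE => z cz; apply: (cl z I).
exact: open_nbhs_nbhs (conj (@codom_open _ _ M c) cz).
Qed.

Lemma spray_smooth c : smooth_on (phase_dom c) (spray c).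
Proof.
move=> k; have oP := @phase_dom_open c.
have Cl : Ck_on k (phase_dom c) (@lsubmx R 1 m m).
  by apply: (@Ck_on_lsubmx _ _ _ _ _ _ id) => //; exact: Ck_on_id.
have Cr : Ck_on k (phase_dom c) (@rsubmx R 1 m m).
  by apply: (@Ck_on_rsubmx _ _ _ _ _ _ id) => //; exact: Ck_on_id.
apply: Ck_on_row_mx => //; apply: Ck_on_N => //.
by apply: (@Gam_smooth _ _ _ _ _ _ _ c (@lsubmx R 1 m m) (@rsubmx R 1 m m) (@rsubmx R 1 m m)).
Qed.

Lemma velocity_is_derive J g c t : open J -> smooth_curve J g -> J t -> dom c (g t) ->
  is_derive t (1 : R) (velocity g ^~ c) (derive1 (velocity g ^~ c) t).
Proof.
move=> oJ sg Jt ct; have [_ sv] := cov_iterP 0 oJ sg.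
exact: (smooth_on_line_is_derive 0 (sv c) (conj Jt ct)).
Qed.

Lemma geodesic_phase J g c t : open J -> geodesic nabla J g -> J t -> dom c (g t) ->
  phase_dom c (phase g c t) /\ is_derive t (1 : R) (phase g c) (spray c (phase g c t)).
Proof.
move=> oJ [sg gg] Jt ct; split.
  by rewrite /phase_dom /= /phase row_mxKl; exact: coord_range.
rewrite /spray /phase row_mxKl row_mxKr coordK //.
apply: (@is_derive_row_mx R m m (coord c \o g) (velocity g ^~ c)).
  exact: curve_is_derive sg Jt ct.
have := gg t c Jt ct; rewrite cov_alongE => /addr0_eq E.
rewrite -E opprK.
exact: velocity_is_derive oJ sg Jt ct.
Qed.

Lemma solves_shift n (Om : set 'rV[R]_n) F S (y : R -> 'rV[R]_n) s : solves Om F S y ->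
  forall r, `|s + r| < S -> is_derive r (1 : R) (fun r => y (s + r)) (F (y (s + r))).
Proof.
move=> Hy r rS; have [_ dy] := Hy _ rS; exact: is_derive_translate.
Qed.

(* Only the chart [c] is needed, because the solution [y] of the geodesic
   equation never leaves it. *)
Lemma geodesic_agree_dir c (y : R -> 'rV[R]_(m + m)) S J g (e : R) : `|e| = 1 ->
  solves (phase_dom c) (spray c) S y -> open J -> is_interval J -> J 0 -> geodesic nabla J g ->
  dom c (g 0) -> phase g c 0 = y 0 ->
  forall s0, 0 <= s0 -> s0 < S -> J (e * s0) ->
    g (e * s0) = param c (lsubmx (y (e * s0))).
Proof.
move=> e1 Hy oJ iJ J0 gg c0 y0 s0 s00 s0S Js0.
pose P s := dom c (g (e * s)) /\ phase g c (e * s) = y (e * s).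
have PE s : P s -> g (e * s) = param c (lsubmx (y (e * s))).
  by move=> [cs <-]; rewrite row_mxKl coordK.
have inJ s : 0 <= s <= s0 -> J (e * s) /\ `|e * s| < S.
  move=> /andP[s1 s2]; split; last by rewrite normrM e1 mul1r ger0_norm // (le_lt_trans s2).
  have [ep|en] := leP 0 e.
    have E1 : e = 1 by rewrite -e1 ger0_norm.
    by apply: (iJ _ _ J0 Js0); rewrite E1 !mul1r s1 s2.
  have E1 : e = -1 by rewrite -[e]opprK -(ltr0_norm en) e1.
  by apply: (iJ _ _ Js0 J0); rewrite E1 !mulN1r lerN2 oppr_le0 s1 s2.
apply: (PE); apply: (@real_induction R P s0); last by rewrite s00 lexx.
move=> s sI IH; have [Js sS] := inJ s sI.
have [Oy dy] := Hy _ sS.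
have cy : {for s, continuous (fun r => y (e * r))}.
  apply: (@continuous_comp _ _ _ (fun r => e * r) y); first exact: mulrl_continuous.
  exact: derive_continuous dy.
have cg : {for s, continuous (fun r => g (e * r))}.
  apply: (@continuous_comp _ _ _ (fun r => e * r) g); first exact: mulrl_continuous.
  exact: gg.1.1.
have Ps : P s.
  have /andP[s1 s2] := sI.
  have [s_0|sp] := eqVneq s 0.
    by rewrite /P s_0 mulr0.
  have sp' : 0 < s by rewrite lt_def sp.
  (* The geodesic and the lifted solution agree before [s]. Limits being unique in a Hausdorff
     space, they agree at [s], and this is what keeps [g] in the chart there. *)
  have gs : g (e * s) = param c (lsubmx (y (e * s))).
    apply: (@left_limit_eq R M _ (fun r => param c (lsubmx (y (e * r)))) s (@carrier_hausdorff _ _ M) sp' cg).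
      have cl : {for s, continuous (fun r => lsubmx (y (e * r)))}.
        apply: continuous_rV => j.
        have -> : (fun r => lsubmx (y (e * r)) 0 j) = (fun r => y (e * r) 0 (lshift m j)).
          by apply/funext => r; rewrite mxE.
        apply: (@continuous_comp _ _ _ (fun r => y (e * r)) (fun z : 'rV[R]_(m + m) => z 0 (lshift m j)) _ cy).
        exact: coord_continuous.
      by apply: (@continuous_comp _ _ _ (fun r => lsubmx (y (e * r))) (param c) _ cl); exact: param_continuous.
    by move=> r rs; exact: PE (IH r rs).
  have cs : dom c (g (e * s)) by rewrite gs; exact: param_dom.
  split=> //.
  have [_ dp] := geodesic_phase oJ gg Js cs.
  have hN : hausdorff_space ('rV[R]_(m + m) : normedModType R) by exact: norm_hausdorff.
  apply: (@left_limit_eq R _ (fun r => phase g c (e * r)) (fun r => y (e * r)) s hN sp') => //.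
  - apply: (@continuous_comp _ _ _ (fun r => e * r) (phase g c)); first exact: mulrl_continuous.
    exact: derive_continuous dp.
  - by move=> r /IH[].
have [cs ps] := Ps.
have nT : \forall r \near e * s, [set r | J r /\ dom c (g r)] r.
  exact: near_and (open_nbhs_nbhs (conj oJ Js)) (curve_dom_near gg.1 Js cs).
have [d1 d10 H1] := (nbhs_norm_ltP _ _).1 nT.
have [d2 d20 H2] := (nbhs_norm_ltP (e * s) [set r : R | `|r| < S]).1 (open_interval_near sS).
have d0 : 0 < Num.min d1 d2 by rewrite lt_min d10.
have loc (r : R) : `|r| < Num.min d1 d2 -> [/\ J (e * s + r), dom c (g (e * s + r)) & `|e * s + r| < S].
  rewrite lt_min => /andP[r1 r2].
  have E : e * s + r - e * s = r by rewrite addrAC subrr add0r.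
  by have [] := H1 (e * s + r); rewrite ?E // => Jr cr; split=> //; apply: H2; rewrite E.
(* Both curves, translated to start at time [e * s], solve the system, and local uniqueness extends
   the agreement beyond [s]. *)
have S1 : solves (phase_dom c) (spray c) (Num.min d1 d2) (fun r => phase g c (e * s + r)).
  move=> r /loc[Jr cr _]; have [h1 h2] := geodesic_phase oJ gg Jr cr.
  exact: (conj h1 (is_derive_translate h2)).
have S2 : solves (phase_dom c) (spray c) (Num.min d1 d2) (fun r => y (e * s + r)).
  by move=> r /loc[_ _ rS]; split; [exact: (Hy _ rS).1|exact: solves_shift Hy r rS].
have U := ode_local_unique d0 (@phase_dom_open c) (@spray_smooth c 1) S1 S2.
have {}U (r : R) : `|r| < Num.min d1 d2 -> phase g c (e * s + r) = y (e * s + r).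
  by apply: U; rewrite addr0.
exists (Num.min d1 d2) => // r /andP[r0 rs0] rd.
have [rs|rs] := ltP r s; first by apply: IH; rewrite r0.
have rr : `|e * (r - s)| < Num.min d1 d2.
  by rewrite normrM e1 mul1r ger0_norm ?subr_ge0 // ltrBlDl.
have E : e * s + e * (r - s) = e * r by rewrite -mulrDr addrC subrK.
have := U _ rr; rewrite E => U'.
by have [_ ? _] := loc _ rr; split=> //; rewrite -E.
Qed.

Lemma geodesic_agree c (y : R -> 'rV[R]_(m + m)) S J g : 
  solves (phase_dom c) (spray c) S y -> open J -> is_interval J -> J 0 -> geodesic nabla J g ->
  dom c (g 0) -> phase g c 0 = y 0 ->
  forall s, `|s| < S -> J s -> g s = param c (lsubmx (y s)).
Proof.
move=> Hy oJ iJ J0 gg c0 y0 s sS Js; have [s0|s0] := leP 0 s.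
  have := @geodesic_agree_dir c y S J g 1 (normr1 _) Hy oJ iJ J0 gg c0 y0 s s0.
  by rewrite mul1r; apply=> //; move: sS; rewrite ger0_norm.
have e1 : `|(-1 : R)| = 1 by rewrite normrN normr1.
have s0' : 0 <= - s by rewrite oppr_ge0 ltW.
have := @geodesic_agree_dir c y S J g (-1) e1 Hy oJ iJ J0 gg c0 y0 (- s) s0'.
by rewrite mulrNN mul1r; apply=> //; move: sS; rewrite ltr0_norm.
Qed.

(** The solution is viewed as a family constant in the parameter [t], to which [ode_smooth]
    applies. *)
Lemma solves_smooth c S y : 0 < S -> solves (phase_dom c) (spray c) S y ->
  smooth_on_line [set s | `|s| < S] y.
Proof.
move=> S0 Hy.
have Cy k : Ck_on k (strip (setT : set R) S) (uncurry2 (fun _ : R => y)).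
  have sc : smooth_on_line (setT : set R) ((fun _ : R => y) ^~ 0).
    move=> l t _; have [-> | ->] : derive1n l (fun _ : R => y 0) = cst (y 0) \/ derive1n l (fun _ : R => y 0) = cst 0.
    - elim: l => [|l [IH|IH]]; [by left| |]; right; rewrite derive1nS IH; apply/funext => r;
        rewrite derive1E; exact: derive_cst.
    - exact: derivable_cst.
    - exact: derivable_cst.
  exact: (@ode_smooth R k _ (phase_dom c) (spray c) setT S (fun _ => y)
    (@phase_dom_open c) (@spray_smooth c) openT (fun _ _ => Hy) sc).
have := @smooth_on_line_slice R 2 _ _ (uncurry2 (fun _ : R => y)) 0 1 (strip_open (sg := S) openT) Cy.
have E (t : R) : ((0 : 'rV[R]_2) + t *: e_ 1) 0 1 = t by rewrite !mxE /= add0r mulr1.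
have -> : [set t : R | strip (setT : set R) S (0 + t *: e_ 1)] = [set s | `|s| < S].
  by apply/seteqP; split => t /=; rewrite /strip /= E; [case|].
apply: smooth_on_line_ext; first exact: abs_open.
by move=> t _; rewrite /uncurry2 E.
Qed.

Lemma solves_geodesic c S y : 0 < S -> solves (phase_dom c) (spray c) S y ->
  geodesic nabla [set s | `|s| < S] (fun s => param c (lsubmx (y s))) /\
  forall s, `|s| < S -> phase (fun s => param c (lsubmx (y s))) c s = y s.
Proof.
move=> S0 Hy; set J := [set s : R | `|s| < S]; set g := fun s => param c (lsubmx (y s)).
have oJ : open J by exact: abs_open.
have sy := solves_smooth S0 Hy.
have oP := @phase_dom_open c.
have sx : smooth_on_line J (fun s => lsubmx (y s)).
  apply: (smooth_on_line_comp oJ oP _ sy) => [s Js|k]; first exact: (Hy s Js).1.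
  by apply: (@Ck_on_lsubmx _ _ _ _ _ _ id) => //; exact: Ck_on_id.
have rx s : J s -> chart_range c (lsubmx (y s)) by move=> Js; exact: (Hy s Js).1.
have gc s : J s -> dom c (g s) by move=> /rx; exact: param_dom.
have sg : smooth_curve J g.
  split=> [s Js|d k s Js ds].
    apply: (@continuous_comp _ _ _ (fun s => lsubmx (y s)) (param c)).
      exact: derive_continuous (smooth_on_line_is_derive 0 sx Js).
    by apply: param_continuous; exact: rx.
  pose T := [set s | J s /\ (coord c @` (dom d `&` dom c)) (lsubmx (y s))].
  have ot := @trans_open _ _ M c d.
  have oT : open T.
    apply: (open_preimage oJ ot) => r Jr.
    exact: derive_continuous (smooth_on_line_is_derive 0 sx Jr).
  have sT : smooth_on_line T (coord d \o g).
    have H : smooth_on_line T (fun s => trans c d (lsubmx (y s))).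
      apply: (smooth_on_line_comp oT ot) => [r []//||]; last exact: trans_smooth.
      by apply: smooth_on_line_sub sx => r [].
    exact: H.
  apply: sT; split=> //; apply/chart_imageE; split=> //; exact: rx.
have cgE s : J s -> coord c (g s) = lsubmx (y s) by move=> /rx; exact: paramK.
have nJ s : J s -> \forall r \near s, J r by move=> Js; exact: open_nbhs_nbhs.
have dy s : J s -> is_derive s (1 : R) (fun s => lsubmx (y s)) (rsubmx (y s)) /\
    is_derive s (1 : R) (fun s => rsubmx (y s)) (- Gam c (g s) (rsubmx (y s)) (rsubmx (y s))).
  move=> Js; have [_ d] := Hy s Js; split; apply: is_derive_rV => j.
    have := is_derive_component (lshift m j) d; rewrite /spray row_mxEl.
    have -> // : (fun r => y r 0 (lshift m j)) = (fun r => lsubmx (y r) 0 j).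
    by apply/funext => r; rewrite mxE.
  have := is_derive_component (rshift m j) d; rewrite /spray row_mxEr.
  have -> // : (fun r => y r 0 (rshift m j)) = (fun r => rsubmx (y r) 0 j).
  by apply/funext => r; rewrite mxE.
have vE s : J s -> velocity g s c = rsubmx (y s).
  move=> Js; rewrite /velocity derive1E; have [[_ <-] _] := dy s Js.
  by apply: near_eq_derive; apply: filterS (nJ s Js) => r /cgE.
have c0 s : J s -> cov_along nabla g (velocity g) s c = 0.
  move=> Js; rewrite cov_alongE vE // derive1E.
  have -> : 'D_1 (velocity g ^~ c) s = - Gam c (g s) (rsubmx (y s)) (rsubmx (y s)).
    by have [_ [_ <-]] := dy s Js; apply: near_eq_derive; apply: filterS (nJ s Js) => r /vE.
  exact: addNr.
split; last by move=> s Js; rewrite /phase cgE // vE // hsubmxK.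
split=> // s d Js ds.
(* The acceleration vanishes in the chart [c] by the equation; being a tangent vector, it vanishes
   in every chart [d]. *)
have h := (cov_iterP 1 oJ sg).1 s Js c d (gc s Js) ds.
apply: etrans h _.
rewrite [cov_iter _ _ _ _ _](c0 s Js); exact: derive_trans0 (gc s Js) ds.
Qed.

(** [xget] returns the right point because it is reached by a geodesic ([solves_geodesic]) and is
    the only one reached ([geodesic_agree]). *)
Lemma geodesic_flowE c (S : R) (y : R -> 'rV[R]_(m + m)) (x : M) (v : components M) s :
  0 < S -> solves (phase_dom c) (spray c) S y -> dom c x -> tangent_at x v ->
  y 0 = row_mx (coord c x) (v c) -> `|s| < S ->
  geodesic_flow nabla x v s = param c (lsubmx (y s)).
Proof.
move=> S0 Hy cx tv y0 sS; have [gg gp] := solves_geodesic S0 Hy.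
have J0 : `|(0 : R)| < S by rewrite normr0.
have g0 : param c (lsubmx (y 0)) = x by rewrite y0 row_mxKl coordK.
apply: xget_unique.
  exists [set s | `|s| < S], (fun s => param c (lsubmx (y s))); split=> //.
  - split; first exact: abs_open.
    move=> a b /=; rewrite !ltr_norml => /andP[a1 a2] /andP[b1 b2] z /andP[az zb].
    by rewrite ltr_norml (lt_le_trans a1 az) (le_lt_trans zb b2).
  - split=> // d dx.
    have v0 : velocity (fun s => param c (lsubmx (y s))) 0 c = v c.
      have := gp 0 J0; rewrite y0 => /(congr1 rsubmx); by rewrite !row_mxKr.
    have tg := velocity_tangent gg.1 J0; rewrite g0 in tg.
    by rewrite (tg c d cx dx) v0 (tv c d cx dx).
move=> _ [J [g [[oJ iJ] [J0' Js] gJ [g0' vg] <-]]].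
apply: (@geodesic_agree c y S J g Hy oJ iJ J0' gJ) => //; rewrite ?g0' //.
by rewrite /phase g0' vg // y0.
Qed.

Lemma tangent_surfaceE (I : set R) (gamma : R -> M) c (t0 : R) : open I -> smooth_curve I gamma ->
  I t0 -> dom c (gamma t0) ->
  exists (T : set R) (S : R) (u : R -> R -> 'rV[R]_(m + m)),
    [/\ open T /\ T t0, T `<=` chart_times I gamma c, 0 < S,
      forall t, T t -> solves (phase_dom c) (spray c) S (u t) /\ u t 0 = phase gamma c t &
      (forall k, Ck_on k (strip T S) (uncurry2 u)) /\
      forall q : euclid R 2, strip T S q ->
        tangent_surface nabla gamma q = param c (lsubmx (uncurry2 u q))].
Proof.
move=> oI sg It0 ct0.
have oP := @phase_dom_open c; have sP := @spray_smooth c.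
have P0 : phase_dom c (phase gamma c t0).
  by rewrite /phase_dom /= /phase row_mxKl; exact: coord_range.
have [r [S [r0 S0 Hex]]] := ode_exists oP (sP 1%N) P0.
have oT0 := chart_times_open (c := c) oI sg.
have sx := smooth_curve_coord (c := c) sg.
have sph : smooth_on_line (chart_times I gamma c) (phase gamma c).
  exact: smooth_on_line_row_mx oT0 sx (smooth_on_line_derive1 sx).
pose T := [set t | chart_times I gamma c t /\ `|phase gamma c t - phase gamma c t0| < r].
have oT : open T.
  have cp t : chart_times I gamma c t -> {for t, continuous (phase gamma c)}.
    by move=> Tt; exact: derive_continuous (smooth_on_line_is_derive 0 sph Tt).
  exact: (open_preimage oT0 (@open_norm_ball _ _ (phase gamma c t0) r) cp).
(* The solutions are chosen separately for each [t]; their joint smoothness comes from the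
   smoothness of the initial phase and [ode_smooth]. *)
have /choice[u Hu] : forall t, exists u : R -> 'rV[R]_(m + m), T t ->
    u 0 = phase gamma c t /\ solves (phase_dom c) (spray c) S u.
  move=> t; have [[_ tr]|nT] := pselect (T t); last by exists (fun=> 0).
  by have [u [h1 h2]] := Hex _ tr; exists u.
exists T, S, u; split=> //.
- by split=> //; split=> //; rewrite subrr normr0.
- by move=> t [].
- by move=> t /Hu[].
split=> [k|q [Tq Sq]].
  apply: (@ode_smooth R k _ (phase_dom c) (spray c) T S u oP sP oT) => [t /Hu[]//|].
  apply: (@smooth_on_line_ext _ _ _ (phase gamma c)) => //; first by move=> t /Hu[].
  by apply: smooth_on_line_sub sph => t [].
rewrite /tangent_surface /fst_coord /snd_coord /uncurry2.
have [[Iq cq] _] := Tq; have [u0 uS] := Hu _ Tq.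
exact: (geodesic_flowE S0 uS cq (velocity_tangent sg Iq) u0 Sq).
Qed.

End Geodesics.

(** * Mixed derivatives and local diffeomorphisms *)

Section Schwarz.
Context {R : realType}.
Local Notation e_ i := (delta_mx 0 i).

Let second_diff n (f : 'rV[R]_n -> R) p (i j : 'I_n) (h : R) :=
  f (p + h *: e_ i + h *: e_ j) - f (p + h *: e_ i) - (f (p + h *: e_ j) - f p).

Lemma mvt_from0 (f df : R -> R) (h : R) :
  (forall th, 0 <= th <= 1 -> is_derive (th * h) (1 : R) f (df (th * h))) ->
  exists2 th, 0 <= th <= 1 & f h - f 0 = h * df (th * h).
Proof.
move=> H; have [|th hth] := @mvt_increment R f df 0 h; last by rewrite !add0r; exists th.
by move=> th hth; rewrite add0r; exact: H.
Qed.

(** Two applications of the mean value theorem express the second difference as [h^2] times the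
    mixed partial at a nearby point. *)
Lemma second_diff_estimate n (U : set 'rV[R]_n) (f : 'rV[R]_n -> R) p i j (e : R) : open U -> smooth_on U f -> U p -> 0 < e ->
  exists2 d, 0 < d & forall h, 0 < h -> h < d ->
    `|second_diff f p i j h - h ^+ 2 * 'D_(e_ j) ('D_(e_ i) f) p| <= e * h ^+ 2.
Proof.
move=> oU Cf Up e0.
have C1 := ((Cf 1%N).2 i).1; have C2 := (((Cf 2%N).2 i).2.2 j).1.
have C3 := (((Cf 2%N).2 i).2.2 j).2.1 p Up.
have [d1 d10 H1] := (nbhs_norm_ltP _ _).1 (near_open oU Up).
have [d2 d20 H2] := (continuous_epsP _ _).1 C3 e e0.
exists (Num.min d1 d2 / 2); first by rewrite divr_gt0 // lt_min d10.
move=> h h0 hd.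
have near_p (a b : R) : 0 <= a <= 1 -> 0 <= b <= 1 -> `|p + (a * h) *: e_ i + (b * h) *: e_ j - p| < Num.min d1 d2.
  move=> /andP[a0 a1] /andP[b0 b1]; rewrite -[p + _ + _]addrA [p + _ - p]addrAC subrr add0r.
  apply: (le_lt_trans (ler_normD _ _)).
  have bnd (k : 'I_n) (x : R) : 0 <= x <= 1 -> `|(x * h) *: (e_ k : 'rV[R]_n)| <= h.
    move=> /andP[x0 x1]; rewrite normrZ ger0_norm; last by rewrite mulr_ge0 // ltW.
    apply: (@le_trans _ _ (x * h * 1)); first by rewrite ler_wpM2l ?norm_e // mulr_ge0 // ltW.
    by rewrite mulr1 ler_piMl // ltW.
  have a01 : 0 <= a <= 1 by rewrite a0.
  have b01 : 0 <= b <= 1 by rewrite b0.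
  apply: (le_lt_trans (lerD (bnd i a a01) (bnd j b b01))).
  by move: hd; move: (Num.min d1 d2) => D; lra.
have I0 : 0 <= (0 : R) <= 1 by rewrite lexx ler01.
have I1 : 0 <= (1 : R) <= 1 by rewrite lexx ler01.
have inU a b : 0 <= a <= 1 -> 0 <= b <= 1 -> U (p + (a * h) *: e_ i + (b * h) *: e_ j).
  by move=> ha hb; apply: H1; apply: lt_le_trans (near_p a b ha hb) _; rewrite ge_min lexx.
pose phi (r : R) := f (p + h *: e_ j + r *: e_ i) - f (p + r *: e_ i).
have Dphi th : 0 <= th <= 1 -> is_derive (th * h) (1 : R) phi
    ('D_(e_ i) f (p + h *: e_ j + (th * h) *: e_ i) - 'D_(e_ i) f (p + (th * h) *: e_ i)).
  move=> hth; apply: is_deriveB.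
    apply: is_derive_line; apply: C1.
    by have := inU th 1 hth I1; rewrite mul1r addrAC.
  apply: is_derive_line; apply: C1.
  by have := inU th 0 hth I0; rewrite mul0r scale0r addr0.
have [th hth E1] : exists2 th, 0 <= th <= 1 & phi h - phi 0 =
    h * ('D_(e_ i) f (p + h *: e_ j + (th * h) *: e_ i) - 'D_(e_ i) f (p + (th * h) *: e_ i)).
  exact: (mvt_from0 (df := fun r => 'D_(e_ i) f (p + h *: e_ j + r *: e_ i) - 'D_(e_ i) f (p + r *: e_ i)) Dphi).
pose psi (r : R) := 'D_(e_ i) f (p + (th * h) *: e_ i + r *: e_ j).
have Dpsi th' : 0 <= th' <= 1 -> is_derive (th' * h) (1 : R) psi
    ('D_(e_ j) ('D_(e_ i) f) (p + (th * h) *: e_ i + (th' * h) *: e_ j)).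
  by move=> hth'; apply: is_derive_line; apply: C2; exact: inU.
have [th' hth' E2] : exists2 th', 0 <= th' <= 1 & psi h - psi 0 =
    h * 'D_(e_ j) ('D_(e_ i) f) (p + (th * h) *: e_ i + (th' * h) *: e_ j).
  exact: (mvt_from0 (df := fun r => 'D_(e_ j) ('D_(e_ i) f) (p + (th * h) *: e_ i + r *: e_ j)) Dpsi).
have S1 : second_diff f p i j h = phi h - phi 0.
  rewrite /second_diff /phi scale0r !addr0 [p + h *: e_ i + _]addrAC.
  by move: (f _) (f _) (f _) (f _) => x y z w; ring.
have S2 : psi h - psi 0 = 'D_(e_ i) f (p + h *: e_ j + (th * h) *: e_ i) - 'D_(e_ i) f (p + (th * h) *: e_ i).
  by rewrite /psi scale0r addr0 [p + (th * h) *: e_ i + h *: e_ j]addrAC.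
have E3 : second_diff f p i j h = h ^+ 2 * 'D_(e_ j) ('D_(e_ i) f) (p + (th * h) *: e_ i + (th' * h) *: e_ j).
  by rewrite S1 E1 -S2 E2 mulrA expr2.
have h20 : 0 <= h ^+ 2 by rewrite sqr_ge0.
rewrite E3 -mulrBr normrM (ger0_norm h20) mulrC; apply: ler_wpM2r => //.
by apply: H2; apply: lt_le_trans (near_p th th' hth hth') _; rewrite ge_min lexx orbT.
Qed.

(** The second difference is symmetric in [i] and [j] and approximates both mixed partials times
    [h^2]. *)
Lemma schwarz n (U : set 'rV[R]_n) (f : 'rV[R]_n -> R) p i j : open U -> smooth_on U f -> U p ->
  'D_(e_ j) ('D_(e_ i) f) p = 'D_(e_ i) ('D_(e_ j) f) p.
Proof.
move=> oU Cf Up; apply/eqP; rewrite -subr_eq0 -normr_le0; apply/ler_addgt0Pr => e e0; rewrite add0r.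
have e2 : 0 < e / 2 by rewrite divr_gt0.
have [d1 d10 H1] := second_diff_estimate i j oU Cf Up e2.
have [d2 d20 H2] := second_diff_estimate j i oU Cf Up e2.
have [h [h0 hd1 hd2]] : exists h : R, [/\ 0 < h, h < d1 & h < d2].
  have m0 : 0 < Num.min d1 d2 by rewrite lt_min d10.
  have m1 : Num.min d1 d2 <= d1 by rewrite ge_min lexx.
  have m2 : Num.min d1 d2 <= d2 by rewrite ge_min lexx orbT.
  exists (Num.min d1 d2 / 2); move: (Num.min d1 d2) m0 m1 m2 => D m0 m1 m2; split; lra.
have := H2 h h0 hd2; have := H1 h h0 hd1.
have -> : second_diff f p j i h = second_diff f p i j h.
  by rewrite /second_diff [p + _ + (h *: e_ i)]addrAC; ring.
move: (second_diff _ _ _ _ _) ('D_(e_ j) _ p) ('D_(e_ i) _ p) => D a b k1 k2.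
have h20 : 0 < h ^+ 2 by rewrite exprn_gt0.
rewrite -(ler_pM2l h20) -[X in X * `|_|]gtr0_norm // -normrM.
have -> : h ^+ 2 * (a - b) = (D - h ^+ 2 * b) - (D - h ^+ 2 * a) by ring.
apply: (le_trans (ler_normB _ _)); apply: (le_trans (lerD k2 k1)).
by rewrite -mulrDl -splitr mulrC.
Qed.

End Schwarz.

(** * Local diffeomorphisms and their transfer to germs on manifolds *)

Section LocalDiffeo.
Context {R : realType}.
Local Notation e_ i := (delta_mx 0 i).

Definition local_diffeo n (f : 'rV[R]_n -> 'rV[R]_n) (x0 : 'rV[R]_n) (W : set 'rV[R]_n) :=
  exists (A B : set 'rV[R]_n) (g : 'rV[R]_n -> 'rV[R]_n),
    [/\ open A /\ open B, A x0 /\ A `<=` W, smooth_on A f /\ smooth_on B g,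
      forall x, A x -> B (f x) /\ g (f x) = x &
      forall y, B y -> A (g y) /\ f (g y) = y].

Lemma local_diffeo_restrict n f x0 (W W' : set 'rV[R]_n) : open W' -> W' x0 ->
  local_diffeo f x0 W -> local_diffeo f x0 W'.
Proof.
move=> oW' Wx [A [B [g [[oA oB] [Ax AW] [sf sg] fA gB]]]].
exists (A `&` W'), (B `&` g @^-1` W'), g; split.
- split; first exact: openI.
  by apply: open_preimage => // y By; exact: Ck_on_cont (sg 0%N) By.
- by split=> // x [].
- by split=> k; [apply: Ck_on_sub (sf k)|apply: Ck_on_sub (sg k)] => x [].
- by move=> x [/fA[Bx gx] Wx']; split=> //; split; rewrite /= ?gx.
- by move=> y [/gB[Ay fy] Wy]; split.
Qed.

Lemma local_diffeo_comp n (f g : 'rV[R]_n -> 'rV[R]_n) x0 (W W' : set 'rV[R]_n) :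
  local_diffeo f x0 W -> local_diffeo g (f x0) W' -> local_diffeo (g \o f) x0 W.
Proof.
move=> [A [B [f' [[oA oB] [Ax AW] [sf sf'] fA fB]]]] Hg.
have [C [D [g' [[oC oD] [Cx CB] [sg sg'] gC gD]]]] := local_diffeo_restrict oB (fA x0 Ax).1 Hg.
exists (A `&` f @^-1` C), D, (f' \o g'); split.
- by split=> //; apply: open_preimage => // y Ay; exact: Ck_on_cont (sf 0%N) Ay.
- by split=> // x [/AW].
- split=> k.
    apply: (@Ck_on_comp_rV _ _ _ _ k _ C f g) => //.
    + by apply: open_preimage => // y Ay; exact: Ck_on_cont (sf 0%N) Ay.
    + by move=> x [].
    + by apply: Ck_on_sub (sf k) => x [].
  apply: (@Ck_on_comp_rV _ _ _ _ k _ B g' f') => //.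
  by move=> y /gD[/CB].
- by move=> x [/fA[Bx fx] /gC[Dx gx]]; split=> //=; rewrite gx.
- move=> y /gD[Cy gy]; have [Ay fy] := fB _ (CB _ Cy).
  by split; [split|]; rewrite /= ?fy.
Qed.

Lemma unitmx_kernel n (A : 'M[R]_n) : (forall v : 'rV[R]_n, v *m A = 0 -> v = 0) -> A \in unitmx.
Proof.
move=> H; rewrite -row_free_unit -kermx_eq0; apply/rowV0P => v /sub_kermxP; exact: H.
Qed.

Lemma local_diffeo_jac n (f : 'rV[R]_n -> 'rV[R]_n) (U : set 'rV[R]_n) x0 : open U -> smooth_on U f -> U x0 ->
  (forall v, 'D_v f x0 = 0 -> v = 0) -> local_diffeo f x0 U.
Proof.
move=> oU sf Ux ker.
have df := C1_differentiable_rV oU (sf 1%N) Ux.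
have ju : jac f x0 \in unitmx.
  by apply: unitmx_kernel => v v0; apply: ker; rewrite jacE.
have [A [B [g [h1 h2 h3 h4 h5]]]] := inverse_function oU sf Ux ju.
by exists A, B, g; split=> //; split=> // k; case: h2 => _ AU; exact: Ck_on_sub AU (sf k).
Qed.

Lemma local_diffeo_global n (f g : 'rV[R]_n -> 'rV[R]_n) x0 : smooth_on setT f -> smooth_on setT g ->
  cancel f g -> cancel g f -> local_diffeo f x0 setT.
Proof.
by move=> sf sg fK gK; exists setT, setT, g; split=> //; split=> //; exact: openT.
Qed.

Lemma smooth_map_euclid n (U : set 'rV[R]_n) (h : 'rV[R]_n -> 'rV[R]_n) : smooth_on U h ->
  @smooth_map R n n (euclid R n) (euclid R n) U h.
Proof.
move=> sh; split; first by move=> p Up; exact: Ck_on_cont (sh 0%N) Up.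
move=> c d k; apply: Ck_on_sub (sh k).
by move=> _ [p [[Up _] _] <-].
Qed.

(** The target diffeomorphism is [T \o coord c]. Its smoothness in the other charts follows by
    composing with transition maps. *)
Lemma locally_diffeomorphic_chart m (M : manifold R m) (c : chart M) (f : euclid R 2 -> M) (p : 'rV[R]_2)
    (N : 'rV[R]_2 -> 'rV[R]_m) (sigma : 'rV[R]_2 -> 'rV[R]_2) (T : 'rV[R]_m -> 'rV[R]_m)
    (u : 'rV[R]_2 -> 'rV[R]_m) (W : set 'rV[R]_2) :
  open W -> W p -> (forall q, W q -> {for q, continuous u}) ->
  (forall q, W q -> chart_range c (u q) /\ f q = param c (u q)) ->
  local_diffeo sigma p W -> local_diffeo T (u p) (chart_range c) ->
  (forall q, W q -> T (u q) = N (sigma q)) ->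
  @locally_diffeomorphic R m m M (euclid R m) f p N (sigma p).
Proof.
move=> oW Wp cu fu Hs [A [B [T' [[oA oB] [Aup Ac] [sT sT'] AT BT]]]] TN.
have oW' : open (W `&` u @^-1` A) by exact: open_preimage.
have [U [U' [s' [[oU oU'] [Up UW] [ss ss'] Us U's]]]] := local_diffeo_restrict oW' (conj Wp Aup) Hs.
have oV : open (dom c `&` coord c @^-1` A).
  by apply: open_preimage oA _; [exact: dom_open|exact: Defs.coord_continuous].
exists U, U', (dom c `&` coord c @^-1` A), B, sigma, (T \o coord c).
have pA x : A x -> dom c (param c x) /\ coord c (param c x) = x.
  by move=> /Ac cx; split; [exact: param_dom|exact: paramK].
split.
- split.
    exists s'; split; [by []|exact: smooth_map_euclid|exact: smooth_map_euclid|exact: Us|exact: U's].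
  exists (param c \o T'); split.
  + by split.
  + split=> [x [cx Ax]|e d k].
      apply: (@continuous_comp _ _ _ (coord c) T); first exact: Defs.coord_continuous.
      exact: Ck_on_cont (sT 0%N) Ax.
    have oO := @chart_image_open _ _ M (dom c `&` coord c @^-1` A) e oV.
    apply: (@Ck_on_sub _ _ _ k (coord e @` ((dom c `&` coord c @^-1` A) `&` dom e))).
      by apply: image_subset => x [[Vx ex] _].
    apply: (@Ck_on_comp_rV _ _ _ _ k _ A (trans e c) T oO oA _ _ (sT k)).
      by move=> x /chart_imageE[_ [_ Ax]].
    by apply: Ck_on_sub (@trans_smooth _ _ _ e c k); apply: image_subset => x [[cx _] ex].
  + split=> [y By|d e k].
      apply: (@continuous_comp _ _ _ T' (param c)); first exact: Ck_on_cont (sT' 0%N) By.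
      by apply: param_continuous; apply: Ac; exact: (BT y By).1.
    have ot := @trans_open _ _ M c e.
    have oO : open (B `&` T' @^-1` (coord c @` (dom e `&` dom c))).
      by apply: open_preimage oB ot _ => y By; exact: Ck_on_cont (sT' 0%N) By.
    apply: (@Ck_on_sub _ _ _ k (B `&` T' @^-1` (coord c @` (dom e `&` dom c)))).
      move=> _ [y [[By _] ey] <-]; split=> //; apply/chart_imageE; split=> //.
      by apply: Ac; exact: (BT y By).1.
    apply: (@Ck_on_comp_rV _ _ _ _ k _ _ T' (trans c e) oO ot).
    * by move=> y [].
    * by apply: Ck_on_sub (sT' k) => y [].
    * exact: trans_smooth.
  + by move=> x [cx Ax]; have [Bx Tx] := AT _ Ax; split=> //=; rewrite Tx coordK.
  + move=> y By; have [Ay Ty] := BT y By; have [h1 h2] := pA _ Ay.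
    by split; [split=> //=; rewrite h2|rewrite /= h2].
- by split.
- have [h1 h2] := fu p Wp; split; last by rewrite /= h2 paramK // TN.
  by rewrite h2; split; [exact: param_dom|rewrite /= paramK].
- move=> q /UW[Wq Aq]; have [h1 h2] := fu q Wq; split; last by rewrite /= h2 paramK // TN.
  by rewrite h2; split; [exact: param_dom|rewrite /= paramK].
Qed.

End LocalDiffeo.

(** * The tangent surface as a fold *)

Section FoldForm.
Context {R : realType}.
Local Notation e_ i := (delta_mx 0 i).
Local Notation D1 f := ('D_(delta_mx 0 1) (f : 'rV[R]_2 -> R)).

Definition sqm (q : 'rV[R]_2) : 'rV[R]_2 := mk2 (q 0 0) (q 0 1 ^+ 2).

Lemma sqm_box (al be : R) q : 0 < be -> box al be q -> box al (be ^+ 2) (sqm q).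
Proof.
move=> be0 [q0 q1]; split; rewrite /= ?mk20 // mk21 normrX.
by rewrite ltrXn2r // nnegrE // ltW.
Qed.

Lemma Ck_on_sqm k (al be : R) : Ck_on k (box al be) sqm.
Proof.
have ob := @box_open R al be.
apply: Ck_on_mk2 => //; first exact: Ck_on_proj.
by apply: Ck_on_X => //; exact: Ck_on_proj.
Qed.

Lemma smooth_sqm (al be : R) n (K : 'rV[R]_2 -> 'rV[R]_n) : 0 < be -> smooth_on (box al (be ^+ 2)) K ->
  smooth_on (box al be) (fun q => K (sqm q)).
Proof.
move=> be0 CK k; apply: (@Ck_on_comp_rV _ _ _ _ k _ (box al (be ^+ 2)) sqm K); [exact: box_open|exact: box_open| | |exact: CK].
- by move=> q; exact: sqm_box.
- exact: Ck_on_sqm.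
Qed.

Lemma smooth_sqmR (al be : R) (K : 'rV[R]_2 -> R) : 0 < be -> smooth_on (box al (be ^+ 2)) K ->
  smooth_on (box al be) (fun q => K (sqm q)).
Proof.
move=> be0 CK k; apply: (@Ck_on_comp _ _ _ k _ (box al (be ^+ 2)) sqm K); [exact: box_open|exact: box_open| | |exact: CK].
- by move=> q; exact: sqm_box.
- exact: Ck_on_sqm.
Qed.

Lemma smooth_axis (al be : R) (f : 'rV[R]_2 -> R) : smooth_on (box al be) f ->
  smooth_on (box al be) (fun q => f (mk2 (q 0 0) 0)).
Proof.
move=> Cf k; have ob := @box_open R al be.
apply: (@Ck_on_comp _ _ _ k _ _ (fun q : 'rV[R]_2 => mk2 (q 0 0) 0) f ob ob); last exact: Cf.
  move=> q [q0 q1]; split; rewrite /= ?mk20 // mk21 normr0.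
  exact: le_lt_trans q1.
by apply: Ck_on_mk2 => //; [exact: Ck_on_proj|exact: (@Ck_on_cst R 2 R)].
Qed.

Lemma is_derive_coord1 (q : 'rV[R]_2) : is_derive q (e_ 1) (fun q : 'rV[R]_2 => q 0 1) 1.
Proof. by apply: (@partial1 R R (fun _ y => y)); exact: is_derive_id. Qed.

Lemma D1_mul_coord (h : 'rV[R]_2 -> R) q : derivable h q (e_ 1) ->
  D1 (fun q => q 0 1 * h q) q = h q + q 0 1 * D1 h q.
Proof.
move=> /derivableP dh; have [_ ->] := @is_deriveM _ _ _ h q (e_ 1) _ _ (is_derive_coord1 q) dh.
by rewrite -![_ *: _]/(_ * _) mulr1 addrC.
Qed.

Lemma D1_sqm0 (al be : R) (K : 'rV[R]_2 -> R) a : 0 < be -> `|a| < al -> smooth_on (box al (be ^+ 2)) K ->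
  D1 (fun q => K (sqm q)) (mk2 a 0) = 0.
Proof.
move=> be0 aal CK.
have b0 : box al (be ^+ 2) (sqm (mk2 a 0)).
  by apply: sqm_box => //; split; rewrite /= ?mk20 // mk21 normr0.
have [dK _] := C1_differentiable (@box_open R al (be ^+ 2)) (CK 1%N) b0.
have ds : is_derive (mk2 a 0) (e_ 1) sqm 0.
  apply: is_derive_rV => j; rewrite mxE; case: (ord2P j) => ->.
    have -> : (fun p => sqm p 0 0) = (fun p : 'rV[R]_2 => p 0 0) by apply/funext => p; rewrite mk20.
    by apply: (@partial1 R R (fun a _ => a)); exact: is_derive_cst.
  have -> : (fun p => sqm p 0 1) = (fun p : 'rV[R]_2 => p 0 1 ^+ 2) by apply/funext => p; rewrite mk21.
  by have := coordX_derive 1 2 (mk2 a 0); rewrite /= mk21 mulr0.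
have [_ ->] := @is_derive_chain _ _ _ _ sqm K (mk2 a 0) _ _ dK ds.
by rewrite linear0.
Qed.

Lemma smooth_D1 (al be : R) (h : 'rV[R]_2 -> R) : smooth_on (box al be) h -> smooth_on (box al be) (D1 h).
Proof. by move=> Ch k; exact: ((Ch k.+1).2 1).2. Qed.

Lemma smooth_derivable (al be : R) (h : 'rV[R]_2 -> R) q i : smooth_on (box al be) h -> box al be q -> derivable h q (e_ i).
Proof. by move=> Ch; exact: ((Ch 1%N).2 i).1. Qed.

Lemma smooth_mul_coord (al be : R) (h : 'rV[R]_2 -> R) : smooth_on (box al be) h ->
  smooth_on (box al be) (fun q => q 0 1 * h q).
Proof.
move=> Ch k; apply: Ck_on_M; [exact: box_open|apply: Ck_on_proj; exact: box_open|exact: Ch].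
Qed.

Lemma axis_D1 (f : 'rV[R]_2 -> R) q : is_derive q (e_ 1) (fun q : 'rV[R]_2 => f (mk2 (q 0 0) 0)) 0.
Proof. by apply: (@partial1 R R (fun a _ => f (mk2 a 0))); exact: is_derive_cst. Qed.

(** Whitney's splitting gives [f = K0(a, w^2) + w K1(a, w^2)]. The vanishing derivative forces
    [K1 = 0] on the axis, so [K1 = y B], and likewise [K0 - K0(a, 0) = y A]. *)
Lemma fold_form (al' al be : R) (f : 'rV[R]_2 -> R) : al' < al -> 0 < be -> smooth_on (box al be) f ->
  (forall a, `|a| < al -> D1 f (mk2 a 0) = 0) ->
  exists A B : 'rV[R]_2 -> R, [/\ smooth_on (box al' (be ^+ 2)) A, smooth_on (box al' (be ^+ 2)) B,
    forall q, box al' be q ->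
      f q = f (mk2 (q 0 0) 0) + q 0 1 ^+ 2 * A (sqm q) + q 0 1 ^+ 3 * B (sqm q) &
    forall a, `|a| < al' -> D1 (D1 f) (mk2 a 0) = 2 * A (mk2 a 0) /\
      D1 (D1 (D1 f)) (mk2 a 0) = 6 * B (mk2 a 0)].
Proof.
move=> al'al be0 Cf f10.
have [K0 [K1 [CK0 CK1 EK']]] := whitney_split al'al be0 Cf.
have EK q : box al' be q -> f q = K0 (sqm q) + q 0 1 * K1 (sqm q) := EK' q.
have ob := @box_open R al' be; have ob2 := @box_open R al' (be ^+ 2).
have st := @box_stable R al' (be ^+ 2).
have on_axis a (b : R) : 0 < b -> `|a| < al' -> box al' b (mk2 a 0).
  by move=> b0 aal; split; rewrite /= ?mk20 // mk21 normr0.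
have sqm0 a : sqm (mk2 a 0) = mk2 a 0 by rewrite /sqm mk20 mk21 expr0n.
have be20 : 0 < be ^+ 2 by rewrite exprn_gt0.
have K00 a : `|a| < al' -> K0 (mk2 a 0) = f (mk2 a 0).
  move=> aal; have := EK _ (on_axis a be be0 aal).
  by rewrite sqm0 mk21 mul0r addr0 => ->.
have s0 := smooth_sqmR be0 CK0; have s1 := smooth_sqmR be0 CK1.
have K10 a : `|a| < al' -> K1 (mk2 a 0) = 0.
  move=> aal; have ba := on_axis a be be0 aal.
  have aal2 : `|a| < al by exact: lt_trans al'al.
  have := f10 a aal2; rewrite (pd_near 1 ba EK).
  have d0 := derivableP (smooth_derivable (i := 1) s0 ba).
  have d1 := derivableP (smooth_derivable (i := 1) (smooth_mul_coord s1) ba).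
  have [_ ->] := is_deriveD d0 d1.
  rewrite (D1_sqm0 be0 aal CK0) D1_mul_coord; last exact: smooth_derivable s1 ba.
  by rewrite mk21 mul0r addr0 add0r sqm0.
have van1 q : box al' (be ^+ 2) q -> q 0 1 = 0 -> K1 q = 0.
  by move=> [q0 _] q1; rewrite -(mk2_eta q) q1 K10.
have [B [CB EB _]] := hadamard_div ob2 st CK1 van1.
have Cd : smooth_on (box al' (be ^+ 2)) (fun q => K0 q - K0 (mk2 (q 0 0) 0)).
  by move=> k; apply: Ck_on_B => //; exact: (smooth_axis CK0).
have van0 q : box al' (be ^+ 2) q -> q 0 1 = 0 -> K0 q - K0 (mk2 (q 0 0) 0) = 0.
  by move=> _ q1; rewrite -[in K0 q](mk2_eta q) q1 subrr.
have [A [CA EA _]] := hadamard_div ob2 st Cd van0.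
have main q : box al' be q ->
    f q = f (mk2 (q 0 0) 0) + q 0 1 * (q 0 1 * (A (sqm q) + q 0 1 * B (sqm q))).
  move=> bq; have bs := sqm_box be0 bq; have [q0 _] := bq.
  rewrite (EK q bq) (EB _ bs) -K00 //.
  have sq0 : sqm q 0 0 = q 0 0 by exact: mk20.
  have sq1 : sqm q 0 1 = q 0 1 ^+ 2 by exact: mk21.
  have := EA _ bs; rewrite sq0 sq1 => /eqP; rewrite subr_eq => /eqP ->.
  move: (A _) (B _) (K0 _) (q 0 1) => x y z w; ring.
exists A, B; split=> //.
  by move=> q bq; rewrite [LHS](main q bq); move: (A _) (B _) (f _) (q 0 1) => x y z w; ring.
(* With [f = f(a, 0) + w^2 G] and [H = 2 G + w D1 G], the first derivative is [w H]; this reads off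
   the higher derivatives on the axis, where [D1 G = B] and [D1 H = 3 B]. *)
pose G q := A (sqm q) + q 0 1 * B (sqm q).
have sA := smooth_sqmR be0 CA; have sB := smooth_sqmR be0 CB.
have sG : smooth_on (box al' be) G by move=> k; apply: Ck_on_D => //; exact: smooth_mul_coord sB k.
have sDG := smooth_D1 sG.
pose H q := 2 * G q + q 0 1 * D1 G q.
have sH : smooth_on (box al' be) H.
  move=> k; apply: Ck_on_D => //; last exact: smooth_mul_coord sDG k.
  by apply: Ck_on_M => //; exact: (@Ck_on_cst R 2 R).
have sDH := smooth_D1 sH.
have sqG := smooth_mul_coord sG.
have E1 q : box al' be q -> D1 f q = q 0 1 * H q.
  move=> bq; rewrite (pd_near 1 bq main).
  have d1 := derivableP (smooth_derivable (i := 1) (smooth_mul_coord sqG) bq).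
  have [_ ->] := is_deriveD (axis_D1 f q) d1.
  rewrite add0r D1_mul_coord; last exact: smooth_derivable sqG bq.
  rewrite D1_mul_coord; last exact: smooth_derivable sG bq.
  by rewrite /H; move: (G q) (D1 G q) (q 0 1) => x y w; ring.
have E2 q : box al' be q -> D1 (D1 f) q = H q + q 0 1 * D1 H q.
  by move=> bq; rewrite (pd_near 1 bq E1) D1_mul_coord //; exact: smooth_derivable sH bq.
have dG a : `|a| < al' -> D1 G (mk2 a 0) = B (mk2 a 0).
  move=> aal; have ba := on_axis a be be0 aal.
  have d0 := derivableP (smooth_derivable (i := 1) sA ba).
  have d1 := derivableP (smooth_derivable (i := 1) (smooth_mul_coord sB) ba).
  have [_ ->] := is_deriveD d0 d1.
  rewrite (D1_sqm0 be0 aal CA) D1_mul_coord; last exact: smooth_derivable sB ba.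
  by rewrite mk21 mul0r addr0 add0r sqm0.
move=> a aal; have ba := on_axis a be be0 aal; split.
  by rewrite E2 // mk21 mul0r addr0 /H mk21 mul0r addr0 /G mk21 mul0r addr0 sqm0.
rewrite (pd_near 1 ba E2).
have d0 := derivableP (smooth_derivable (i := 1) sH ba).
have d1 := derivableP (smooth_derivable (i := 1) (smooth_mul_coord sDH) ba).
have [_ ->] := is_deriveD d0 d1.
rewrite D1_mul_coord; last exact: smooth_derivable sDH ba.
rewrite mk21 mul0r addr0.
have EH : D1 H (mk2 a 0) = 3 * B (mk2 a 0).
  have s2 : smooth_on (box al' be) (fun q => 2 * G q).
    by move=> k; apply: Ck_on_M => //; exact: (@Ck_on_cst R 2 R).
  have e0 := derivableP (smooth_derivable (i := 1) s2 ba).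
  have e1 := derivableP (smooth_derivable (i := 1) (smooth_mul_coord sDG) ba).
  have [_ ->] := is_deriveD e0 e1.
  rewrite D1_mul_coord; last exact: smooth_derivable sDG ba.
  have -> : D1 (fun q => 2 * G q) (mk2 a 0) = 2 * D1 G (mk2 a 0).
    have dg := derivableP (smooth_derivable (i := 1) sG ba).
    by have [_ ->] := @is_deriveZ _ _ _ G 2 _ _ _ dg.
  rewrite mk21 mul0r addr0 dG //; move: (B _) => b; ring.
rewrite EH; move: (B _) => b; ring.
Qed.

End FoldForm.

(** * Third-order jet of the family of geodesics *)

Section LocalForm.
Context {R : realType} {m : nat} {M : manifold R m}.
Variable nabla : connection M.
Local Notation e_ i := (delta_mx 0 i).
Local Notation Gam := (Gam nabla).

Lemma is_derive_bigsum (V W : normedModType R) n (h : 'I_n -> V -> W) (dh : 'I_n -> W) x v :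
  (forall i, is_derive x v (h i) (dh i)) -> is_derive x v (fun y => \sum_i h i y) (\sum_i dh i).
Proof.
move=> H; have -> : (fun y => \sum_i h i y) = \sum_i h i by apply/funext => y; rewrite fct_sumE.
exact: is_derive_sum.
Qed.

(** A stationary base point removes the derivative of the Christoffel symbols. This is the situation
    on [s = 0], where [Dd X] vanishes. *)
Lemma Gam_is_derive0 (c : chart M) n (X A B : 'rV[R]_n -> 'rV[R]_m) p v dA dB :
  chart_range c (X p) -> is_derive p v X 0 -> is_derive p v A dA -> is_derive p v B dB ->
  is_derive p v (fun q => Gam c (param c (X q)) (A q) (B q))
    (Gam c (param c (X p)) dA (B p) + Gam c (param c (X p)) (A p) dB).
Proof.
move=> cX DX DA DB; apply: is_derive_rV => l.
pose ch mu nu (x : 'rV[R]_m) := christoffel nabla c l mu nu (param c x).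
have -> : (fun q => Gam c (param c (X q)) (A q) (B q) 0 l) =
    (fun q => \sum_mu \sum_nu ch mu nu (X q) * A q 0 mu * B q 0 nu).
  by apply/funext => q; rewrite mxE.
have -> : (Gam c (param c (X p)) dA (B p) + Gam c (param c (X p)) (A p) dB) 0 l =
    \sum_mu \sum_nu (ch mu nu (X p) * dA 0 mu * B p 0 nu + ch mu nu (X p) * A p 0 mu * dB 0 nu).
  rewrite !mxE -big_split; apply: eq_bigr => mu _ /=; exact: esym (big_split _ _ _ _ _).
apply: is_derive_bigsum => mu; apply: is_derive_bigsum => nu.
have Dch : is_derive p v (fun q => ch mu nu (X q)) 0.
  have oc := @codom_open _ _ M c.
  have [dc _] := C1_differentiable oc (@christoffel_smooth _ _ _ nabla c l mu nu 1) cX.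
  have := is_derive_chain dc DX; by rewrite linear0.
have DAmu : is_derive p v (fun q => A q 0 mu) (dA 0 mu) by exact: is_derive_component.
have DBnu : is_derive p v (fun q => B q 0 nu) (dB 0 nu) by exact: is_derive_component.
have D1 := @is_deriveM _ _ _ (fun q => A q 0 mu) p v _ _ Dch DAmu.
have D2 := @is_deriveM _ _ _ (fun q => B q 0 nu) p v _ _ D1 DBnu.
apply: is_derive_eq D2 _; rewrite /= -![_ *: _]/(_ * _) fctE.
by move: (ch _ _ _) (A _ _ _) (B _ _ _) (dA _ _) (dB _ _) => a b d e f; ring.
Qed.

(* Locked: otherwise failing unifications unfold derivatives down to limits. *)
Definition pd : 'I_2 -> ('rV[R]_2 -> 'rV[R]_m) -> 'rV[R]_2 -> 'rV[R]_m :=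
  locked (fun i F => 'D_(e_ i) F).

Lemma pdE i F : pd i F = 'D_(e_ i) F.
Proof. by rewrite /pd -lock. Qed.

(** With coordinates [(t, s)] this is the derivative in [s] at fixed [t + s]. *)
Definition Dd (F : 'rV[R]_2 -> 'rV[R]_m) (q : 'rV[R]_2) : 'rV[R]_m := pd 1 F q - pd 0 F q.

Section OnOpen.
Variable Om : set 'rV[R]_2.
Hypothesis oOm : open Om.
Implicit Types (F G : 'rV[R]_2 -> 'rV[R]_m) (p : 'rV[R]_2).

Lemma smooth_pd F i : smooth_on Om F -> smooth_on Om (pd i F).
Proof. by move=> CF k; rewrite pdE; exact: ((CF k.+1).2 i).2. Qed.

Lemma smooth_pd_derive F i p : smooth_on Om F -> Om p -> is_derive p (e_ i) F (pd i F p).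
Proof. by move=> CF Op; rewrite pdE; apply: derivableP; exact: ((CF 1%N).2 i).1. Qed.

Lemma Dd_smooth F : smooth_on Om F -> smooth_on Om (Dd F).
Proof. by move=> CF k; apply: Ck_on_B => //; exact: smooth_pd CF k. Qed.

Lemma Dd_is_derive F p : smooth_on Om F -> Om p -> is_derive p (mk2 (-1) 1) F (Dd F p).
Proof.
move=> CF Op; have dF := C1_differentiable_rV oOm (CF 1%N) Op.
have -> : Dd F p = 'D_(mk2 (-1) 1) F p.
  rewrite (derive_sum_e_rV _ dF) big_ord_recl big_ord1 mk20 scaleN1r addrC /Dd !pdE; congr (_ - _).
  have -> : lift ord0 ord0 = (1 : 'I_2) by exact: val_inj.
  by rewrite mk21 scale1r.
by apply: derivableP; exact: diff_derivable.
Qed.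

Lemma pd_ext F G i p : Om p -> (forall q, Om q -> F q = G q) -> pd i F p = pd i G p.
Proof.
move=> Op FG; rewrite !pdE.
by apply: near_eq_derive; apply: filterS (near_open oOm Op) => q; exact: FG.
Qed.

Lemma Dd_ext F G p : Om p -> (forall q, Om q -> F q = G q) -> Dd F p = Dd G p.
Proof. by move=> Op FG; rewrite /Dd !(pd_ext _ Op FG). Qed.

Lemma pdD F G i p : smooth_on Om F -> smooth_on Om G -> Om p ->
  pd i (fun q => F q + G q) p = pd i F p + pd i G p.
Proof.
move=> CF CG Op.
have [_ h] := is_deriveD (smooth_pd_derive i CF Op) (smooth_pd_derive i CG Op).
by rewrite {1}pdE.
Qed.

Lemma pdZ F i p (k : R) : smooth_on Om F -> Om p -> pd i (fun q => k *: F q) p = k *: pd i F p.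
Proof.
move=> CF Op.
have [_ h] := @is_deriveZ _ _ _ F k _ _ _ (smooth_pd_derive i CF Op).
by rewrite {1}pdE.
Qed.

Lemma schwarz_rV F i j p : smooth_on Om F -> Om p -> pd j (pd i F) p = pd i (pd j F) p.
Proof.
move=> CF Op; apply/rowP => l.
have Cl : smooth_on Om (fun q => F q 0 l) by move=> k; exact: Ck_on_coord.
have E a b : pd b (pd a F) p 0 l = 'D_(e_ b) ('D_(e_ a) (fun q => F q 0 l)) p.
  have [h1 <-] := smooth_pd_derive b (smooth_pd a CF) Op.
  rewrite -derive_coord //; apply: near_eq_derive; apply: filterS (near_open oOm Op) => q Oq.
  by have [h2 <-] := smooth_pd_derive a CF Oq; rewrite derive_coord.
exact: etrans (E i j) (etrans (schwarz i j oOm Cl Op) (esym (E j i))).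
Qed.

Lemma DdD F G p : smooth_on Om F -> smooth_on Om G -> Om p ->
  Dd (fun q => F q + G q) p = Dd F p + Dd G p.
Proof. by move=> CF CG Op; rewrite /Dd !pdD // opprD addrACA. Qed.

Lemma DdZ F p (k : R) : smooth_on Om F -> Om p -> Dd (fun q => k *: F q) p = k *: Dd F p.
Proof. by move=> CF Op; rewrite /Dd !pdZ // scalerBr. Qed.

Lemma axis_is_derive F t : smooth_on Om F -> Om (mk2 t 0) ->
  is_derive t (1 : R) (fun t => F (mk2 t 0)) (pd 0 F (mk2 t 0)).
Proof.
move=> CF Ot; have /is_derive_epsP H := smooth_pd_derive 0 CF Ot.
apply/is_derive_epsP => e /H[d d0 Hd]; exists d => // h h0 hd; have := Hd h h0 hd.
have -> // : h *: e_ 0 + mk2 t 0 = mk2 (h *: 1 + t) 0.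
by apply: rV2_ext; rewrite !mxE /= ?mulr0 ?addr0.
Qed.

Lemma axis_derive F f (T : set R) t : open T -> T t -> (forall t, T t -> Om (mk2 t 0)) ->
  (forall t, T t -> F (mk2 t 0) = f t) -> smooth_on Om F -> pd 0 F (mk2 t 0) = derive1 f t.
Proof.
move=> oT Tt TO Ff CF; have [_ <-] := axis_is_derive CF (TO t Tt); rewrite derive1E.
by apply: near_eq_derive; apply: filterS (open_nbhs_nbhs (conj oT Tt)) => s; exact: Ff.
Qed.

Section Jet.
Variable c : chart M.
Variables X V : 'rV[R]_2 -> 'rV[R]_m.
Hypothesis tf : torsion_free nabla.
Hypothesis CX : smooth_on Om X.
Hypothesis CV : smooth_on Om V.
Hypothesis rX : forall q, Om q -> chart_range c (X q).
Let Y q := Gam c (param c (X q)) (V q) (V q).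
Hypothesis D1X : forall q, Om q -> pd 1 X q = V q.
Hypothesis D1V : forall q, Om q -> pd 1 V q = - Y q.

Let CY : smooth_on Om Y.
Proof. by move=> k; apply: (@Gam_smooth _ _ _ _ _ _ _ c X V V). Qed.

Lemma jet_Dd q : Om q -> Dd X q = V q + (-1) *: pd 0 X q.
Proof. by move=> Oq; rewrite /Dd D1X // scaleN1r. Qed.

Lemma jet_D1D0X q : Om q -> pd 1 (pd 0 X) q = pd 0 V q.
Proof. by move=> Oq; rewrite schwarz_rV //; exact: pd_ext Oq D1X. Qed.

Lemma jet_D1D0V q : Om q -> pd 1 (pd 0 V) q = - pd 0 Y q.
Proof.
move=> Oq; rewrite schwarz_rV // (pd_ext 0 Oq (G := fun q => (-1) *: Y q)).
  by rewrite pdZ // scaleN1r.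
by move=> p Op; rewrite D1V // scaleN1r.
Qed.

(** Expansion of [(d/ds - d/dt)^2]: the geodesic equation replaces the second [s]-derivative by
    [- Y], and mixed partials commute. *)
Lemma jet_Dd2 q : Om q -> Dd (Dd X) q = (-1) *: Y q + ((-2) *: pd 0 V q + pd 0 (pd 0 X) q).
Proof.
move=> Oq; have C0X := smooth_pd 0 CX.
have Cm : smooth_on Om (fun q => (-1) *: pd 0 X q) by move=> k; exact: Ck_on_Z.
rewrite (Dd_ext Oq jet_Dd) DdD // DdZ // {1 2}/Dd D1V // jet_D1D0X //.
move: (Y q) (pd 0 V q) (pd 0 (pd 0 X) q) => y v x.
by apply/rowP => j; rewrite !mxE; ring.
Qed.

Lemma jet_Dd3 q : Om q -> Dd (Dd (Dd X)) q =
  (-1) *: Dd Y q + (2 *: pd 0 Y q + (3 *: pd 0 (pd 0 V) q + (-1) *: pd 0 (pd 0 (pd 0 X)) q)).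
Proof.
move=> Oq; have C0X := smooth_pd 0 CX; have C00X := smooth_pd 0 C0X; have C0V := smooth_pd 0 CV.
have C1 : smooth_on Om (fun q => (-1) *: Y q) by move=> k; apply: Ck_on_Z => //; exact: CY.
have C2 : smooth_on Om (fun q => (-2) *: pd 0 V q) by move=> k; apply: Ck_on_Z => //; exact: C0V.
have C3 : smooth_on Om (fun q => (-2) *: pd 0 V q + pd 0 (pd 0 X) q).
  by move=> k; apply: Ck_on_D => //; exact: C00X.
have E1 : Dd (pd 0 V) q = - pd 0 Y q - pd 0 (pd 0 V) q by rewrite {1}/Dd jet_D1D0V.
have E2 : Dd (pd 0 (pd 0 X)) q = pd 0 (pd 0 V) q - pd 0 (pd 0 (pd 0 X)) q.
  by rewrite {1}/Dd (schwarz_rV 0 1 C0X Oq) (pd_ext 0 Oq jet_D1D0X).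
have Z1 := DdZ (-1) CY Oq; have Z2 := DdZ (-2) C0V Oq.
have Z3 : Dd (fun q => (-2) *: pd 0 V q + pd 0 (pd 0 X) q) q =
    (-2) *: (- pd 0 Y q - pd 0 (pd 0 V) q) + (pd 0 (pd 0 V) q - pd 0 (pd 0 (pd 0 X)) q).
  by apply: etrans (DdD C2 C00X Oq) _; rewrite Z2 E1 E2.
apply: etrans (Dd_ext Oq jet_Dd2) _; apply: etrans (DdD C1 C3 Oq) _; rewrite Z1 Z3.
move: (Dd Y q) (pd 0 Y q) (pd 0 (pd 0 V) q) (pd 0 (pd 0 (pd 0 X)) q) => w y v x.
by apply/rowP => j; rewrite !mxE; ring.
Qed.

Variables (T : set R) (x v : R -> 'rV[R]_m).
Hypothesis oT : open T.
Hypothesis TO : forall t, T t -> Om (mk2 t 0).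
Hypothesis Xx : forall t, T t -> X (mk2 t 0) = x t.
Hypothesis Vv : forall t, T t -> V (mk2 t 0) = v t.
Hypothesis dx : forall t, T t -> derive1 x t = v t.

Let G t := Gam c (param c (x t)) (v t) (v t).
Let E2 t := derive1 v t + G t.
Let E3 t := derive1 E2 t + Gam c (param c (x t)) (v t) (E2 t).

Let a0X t : T t -> pd 0 X (mk2 t 0) = v t.
Proof. by move=> Tt; rewrite (axis_derive oT Tt TO Xx CX) dx. Qed.
Let a0V t : T t -> pd 0 V (mk2 t 0) = derive1 v t.
Proof. by move=> Tt; rewrite (axis_derive oT Tt TO Vv CV). Qed.
Let a00X t : T t -> pd 0 (pd 0 X) (mk2 t 0) = derive1 v t.
Proof. by move=> Tt; rewrite (axis_derive oT Tt TO a0X (smooth_pd 0 CX)). Qed.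
Let aY t : T t -> Y (mk2 t 0) = G t.
Proof. by move=> Tt; rewrite /Y Xx // Vv. Qed.

Lemma jet_axis1 t : T t -> Dd X (mk2 t 0) = 0.
Proof. by move=> Tt; rewrite jet_Dd ?Vv ?a0X ?scaleN1r ?subrr //; exact: TO. Qed.

(** On the axis both [dV/dt] and the second [t]-derivative of [X] are [v'], so the sum is
    [- G - 2 v' + v']. *)
Lemma jet_axis2 t : T t -> Dd (Dd X) (mk2 t 0) = - E2 t.
Proof.
move=> Tt; rewrite jet_Dd2 ?aY ?a0V ?a00X //; last exact: TO.
rewrite /E2; move: (G t) (derive1 v t) => g w.
by apply/rowP => j; rewrite !mxE; ring.
Qed.

(** On the axis [jet_Dd3] reads [- Dd Y + 2 G' + 3 v'' - v'']. Since [Dd X = 0] and [Dd V = - E2]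
    there, [Dd Y] is minus the sum of [Gam(E2, v)] and [Gam(v, E2)], which are equal by symmetry,
    and the total is [2 E3]. *)
Lemma jet_axis3 t : T t -> Dd (Dd (Dd X)) (mk2 t 0) = 2 *: E3 t.
Proof.
move=> Tt; have Ot := TO Tt.
rewrite jet_Dd3 // (axis_derive oT Tt TO aY CY) (axis_derive oT Tt TO a0V (smooth_pd 0 CV)).
rewrite (axis_derive oT Tt TO a00X (smooth_pd 0 (smooth_pd 0 CX))).
have DX := Dd_is_derive CX Ot; rewrite jet_axis1 // in DX.
have DV := Dd_is_derive CV Ot.
have [_ e1] := Gam_is_derive0 (rX Ot) DX DV DV.
have [_ e2] := Dd_is_derive CY Ot; rewrite e1 in e2.
have DVE : Dd V (mk2 t 0) = - E2 t.
  rewrite /Dd D1V // aY // a0V // /E2; move: (G t) (derive1 v t) => g w.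
  by apply/rowP => j; rewrite !mxE; ring.
have dv : is_derive t (1 : R) (derive1 v) (derive1 (derive1 v) t).
  have H := axis_is_derive (smooth_pd 0 CV) Ot.
  rewrite (axis_derive oT Tt TO a0V (smooth_pd 0 CV)) in H; apply: near_eq_is_derive H.
  by apply: filterS (open_nbhs_nbhs (conj oT Tt)) => s; exact: a0V.
have dG : is_derive t (1 : R) G (derive1 G t).
  have H := axis_is_derive CY Ot; rewrite (axis_derive oT Tt TO aY CY) in H.
  apply: near_eq_is_derive H.
  by apply: filterS (open_nbhs_nbhs (conj oT Tt)) => s; exact: aY.
have dE2 : derive1 E2 t = derive1 (derive1 v) t + derive1 G t.
  by rewrite [LHS]derive1E; have [_ ->] := is_deriveD dv dG.
have cx : dom c (param c (x t)) by rewrite -Xx //; apply: param_dom; exact: rX.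
rewrite -e2 DVE Xx // Vv // /E3 dE2 (Gam_sym (- E2 t) (v t) tf cx).
rewrite -[- E2 t]scaleN1r GamZr.
move: (Gam _ _ _ _) (derive1 G t) (derive1 (derive1 v) t) => g w z.
by apply/rowP => j; rewrite !mxE; ring.
Qed.

End Jet.

End OnOpen.

End LocalForm.

(** * The tangent surface in fold form *)

Section SurfaceForm.
Context {R : realType} {m : nat} {M : manifold R m}.
Variable nabla : connection M.
Local Notation e_ i := (delta_mx 0 i).
Local Notation Gam := (Gam nabla).

Lemma half_eq (y z : R) : 2 * y = - z -> y = - 2^-1 * z.
Proof. by move=> h; lra. Qed.

Lemma third_eq (y z : R) : 6 * y = 2 * z -> y = 3^-1 * z.
Proof. by move=> h; lra. Qed.

Definition fold_param (x : R -> 'rV[R]_m) (A B : 'rV[R]_2 -> 'rV[R]_m) (q : 'rV[R]_2) : 'rV[R]_m :=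
  x (q 0 0) + q 0 1 ^+ 2 *: A (sqm q) + q 0 1 ^+ 3 *: B (sqm q).

Theorem surface_form (I : set R) (gamma : R -> M) (c : chart M) (t0 : R) :
  torsion_free nabla -> open I -> smooth_curve I gamma -> I t0 -> dom c (gamma t0) ->
  exists (al be : R) (A B : 'rV[R]_2 -> 'rV[R]_m),
  let S := fold_param (fun a => coord c (gamma (t0 + a))) A B in
  [/\ 0 < al /\ 0 < be,
    smooth_on (box al (be ^+ 2)) A /\ smooth_on (box al (be ^+ 2)) B,
    smooth_on (box al be) (fun q : 'rV[R]_2 => coord c (gamma (t0 + q 0 0))) /\
    (forall a, `|a| < al -> chart_times I gamma c (t0 + a)),
    forall a, `|a| < al -> A (mk2 a 0) = - 2^-1 *: cov_iter nabla gamma 2 (t0 + a) c /\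
      B (mk2 a 0) = 3^-1 *: cov_iter nabla gamma 3 (t0 + a) c &
    forall q, box al be q -> chart_range c (S q) /\
      tangent_surface nabla gamma (mk2 (t0 + q 0 0 - q 0 1) (q 0 1)) = param c (S q)].
Proof.
move=> tf oI sg It0 ct0.
have [T [S [u [[oT Tt0] TI S0 Hu [Cu Eu]]]]] := tangent_surfaceE nabla oI sg It0 ct0.
pose Om := strip T S; have oOm : open Om by exact: strip_open.
pose X q := lsubmx (uncurry2 u q); pose V q := rsubmx (uncurry2 u q).
have CX : smooth_on Om X by move=> k; exact: Ck_on_lsubmx oOm (Cu k).
have CV : smooth_on Om V by move=> k; exact: Ck_on_rsubmx oOm (Cu k).
have rX q : Om q -> chart_range c (X q).
  by move=> [Tq Sq]; have [h _] := (Hu _ Tq).1 _ Sq.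
have Du q : Om q -> is_derive q (e_ 1) (uncurry2 u) (spray nabla c (uncurry2 u q)).
  by move=> [Tq Sq]; have [_ h] := (Hu _ Tq).1 _ Sq; exact: partial1 h.
have D1X q : Om q -> pd 1 X q = V q.
  move=> Oq; rewrite pdE; suff [_ ->] : is_derive q (e_ 1) X (V q) by [].
  apply: is_derive_rV => j.
  have -> : (fun p => X p 0 j) = (fun p => uncurry2 u p 0 (lshift m j)) by apply/funext => p; rewrite mxE.
  by have := is_derive_component (lshift m j) (Du q Oq); rewrite row_mxEl.
have D1V q : Om q -> pd 1 V q = - Gam c (param c (X q)) (V q) (V q).
  move=> Oq; rewrite pdE; suff [_ ->] : is_derive q (e_ 1) V (- Gam c (param c (X q)) (V q) (V q)) by [].
  apply: is_derive_rV => j.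
  have -> : (fun p => V p 0 j) = (fun p => uncurry2 u p 0 (rshift m j)) by apply/funext => p; rewrite mxE.
  by have := is_derive_component (rshift m j) (Du q Oq); rewrite row_mxEr.
pose x t := coord c (gamma t); pose v t := velocity gamma t c.
have TO t : T t -> Om (mk2 t 0) by move=> Tt; split; rewrite /= ?mk20 // mk21 normr0.
have u0 t : T t -> uncurry2 u (mk2 t 0) = phase gamma c t.
  by move=> Tt; rewrite /uncurry2 mk20 mk21; exact: (Hu t Tt).2.
have Xx t : T t -> X (mk2 t 0) = x t by move=> Tt; rewrite /X u0 // row_mxKl.
have Vv t : T t -> V (mk2 t 0) = v t by move=> Tt; rewrite /V u0 // row_mxKr.
have dx t : T t -> derive1 x t = v t by [].
pose E2 t := cov_iter nabla gamma 2 t c; pose E3 t := cov_iter nabla gamma 3 t c.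
have xE t : T t -> param c (x t) = gamma t by move=> Tt; rewrite /x coordK //; exact: (TI t Tt).2.
have J1 t : T t -> Dd X (mk2 t 0) = 0.
  by move=> Tt; exact: (jet_axis1 CX D1X oT TO Xx Vv dx Tt).
have E2E t : T t -> derive1 v t + Gam c (param c (x t)) (v t) (v t) = E2 t.
  by move=> Tt; rewrite /E2 /cov_iter /= cov_alongE xE.
have J2 t : T t -> Dd (Dd X) (mk2 t 0) = - E2 t.
  by move=> Tt; rewrite -(E2E t Tt); exact: (jet_axis2 oOm CX CV D1X D1V oT TO Xx Vv dx Tt).
have J3 t : T t -> Dd (Dd (Dd X)) (mk2 t 0) = 2 *: E3 t.
  move=> Tt.
  pose F2 t := derive1 v t + Gam c (param c (x t)) (v t) (v t).
  have h : Dd (Dd (Dd X)) (mk2 t 0) = 2 *: (derive1 F2 t + Gam c (param c (x t)) (v t) (F2 t)).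
    exact: (jet_axis3 oOm tf CX CV rX D1X D1V oT TO Xx Vv dx Tt).
  have F2E : F2 t = E2 t := E2E t Tt.
  have dF2 : derive1 F2 t = derive1 E2 t.
    rewrite !derive1E; apply: near_eq_derive.
    by apply: filterS (open_nbhs_nbhs (conj oT Tt)) => s Ts; exact: E2E.
  have E3E : E3 t = derive1 E2 t + Gam c (gamma t) (v t) (E2 t) by exact: cov_alongE.
  by rewrite h dF2 F2E (xE t Tt) E3E.
have [r r0 Hr] := (nbhs_norm_ltP _ _).1 (open_nbhs_nbhs (conj oT Tt0)).
(* Both [|a|] and [|w|] are kept below [r / 2], so that [t0 + a - w] stays in [T]; [al1] below
   leaves room for the shrinking in [a] required by [fold_form]. *)
pose be := Num.min S (r / 2).
have be0 : 0 < be by rewrite lt_min S0 divr_gt0.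
have beS : be <= S by rewrite ge_min lexx.
have ber : be <= r / 2 by rewrite ge_min lexx orbT.
have al1 : r / 4 < r / 2 by lra.
(* Passage from [(a, w)] to [(t, s) = (t0 + a - w, w)]; its derivative in [w] is the direction
   [(-1, 1)] of [Dd]. *)
pose phi (q : 'rV[R]_2) := mk2 (t0 + q 0 0 - q 0 1) (q 0 1).
have Tal a : `|a| < r / 2 -> T (t0 + a).
  move=> ar; apply: Hr; rewrite addrAC subrr add0r.
  by apply: (lt_trans ar); lra.
have phiO q : box (r / 2) be q -> Om (phi q).
  move=> [q0 q1]; split; rewrite /= ?mk20 ?mk21; last exact: lt_le_trans q1 beS.
  apply: Hr; have -> : t0 + q 0 0 - q 0 1 - t0 = q 0 0 - q 0 1 by ring.
  apply: (le_lt_trans (ler_normB _ _)).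
  have q1r := lt_le_trans q1 ber; move: q0 q1r; rewrite /=.
  by move: `|q 0 0| `|q 0 1| => y z; lra.
have phi0 a : phi (mk2 a 0) = mk2 (t0 + a) 0 by rewrite /phi mk20 mk21 subr0.
have ob := @box_open R (r / 2) be.
have Cphi k : Ck_on k (box (r / 2) be) phi.
  have C0 : Ck_on k (box (r / 2) be) (fun q : 'rV[R]_2 => q 0 0) by exact: Ck_on_proj.
  have C1 : Ck_on k (box (r / 2) be) (fun q : 'rV[R]_2 => q 0 1) by exact: Ck_on_proj.
  apply: Ck_on_mk2 => //; apply: Ck_on_B => //; apply: Ck_on_D => //.
  exact: (@Ck_on_cst R 2 R).
have dphi q : is_derive q (e_ 1) phi (mk2 (-1) 1).
  apply: is_derive_rV => j; case: (ord2P j) => ->.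
    have -> : (fun p => phi p 0 0) = (fun p : 'rV[R]_2 => t0 + p 0 0 - p 0 1) by apply/funext => p; rewrite mk20.
    rewrite mk20; apply: (@partial1 R R (fun a y => t0 + a - y)) => /=.
    by rewrite -[-1]add0r; apply: is_deriveB.
  have -> : (fun p => phi p 0 1) = (fun p : 'rV[R]_2 => p 0 1) by apply/funext => p; rewrite mk21.
  by rewrite mk21; exact: is_derive_coord1.
have DF (F : 'rV[R]_2 -> 'rV[R]_m) l q : smooth_on Om F -> box (r / 2) be q ->
    'D_(e_ 1) (fun q => F (phi q) 0 l) q = Dd F (phi q) 0 l.
  move=> CF bq; have Oq := phiO q bq.
  have dF := C1_differentiable_rV oOm (CF 1%N) Oq.
  have := @is_derive_chain _ _ _ _ phi F q _ _ dF (dphi q).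
  rewrite -deriveE //; have [_ ->] := Dd_is_derive oOm CF Oq.
  by move=> h; have [_ ->] := is_derive_component l h.
have CDX := Dd_smooth oOm CX; have CDDX := Dd_smooth oOm CDX.
pose XP l q := X (phi q) 0 l.
have CXP l : smooth_on (box (r / 2) be) (XP l).
  move=> k; apply: (Ck_on_coord _ ob).
  exact: (@Ck_on_comp_rV _ _ _ _ k _ Om phi X ob oOm phiO (Cphi k) (CX k)).
have axis a : `|a| < r / 2 -> box (r / 2) be (mk2 a 0).
  by move=> ar; split; rewrite /= ?mk20 // mk21 normr0.
have XP1 l a : `|a| < r / 2 -> 'D_(e_ 1) (XP l) (mk2 a 0) = 0.
  move=> ar; rewrite [LHS](DF X l _ CX (axis a ar)) phi0 J1; last exact: Tal.
  by rewrite mxE.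
have XP2 l a : `|a| < r / 2 -> 'D_(e_ 1) ('D_(e_ 1) (XP l)) (mk2 a 0) = - E2 (t0 + a) 0 l.
  move=> ar; rewrite (pd_near 1 (axis a ar) (fun q bq => DF X l q CX bq)).
  rewrite (DF (Dd X) l _ CDX (axis a ar)) phi0 J2; last exact: Tal.
  by rewrite mxE.
have XP3 l a : `|a| < r / 2 -> 'D_(e_ 1) ('D_(e_ 1) ('D_(e_ 1) (XP l))) (mk2 a 0) = 2 * E3 (t0 + a) 0 l.
  move=> ar.
  have h q : box (r / 2) be q -> 'D_(e_ 1) ('D_(e_ 1) (XP l)) q = Dd (Dd X) (phi q) 0 l.
    move=> bq; rewrite (pd_near 1 bq (fun q bq => DF X l q CX bq)).
    exact: DF CDX bq.
  rewrite (pd_near 1 (axis a ar) h) (DF (Dd (Dd X)) l _ CDDX (axis a ar)) phi0 J3; last exact: Tal.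
  by rewrite mxE.
have /choice[AB HAB] : forall l, exists P : ('rV[R]_2 -> R) * ('rV[R]_2 -> R),
    [/\ smooth_on (box (r / 4) (be ^+ 2)) P.1, smooth_on (box (r / 4) (be ^+ 2)) P.2,
     forall q, box (r / 4) be q ->
      XP l q = XP l (mk2 (q 0 0) 0) + q 0 1 ^+ 2 * P.1 (sqm q) + q 0 1 ^+ 3 * P.2 (sqm q) &
     forall a, `|a| < r / 4 -> P.1 (mk2 a 0) = - 2^-1 * E2 (t0 + a) 0 l /\
       P.2 (mk2 a 0) = 3^-1 * E3 (t0 + a) 0 l].
  move=> l; have [A [B [CA CB EAB H]]] := fold_form al1 be0 (CXP l) (XP1 l).
  exists (A, B); split=> // a ar; have [h2 h3] := H a ar.
  have ar' : `|a| < r / 2 by exact: lt_trans al1.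
  split=> /=.
    have h := XP2 l a ar'; rewrite [LHS]h2 in h.
    exact: half_eq h.
  have h := XP3 l a ar'; rewrite [LHS]h3 in h.
  exact: third_eq h.
pose A q : 'rV[R]_m := \row_l (AB l).1 q; pose B q : 'rV[R]_m := \row_l (AB l).2 q.
have bb : box (r / 4) be `<=` box (r / 2) be by apply: box_mono => //; exact: ltW.
have ob4 := @box_open R (r / 4) be; have ob2 := @box_open R (r / 4) (be ^+ 2).
have SE q : box (r / 4) be q -> X (phi q) = fold_param (fun a => coord c (gamma (t0 + a))) A B q.
  move=> bq; have [q0 _] := bq; apply/rowP => l.
  have [_ _ h _] := HAB l; have := h q bq; rewrite /XP => ->.
  rewrite phi0 Xx; last by apply: Tal; exact: lt_trans al1.
  by rewrite !mxE.
exists (r / 4), be, A, B; split.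
- by split=> //; rewrite divr_gt0.
- split=> k; apply: Ck_on_rV => // l; have [CA CB _ _] := HAB l.
    by apply: Ck_on_ext (CA k) => // q _; rewrite mxE.
  by apply: Ck_on_ext (CB k) => // q _; rewrite mxE.
- split=> [k|a ar]; last by apply: TI; apply: Tal; exact: lt_trans al1.
  apply: (@Ck_on_ext _ _ _ _ _ (fun q : 'rV[R]_2 => X (mk2 (t0 + q 0 0) 0))) => //.
    by move=> q [q0 _]; rewrite Xx //; apply: Tal; exact: lt_trans al1.
  apply: (@Ck_on_comp_rV _ _ _ _ k _ Om (fun q : 'rV[R]_2 => mk2 (t0 + q 0 0) 0) X ob4 oOm _ _ (CX k)).
    by move=> q [q0 _]; apply: TO; apply: Tal; exact: lt_trans al1.
  apply: Ck_on_mk2 => //; last exact: (@Ck_on_cst R 2 R).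
  by apply: Ck_on_D => //; [exact: (@Ck_on_cst R 2 R)|exact: Ck_on_proj].
- move=> a ar; split; apply/rowP => l; rewrite [LHS]mxE [RHS]mxE; have [_ _ _ h] := HAB l; have [h1 h2] := h a ar;
   [exact: h1|exact: h2].
- move=> q bq; have Oq := phiO q (bb q bq); rewrite -SE //; split; first exact: rX.
  exact: Eu Oq.
Qed.

End SurfaceForm.

(** * The cuspidal edge *)

Section FoldChart.
Context {R : realType}.
Local Notation e_ i := (delta_mx 0 i).

Lemma is_derive_scale (V : normedModType R) m (f : V -> R) (h : V -> 'rV[R]_m) p v df dh :
  is_derive p v f df -> is_derive p v h dh ->
  is_derive p v (fun y => f y *: h y) (df *: h p + f p *: dh).
Proof.
move=> Df Dh; apply: is_derive_rV => j.
have -> : (fun y => (f y *: h y) 0 j) = (fun y => f y * h y 0 j) by apply/funext => y; rewrite mxE.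
have Dj := is_derive_component j Dh.
apply: is_derive_eq (@is_deriveM _ _ _ (fun y => h y 0 j) p v _ _ Df Dj) _.
rewrite !mxE -[f p *: dh 0 j]/(f p * dh 0 j) -[h p 0 j *: df]/(h p 0 j * df); ring.
Qed.

Lemma is_derive_mulmx n m (Q : 'M[R]_(n, m)) (p v : 'rV[R]_n) :
  is_derive p v (fun X : 'rV[R]_n => X *m Q) (v *m Q).
Proof.
apply/is_derive_epsP => e e0; exists 1 => // h h0 _.
rewrite mulmxDl addrK -scalemxAl scalerA mulVf // scale1r subrr normr0; exact: ltW.
Qed.

Lemma is_derive_proj n (p v : 'rV[R]_n) i : is_derive p v (fun X : 'rV[R]_n => X 0 i) (v 0 i).
Proof. exact: (@is_derive_component R _ n id p v v i (is_derive_id p v)). Qed.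

Definition indep3 m (w0 w1 w2 : 'rV[R]_m) :=
  forall a b c : R, a *: w0 + b *: w1 + c *: w2 = 0 -> [/\ a = 0, b = 0 & c = 0].

Section Dimension.
Variable n : nat.
Definition o0 : 'I_n.+3 := @Ordinal n.+3 0 isT.
Definition o1 : 'I_n.+3 := @Ordinal n.+3 1 isT.
Definition o2 : 'I_n.+3 := @Ordinal n.+3 2 isT.

(** [U] selects the first three rows of the zero-padded matrix [f]. Since [U *m f] has the rank of
    [U], some invertible matrix has the same product with [U]. *)
Lemma complete_basis (w0 w1 w2 : 'rV[R]_n.+3) : indep3 w0 w1 w2 ->
  exists Q : 'M[R]_n.+3, [/\ Q \in unitmx, row o0 Q = w0, row o1 Q = w1 & row o2 Q = w2].
Proof.
move=> ind; pose W : 'M[R]_(1 + (1 + 1), n.+3) := col_mx w0 (col_mx w1 w2).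
have rW : row_free W.
  rewrite -kermx_eq0; apply/rowV0P => v /sub_kermxP vW.
  rewrite -[v]hsubmxK -[rsubmx v]hsubmxK !mul_row_col in vW *.
  move: (lsubmx v) (lsubmx (rsubmx v)) (rsubmx (rsubmx v)) vW => a b c.
  rewrite [a]mx11_scalar [b]mx11_scalar [c]mx11_scalar !mul_scalar_mx addrA => /ind[-> -> ->].
  have z : (0 : R)%:M = 0 :> 'M[R]_1 by rewrite -[LHS]scalemx1 scale0r.
  by rewrite z !row_mx0.
pose f : 'M[R]_(1 + (1 + 1) + n) := col_mx W 0.
pose U : 'M[R]_(1 + (1 + 1), 1 + (1 + 1) + n) := row_mx 1%:M 0.
have Uf : U *m f = W by rewrite /U /f mul_row_col mul1mx mul0mx addr0.
have rU : \rank (U *m f) = \rank U.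
  rewrite Uf (eqP rW); apply/esym/eqP; rewrite -/(row_free U); apply/row_freeP.
  by exists (col_mx 1%:M 0); rewrite mul_row_col mul1mx mul0mx addr0.
have [Q uQ] := complete_unitmx rU; rewrite Uf => WQ.
have E : usubmx (Q : 'M[R]_(1 + (1 + 1) + n)) = W.
  by rewrite WQ -[in RHS](vsubmxK Q) /U mul_row_col mul1mx mul0mx addr0.
exists Q; split=> //; apply/rowP => j; rewrite mxE.
- have := congr1 (fun Z : 'M[R]_(1 + (1 + 1), n.+3) => Z (lshift _ 0) j) E.
  rewrite /W col_mxEu mxE => <-; congr (Q _ j); exact: val_inj.
- have := congr1 (fun Z : 'M[R]_(1 + (1 + 1), n.+3) => Z (rshift _ (lshift _ 0)) j) E.
  rewrite /W col_mxEd col_mxEu mxE => <-; congr (Q _ j); exact: val_inj.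
- have := congr1 (fun Z : 'M[R]_(1 + (1 + 1), n.+3) => Z (rshift _ (rshift _ 0)) j) E.
  rewrite /W col_mxEd col_mxEd mxE => <-; congr (Q _ j); exact: val_inj.
Qed.

Lemma mulmx_first3 (X : 'rV[R]_n.+3) (Q : 'M[R]_n.+3) : (forall i : 'I_n.+3, (3 <= i)%N -> X 0 i = 0) ->
  X *m Q = X 0 o0 *: row o0 Q + X 0 o1 *: row o1 Q + X 0 o2 *: row o2 Q.
Proof.
move=> X0; rewrite mulmx_sum_row (bigD1 o0) //= (bigD1 o1) //= (bigD1 o2) //= big1 ?addr0 ?addrA //.
move=> i /andP[/andP[i0 i1] i2]; rewrite X0 ?scale0r //.
by case: i i0 i1 i2 => -[|[|[|k]]].
Qed.

Definition slab al be : set 'rV[R]_n.+3 := [set X | box al be (mk2 (X 0 o0) (X 0 o1))].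

Lemma Ck_on_mk2_first k (U : set 'rV[R]_n.+3) : open U ->
  Ck_on k U (fun X : 'rV[R]_n.+3 => mk2 (X 0 o0) (X 0 o1)).
Proof. by move=> oU; apply: Ck_on_mk2 => //; exact: Ck_on_proj. Qed.

Lemma slab_open al be : open (slab al be).
Proof.
have c2 (X : 'rV[R]_n.+3) : setT X -> {for X, continuous (fun X : 'rV[R]_n.+3 => mk2 (X 0 o0) (X 0 o1))}.
  by move=> _; apply: (Ck_on_cont (Ck_on_mk2_first 0 openT)).
have := open_preimage openT (@box_open R al be) c2; by rewrite setTI.
Qed.

Lemma fold_chart (al be : R) (x : R -> 'rV[R]_n.+3) (A B : 'rV[R]_2 -> 'rV[R]_n.+3) :
  0 < al -> 0 < be -> smooth_on_line [set a | `|a| < al] x ->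
  smooth_on (box al be) A -> smooth_on (box al be) B ->
  indep3 (derive1 x 0) (A (mk2 0 0)) (B (mk2 0 0)) ->
  exists Phi : 'rV[R]_n.+3 -> 'rV[R]_n.+3, local_diffeo Phi 0 (slab al be) /\
    forall X : 'rV[R]_n.+3, (forall i : 'I_n.+3, (3 <= i)%N -> X 0 i = 0) ->
      Phi X = x (X 0 o0) + X 0 o1 *: A (mk2 (X 0 o0) (X 0 o1)) + X 0 o2 *: B (mk2 (X 0 o0) (X 0 o1)).
Proof.
move=> al0 be0 sx CA CB ind; set E1 := derive1 x 0 in ind *; set A0 := A (mk2 0 0) in ind *; set B0 := B (mk2 0 0) in ind *.
have [Q [uQ r0 r1 r2]] := complete_basis ind.
pose pq (X : 'rV[R]_n.+3) := mk2 (X 0 o0) (X 0 o1).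
(* Linear isomorphism plus a perturbation whose derivative at [0] vanishes. Where the coordinates
   from 3 on are zero the linear parts cancel and the fold expression remains; the other coordinates
   move along the vectors completing the basis. *)
pose Phi X := X *m Q + ((x (X 0 o0) - X 0 o0 *: E1) + (X 0 o1 *: (A (pq X) - A0) + X 0 o2 *: (B (pq X) - B0))).
have oS := @slab_open al be; have ob := @box_open R al be.
have S0 : slab al be 0.
  by rewrite /slab /=; split; rewrite /= ?mk20 ?mk21 mxE normr0.
have pq0 : pq 0 = mk2 0 0 by rewrite /pq !mxE.
have Cpq k : Ck_on k (slab al be) pq by exact: Ck_on_mk2_first.
have Cpr k i : Ck_on k (slab al be) (fun X : 'rV[R]_n.+3 => X 0 i) by exact: Ck_on_proj.
have CAp k : Ck_on k (slab al be) (fun X => A (pq X)).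
  by apply: (@Ck_on_comp_rV _ _ _ _ k _ (box al be) pq A oS ob _ (Cpq k) (CA k)).
have CBp k : Ck_on k (slab al be) (fun X => B (pq X)).
  by apply: (@Ck_on_comp_rV _ _ _ _ k _ (box al be) pq B oS ob _ (Cpq k) (CB k)).
have Cx k : Ck_on k (slab al be) (fun X : 'rV[R]_n.+3 => x (X 0 o0)).
  have Cs := @line_strip R _ [set a | `|a| < al] be x (@abs_open R al) sx.
  apply: (@Ck_on_ext _ _ _ _ _ (fun X => x (pq X 0 0))) => //; first by move=> X _; rewrite mk20.
  by apply: (@Ck_on_comp_rV _ _ _ _ k _ (box al be) pq (fun q : 'rV[R]_2 => x (q 0 0)) oS ob _ (Cpq k) (Cs k)).
have Ccst k (w : 'rV[R]_n.+3) : Ck_on k (slab al be) (fun _ : 'rV[R]_n.+3 => w) by exact: Ck_on_cst.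
have CPhi : smooth_on (slab al be) Phi.
  move=> k; apply: Ck_on_D => //; first by apply: Ck_on_mulmx => //; exact: Ck_on_id.
  apply: Ck_on_D => //.
    by apply: Ck_on_B => //; apply: Ck_on_scale.
  apply: Ck_on_D => //; apply: Ck_on_scale => //; apply: Ck_on_B => //.
exists Phi; split; last first.
  move=> X X0; rewrite /Phi mulmx_first3 // r0 r1 r2.
  rewrite !scalerBr -/(pq X).
  move: (x _) (X 0 o0 *: E1) (X 0 o1 *: A0) (X 0 o2 *: B0) (X 0 o1 *: A _) (X 0 o2 *: B _) => a b c d e f.
  by apply/rowP => j; rewrite !mxE; ring.
apply: (local_diffeo_jac oS CPhi S0) => v Dv.
have D0 : is_derive (0 : 'rV[R]_n.+3) v Phi (v *m Q).
  have dA : is_derive (0 : 'rV[R]_n.+3) v (fun X => A (pq X) - A0) ('D_v (fun X => A (pq X) - A0) 0).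
    apply: derivableP; apply: diff_derivable; apply: (C1_differentiable_rV oS _ S0).
    by apply: Ck_on_B.
  have dB : is_derive (0 : 'rV[R]_n.+3) v (fun X => B (pq X) - B0) ('D_v (fun X => B (pq X) - B0) 0).
    apply: derivableP; apply: diff_derivable; apply: (C1_differentiable_rV oS _ S0).
    by apply: Ck_on_B.
  have d1 := is_derive_scale (is_derive_proj 0 v o1) dA.
  have d2 := is_derive_scale (is_derive_proj 0 v o2) dB.
  rewrite pq0 subrr scaler0 mxE scale0r addr0 in d1.
  rewrite pq0 subrr scaler0 mxE scale0r addr0 in d2.
  have d3 : is_derive (0 : 'rV[R]_n.+3) v (fun X : 'rV[R]_n.+3 => X 0 o0 *: E1) (v 0 o0 *: E1).
    have := is_derive_scale (is_derive_proj 0 v o0) (is_derive_cst E1 (0 : 'rV[R]_n.+3) v).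
    by rewrite scaler0 addr0.
  have d4 : is_derive (0 : 'rV[R]_n.+3) v (fun X : 'rV[R]_n.+3 => x (X 0 o0)) (v 0 o0 *: E1).
    apply: is_derive_rV => j; rewrite mxE.
    have h00 : `|(0 : R)| < al by rewrite normr0.
    have dx := smooth_on_line_is_derive 0 sx h00.
    have z0 : (0 : 'rV[R]_n.+3) 0 o0 = 0 by rewrite mxE.
    apply: (@is_derive_outer _ _ (fun a => x a 0 j) (E1 0 j) (fun X : 'rV[R]_n.+3 => X 0 o0) 0 v (v 0 o0)).
      by rewrite z0; exact: is_derive_component dx.
    exact: is_derive_proj.
  have d5 := is_deriveB d4 d3; rewrite subrr in d5.
  have d6 := is_deriveD d5 (is_deriveD d1 d2); rewrite !addr0 in d6.
  by have := is_deriveD (is_derive_mulmx Q 0 v) d6; rewrite addr0.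
have : v *m Q = 0 by rewrite -Dv; case: D0.
by move=> vQ; rewrite -[v](mulmxK uQ) vQ mul0mx.
Qed.

End Dimension.

End FoldChart.

(** * The models as triangular images of monomial maps *)

Section NormalForms.
Context {R : realType}.
Local Notation e_ i := (delta_mx 0 i).

Lemma local_diffeo_inverse n (f : 'rV[R]_n -> 'rV[R]_n) x0 U : local_diffeo f x0 U ->
  exists (A B : set 'rV[R]_n) (g : 'rV[R]_n -> 'rV[R]_n),
    [/\ open A /\ open B, A x0 /\ A `<=` U, smooth_on B g /\ local_diffeo g (f x0) setT,
     (forall x, A x -> B (f x) /\ g (f x) = x) & forall y, B y -> A (g y) /\ f (g y) = y].
Proof.
move=> [A [B [g [[oA oB] [Ax AU] [sf sg] fA gB]]]]; exists A, B, g; split=> //.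
split=> //; exists B, A, f; split=> //; split=> //; exact: (fA x0 Ax).1.
Qed.

(** Used with [k = 1] to pass from [(t, s)] to [(a, w)], and with [k = -1] to return to the
    parameters of a model. *)
Lemma mk2_shear_diffeo t0 k (p : 'rV[R]_2) :
  local_diffeo (fun q : 'rV[R]_2 => mk2 (q 0 0 - t0 + k * q 0 1) (q 0 1)) p setT.
Proof.
have C0 l : Ck_on l setT (fun q : 'rV[R]_2 => q 0 0) by apply: Ck_on_proj; exact: openT.
have C1 l : Ck_on l setT (fun q : 'rV[R]_2 => q 0 1) by apply: Ck_on_proj; exact: openT.
have cc l (z : R) : Ck_on l setT (fun _ : 'rV[R]_2 => z) by exact: Ck_on_cst.
apply: (@local_diffeo_global _ _ _ (fun q => mk2 (q 0 0 - k * q 0 1 + t0) (q 0 1))).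
- move=> l; apply: Ck_on_mk2 => //; try exact: openT.
  apply: Ck_on_D; [exact: openT| |apply: Ck_on_M => //; exact: openT].
  by apply: Ck_on_B => //; exact: openT.
- move=> l; apply: Ck_on_mk2 => //; try exact: openT.
  apply: Ck_on_D => //; try exact: openT.
  by apply: Ck_on_B => //; [exact: openT|apply: Ck_on_M => //; exact: openT].
- by move=> q; apply: rV2_ext; rewrite !(mk20, mk21) //; ring.
- by move=> q; apply: rV2_ext; rewrite !(mk20, mk21) //; ring.
Qed.

Lemma surface_diffeo m (M : manifold R m) (c : chart M) (f : euclid R 2 -> M) (t0 al be : R)
    (S : 'rV[R]_2 -> 'rV[R]_m) (N : 'rV[R]_2 -> 'rV[R]_m) (W0 : set 'rV[R]_2)
    (sg : 'rV[R]_2 -> 'rV[R]_2) (T : 'rV[R]_m -> 'rV[R]_m) :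
  0 < al -> 0 < be -> smooth_on (box al be) S ->
  (forall q, box al be q -> chart_range c (S q) /\ f (mk2 (t0 + q 0 0 - q 0 1) (q 0 1)) = param c (S q)) ->
  open W0 -> W0 0 -> local_diffeo sg 0 setT -> sg 0 = 0 -> local_diffeo T (S 0) setT ->
  (forall q, box al be q -> W0 q -> T (S q) = N (sg q)) ->
  @locally_diffeomorphic R m m M (euclid R m) f (pt t0 0) N (pt 0 0).
Proof.
move=> al0 be0 CS fS oW0 W00 Hsg sg0 HT TN.
(* Inverse of [(a, w) |-> (t0 + a - w, w)], the parametrisation in which the surface is given. *)
pose chi (q : 'rV[R]_2) := mk2 (q 0 0 - t0 + 1 * q 0 1) (q 0 1).
have ob := @box_open R al be.
have b0 : box al be 0 by split; rewrite /= mxE normr0.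
pose B0 := box al be `&` W0; have oB0 : open B0 by exact: openI.
have Cchi : Ck_on 0 setT chi.
  have [A [B [g [[oA _] [_ _] [sc _] _ _]]]] := mk2_shear_diffeo t0 1 0.
  have oT : open (@setT 'rV[R]_2) by exact: openT.
  apply: Ck_on_mk2 => //; last exact: Ck_on_proj.
  apply: Ck_on_D => //; first by apply: Ck_on_B => //; [exact: Ck_on_proj|exact: (@Ck_on_cst R 2 R)].
  by apply: Ck_on_M => //; [exact: (@Ck_on_cst R 2 R)|exact: Ck_on_proj].
have oW : open (chi @^-1` B0).
  have := open_preimage openT oB0 (fun q Tq => Ck_on_cont Cchi Tq); by rewrite setTI.
have chi0 : chi (mk2 t0 0) = 0.
  by apply: rV2_ext; rewrite /chi !(mk20, mk21) !mxE //= subrr mulr0 addr0.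
have Wp : (chi @^-1` B0) (mk2 t0 0) by rewrite /= chi0; split.
have E0 : (pt 0 0 : 'rV[R]_2) = (sg \o chi) (mk2 t0 0).
  by rewrite /= chi0 sg0; apply: rV2_ext; rewrite !mxE.
rewrite E0.
apply: (@locally_diffeomorphic_chart R m M c f (mk2 t0 0) N (sg \o chi) T (S \o chi) (chi @^-1` B0) oW Wp).
- move=> q [bq _]; apply: (@continuous_comp _ _ _ chi S); first exact: Ck_on_cont Cchi I.
  exact: Ck_on_cont (CS 0%N) bq.
- move=> q [bq _]; have [h1 h2] := fS _ bq; split=> //; rewrite /= -h2; congr f.
  by apply: rV2_ext; rewrite /chi !(mk20, mk21) //; ring.
- apply: (@local_diffeo_restrict _ _ _ _ setT) => //.
  have Hsg' : local_diffeo sg (chi (mk2 t0 0)) setT by rewrite chi0.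
  exact: local_diffeo_comp (mk2_shear_diffeo t0 1 (mk2 t0 0)) Hsg'.
- apply: (@local_diffeo_restrict _ _ _ _ setT); first exact: codom_open.
  + by rewrite /= chi0; exact: (fS _ b0).1.
  + by rewrite /= chi0.
- by move=> q [bq Wq]; exact: TN.
Qed.

Definition emb3 n (a b c : R) : 'rV[R]_n.+3 := \row_(i < n.+3) nth 0 [:: a; b; c] i.

Lemma emb3_0 n a b c : @emb3 n a b c 0 (o0 n) = a. Proof. by rewrite mxE. Qed.
Lemma emb3_1 n a b c : @emb3 n a b c 0 (o1 n) = b. Proof. by rewrite mxE. Qed.
Lemma emb3_2 n a b c : @emb3 n a b c 0 (o2 n) = c. Proof. by rewrite mxE. Qed.
Lemma emb3_ge n a b c (i : 'I_n.+3) : (3 <= i)%N -> @emb3 n a b c 0 i = 0.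
Proof. by move=> i3; rewrite mxE nth_default. Qed.

Lemma Ck_on_emb3 n p k (U : set 'rV[R]_p) (f g h : 'rV[R]_p -> R) : open U ->
  Ck_on k U f -> Ck_on k U g -> Ck_on k U h -> Ck_on k U (fun q => @emb3 n (f q) (g q) (h q)).
Proof.
move=> oU Cf Cg Ch; apply: Ck_on_rV => // -[[|[|[|j]]] ij].
- by apply: Ck_on_ext Cf => // q _; rewrite mxE.
- by apply: Ck_on_ext Cg => // q _; rewrite mxE.
- by apply: Ck_on_ext Ch => // q _; rewrite mxE.
- apply: (@Ck_on_ext _ _ _ _ _ (fun _ => 0)) => //; last exact: (@Ck_on_cst R p R).
  by move=> q _; rewrite emb3_ge.
Qed.

(** Changes coordinates 1 and 2 and fixes all others, so one map serves every dimension and its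
    inverse has the same shape. *)
Definition tri n (a b : 'rV[R]_n.+3 -> R) (X : 'rV[R]_n.+3) : 'rV[R]_n.+3 :=
  \row_i (if i == o1 n then a X else if i == o2 n then b X else X 0 i).

Lemma tri0 n a b X : @tri n a b X 0 (o0 n) = X 0 (o0 n). Proof. by rewrite mxE. Qed.
Lemma tri1 n a b X : @tri n a b X 0 (o1 n) = a X. Proof. by rewrite mxE. Qed.
Lemma tri2 n a b X : @tri n a b X 0 (o2 n) = b X. Proof. by rewrite mxE. Qed.

Lemma tri_smooth n a b : smooth_on setT a -> smooth_on setT b -> smooth_on setT (@tri n a b).
Proof.
move=> Ca Cb k; have oT := @openT 'rV[R]_n.+3; apply: Ck_on_rV => // j.
apply: (@Ck_on_ext _ _ _ _ _ (if j == o1 n then a else if j == o2 n then b else fun X => X 0 j)) => //.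
  by move=> X _; rewrite mxE; case: ifP => // _; case: ifP.
by case: ifP => // _; case: ifP => // _; exact: Ck_on_proj.
Qed.

Lemma tri_cancel n a b a' b' :
  (forall X, a' (@tri n a b X) = X 0 (o1 n)) -> (forall X, b' (@tri n a b X) = X 0 (o2 n)) ->
  cancel (@tri n a b) (tri a' b').
Proof.
move=> ha hb X; apply/rowP => j; rewrite mxE; case: eqP => [->|/eqP j1]; first exact: ha.
case: eqP => [->|/eqP j2]; first exact: hb.
by rewrite mxE (negbTE j1) (negbTE j2).
Qed.

Lemma tri_emb3 n a b x y z : @tri n a b (emb3 n x y z) = emb3 n x (a (emb3 n x y z)) (b (emb3 n x y z)).
Proof.
apply/rowP => -[[|[|[|j]]] ij]; rewrite [LHS]mxE.
- by rewrite !mxE.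
- by rewrite [RHS]mxE.
- by rewrite [RHS]mxE.
- by rewrite /= !emb3_ge.
Qed.

Section Models.
Variable n : nat.
Let x0 (X : 'rV[R]_n.+3) := X 0 (o0 n).
Let x1 (X : 'rV[R]_n.+3) := X 0 (o1 n).
Let x2 (X : 'rV[R]_n.+3) := X 0 (o2 n).
Let oT := @openT 'rV[R]_n.+3.
Let C0 k : Ck_on k setT x0. Proof. exact: Ck_on_proj. Qed.
Let C1 k : Ck_on k setT x1. Proof. exact: Ck_on_proj. Qed.
Let C2 k : Ck_on k setT x2. Proof. exact: Ck_on_proj. Qed.
Let cc k (z : R) : Ck_on k setT (fun _ : 'rV[R]_n.+3 => z). Proof. exact: Ck_on_cst. Qed.

(** With [t = a - w] and [s = w] one has [t^2 + 2st = a^2 - w^2] and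
    [t^3 + 3st^2 = a^3 - 3 a w^2 + 2 w^3]. *)
Definition cusp_tri : 'rV[R]_n.+3 -> 'rV[R]_n.+3 :=
  tri (fun X => x0 X ^+ 2 - x1 X) (fun X => x0 X ^+ 3 - 3 * (x0 X * x1 X) + 2 * x2 X).

Lemma cusp_tri_diffeo X : local_diffeo cusp_tri X setT.
Proof.
pose y1 X := x0 X ^+ 2 - x1 X.
pose y2 X := 2^-1 * (x2 X - x0 X ^+ 3 + 3 * (x0 X * y1 X)).
have Cy1 : smooth_on setT y1 by move=> k; apply: Ck_on_B => //; exact: Ck_on_X.
apply: (@local_diffeo_global _ _ _ (tri y1 y2)).
- apply: tri_smooth => // k; apply: Ck_on_D => //; last exact: Ck_on_M.
  by apply: Ck_on_B => //; [exact: Ck_on_X|apply: Ck_on_M => //; exact: Ck_on_M].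
- apply: tri_smooth => // k; apply: Ck_on_M => //; apply: Ck_on_D => //.
    by apply: Ck_on_B => //; exact: Ck_on_X.
  by apply: Ck_on_M => //; apply: Ck_on_M.
- apply: tri_cancel => Z; rewrite /y1 /y2 /x0 /x1 /x2 !(tri0, tri1, tri2); first by ring.
  by rewrite /y1 /x0 /x1 !(tri0, tri1); field.
- apply: tri_cancel => Z; rewrite /x0 /x1 /x2 !(tri0, tri1, tri2) /y2 /y1 /x0 /x1 /x2; first by ring.
  by field.
Qed.

Lemma cuspidal_edgeE (q : 'rV[R]_2) :
  @cuspidal_edge R n.+3 (mk2 (q 0 0 - q 0 1) (q 0 1)) = cusp_tri (emb3 n (q 0 0) (q 0 1 ^+ 2) (q 0 1 ^+ 3)).
Proof.
rewrite /cusp_tri tri_emb3 /x0 /x1 /x2 !(emb3_0, emb3_1, emb3_2).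
set p := mk2 _ _.
have -> : @cuspidal_edge R n.+3 p = emb3 n (p 0 0 + p 0 1) (p 0 0 ^+ 2 + 2 * p 0 1 * p 0 0)
   (p 0 0 ^+ 3 + 3 * p 0 1 * p 0 0 ^+ 2) by [].
by rewrite !(mk20, mk21); congr (emb3 n _ _ _); ring.
Qed.

(** With [t = a - w] and [s = w] one has [t^4 + 4st^3 = a^4 - 6 a^2 w^2 + 8 a w^3 - 3 w^4], a
    function of [a], [w^2] and [a w^3]. *)
Definition umbrella_tri : 'rV[R]_n.+3 -> 'rV[R]_n.+3 :=
  tri (fun X => x0 X ^+ 2 - x1 X)
      (fun X => x0 X ^+ 4 - 6 * (x0 X ^+ 2 * x1 X) + 8 * x2 X - 3 * x1 X ^+ 2).

Lemma umbrella_tri_diffeo X : local_diffeo umbrella_tri X setT.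
Proof.
pose y1 X := x0 X ^+ 2 - x1 X.
pose y2 X := 8^-1 * (x2 X - x0 X ^+ 4 + 6 * (x0 X ^+ 2 * y1 X) + 3 * y1 X ^+ 2).
have Cy1 : smooth_on setT y1 by move=> k; apply: Ck_on_B => //; exact: Ck_on_X.
have CX k p : Ck_on k setT (fun X => x0 X ^+ p) by exact: Ck_on_X.
apply: (@local_diffeo_global _ _ _ (tri y1 y2)).
- apply: tri_smooth => // k; apply: Ck_on_B => //; last by apply: Ck_on_M => //; exact: Ck_on_X.
  apply: Ck_on_D => //; last exact: Ck_on_M.
  by apply: Ck_on_B => //; apply: Ck_on_M => //; exact: Ck_on_M.
- apply: tri_smooth => // k; apply: Ck_on_M => //; apply: Ck_on_D => //.
    apply: Ck_on_D => //; first by apply: Ck_on_B.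
    by apply: Ck_on_M => //; apply: Ck_on_M.
  by apply: Ck_on_M => //; apply: Ck_on_X.
- apply: tri_cancel => Z; rewrite /y1 /y2 /x0 /x1 /x2 !(tri0, tri1, tri2); first by ring.
  by rewrite /y1 /x0 /x1 !(tri0, tri1); field.
- apply: tri_cancel => Z; rewrite /x0 /x1 /x2 !(tri0, tri1, tri2) /y2 /y1 /x0 /x1 /x2; first by ring.
  by field.
Qed.

End Models.

Lemma folded_umbrellaE (q : 'rV[R]_2) :
  @folded_umbrella R (mk2 (q 0 0 - q 0 1) (q 0 1)) =
  umbrella_tri (emb3 0 (q 0 0) (q 0 1 ^+ 2) (q 0 0 * q 0 1 ^+ 3)).
Proof.
rewrite /umbrella_tri tri_emb3 !(emb3_0, emb3_1, emb3_2).
set p := mk2 _ _.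
have -> : @folded_umbrella R p = emb3 0 (p 0 0 + p 0 1) (p 0 0 ^+ 2 + 2 * p 0 1 * p 0 0)
   (p 0 0 ^+ 4 + 4 * p 0 1 * p 0 0 ^+ 3) by [].
by rewrite !(mk20, mk21); congr (emb3 0 _ _ _); ring.
Qed.

End NormalForms.

(** * The case of independent first three derivatives *)

Section CuspidalEdge.
Context {R : realType}.
Local Notation e_ i := (delta_mx 0 i).

Lemma indep3_scale m (w0 w1 w2 : 'rV[R]_m) k1 k2 : k1 != 0 -> k2 != 0 ->
  indep3 w0 w1 w2 -> indep3 w0 (k1 *: w1) (k2 *: w2).
Proof.
move=> k10 k20 ind a b c; rewrite !scalerA => /ind[-> /eqP h1 /eqP h2].
by move: h1 h2; rewrite !mulf_eq0 (negbTE k10) (negbTE k20) !orbF => /eqP -> /eqP ->.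
Qed.

Lemma lin_indep_indep3 m (M : manifold R m) (p : M) (v0 v1 v2 : components M) c : dom c p ->
  tangent_at p v0 -> tangent_at p v1 -> tangent_at p v2 -> lin_indep p [:: v0; v1; v2] ->
  indep3 (v0 c) (v1 c) (v2 c).
Proof.
move=> cp t0 t1 t2 li a b d E.
have tv i : (i < size [:: v0; v1; v2])%N -> tangent_at p (nth (fun=> 0) [:: v0; v1; v2] i).
  case: i => [|[|[|i]]] ?; [exact: t0|exact: t1|exact: t2|by []].
have H := @lin_indep_chart _ _ _ p [:: v0; v1; v2] c cp tv li (fun i => nth 0 [:: a; b; d] i).
have {}H : forall i : 'I_3, nth 0 [:: a; b; d] i = 0.
  by apply: H; rewrite !big_ord_recl big_ord0 /= addr0 addrA.
split; [exact: (H (@Ordinal 3 0 isT))|exact: (H (@Ordinal 3 1 isT))|exact: (H (@Ordinal 3 2 isT))].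
Qed.

Lemma indep3_lin_indep m (M : manifold R m) (p : M) (v0 v1 v2 : components M) c : dom c p ->
  indep3 (v0 c) (v1 c) (v2 c) -> lin_indep p [:: v0; v1; v2].
Proof.
move=> cp ind a H; have := H c cp; rewrite !big_ord_recl big_ord0 /= addr0 addrA => /ind[h0 h1 h2].
move=> -[[|[|[|i]]] ii] //; [rewrite -[RHS]h0|rewrite -[RHS]h1|rewrite -[RHS]h2]; congr a; exact: val_inj.
Qed.

Definition pow23 n (q : 'rV[R]_2) : 'rV[R]_n.+3 := emb3 n (q 0 0) (q 0 1 ^+ 2) (q 0 1 ^+ 3).

Lemma Ck_on_pow23 n k (U : set 'rV[R]_2) : open U -> Ck_on k U (@pow23 n).
Proof.
move=> oU; have C1 p : Ck_on k U (fun q : 'rV[R]_2 => q 0 1 ^+ p) by apply: Ck_on_X => //; exact: Ck_on_proj.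
by apply: Ck_on_emb3 => //; exact: Ck_on_proj.
Qed.

Lemma pow23_0 n : @pow23 n 0 = 0.
Proof. by apply/rowP => -[[|[|[|j]]] ij]; rewrite !mxE ?expr0n //= nth_nil. Qed.

Lemma fold_param_pow23 n (x : R -> 'rV[R]_n.+3) A B q : fold_param x A B q =
  let X := @pow23 n q in
  x (X 0 (o0 n)) + X 0 (o1 n) *: A (mk2 (X 0 (o0 n)) (X 0 (o1 n))) + X 0 (o2 n) *: B (mk2 (X 0 (o0 n)) (X 0 (o1 n))).
Proof. by rewrite /pow23 /= !(emb3_0, emb3_1, emb3_2). Qed.

Lemma smooth_fold_param m (al be : R) (x : R -> 'rV[R]_m) A B : 0 < be ->
  smooth_on (box al be) (fun q : 'rV[R]_2 => x (q 0 0)) ->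
  smooth_on (box al (be ^+ 2)) A -> smooth_on (box al (be ^+ 2)) B ->
  smooth_on (box al be) (fold_param x A B).
Proof.
move=> be0 Cx CA CB k; have ob := @box_open R al be.
have C1 p : Ck_on k (box al be) (fun q : 'rV[R]_2 => q 0 1 ^+ p).
  by apply: Ck_on_X => //; exact: Ck_on_proj.
apply: Ck_on_D => //; first by apply: Ck_on_D => //; apply: Ck_on_scale => //; exact: smooth_sqm be0 CA k.
by apply: Ck_on_scale => //; exact: smooth_sqm be0 CB k.
Qed.

Lemma curve_coord_derive1 m (M : manifold R m) (I : set R) (gamma : R -> M) c t0 :
  smooth_curve I gamma -> I t0 -> dom c (gamma t0) ->
  derive1 (fun a => coord c (gamma (t0 + a))) 0 = velocity gamma t0 c.
Proof.
move=> sg It0 ct0; have D := curve_is_derive sg It0 ct0.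
rewrite -[X in is_derive X](addr0 t0) in D.
by have [_ <-] := @is_derive_translate _ _ (coord c \o gamma) t0 0 _ D; rewrite derive1E.
Qed.

Theorem cuspidal_case n (M : manifold R n.+3) (nabla : connection M) (I : set R) (gamma : R -> M) (t0 : R) :
  torsion_free nabla -> open I -> smooth_curve I gamma -> I t0 ->
  lin_indep (gamma t0) [:: cov_iter nabla gamma 1 t0; cov_iter nabla gamma 2 t0; cov_iter nabla gamma 3 t0] ->
  locally_diffeomorphic (tangent_surface nabla gamma) (pt t0 0) (@cuspidal_edge R n.+3) (pt 0 0).
Proof.
move=> tf oI sg It0 li; have [c ct0] := dom_cover (gamma t0).
have [al [be [A [B [[al0 be0] [CA CB] [Cx _] HAB fS]]]]] := surface_form tf oI sg It0 ct0.
set x := fun a => coord c (gamma (t0 + a)) in Cx fS.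
have be20 : 0 < be ^+ 2 by rewrite exprn_gt0.
have sx : smooth_on_line [set a : R | `|a| < al] x by exact: strip_line be0 (@abs_open R al) Cx.
have h0 : `|(0 : R)| < al by rewrite normr0.
have ind : indep3 (derive1 x 0) (A (mk2 0 0)) (B (mk2 0 0)).
  have tg k := (cov_iterP nabla k oI sg).1 t0 It0.
  have ind := lin_indep_indep3 ct0 (tg 0%N) (tg 1%N) (tg 2%N) li.
  have [EA EB] := HAB 0 h0; rewrite addr0 in EA EB; rewrite EA EB (curve_coord_derive1 sg It0 ct0).
  by apply: indep3_scale ind; rewrite ?oppr_eq0 invr_eq0 pnatr_eq0.
have [Phi [lPhi PhiE]] := fold_chart al0 be20 sx CA CB ind.
have [AP [BP [Th [[oA oB] [A0 AS] [_ lTh] TA _]]]] := local_diffeo_inverse lPhi.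
have SE q : fold_param x A B q = Phi (@pow23 n q).
  by rewrite PhiE ?fold_param_pow23 // => i; exact: emb3_ge.
have oW : open (@pow23 n @^-1` AP).
  have := open_preimage openT oA (fun q Tq => Ck_on_cont (@Ck_on_pow23 n 0 setT openT) Tq).
  by rewrite setTI.
(* The shear with factor [-1] turns [(a, w)] into [(a - w, w)], the arguments of the model; the
   target map straightens the surface by [Th] and then applies the model's triangular map. *)
apply: (@surface_diffeo R n.+3 M c (tangent_surface nabla gamma) t0 al be (fold_param x A B)
   (@cuspidal_edge R n.+3) (@pow23 n @^-1` AP) (fun q : 'rV[R]_2 => mk2 (q 0 0 - 0 + (-1) * q 0 1) (q 0 1))
   (@cusp_tri R n \o Th)) => //.
- exact: smooth_fold_param.
- by rewrite /= pow23_0.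
- exact: mk2_shear_diffeo.
- by apply: rV2_ext; rewrite !(mk20, mk21) !mxE //; ring.
- rewrite SE pow23_0; apply: local_diffeo_comp lTh _; exact: cusp_tri_diffeo.
- move=> q _ Wq; rewrite /= SE (TA _ Wq).2 /pow23 -cuspidal_edgeE; congr cuspidal_edge.
  by apply: rV2_ext; rewrite !(mk20, mk21) //; ring.
Qed.

End CuspidalEdge.

(** * The folded umbrella *)

Section FoldedUmbrella.
Context {R : realType}.
Local Notation e_ i := (delta_mx 0 i).

Lemma Ck_on_sqrt n k (U : set 'rV[R]_n) (f : 'rV[R]_n -> R) : open U -> (forall x, U x -> 0 < f x) ->
  Ck_on k U f -> Ck_on k U (fun x => Num.sqrt (f x)).
Proof.
move=> oU f0; have c0 : Ck_on 0 U f -> forall x, U x -> {for x, continuous (fun x => Num.sqrt (f x))}.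
  move=> Cf x Ux; apply: (@continuous_comp _ _ _ f Num.sqrt _ (Ck_on_cont Cf Ux)); exact: sqrt_continuous.
elim: k => [|k IH] Cf; first by split=> //; exact: c0.
have Cg := IH (Ck_onW Cf).
apply: (@Ck_onS _ _ _ _ _ _ (fun i x => 'D_(e_ i) f x * (2 * Num.sqrt (f x))^-1)) => //.
- by apply: c0; exact: Ck_on_le Cf.
- move=> i x Ux; have df := derivableP ((Cf.2 i).1 x Ux).
  by apply: is_derive_outer df; exact: is_derive1_sqrt (f0 x Ux).
- move=> i; apply: Ck_on_M => //; first exact: (Cf.2 i).2.
  apply: Ck_on_inv => //; first by move=> x Ux; rewrite mulf_neq0 // gt_eqF // sqrtr_gt0 f0.
  by apply: Ck_on_M => //; exact: Ck_on_cst.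
Qed.

Lemma norm_box (b d : R) (q : 'rV[R]_2) : 0 < d -> b <= d -> box b b q -> `|q| < d.
Proof.
move=> d0 bd [q0 q1]; apply: norm_rV_lt => // i.
by case: (ord2P i) => ->; [apply: lt_le_trans q0 _|apply: lt_le_trans q1 _].
Qed.

Lemma open_box (U : set 'rV[R]_2) : open U -> U 0 -> exists2 b, 0 < b & box b b `<=` U.
Proof.
move=> oU U0; have [d d0 Hd] := (nbhs_norm_ltP _ _).1 (near_open oU U0).
by exists d => // q bq; apply: Hd; rewrite subr0; exact: norm_box bq.
Qed.

Lemma is_derive_coord_mul n (h : 'rV[R]_n -> R) i (v : 'rV[R]_n) : derivable h 0 v ->
  is_derive (0 : 'rV[R]_n) v (fun X : 'rV[R]_n => X 0 i * h X) (v 0 i * h 0).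
Proof.
move=> /derivableP dh.
apply: is_derive_eq (@is_deriveM _ _ _ h 0 v _ _ (is_derive_proj 0 v i) dh) _.
by rewrite mxE scale0r add0r -[h 0 *: _]/(h 0 * v 0 i) mulrC.
Qed.

Lemma derive_axis0 (f g : 'rV[R]_2 -> R) : (\forall a \near (0 : R), f (mk2 a 0) = g (mk2 a 0)) ->
  'D_(e_ 0) f 0 = 'D_(e_ 0) g 0.
Proof.
move=> fg.
have E (h : 'rV[R]_2 -> R) : 'D_(e_ 0) h 0 = 'D_1 (fun a => h (mk2 a 0)) (0 : R).
  suff <- : (fun a : R => h (a *: e_ 0 + 0)) = (fun a => h (mk2 a 0)) by exact: derive_line.
  apply/funext => a; congr h.
  by apply: rV2_ext; rewrite !mxE /= ?addr0 ?mulr1 ?mulr0.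
by rewrite !E; exact: near_eq_derive.
Qed.

Lemma smooth_derivable_dir n (U : set 'rV[R]_n) (f : 'rV[R]_n -> R) x v : open U -> smooth_on U f -> U x ->
  derivable f x v.
Proof. by move=> oU Cf Ux; apply: diff_derivable; exact: (C1_differentiable oU (Cf 1%N) Ux).1. Qed.

Lemma mk2_00 : mk2 0 0 = 0 :> 'rV[R]_2.
Proof. by apply: rV2_ext; rewrite !mxE. Qed.

(* The source coordinates [Sm] make the first two components [(a, w^2)];
   Whitney's splitting [r' = r0(a, w^2) + w r1(a, w^2)] of the remaining factor
   then allows [r0] itself to serve as the first coordinate. *)
Lemma umbrella_normal (r : R) (Q0 Q1 Q2 : 'rV[R]_2 -> R) : 0 < r ->
  smooth_on (box r r) Q0 -> smooth_on (box r r) Q1 -> smooth_on (box r r) Q2 ->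
  Q2 0 = 0 -> 'D_(e_ 0) Q2 0 != 0 ->
  exists (W : set 'rV[R]_2) (sg : 'rV[R]_2 -> 'rV[R]_2) (T : 'rV[R]_3 -> 'rV[R]_3),
    [/\ open W /\ W 0, local_diffeo sg 0 setT, sg 0 = 0, local_diffeo T 0 setT &
     forall q, W q ->
       T (emb3 0 (q 0 0 + q 0 1 ^+ 3 * Q0 q) (q 0 1 ^+ 2 + q 0 1 ^+ 3 * Q1 q) (q 0 1 ^+ 3 * Q2 q)) =
       emb3 0 (sg q 0 0) (sg q 0 1 ^+ 2) (sg q 0 0 * sg q 0 1 ^+ 3)].
Proof.
move=> r0 C0 C1 C2 Q20 dQ2; have ob := @box_open R r r.
have b0 b b' : 0 < b -> 0 < b' -> box b b' (0 : 'rV[R]_2) by move=> ? ?; split; rewrite /= mxE normr0.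
(* [w^2 + w^3 Q1] is [w^2 f1] with [f1 > 0] near the origin, so [w] times the square root of [f1] is
   a smooth coordinate whose square is the second component. *)
pose f1 (q : 'rV[R]_2) := 1 + q 0 1 * Q1 q.
have Cf1 : smooth_on (box r r) f1.
  move=> k; apply: Ck_on_D => //; first exact: (@Ck_on_cst R 2 R).
  exact: smooth_mul_coord C1 k.
pose U1 := box r r `&` f1 @^-1` [set y : R | 0 < y].
have oU1 : open U1.
  by apply: open_preimage; [exact: box_open|exact: open_gt|move=> q bq; exact: Ck_on_cont (Cf1 0%N) bq].
have U10 : U1 0 by split; [exact: b0|rewrite /= /f1 mxE mul0r addr0].
have sub1 : U1 `<=` box r r by move=> q [].
pose e (q : 'rV[R]_2) : R := Num.sqrt (f1 q).
have Ce : smooth_on U1 e.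
  by move=> k; apply: Ck_on_sqrt => //; [move=> q []|exact: Ck_on_sub sub1 (Cf1 k)].
have e_gt0 q : U1 q -> 0 < e q by move=> [_ h]; rewrite sqrtr_gt0.
have e_sq q : U1 q -> e q ^+ 2 = f1 q by move=> [_ /ltW h]; rewrite sqr_sqrtr.
have e1 (q : 'rV[R]_2) : q 0 1 = 0 -> e q = 1 by move=> q1; rewrite /e /f1 q1 mul0r addr0 sqrtr1.
have Cp k i : Ck_on k U1 (fun q : 'rV[R]_2 => q 0 i) by exact: Ck_on_proj.
pose Sm (q : 'rV[R]_2) := mk2 (q 0 0 + q 0 1 * (q 0 1 ^+ 2 * Q0 q)) (q 0 1 * e q).
have Ch0 : smooth_on U1 (fun q : 'rV[R]_2 => q 0 1 ^+ 2 * Q0 q).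
  by move=> k; apply: Ck_on_M => //; [exact: Ck_on_X|exact: Ck_on_sub sub1 (C0 k)].
have CSm : smooth_on U1 Sm.
  move=> k; apply: Ck_on_mk2 => //; last exact: Ck_on_M.
  by apply: Ck_on_D => //; exact: Ck_on_M.
have Sm_axis (a : R) : Sm (mk2 a 0) = mk2 a 0.
  by apply: rV2_ext; rewrite /Sm !(mk20, mk21) !mul0r ?addr0.
have Sm0 : Sm 0 = 0 by rewrite -mk2_00 Sm_axis.
have lSm : local_diffeo Sm 0 U1.
  apply: local_diffeo_jac => // v Dv.
  have D : is_derive (0 : 'rV[R]_2) v Sm v.
    apply: is_derive_rV => j; case: (ord2P j) => ->.
      have -> : (fun q => Sm q 0 0) = (fun q : 'rV[R]_2 => q 0 0 + q 0 1 * (q 0 1 ^+ 2 * Q0 q)) by apply/funext => q; rewrite mk20.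
      have := is_deriveD (is_derive_proj 0 v 0) (is_derive_coord_mul 1 (smooth_derivable_dir (v := v) oU1 Ch0 U10)).
      by rewrite mxE expr0n /= mul0r mulr0 addr0.
    have -> : (fun q => Sm q 0 1) = (fun q : 'rV[R]_2 => q 0 1 * e q) by apply/funext => q; rewrite mk21.
    have := is_derive_coord_mul 1 (smooth_derivable_dir (v := v) oU1 Ce U10).
    by rewrite (e1 0) ?mulr1 // mxE.
  by case: D => _ <-.
have [AS [BS [ka [[oA oB] [A0 AU] [Cka _] SA SB]]]] := local_diffeo_inverse lSm.
(* The new second coordinate cubed is [w^3 e^3], so the third component is this cube times [F]. *)
pose F q := Q2 q * (e q)^-1 ^+ 3.
have CF : smooth_on U1 F.
  move=> k; apply: Ck_on_M => //; first exact: Ck_on_sub sub1 (C2 k).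
  by apply: Ck_on_X => //; apply: Ck_on_inv => // q /e_gt0 h; rewrite gt_eqF.
pose rr q := F (ka q).
have Crr : smooth_on BS rr.
  move=> k; apply: (@Ck_on_comp _ _ _ k _ U1 ka F oB oU1 _ (Cka k) (CF k)).
  by move=> y /SB[/AU].
have BS0 : BS 0 by rewrite -Sm0; exact: (SA 0 A0).1.
have [b b_gt0 bB] := open_box oB BS0.
have b2 : b / 2 < b by lra.
have b20 : 0 < b / 2 by rewrite divr_gt0.
have bb0 : 0 < b ^+ 2 by rewrite exprn_gt0.
have [r0' [r1' [Cr0 Cr1 Er]]] := whitney_split b2 b_gt0 (fun k => Ck_on_sub bB (Crr k)).
have {}Er q : box (b / 2) b q -> rr q = r0' (sqm q) + q 0 1 * r1' (sqm q) := Er q.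
have ob2 := @box_open R (b / 2) (b ^+ 2).
have near_axis (V : set 'rV[R]_2) : open V -> V 0 -> \forall a \near (0 : R), V (mk2 a 0).
  move=> oV V0; have [d d0 Hd] := open_box oV V0.
  apply: (nbhs_norm_ltP _ _).2; exists d => // a; rewrite subr0 => ad.
  by apply: Hd; split; rewrite /= ?mk20 // mk21 normr0.
(* On the axis [Sm] is the identity and [e = 1], so [r0] inherits from [Q2] its zero at the origin
   and its nonzero derivative. *)
have r0Q : \forall a \near (0 : R), r0' (mk2 a 0) = Q2 (mk2 a 0).
  apply: filterS (near_and (near_axis _ oA A0) (near_axis _ (@box_open R (b / 2) b) (b0 _ _ b20 b_gt0))) => a [Aa ba].
  have := Er _ ba; rewrite /sqm mk20 mk21 expr0n mul0r addr0 => <-.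
  have -> : rr (mk2 a 0) = F (mk2 a 0) by rewrite /rr -{1}(Sm_axis a) (SA _ Aa).2.
  by rewrite /F e1 ?mk21 // invr1 expr1n mulr1.
have r00 : r0' 0 = 0 by have := nbhs_singleton r0Q; rewrite mk2_00 Q20.
have dr0 : 'D_(e_ 0) r0' 0 != 0 by rewrite (derive_axis0 r0Q).
have [dr dr_sum] := C1_differentiable ob2 (Cr0 1%N) (b0 _ _ b20 bb0).
pose Rm (q : 'rV[R]_2) := mk2 (r0' (sqm q)) (q 0 1).
have obb := @box_open R (b / 2) b.
have CRm : smooth_on (box (b / 2) b) Rm.
  by move=> k; apply: Ck_on_mk2 => //; [exact: smooth_sqmR b_gt0 Cr0 k|exact: Ck_on_proj].
have sqm0 : sqm 0 = 0 :> 'rV[R]_2 by apply: rV2_ext; rewrite /sqm !(mk20, mk21) !mxE // expr0n.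
have lRm : local_diffeo Rm 0 (box (b / 2) b).
  apply: local_diffeo_jac => //; first exact: b0.
  move=> v Dv.
  have dsq : is_derive (0 : 'rV[R]_2) v sqm (mk2 (v 0 0) 0).
    apply: is_derive_rV => j; case: (ord2P j) => ->.
      have -> : (fun q => sqm q 0 0) = (fun q : 'rV[R]_2 => q 0 0) by apply/funext => q; rewrite mk20.
      by rewrite mk20; exact: is_derive_proj.
    have -> : (fun q => sqm q 0 1) = (fun q : 'rV[R]_2 => q 0 1 * q 0 1) by apply/funext => q; rewrite mk21 expr2.
    have [d1 _] := is_derive_proj (0 : 'rV[R]_2) v 1.
    by have := is_derive_coord_mul 1 d1; rewrite mxE mulr0 mk21.
  rewrite -sqm0 in dr.
  have D0 := is_derive_chain dr dsq.
  rewrite sqm0 in D0; rewrite dr_sum sum_ord2 mk20 mk21 mul0r addr0 in D0.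
  have D : is_derive (0 : 'rV[R]_2) v Rm (mk2 (v 0 0 * 'D_(e_ 0) r0' 0) (v 0 1)).
    apply: is_derive_rV => j; case: (ord2P j) => ->.
      have -> : (fun q => Rm q 0 0) = r0' \o sqm by apply/funext => q; rewrite mk20.
      by rewrite mk20.
    have -> : (fun q => Rm q 0 1) = (fun q : 'rV[R]_2 => q 0 1) by apply/funext => q; rewrite mk21.
    by rewrite mk21; exact: is_derive_proj.
  case: D => _; rewrite Dv => E.
  have E0 := congr1 (fun w : 'rV[R]_2 => w 0 0) E; have E1 := congr1 (fun w : 'rV[R]_2 => w 0 1) E.
  rewrite mk20 mxE in E0; rewrite mk21 mxE in E1.
  apply: rV2_ext; rewrite mxE //; apply/eqP; move/esym/eqP: E0.
  by rewrite mulf_eq0 (negbTE dr0) orbF.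
pose pq (X : 'rV[R]_3) := mk2 (X 0 (o0 0)) (X 0 (o1 0)).
(* With [y = w^2] the term [y^2 r1] equals [w^4 r1]; subtracting it from [w^3 (r0 + w r1)] leaves
   [w^3 r0]. *)
pose Tm (X : 'rV[R]_3) := emb3 0 (r0' (pq X)) (X 0 (o1 0)) (X 0 (o2 0) - X 0 (o1 0) * (X 0 (o1 0) * r1' (pq X))).
have oS := @slab_open R 0 (b / 2) (b ^+ 2).
have pq0 : pq 0 = 0 by apply: rV2_ext; rewrite !(mk20, mk21) !mxE.
have S0 : slab (b / 2) (b ^+ 2) (0 : 'rV[R]_3) by rewrite /slab /= -/(pq 0) pq0; exact: b0.
have Cpq k : Ck_on k (slab (b / 2) (b ^+ 2)) pq by exact: Ck_on_mk2_first.
have CX k i : Ck_on k (slab (b / 2) (b ^+ 2)) (fun X : 'rV[R]_3 => X 0 i) by exact: Ck_on_proj.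
have Cr0p k : Ck_on k (slab (b / 2) (b ^+ 2)) (fun X => r0' (pq X)).
  by apply: (@Ck_on_comp _ _ _ k _ (box (b / 2) (b ^+ 2)) pq r0' oS ob2 _ (Cpq k) (Cr0 k)).
have Cr1p k : Ck_on k (slab (b / 2) (b ^+ 2)) (fun X => X 0 (o1 0) * r1' (pq X)).
  apply: Ck_on_M => //.
  by apply: (@Ck_on_comp _ _ _ k _ (box (b / 2) (b ^+ 2)) pq r1' oS ob2 _ (Cpq k) (Cr1 k)).
have CTm : smooth_on (slab (b / 2) (b ^+ 2)) Tm.
  by move=> k; apply: Ck_on_emb3 => //; apply: Ck_on_B => //; exact: Ck_on_M.
have lTm : local_diffeo Tm 0 (slab (b / 2) (b ^+ 2)).
  apply: local_diffeo_jac => // v Dv.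
  have dpq : is_derive (0 : 'rV[R]_3) v pq (pq v).
    apply: is_derive_rV => j; case: (ord2P j) => ->.
      have -> : (fun q => pq q 0 0) = (fun q : 'rV[R]_3 => q 0 (o0 0)) by apply/funext => q; rewrite mk20.
      by rewrite mk20; exact: is_derive_proj.
    have -> : (fun q => pq q 0 1) = (fun q : 'rV[R]_3 => q 0 (o1 0)) by apply/funext => q; rewrite mk21.
    by rewrite mk21; exact: is_derive_proj.
  rewrite -pq0 in dr.
  have D0 := is_derive_chain dr dpq.
  rewrite pq0 in D0; rewrite dr_sum sum_ord2 mk20 mk21 in D0.
  have D2 := is_deriveB (is_derive_proj 0 v (o2 0)) (is_derive_coord_mul (o1 0) (smooth_derivable_dir (v := v) oS Cr1p S0)).
  rewrite mxE mul0r mulr0 subr0 in D2.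
  have D : is_derive (0 : 'rV[R]_3) v Tm (emb3 0 (v 0 (o0 0) * 'D_(e_ 0) r0' 0 + v 0 (o1 0) * 'D_(e_ 1) r0' 0) (v 0 (o1 0)) (v 0 (o2 0))).
    apply: is_derive_rV => -[[|[|[|//]]] ij].
    - have -> : (fun q => Tm q 0 (Ordinal ij)) = r0' \o pq by apply/funext => q; rewrite mxE.
      by rewrite mxE.
    - have -> : (fun q => Tm q 0 (Ordinal ij)) = (fun q : 'rV[R]_3 => q 0 (o1 0)) by apply/funext => q; rewrite mxE.
      by rewrite mxE; exact: is_derive_proj.
    - have -> : (fun q => Tm q 0 (Ordinal ij)) = (fun X : 'rV[R]_3 => X 0 (o2 0) - X 0 (o1 0) * (X 0 (o1 0) * r1' (pq X))).
        by apply/funext => q; rewrite mxE.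
      by rewrite mxE.
  case: D => _; rewrite Dv => E.
  have E0 := congr1 (fun w : 'rV[R]_3 => w 0 (o0 0)) E; have E1 := congr1 (fun w : 'rV[R]_3 => w 0 (o1 0)) E.
  have E2 := congr1 (fun w : 'rV[R]_3 => w 0 (o2 0)) E.
  rewrite emb3_0 mxE in E0; rewrite emb3_1 mxE in E1; rewrite emb3_2 mxE in E2.
  have v0 : v 0 (o0 0) = 0.
    move: E0; rewrite -E1 mul0r addr0 => /esym/eqP; rewrite mulf_eq0 (negbTE dr0) orbF => /eqP //.
  apply/rowP => -[[|[|[|//]]] ij]; rewrite mxE.
  - by rewrite -[RHS]v0; congr (v 0 _); exact: val_inj.
  - by rewrite [RHS]E1; congr (v 0 _); exact: val_inj.
  - by rewrite [RHS]E2; congr (v 0 _); exact: val_inj.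
have lT (n : nat) (f : 'rV[R]_n -> 'rV[R]_n) (U : set 'rV[R]_n) : local_diffeo f 0 U -> local_diffeo f 0 setT.
  by apply: local_diffeo_restrict => //; exact: openT.
exists (AS `&` Sm @^-1` (box (b / 2) b)), (Rm \o Sm), Tm; split.
- split; last by split=> //; rewrite /= Sm0; exact: b0.
  apply: open_preimage => // q Aq; apply: (@Ck_on_cont _ _ _ 0 U1); [exact: CSm|exact: AU].
- by apply: local_diffeo_comp (lT _ _ _ lSm) _; rewrite Sm0; exact: lRm.
- by rewrite /= Sm0 /Rm sqm0 r00 mxE mk2_00.
- exact: lT lTm.
move=> q [Aq bq]; have Uq := AU _ Aq; have eq0 := e_gt0 q Uq; have esq := e_sq q Uq.
set q' := Sm q in bq *.
have h0 : q' 0 0 = q 0 0 + q 0 1 ^+ 3 * Q0 q by rewrite mk20 mulrA -exprS.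
have h1 : q' 0 1 = q 0 1 * e q by rewrite mk21.
have h1s : q' 0 1 ^+ 2 = q 0 1 ^+ 2 + q 0 1 ^+ 3 * Q1 q.
  by rewrite h1 exprMn esq /f1; ring.
have h3 : q 0 1 ^+ 3 * Q2 q = q' 0 1 ^+ 3 * (r0' (sqm q') + q' 0 1 * r1' (sqm q')).
  rewrite -(Er _ bq) /rr (SA _ Aq).2 h1 /F; move: (Q2 q) (q 0 1) (e q) eq0 => x y z z0.
  by field; rewrite gt_eqF.
rewrite -h0 -h1s h3 /Tm /pq !(emb3_0, emb3_1, emb3_2) -/(sqm q') /Rm /= !(mk20, mk21).
by congr (emb3 0 _ _ _); ring.
Qed.

End FoldedUmbrella.

(** * Remainder in the chart built on the fourth derivative *)

Section Umbrella.
Context {R : realType}.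
Local Notation e_ i := (delta_mx 0 i).

Lemma ball_scal_stable n (i : 'I_n) (d : R) : scal_stable i [set X : 'rV[R]_n | `|X| < d].
Proof.
move=> t X /andP[t0 t1] /= Xd; have d0 : 0 < d by exact: le_lt_trans (normr_ge0 X) Xd.
apply: norm_rV_lt => // j; rewrite scalE; have Xj := le_lt_trans (coord_le_norm X j) Xd.
case: ifP => _; last by rewrite mul1r.
by rewrite normrM ger0_norm //; apply: le_lt_trans Xj; rewrite ler_piMl.
Qed.

(* The chart [Th] is inverse to [Gs] with [B] replaced by the constant [N], so
   [Th \o Gs] is the identity where the third coordinate vanishes. *)
Lemma fold_remainder (al be : R) (x : R -> 'rV[R]_3) (A B : 'rV[R]_2 -> 'rV[R]_3) (N : 'rV[R]_3) :
  0 < al -> 0 < be -> smooth_on_line [set a | `|a| < al] x ->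
  smooth_on (box al be) A -> smooth_on (box al be) B -> indep3 (derive1 x 0) (A (mk2 0 0)) N ->
  let pq (X : 'rV[R]_3) := mk2 (X 0 (o0 0)) (X 0 (o1 0)) in
  let Gs (X : 'rV[R]_3) := x (X 0 (o0 0)) + X 0 (o1 0) *: A (pq X) + X 0 (o2 0) *: B (pq X) in
  exists (rho : R) (Th : 'rV[R]_3 -> 'rV[R]_3) (P : 'I_3 -> 'rV[R]_3 -> R),
  let cube := [set X : 'rV[R]_3 | `|X| < rho] in
  [/\ 0 < rho /\ local_diffeo Th (x 0) setT, forall j, smooth_on cube (P j), Th (x 0) = 0,
    forall X : 'rV[R]_3, cube X -> Th (Gs X) =
      emb3 0 (X 0 (o0 0) + X 0 (o2 0) * P (o0 0) X) (X 0 (o1 0) + X 0 (o2 0) * P (o1 0) X) (X 0 (o2 0) * P (o2 0) X) &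
    forall a, `|a| < rho -> P (o0 0) (emb3 0 a 0 0) *: derive1 x a + P (o1 0) (emb3 0 a 0 0) *: A (mk2 a 0) +
       P (o2 0) (emb3 0 a 0 0) *: N = B (mk2 a 0)].
Proof.
move=> al0 be0 sx CA CB ind pq Gs.
have CN : smooth_on (box al be) (fun _ : 'rV[R]_2 => N) by move=> k; exact: Ck_on_cst.
have [Phi [lPhi PhiE']] := fold_chart al0 be0 sx CA CN ind.
have PhiE (X : 'rV[R]_3) : Phi X = x (X 0 (o0 0)) + X 0 (o1 0) *: A (pq X) + X 0 (o2 0) *: N.
  by apply: PhiE' => -[i i3] /= i3'; move: (leq_trans i3 i3'); rewrite ltnn.
have [AP [BP [Th [[oA oB] [A0 AS] [CTh lTh] TA TB]]]] := local_diffeo_inverse lPhi.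
have Phi0 : Phi 0 = x 0 by rewrite PhiE !mxE !scale0r !addr0.
have oS := @slab_open R 0 al be; have ob := @box_open R al be.
have Cpq k : Ck_on k (slab al be) pq by exact: Ck_on_mk2_first.
have CX k i : Ck_on k (slab al be) (fun X : 'rV[R]_3 => X 0 i) by exact: Ck_on_proj.
have CAp k : Ck_on k (slab al be) (fun X => A (pq X)).
  by apply: (@Ck_on_comp_rV _ _ _ _ k _ (box al be) pq A oS ob _ (Cpq k) (CA k)).
have CBp k : Ck_on k (slab al be) (fun X => B (pq X)).
  by apply: (@Ck_on_comp_rV _ _ _ _ k _ (box al be) pq B oS ob _ (Cpq k) (CB k)).
have Cx k : Ck_on k (slab al be) (fun X : 'rV[R]_3 => x (X 0 (o0 0))).
  have Cs := @line_strip R _ [set a | `|a| < al] be x (@abs_open R al) sx.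
  apply: (@Ck_on_ext _ _ _ _ _ (fun X => x (pq X 0 0))) => //; first by move=> X _; rewrite mk20.
  by apply: (@Ck_on_comp_rV _ _ _ _ k _ (box al be) pq (fun q : 'rV[R]_2 => x (q 0 0)) oS ob _ (Cpq k) (Cs k)).
have CG : smooth_on (slab al be) Gs.
  move=> k; apply: Ck_on_D => //; last exact: Ck_on_scale.
  by apply: Ck_on_D => //; exact: Ck_on_scale.
have oO : open ((slab al be `&` Gs @^-1` BP) `&` AP).
  apply: openI (open_preimage oS oB _) oA => X SX; exact: Ck_on_cont (CG 0%N) SX.
have Gs0 : Gs 0 = Phi 0 by rewrite Phi0 /Gs !mxE !scale0r !addr0.
have S0 : slab al be (0 : 'rV[R]_3) by split; rewrite /= ?mk20 ?mk21 mxE normr0.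
have O0 : ((slab al be `&` Gs @^-1` BP) `&` AP) 0.
  by split=> //; split=> //; rewrite /= Gs0; exact: (TA 0 A0).1.
have [rho rho0 Hrho] := (nbhs_norm_ltP _ _).1 (near_open oO O0).
pose cube := [set X : 'rV[R]_3 | `|X| < rho].
have cubeS X : cube X -> [/\ slab al be X, BP (Gs X) & AP X].
  move=> cX; have cX' : `|X - 0| < rho by rewrite subr0.
  by have [[? ?] ?] := Hrho X cX'; split.
have oc : open cube.
  have := @open_norm_ball _ _ (0 : 'rV[R]_3) rho; rewrite /cube; congr open.
  by apply/seteqP; split=> X /=; rewrite subr0.
have sub_slab : cube `<=` slab al be by move=> X /cubeS[].
pose h X := Th (Gs X).
have Ch : smooth_on cube h.
  move=> k; apply: (@Ck_on_comp_rV _ _ _ _ k _ BP Gs Th oc oB _ _ (CTh k)).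
    by move=> X /cubeS[].
  exact: Ck_on_sub sub_slab (CG k).
have hfix X : cube X -> X 0 (o2 0) = 0 -> h X = X.
  move=> cX X2; have [_ _ AX] := cubeS X cX.
  have E : Gs X = Phi X by rewrite PhiE /Gs X2 !scale0r.
  by rewrite /h E (TA X AX).2.
(* The part of [h] where the third coordinate vanishes: there [h] is the identity, so [h - base] is
   divisible by that coordinate. *)
pose base (j : 'I_3) (X : 'rV[R]_3) : R := if j == o2 0 then 0 else X 0 j.
have Cbase j : smooth_on cube (base j).
  by move=> k; rewrite /base; case: (j == _); [exact: (@Ck_on_cst R 3 R)|exact: Ck_on_proj].
have /choice[P HP] : forall j : 'I_3, exists P : 'rV[R]_3 -> R, smooth_on cube P /\
    forall X, cube X -> h X 0 j = base j X + X 0 (o2 0) * P X.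
  move=> j.
  have Ck : smooth_on cube (fun X => h X 0 j - base j X).
    by move=> k; apply: Ck_on_B => //; [exact: Ck_on_coord oc (Ch k)|exact: Cbase].
  have k0 X : cube X -> X 0 (o2 0) = 0 -> h X 0 j - base j X = 0.
    move=> cX X2; rewrite (hfix X cX X2) /base; case: eqP => [->|_]; last exact: subrr.
    by rewrite X2 subr0.
  have [P [CP EP _]] := hadamard_div oc (@ball_scal_stable _ _ rho) Ck k0.
  by exists P; split=> // X cX; rewrite -(EP X cX) addrC subrK.
exists rho, Th, P; split.
- by split=> //; rewrite -Phi0.
- by move=> j; exact: (HP j).1.
- by rewrite -Phi0 (TA 0 A0).2.
- move=> X cX; rewrite -/(h X); apply/rowP => j; rewrite ((HP j).2 X cX) mxE /base.
  move: j => -[[|[|[|//]]] ij] /=.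
  + by congr (X 0 _ + _ * P _ _); exact: val_inj.
  + by congr (X 0 _ + _ * P _ _); exact: val_inj.
  + by rewrite add0r; congr (_ * P _ _); exact: val_inj.
move=> a arho; set p := emb3 0 a 0 0.
have cp : cube p.
  by apply: norm_rV_lt => // -[[|[|[|//]]] ij]; rewrite mxE //= normr0.
have p2 : p 0 (o2 0) = 0 by exact: emb3_2.
have p1 : p 0 (o1 0) = 0 by exact: emb3_1.
have p0 : p 0 (o0 0) = a by exact: emb3_0.
have pqp : pq p = mk2 a 0 by rewrite /pq p0 p1.
have Sp := sub_slab p cp.
have aal : `|a| < al by have [+ _] := Sp; rewrite /= mk20 p0.
(* The derivative of [h] in the third direction at the axis point [p]. Differentiating
   [Phi \o h = Gs] there shows that the differential of [Phi] sends [w] to [B]. *)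
pose w : 'rV[R]_3 := \row_j P j p.
have Dh : is_derive p (e_ (o2 0)) h w.
  apply: is_derive_rV => j; rewrite mxE; have [CP EP] := HP j.
  have E : \forall X \near p, base j X + X 0 (o2 0) * P j X = h X 0 j.
    by apply: filterS (near_open oc cp) => X cX; rewrite EP.
  apply: near_eq_is_derive E _.
  have db : is_derive p (e_ (o2 0)) (base j) 0.
    have [j2|j2] := eqVneq j (o2 0).
      have -> : base j = cst 0 by apply/funext => X; rewrite /base j2 eqxx.
      exact: is_derive_cst.
    have -> : base j = (fun X : 'rV[R]_3 => X 0 j) by apply/funext => X; rewrite /base (negbTE j2).
    by have := is_derive_proj p (e_ (o2 0)) j; rewrite mxE eqxx (negbTE j2).
  have dP := derivableP (smooth_derivable_dir (v := e_ (o2 0)) oc CP cp).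
  have dM := @is_deriveM _ _ _ (P j) p (e_ (o2 0)) _ _ (is_derive_proj p (e_ (o2 0)) (o2 0)) dP.
  have dD := is_deriveD db dM.
  by apply: is_derive_eq dD _; rewrite add0r p2 scale0r add0r mxE !eqxx -[_ *: _]/(_ * _) mulr1.
have dPhi : differentiable Phi (h p).
  have [_ _ AX] := cubeS p cp; rewrite (hfix p cp p2).
  have [A' [B' [g [[oA' _] [A0' _] [CPhi _] _ _]]]] := lPhi.
  have CF : smooth_on (slab al be) (fun X : 'rV[R]_3 => x (X 0 (o0 0)) + X 0 (o1 0) *: A (pq X) + X 0 (o2 0) *: N).
    move=> k; apply: Ck_on_D => //; last by apply: Ck_on_scale => //; exact: Ck_on_cst.
    by apply: Ck_on_D => //; exact: Ck_on_scale.
  have -> : Phi = (fun X : 'rV[R]_3 => x (X 0 (o0 0)) + X 0 (o1 0) *: A (pq X) + X 0 (o2 0) *: N).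
    by apply/funext => X; exact: PhiE.
  exact: C1_differentiable_rV oS (CF 1%N) Sp.
have [_ e1] := is_derive_chain dPhi Dh.
have e2 : 'D_(e_ (o2 0)) (Phi \o h) p = B (mk2 a 0).
  have E : \forall X \near p, Gs X = (Phi \o h) X.
    by apply: filterS (near_open oc cp) => X /cubeS[_ BX _]; rewrite /= /h (TB _ BX).2.
  rewrite -(near_eq_derive _ E).
  suff [_ ->] : is_derive p (e_ (o2 0)) Gs (B (mk2 a 0)) by [].
  apply/is_derive_epsP => e e_0; exists 1 => // k k0 _.
  have q0 : (k *: e_ (o2 0) + p) 0 (o0 0) = a by rewrite !mxE /= mulr0 add0r.
  have q1 : (k *: e_ (o2 0) + p) 0 (o1 0) = 0 by rewrite !mxE /= mulr0 add0r.
  have q2 : (k *: e_ (o2 0) + p) 0 (o2 0) = k by rewrite !mxE /= mulr1 addr0.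
  have pqq : pq (k *: e_ (o2 0) + p) = mk2 a 0 by rewrite /pq q0 q1.
  rewrite /Gs pqq pqp q0 q1 q2 p0 p1 p2 !scale0r !addr0 [x a + _]addrC addrK scalerA mulVf // scale1r subrr normr0.
  exact: ltW.
have e3 : is_derive p w Phi (w 0 (o0 0) *: derive1 x a + w 0 (o1 0) *: A (mk2 a 0) + w 0 (o2 0) *: N).
  have -> : Phi = (fun X : 'rV[R]_3 => x (X 0 (o0 0)) + X 0 (o1 0) *: A (pq X) + X 0 (o2 0) *: N).
    by apply/funext => X; exact: PhiE.
  have d1 : is_derive p w (fun X : 'rV[R]_3 => x (X 0 (o0 0))) (w 0 (o0 0) *: derive1 x a).
    apply: is_derive_rV => j; rewrite mxE.
    have dx := smooth_on_line_is_derive 0 sx aal.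
    apply: (@is_derive_outer _ _ (fun a => x a 0 j) (derive1 x a 0 j) (fun X : 'rV[R]_3 => X 0 (o0 0)) p w (w 0 (o0 0))).
      by rewrite p0; exact: is_derive_component dx.
    exact: is_derive_proj.
  have dAp : is_derive p w (fun X => A (pq X)) ('D_w (fun X => A (pq X)) p).
    by apply: derivableP; apply: diff_derivable; exact: C1_differentiable_rV oS (CAp 1%N) Sp.
  have d2 := is_derive_scale (is_derive_proj p w (o1 0)) dAp.
  rewrite p1 scale0r addr0 pqp in d2.
  have d3 := is_derive_scale (is_derive_proj p w (o2 0)) (is_derive_cst N p w).
  rewrite scaler0 addr0 in d3.
  exact: is_deriveD (is_deriveD d1 d2) d3.
have [_ e4] := e3.
have wj j : w 0 j = P j p by rewrite mxE.
rewrite -!wj -e2 e1 (hfix p cp p2) -deriveE ?e4 // -(hfix p cp p2); exact: dPhi.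
Qed.

End Umbrella.

(** * The case of dependent third and independent fourth derivative *)

Section UmbrellaCase.
Context {R : realType}.
Local Notation e_ i := (delta_mx 0 i).

(** One component of the differentiated relation, with [g1], [g2], [g3] the Christoffel terms. Since
    [e3] and [g3] are the same combination of the first two, the Christoffel terms cancel and a
    relation between [e1], [e2] and [n] remains. *)
Lemma umbrella_scalar (e1 e2 e3 n g1 g2 g3 p0 p1 d0 d1 d2 : R) :
  e3 = 3 * p0 * e1 - 3 / 2 * p1 * e2 -> g3 = 3 * p0 * g1 - 3 / 2 * p1 * g2 ->
  d0 * e1 + p0 * (e2 - g1) + (d1 * (- 2^-1 * e2) + p1 * (- 2^-1 * (e3 - g2))) + d2 * n = 3^-1 * (n - g3) ->
  (d0 - 3 / 2 * p0 * p1) * e1 + (p0 - 2^-1 * d1 + 3 / 4 * p1 ^+ 2) * e2 + (d2 - 3^-1) * n = 0.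
Proof.
move=> -> -> h; rewrite -[RHS](subrr (3^-1 * (n - (3 * p0 * g1 - 3 / 2 * p1 * g2)))) -{1}h.
by field.
Qed.

Theorem umbrella_case (M : manifold R 3) (nabla : connection M) (I : set R) (gamma : R -> M) (t0 : R) :
  torsion_free nabla -> open I -> smooth_curve I gamma -> I t0 ->
  ~ lin_indep (gamma t0) [:: cov_iter nabla gamma 1 t0; cov_iter nabla gamma 2 t0; cov_iter nabla gamma 3 t0] ->
  lin_indep (gamma t0) [:: cov_iter nabla gamma 1 t0; cov_iter nabla gamma 2 t0; cov_iter nabla gamma 4 t0] ->
  locally_diffeomorphic (tangent_surface nabla gamma) (pt t0 0) (@folded_umbrella R) (pt 0 0).
Proof.
move=> tf oI sg It0 dep li; have [c ct0] := dom_cover (gamma t0).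
have [al [be [A [B [[al0 be0] [CA CB] [Cx TI] HAB fS]]]]] := surface_form tf oI sg It0 ct0.
set x := fun a => coord c (gamma (t0 + a)) in Cx fS.
have be20 : 0 < be ^+ 2 by rewrite exprn_gt0.
have sx : smooth_on_line [set a : R | `|a| < al] x by exact: strip_line be0 (@abs_open R al) Cx.
have h0 : `|(0 : R)| < al by rewrite normr0.
pose E k t := cov_iter nabla gamma k t c.
pose N := E 4%N t0.
have tg k := (cov_iterP nabla k oI sg).1 t0 It0.
have ind : indep3 (E 1%N t0) (E 2%N t0) N := lin_indep_indep3 ct0 (tg 0%N) (tg 1%N) (tg 3%N) li.
have [EA EB] := HAB 0 h0; rewrite addr0 in EA EB.
have x0E : derive1 x 0 = E 1%N t0 by exact: curve_coord_derive1 sg It0 ct0.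
have indA : indep3 (derive1 x 0) (A (mk2 0 0)) N.
  rewrite EA x0E -[N]scale1r; apply: (indep3_scale _ _ ind); last exact: oner_neq0.
  by rewrite oppr_eq0 invr_eq0 pnatr_eq0.
have [rho [Th [P [[rho0 lTh] CP Th0 ThG HP]]]] := fold_remainder al0 be20 sx CA CB indA.
set cube := [set X : 'rV[R]_3 | `|X| < rho] in CP ThG.
have oc : open cube.
  have := @open_norm_ball _ _ (0 : 'rV[R]_3) rho; rewrite /cube; congr open.
  by apply/seteqP; split=> X /=; rewrite subr0.
have Cpow k (U : set 'rV[R]_2) : open U -> Ck_on k U (@pow23 R 0) by exact: Ck_on_pow23.
have oW1 : open (@pow23 R 0 @^-1` cube).
  by have := open_preimage openT oc (fun q Tq => Ck_on_cont (Cpow 0%N setT openT) Tq); rewrite setTI.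
have W10 : (@pow23 R 0 @^-1` cube) 0 by rewrite /= pow23_0 /cube /= normr0.
have [r r0 rW] := open_box oW1 W10.
pose Q j (q : 'rV[R]_2) : R := P j (@pow23 R 0 q).
have obr := @box_open R r r.
have CQ j : smooth_on (box r r) (Q j).
  move=> k; exact: (@Ck_on_comp _ _ _ k _ cube (@pow23 R 0) (P j) obr oc rW (Cpow k _ obr) (CP j k)).
have b0 : box r r (0 : 'rV[R]_2) by split; rewrite /= mxE normr0.
have pw0 a : @pow23 R 0 (mk2 a 0) = emb3 0 a 0 0 by rewrite /pow23 mk20 mk21 !expr0n.
pose p j (a : R) := Q j (mk2 a 0).
have Dp j : is_derive (0 : R) (1 : R) (p j) ('D_(e_ 0) (Q j) 0).
  have z : (0 : 'rV[R]_2) + 0 *: e_ 0 = 0 by rewrite scale0r addr0.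
  have d : derivable (Q j) (0 + (0 : R) *: e_ 0) (e_ 0) by rewrite z; exact: smooth_derivable (CQ j) b0.
  have := is_derive_line d; rewrite z; apply: near_eq_is_derive.
  apply: filterE => s; congr (Q j _).
  by apply: rV2_ext; rewrite !mxE /= ?mulr1 ?mulr0 add0r.
have p00 j : p j 0 = Q j 0 by rewrite /p mk2_00.
(* The expression of [B] along the curve in terms of [x'], [A] and [N], with the values of [A] and
   [B] inserted; it is differentiated at [a = 0] below. *)
have ident a : `|a| < rho -> `|a| < al ->
    p (o0 0) a *: E 1%N (t0 + a) + p (o1 0) a *: (- 2^-1 *: E 2%N (t0 + a)) + p (o2 0) a *: N =
    3^-1 *: E 3%N (t0 + a).
  move=> ar aal; have [Ia ca] := TI a aal; have [EAa EBa] := HAB a aal.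
  have := HP a ar; rewrite EAa EBa.
  have -> : derive1 x a = E 1%N (t0 + a).
    have D := curve_is_derive sg Ia ca.
    by rewrite derive1E; have [_ ->] := @is_derive_translate _ _ (coord c \o gamma) t0 a _ D.
  by rewrite -!pw0.
have DE k : is_derive (0 : R) (1 : R) (fun a => E k.+1 (t0 + a)) (derive1 (E k.+1) t0).
  have D := smooth_on_line_is_derive 0 ((cov_iterP nabla k oI sg).2 c) (conj It0 ct0).
  by apply: is_derive_translate; rewrite addr0; exact: D.
pose G k := Gam nabla c (gamma t0) (E 1%N t0) (E k t0).
(* The ordinary derivative is the next covariant derivative minus a Christoffel term. *)
have dE k : derive1 (E k.+1) t0 = E k.+2 t0 - G k.+1.
  have -> : E k.+2 t0 = derive1 (E k.+1) t0 + G k.+1 by exact: cov_alongE.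
  by rewrite addrK.
have rho00 : `|(0 : R)| < rho by rewrite normr0.
have id0 := ident 0 rho00 h0; rewrite !p00 addr0 in id0.
set q0 := Q (o0 0) 0 in id0; set q1 := Q (o1 0) 0 in id0.
have E3E : E 3%N t0 = 3 *: (q0 *: E 1%N t0 + q1 *: (- 2^-1 *: E 2%N t0) + Q (o2 0) 0 *: N).
  by rewrite id0 scalerA divff ?scale1r // pnatr_eq0.
(* A nonzero value would give the third derivative a component along [N], which would make the first
   three derivatives independent. *)
have Q20 : Q (o2 0) 0 = 0.
  apply/eqP/negPn/negP => q2; apply: dep; apply: (indep3_lin_indep ct0) => a b d.
  rewrite -/(E 1%N t0) -/(E 2%N t0) -/(E 3%N t0) E3E => H.
  have /ind[h1 h2 /eqP h3] : (a + d * 3 * q0) *: E 1%N t0 + (b - d * 3 / 2 * q1) *: E 2%N t0 + (d * 3 * Q (o2 0) 0) *: N = 0.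
    rewrite -[RHS]H; move: (E 1%N t0) (E 2%N t0) (N) (Q (o2 0) 0) => e1 e2 n z.
    by apply/rowP => j; rewrite !mxE; field.
  have d0 : d = 0.
    by move: h3; rewrite !mulf_eq0 (negbTE q2) pnatr_eq0 /= !orbF => /eqP.
  by move: h1 h2; rewrite d0 !mul0r addr0 subr0.
have E3E' : E 3%N t0 = (3 * q0) *: E 1%N t0 + (- (3 / 2) * q1) *: E 2%N t0.
  rewrite E3E Q20 scale0r addr0; move: (E 1%N t0) (E 2%N t0) => e1 e2.
  by apply/rowP => j; rewrite !mxE; field.
have G3E : G 3%N = (3 * q0) *: G 1%N + (- (3 / 2) * q1) *: G 2%N by rewrite /G E3E' GamDr !GamZr.
have dF : is_derive (0 : R) (1 : R)
    (fun a => p (o0 0) a *: E 1%N (t0 + a) + p (o1 0) a *: (- 2^-1 *: E 2%N (t0 + a)) + p (o2 0) a *: N)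
    ('D_(e_ 0) (Q (o0 0)) 0 *: E 1%N t0 + q0 *: (E 2%N t0 - G 1%N) +
     ('D_(e_ 0) (Q (o1 0)) 0 *: (- 2^-1 *: E 2%N t0) + q1 *: (- 2^-1 *: (E 3%N t0 - G 2%N))) +
     'D_(e_ 0) (Q (o2 0)) 0 *: N).
  have d1 := is_derive_scale (Dp (o0 0)) (DE 0%N).
  have d2 := is_derive_scale (Dp (o1 0)) (@is_deriveZ _ _ _ _ (- 2^-1) _ _ _ (DE 1%N)).
  have d3 := is_derive_scale (Dp (o2 0)) (is_derive_cst N (0 : R) (1 : R)).
  have d := is_deriveD (is_deriveD d1 d2) d3.
  apply: is_derive_eq d _; rewrite !p00 !dE scaler0 !addr0 -/q0 -/q1 /=.
  by rewrite addr0.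
have dG : is_derive (0 : R) (1 : R) (fun a => 3^-1 *: E 3%N (t0 + a)) (3^-1 *: (N - G 3%N)).
  by rewrite /N -dE; exact: (@is_deriveZ _ _ _ _ 3^-1 _ _ _ (DE 2%N)).
have near_id : \forall a \near (0 : R), p (o0 0) a *: E 1%N (t0 + a) + p (o1 0) a *: (- 2^-1 *: E 2%N (t0 + a)) + p (o2 0) a *: N =
    3^-1 *: E 3%N (t0 + a).
  have m0 : 0 < Num.min rho al by rewrite lt_min rho0.
  have small (a : R) : `|a - 0| < Num.min rho al -> `|a| < rho /\ `|a| < al.
    by rewrite subr0 lt_min => /andP[].
  apply: (nbhs_norm_ltP _ _).2; exists (Num.min rho al); first exact: m0.
  move=> a /small[h1 h2]; exact: ident a h1 h2.
have EQ := near_eq_derive (1 : R) near_id.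
have [_ eF] := dF; have [_ eG] := dG; rewrite eF eG in EQ.
(* By independence of [E 1], [E 2] and [N] the coefficient of [N] in the differentiated relation
   vanishes, and this coefficient is [d2 - 1/3]. *)
have dQ2 : 'D_(e_ 0) (Q (o2 0)) 0 = 3^-1.
  set d0 := 'D_(e_ 0) (Q (o0 0)) 0 in EQ; set d1 := 'D_(e_ 0) (Q (o1 0)) 0 in EQ; set d2 := 'D_(e_ 0) (Q (o2 0)) 0 in EQ *.
  have /ind[_ _ /eqP] : (d0 - 3 / 2 * q0 * q1) *: E 1%N t0 + (q0 - 2^-1 * d1 + 3 / 4 * q1 ^+ 2) *: E 2%N t0 + (d2 - 3^-1) *: N = 0.
    apply/rowP => j.
    have := congr1 (fun w : 'rV[R]_3 => w 0 j) EQ.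
    have := congr1 (fun w : 'rV[R]_3 => w 0 j) E3E'.
    have := congr1 (fun w : 'rV[R]_3 => w 0 j) G3E.
    move: (E 1%N t0) (E 2%N t0) (E 3%N t0) (N) (G 1%N) (G 2%N) (G 3%N) => e1 e2 e3 n g1 g2 g3.
    rewrite !mxE => H1 H2 H3; apply: umbrella_scalar H3; [rewrite H2|rewrite H1]; ring.
  by rewrite subr_eq0 => /eqP.
have dQ2n : 'D_(e_ 0) (Q (o2 0)) 0 != 0 by rewrite dQ2 invr_eq0 pnatr_eq0.
have [W [sm [T [[oW W0] lsm sm0 lT HT]]]] := umbrella_normal r0 (CQ (o0 0)) (CQ (o1 0)) (CQ (o2 0)) Q20 dQ2n.
have fold0 : fold_param x A B 0 = x 0.
  by rewrite /fold_param !mxE !expr0n /= !scale0r !addr0.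
apply: (@surface_diffeo R 3 M c (tangent_surface nabla gamma) t0 al be (fold_param x A B)
   (@folded_umbrella R) (W `&` box r r)
   ((fun q : 'rV[R]_2 => mk2 (q 0 0 - 0 + (-1) * q 0 1) (q 0 1)) \o sm)
   (@umbrella_tri R 0 \o (T \o Th)) al0 be0) => //.
- exact: smooth_fold_param.
- exact: openI.
- by apply: local_diffeo_comp lsm _; rewrite sm0; exact: mk2_shear_diffeo.
- by rewrite /= sm0; apply: rV2_ext; rewrite !(mk20, mk21) !mxE //; ring.
- rewrite fold0; apply: local_diffeo_comp; last exact: umbrella_tri_diffeo.
  by apply: local_diffeo_comp lTh _; rewrite Th0; exact: lT.
- move=> q _ [Wq bq] /=; rewrite (@fold_param_pow23 R 0 x A B q) ThG; last exact: rW.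
  rewrite /pow23 !(emb3_0, emb3_1, emb3_2) -/(@pow23 R 0 q).
  rewrite (HT q Wq) -folded_umbrellaE; congr folded_umbrella.
  by apply: rV2_ext; rewrite !(mk20, mk21) //; ring.
Qed.

End UmbrellaCase.

(* Assembly of the three cases *)
Local Close Scope ring_scope.
Local Close Scope classical_set_scope.

Theorem theorem1p2 (R : realType) (m : nat) (M : manifold R m)
    (nabla : connection M) (nabla_torsion_free : torsion_free nabla)
    (I : set R) (I_open : open I) (I_itv : is_interval I)
    (gamma : R -> M) (gamma_smooth : smooth_curve I gamma)
    (t0 : R) (t0I : I t0) :
  (m = 3%N ->
     (lin_indep (gamma t0) [:: cov_iter nabla gamma 1 t0;
                               cov_iter nabla gamma 2 t0;
                               cov_iter nabla gamma 3 t0] ->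
      locally_diffeomorphic (tangent_surface nabla gamma) (pt t0 0%R)
                            (@cuspidal_edge R m) (pt 0%R 0%R)) /\
     (~ lin_indep (gamma t0) [:: cov_iter nabla gamma 1 t0;
                                 cov_iter nabla gamma 2 t0;
                                 cov_iter nabla gamma 3 t0] ->
      lin_indep (gamma t0) [:: cov_iter nabla gamma 1 t0;
                               cov_iter nabla gamma 2 t0;
                               cov_iter nabla gamma 4 t0] ->
      locally_diffeomorphic (tangent_surface nabla gamma) (pt t0 0%R)
                            (@folded_umbrella R) (pt 0%R 0%R))) /\
  ((4 <= m)%N ->
     lin_indep (gamma t0) [:: cov_iter nabla gamma 1 t0;
                              cov_iter nabla gamma 2 t0;
                              cov_iter nabla gamma 3 t0] ->
     locally_diffeomorphic (tangent_surface nabla gamma) (pt t0 0%R)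
                           (@cuspidal_edge R m) (pt 0%R 0%R)).
Proof.
split=> [m3|].
  subst m; split=> [li|dep li].
    exact: (cuspidal_case nabla_torsion_free I_open gamma_smooth t0I li).
  exact: (umbrella_case nabla_torsion_free I_open gamma_smooth t0I dep li).
(* [cuspidal_case] is stated in dimension [n.+3]; the dimensions 0, 1 and 2 contradict [4 <= m]. *)
case: m M nabla nabla_torsion_free gamma gamma_smooth => [|[|[|n]]] M nabla tf gamma sg m4 li //.
exact: (cuspidal_case tf I_open sg t0I li).
Qed.
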